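(* For each integer $N\ge 1$, let $\{\mathcal X^N_z\}_{z\in V_N}$ be the discrete Gaussian free field on $V_N=([0,N-1]\cap\mathbb Z)^2$ with Dirichlet boundary conditions, let $\mathcal X_N^*=\max_{z\in V_N}\mathcal X_z^N$, and set $M_N=\mathcal X_N^*-E\mathcal X_N^*$. Then the sequence of random variables $\{M_N\}_{N\ge 1}$ is tight.
   Context: For an integer $N\ge1$, $V_N=([0,N-1]\cap\mathbb Z)^2$, $V_N^o=((0,N-1)\cap\mathbb Z)^2$ and $\partial V_N=V_N\setminus V_N^o$. Let $\{w_m\}_{m\ge0}$ be simple random walk on $\mathbb Z^2$, killed at $\tau=\min\{m\ge 0: w_m\in\partial V_N\}$, and let $E^x$ denote expectation for the walk started at $x$. Define $G_N(x,y)=E^x\big(\sum_{m=0}^{\tau-1}\mathbf 1_{\{w_m=y\}}\big)$ for $x,y\in V_N$ (so $G_N(x,y)=0$ if $x$ or $y$ lies in $\partial V_N$). The discrete Gaussian free field (GFF) on $V_N$ with Dirichlet boundary conditions is the zero-mean Gaussian field $\{\mathcal X_z^N\}_{z\in V_N}$ with covariance $E(\mathcal X_x^N\mathcal X_y^N)=G_N(x,y)$. *)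

(* Defs.v *)
From mathcomp Require Import all_boot all_order all_algebra.
From mathcomp Require Import all_classical all_reals all_analysis.

Set Implicit Arguments.
Unset Strict Implicit.
Unset Printing Implicit Defensive.

Import Order.TTheory GRing.Theory Num.Theory.
Import numFieldNormedType.Exports.

Local Open Scope classical_set_scope.
Local Open Scope ring_scope.

Definition box (N : nat) : set (int * int) :=
  [set z | (0 <= z.1 <= N%:Z - 1) && (0 <= z.2 <= N%:Z - 1)].

Definition box_interior (N : nat) : set (int * int) :=
  [set z | (0 < z.1 < N%:Z - 1) && (0 < z.2 < N%:Z - 1)].

Definition box_boundary (N : nat) : set (int * int) :=
  box N `\` box_interior N.

(* The finite type indexing the points of [box N]. *)
Definition site (N : nat) : finType := ('I_N * 'I_N)%type.

Definition site_point (N : nat) (z : site N) : int * int :=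
  ((z.1 : nat)%:Z, (z.2 : nat)%:Z).

Definition unit_steps : seq (int * int) :=
  [:: (1, 0); (-1, 0); (0, 1); (0, -1)].

Section SimpleRandomWalk.
Context (R : realType) (d : measure_display) (T : measurableType d).
Implicit Types (P : probability T R) (w : nat -> T -> int * int).

(* The codomain is countable and carries the discrete sigma-algebra, hence
   the quantification over arbitrary sets [A i]. *)
Definition mutually_independent P (xi : nat -> T -> int * int) : Prop :=
  forall (J : seq nat) (A : nat -> set (int * int)), uniq J ->
    P (\bigcap_(i in [set` J]) (xi i @^-1` A i)) =
    (\prod_(i <- J) P (xi i @^-1` A i))%E.

Definition increment w (m : nat) (t : T) : int * int := w m.+1 t - w m t.

Record simple_random_walk P (x : int * int) w : Prop := SimpleRandomWalk {
  srw_measurable : forall m z, measurable [set t | w m t = z] ;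
  srw_start : P [set t | w 0%N t = x] = 1%E ;
  srw_uniform : forall m e, e \in unit_steps ->
    P [set t | increment w m t = e] = (4^-1)%:E ;
  srw_independent : mutually_independent P (increment w) }.

(* First time the path visits the boundary; [+oo] if it never does. *)
Definition hitting_time (N : nat) (path : nat -> int * int) : \bar R :=
  ereal_inf [set (m%:R)%:E | m in [set m : nat | box_boundary N (path m)]].

(* [P x] is the law under which the walk [w] starts at [x]. *)
Definition green (P : int * int -> probability T R) w (N : nat)
    (x y : int * int) : \bar R :=
  (\int[P x]_t
     \sum_(0 <= m <oo | (m%:R)%:E < hitting_time N (w ^~ t))
       ((w m t == y)%:R)%:E)%E.

End SimpleRandomWalk.

Section GaussianFields.
Context (R : realType) (d : measure_display) (T : measurableType d)
  (P : probability T R).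

(* [normal_prob m 0] is a junk value in the library, so the degenerate
   Gaussian law is given separately; [s] is the standard deviation. *)
Definition gaussian_law (m s : R) (A : set R) : \bar R :=
  if s == 0 then dirac m A else normal_prob m s A.

Definition gaussian_variable (Y : T -> R) : Prop :=
  exists m s : R, forall A : set R, measurable A ->
    pushforward P Y A = gaussian_law m s A.

Definition gaussian_field (I : finType) (X : I -> {RV P >-> R}) : Prop :=
  forall a : I -> R, gaussian_variable (fun t => \sum_i a i * X i t).

Record discrete_GFF (dW : measure_display) (W : measurableType dW)
    (PW : int * int -> probability W R) (w : nat -> W -> int * int)
    (N : nat) (X : site N -> {RV P >-> R}) : Prop := DiscreteGFF {
  gff_gaussian : gaussian_field X ;
  gff_centered : forall x, ('E_P[X x] = 0)%E ;
  gff_covariance : forall x y,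
    ('E_P[fun t => (X x t * X y t)%R])%E =
      green PW w N (site_point x) (site_point y) }.

(* The box has side [n.+1], so it is nonempty and the value at the corner is a
   neutral initial value for the maximum. *)
Definition field_max (n : nat) (X : site n.+1 -> {RV P >-> R}) (t : T) : R :=
  \big[Num.max/X (ord0, ord0) t]_(z : site n.+1) X z t.

Definition centered_max (n : nat) (X : site n.+1 -> {RV P >-> R}) (t : T) : R :=
  field_max X t - fine ('E_P[field_max X])%E.

End GaussianFields.

(* The variables need not live on a common probability space. *)
Definition tight (R : realType) (d : nat -> measure_display)
    (T : forall n, measurableType (d n)) (P : forall n, probability (T n) R)
    (M : forall n, T n -> R) : Prop :=
  forall e : R, 0 < e -> exists2 K : set R, compact K &
    forall n, (P n (M n @^-1` (~` K)) <= e%:E)%E.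

(* Main.v *)
(** A comparison argument of Dekking and Host reduces tightness to a bound on
    increments of the mean. Two disjoint translates of V_N sit in V_{2N}, and
    the field there has larger increments than two independent copies of the
    field on V_N, so Sudakov-Fernique gives
    E max(M, M') <= E X*_{2N}, whence E|M_N| <= 2 (E X*_{2N} - E X*_N).
    It remains to know E X*_N up to a bounded error.

    The potential kernel estimate makes the variance of X_x - X_y equal to a
    multiple of log |x - y| up to a constant, so the field is compared, again
    by Sudakov-Fernique, with Gaussian fields on binary trees.
    Upper bound: interleaving the binary digits of both coordinates embeds V_N
    in the leaves of a branching random walk whose increments dominate those
    of the field; the tail of its maximum satisfies a recursion for which an
    explicit supersolution with the 3/2 log correction is exhibited.
    Lower bound: a tree whose level variances are slightly reduced near the
    leaves and increased near the root is embedded in the bulk of V_N, the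
    variance deficit paying for the gaps that separate the blocks; the maximum
    of that tree is bounded below through the recursion for truncated tails,
    with explicit sub- and supersolutions of a killed Gaussian kernel. *)
Require Import Defs.
From HB Require Import structures.
From mathcomp Require Import all_boot all_order all_algebra.
From mathcomp Require Import all_classical all_reals all_analysis.
From mathcomp Require Import measurable_realfun zify ring lra.

Set Implicit Arguments.
Unset Strict Implicit.
Unset Printing Implicit Defensive.

Import Order.TTheory GRing.Theory Num.Theory.
Import numFieldNormedType.Exports.

Local Open Scope classical_set_scope.
Local Open Scope ring_scope.

(** * Gaussian integrals *)

(** Both bounds on the mean maximum must be exact up to a constant, so no estimate may lose the
    factor 3/2 of the logarithm. Its source is the profile y exp(-y^2/(2t)), an odd solution of the
    heat equation: a unit Gaussian step turns t into t + 1 and multiplies the amplitude by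
    (t/(t+1))^(3/2). Both tree bounds follow this profile in the frame of the front; errors are made
    to telescope by slightly distorting its width. For the lower bound a truncated second moment is
    propagated in the form w >= 2 t f - t^2 S for all t, which is linear in the moments f and S and
    so survives convolution. It gives only a positive probability of reaching the front; the mean
    follows because this holds on about sqrt n consecutive levels, along which the deficit contracts
    geometrically. Fields are known only through the laws of their linear combinations and live on
    unrelated spaces, hence a Lindeberg exchange for Sudakov-Fernique, preceded by a uniqueness
    argument. The Green function is reached through log |z| itself, whose lattice Laplacian is
    explicit and of order |z|^-4. *)

Section LebesgueAffine.
Context {R : realType}.
Local Notation mu := (@lebesgue_measure R).
Variables (a b : R).
Hypothesis a0 : 0 < a.

Let phi (x : R) : R := a * x + b.
Let mphi : measurable_fun setT phi.
Proof. by apply: measurable_funD => //; apply: measurable_funM. Qed.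
Let phiT : measurableTypeR R -> measurableTypeR R := phi.
Let mphi_mixin := isMeasurableFun.Build _ _ (measurableTypeR R) (measurableTypeR R) phiT mphi.
Let mphi_pack : {mfun measurableTypeR R >-> measurableTypeR R} := HB.pack phiT mphi_mixin.

(** Lebesgue measure is determined by its values on bounded half-open intervals, and the rescaled
    pushforward under the affine map has the same values there. *)
Lemma lebesgue_measure_affine (A : set R) : measurable A ->
  mu A = (a%:E * mu ((fun x : R => a * x + b)%R @^-1` A))%E.
Proof.
move=> mA.
have k0 : (0 <= a)%R by exact: ltW.
pose k : {nonneg R} := NngNum k0.
pose M : {measure set (measurableTypeR R) -> \bar R} :=
  mscale k (pushforward mu mphi_pack).
rewrite -[RHS]/(M mphi A); move: A mA.
apply: lebesgue_measure_unique => //= _ [[x y]] _ <-.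
rewrite /M.
rewrite /mscale /= /pushforward.
have -> : phi @^-1` [set` `]x, y]] = `](x - b) / a, (y - b) / a]%classic.
  apply/seteqP; split=> z /=; rewrite !in_itv/= /phi => /andP[h1 h2]; apply/andP; split.
  - by rewrite ltr_pdivrMr// mulrC ltrBlDr.
  - by rewrite ler_pdivlMr// mulrC lerBrDr.
  - by move: h1; rewrite ltr_pdivrMr// mulrC ltrBlDr.
  - by move: h2; rewrite ler_pdivlMr// mulrC lerBrDr.
rewrite !lebesgue_measure_itv/= !lte_fin ltr_pM2r ?invr_gt0// ltrD2r.
case: ifPn => _; last by rewrite mule0.
by rewrite -!EFinD -EFinM; congr (_%:E); field; rewrite gt_eqF.
Qed.

Lemma ge0_integral_affine (f : R -> \bar R) : measurable_fun setT f ->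
  (forall x, 0 <= f x)%E ->
  (\int[mu]_x f x = a%:E * \int[mu]_x f (a * x + b)%R)%E.
Proof.
move=> mf f0.
have k0 : (0 <= a)%R by exact: ltW.
pose k : {nonneg R} := NngNum k0.
rewrite (eq_measure_integral (mscale k (pushforward mu mphi_pack))); last first.
  by move=> A mA _; exact: lebesgue_measure_affine.
rewrite ge0_integral_mscale//=; congr (_ * _)%E.
by rewrite ge0_integral_pushforward//.
Qed.

End LebesgueAffine.

Section NormalDensity.
Context {R : realType} (m s : R).
Local Notation mu := (@lebesgue_measure R).
Local Notation pdf := (normal_pdf m s).
Local Notation prob := (@normal_prob R m s).
Local Open Scope charge_scope.

(** The density and the Radon-Nikodym derivative of the normal law have the same integral over every
    measurable set, so they agree almost everywhere. *)
Lemma ge0_integral_normal (f : R -> \bar R) : measurable_fun setT f ->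
  (forall x, 0 <= f x)%E ->
  (\int[prob]_x f x = \int[mu]_x (f x * (pdf x)%:E))%E.
Proof.
move=> mf f0; have dom := @normal_prob_dominates R m s.
have mpdf : measurable_fun setT (fun x => (pdf x)%:E : \bar R).
  by apply/measurable_EFinP; exact: measurable_normal_pdf.
rewrite -(Radon_Nikodym_SigmaFinite.change_of_variables dom f0)//.
have iRN := Radon_Nikodym_SigmaFinite.f_integrable dom.
apply: ge0_ae_eq_integral => //.
- by apply: emeasurable_funM => //; exact: measurable_int iRN.
- exact: emeasurable_funM.
- by move=> x _; rewrite mule_ge0// Radon_Nikodym_SigmaFinite.f_ge0.
- by move=> x _; rewrite mule_ge0// lee_fin normal_pdf_ge0.
apply: ae_eqe_mul2l; apply: integral_ae_eq => // E _ mE.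
by rewrite -Radon_Nikodym_SigmaFinite.f_integral.
Qed.

End NormalDensity.

Section StdGauss.
Context {R : realType}.
Local Notation mu := (@lebesgue_measure R).

Definition sgauss : probability (measurableTypeR R) R := @normal_prob R 0 1.
Arguments sgauss : simpl never.

Lemma sgauss_pdfE (x : R) :
  normal_pdf 0 1 x = normal_peak 1 * expR (- (x ^+ 2 / 2)) :> R.
Proof.
rewrite normal_pdfE ?oner_neq0// /normal_fun subr0 expr1n mulNr.
by rewrite -(mulr_natr 1) mul1r.
Qed.

Lemma ge0_integral_sgauss (f : R -> \bar R) : measurable_fun setT f ->
  (forall x, 0 <= f x)%E ->
  (\int[sgauss]_x f x = \int[mu]_x (f x * (normal_pdf 0 1 x)%:E))%E.
Proof. exact: ge0_integral_normal. Qed.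

(** Completing the square: the weight times the standard density is a multiple of the density of the
    normal law with mean b/a and variance 1/a. The case a = 1 is the Cameron-Martin shift; the
    general case is behind the convolution formulas below. *)
Lemma ge0_sgauss_quadratic (a b : R) (f : R -> \bar R) : 0 < a ->
  measurable_fun setT f -> (forall x, 0 <= f x)%E ->
  (\int[sgauss]_x (f x * (expR (- ((a - 1) * x ^+ 2 / 2) + b * x))%:E) =
   ((Num.sqrt a)^-1 * expR (b ^+ 2 / (2 * a)))%:E *
   \int[sgauss]_x f (b / a + x / Num.sqrt a)%R)%E.
Proof.
move=> a0 mf f0.
have sa0 : 0 < Num.sqrt a by rewrite sqrtr_gt0.
have saN : Num.sqrt a != 0 by rewrite gt_eqF.
have maff : measurable_fun setT (fun x : R => b / a + x / Num.sqrt a).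
  by apply: measurable_funD => //; exact: measurable_funM.
have mexp (c d : R) : measurable_fun setT (fun x : R => expR (- (c * x ^+ 2 / 2) + d * x)).
  apply: measurableT_comp => //; apply: measurable_funD.
    apply: measurableT_comp => //; apply: measurable_funM => //.
    by apply: measurable_funM => //; exact: measurable_funX.
  exact: measurable_funM.
rewrite [LHS]ge0_integral_sgauss; last 2 first.
- by apply: emeasurable_funM => //; exact/measurable_EFinP.
- by move=> x; rewrite mule_ge0// lee_fin expR_ge0.
rewrite [X in _ = (_ * X)%E]ge0_integral_sgauss//; last exact: measurableT_comp.
have ia : 0 < (Num.sqrt a)^-1 by rewrite invr_gt0 sqrtr_gt0.
rewrite (@ge0_integral_affine R (Num.sqrt a)^-1 (b / a) ia); last 2 first.
- apply: emeasurable_funM; last by apply/measurable_EFinP; exact: measurable_normal_pdf.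
  by apply: emeasurable_funM => //; exact/measurable_EFinP.
- by move=> x; rewrite !mule_ge0// lee_fin ?expR_ge0// normal_pdf_ge0.
rewrite EFinM -muleA; congr (_ * _)%E.
rewrite -ge0_integralZl//; last 2 first.
- apply: emeasurable_funM; last by apply/measurable_EFinP; exact: measurable_normal_pdf.
  exact: measurableT_comp.
- by move=> x _; rewrite mule_ge0// lee_fin normal_pdf_ge0.
apply: eq_integral => x _.
rewrite !sgauss_pdfE -muleA -EFinM.
rewrite [RHS]muleCA -EFinM; congr (f _ * _%:E)%E; first by rewrite addrC [_^-1 * x]mulrC.
rewrite [LHS]mulrCA [RHS]mulrCA -!expRD; congr (_ * expR _).
set t := Num.sqrt a in saN *.
have -> : a = t ^+ 2 by rewrite sqr_sqrtr// ltW.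
by field; rewrite saN.
Qed.

End StdGauss.

(** * Expectations and integrability of real functions *)

Section Expectation.
Context {R : realType} {d : measure_display} {T : measurableType d}.
Variable P : probability T R.
Implicit Types f g : T -> R.

Definition Ex (f : T -> R) : R := \int[P]_t f t.
Definition L1 (f : T -> R) : Prop := P.-integrable setT (EFin \o f).

Lemma L1_measurable f : L1 f -> measurable_fun setT f.
Proof. by move=> /measurable_int/measurable_EFinP. Qed.

Lemma L1_eq f g : f =1 g -> L1 f -> L1 g.
Proof. by move=> /funext ->. Qed.

Lemma L1_dom f g : measurable_fun setT f -> (forall t, `|f t| <= g t) -> L1 g ->
  L1 f.
Proof.
move=> mf fg; apply: le_integrable => //; first exact/measurable_EFinP.
by move=> t _ /=; rewrite lee_fin (le_trans (fg t))// ler_norm.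
Qed.

Lemma L1_cst c : L1 (fun=> c).
Proof. exact: finite_measure_integrable_cst. Qed.

Lemma L1_bounded f M : measurable_fun setT f -> (forall t, `|f t| <= M) -> L1 f.
Proof. by move=> mf fM; apply: L1_dom (L1_cst M). Qed.

Lemma L1D f g : L1 f -> L1 g -> L1 (fun t => f t + g t).
Proof. by move=> /integrableD h /h; apply. Qed.

Lemma L1Z c f : L1 f -> L1 (fun t => c * f t).
Proof. by move=> /(integrableZl measurableT c). Qed.

Lemma L1N f : L1 f -> L1 (fun t => - f t).
Proof. by move=> /(L1Z (-1)); apply: L1_eq => t; rewrite mulN1r. Qed.

Lemma L1B f g : L1 f -> L1 g -> L1 (fun t => f t - g t).
Proof. by move=> Lf /L1N; exact: L1D. Qed.

Lemma L1_norm f : L1 f -> L1 (fun t => `|f t|).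
Proof. exact: integrable_norm. Qed.

Lemma L1_sum (I : Type) (r : seq I) (F : I -> T -> R) : (forall i, L1 (F i)) ->
  L1 (fun t => \sum_(i <- r) F i t).
Proof.
move=> LF; elim: r => [|i r ih].
  by apply: L1_eq (L1_cst 0) => t; rewrite big_nil.
by apply: L1_eq (L1D (LF i) ih) => t; rewrite big_cons.
Qed.

Lemma L1_max f g : L1 f -> L1 g -> L1 (fun t => Num.max (f t) (g t)).
Proof.
move=> Lf Lg; apply: L1_dom (L1D (L1_norm Lf) (L1_norm Lg)).
  by apply: measurable_maxr; exact: L1_measurable.
move=> t /=; rewrite maxEle; case: ifP => _; by rewrite ?lerDl ?lerDr ?normr_ge0.
Qed.

Lemma ExE f : L1 f -> (\int[P]_t (f t)%:E)%E = (Ex f)%:E.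
Proof.
by move=> Lf; rewrite /Ex /Rintegral fineK//; exact: integrable_fin_num Lf.
Qed.

Lemma eq_Ex f g : f =1 g -> Ex f = Ex g.
Proof. by move=> /funext ->. Qed.

Lemma Ex_cst c : Ex (fun=> c) = c.
Proof. rewrite /Ex Rintegral_cst// -[RHS]mulr1; congr (_ * _).
transitivity (fine (1%E : \bar R)) => //; congr fine; exact: probability_setT. Qed.

Lemma ExD f g : L1 f -> L1 g -> Ex (fun t => f t + g t) = Ex f + Ex g.
Proof. by move=> Lf Lg; rewrite /Ex RintegralD. Qed.

Lemma ExB f g : L1 f -> L1 g -> Ex (fun t => f t - g t) = Ex f - Ex g.
Proof. by move=> Lf Lg; rewrite /Ex RintegralB. Qed.

Lemma ExZ c f : L1 f -> Ex (fun t => c * f t) = c * Ex f.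
Proof. by move=> Lf; rewrite /Ex RintegralZl. Qed.

Lemma ExN f : L1 f -> Ex (fun t => - f t) = - Ex f.
Proof.
by move=> Lf; rewrite -mulN1r -ExZ//; apply: eq_Ex => t; rewrite mulN1r.
Qed.

Lemma Ex_sum (I : Type) (r : seq I) (F : I -> T -> R) : (forall i, L1 (F i)) ->
  Ex (fun t => \sum_(i <- r) F i t) = \sum_(i <- r) Ex (F i).
Proof.
move=> LF; elim: r => [|i r ih].
  by rewrite big_nil -[RHS](Ex_cst 0); apply: eq_Ex => t; rewrite big_nil.
rewrite big_cons -ih -ExD//; last exact: L1_sum.
by apply: eq_Ex => t; rewrite big_cons.
Qed.

Lemma le_Ex f g : L1 f -> L1 g -> (forall t, f t <= g t) -> Ex f <= Ex g.
Proof. by move=> Lf Lg fg; rewrite /Ex le_Rintegral. Qed.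

Lemma Ex_ge0 f : (forall t, 0 <= f t) -> 0 <= Ex f.
Proof. by move=> f0; rewrite /Ex Rintegral_ge0. Qed.

Lemma ler_norm_Ex f : L1 f -> `|Ex f| <= Ex (fun t => `|f t|).
Proof. by move=> Lf; rewrite /Ex le_normr_Rintegral. Qed.

Lemma Ex_dominated (f_ : nat -> T -> R) (f g : T -> R) :
  (forall n, measurable_fun setT (f_ n)) -> measurable_fun setT f ->
  (forall t, f_ ^~ t @ \oo --> f t) -> L1 g ->
  (forall n t, `|f_ n t| <= g t) -> (fun n => Ex (f_ n)) @ \oo --> Ex f.
Proof.
move=> mf_ mf f_f Lg fg.
have Lf_ n : L1 (f_ n) by apply: L1_dom Lg => //; exact: fg.
have Lf : L1 f.
  apply: (L1_dom mf _ Lg) => t.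
  have c : `|f_ n t| @[n --> \oo] --> `|f t| by apply: cvg_norm; exact: f_f.
  rewrite -(cvg_lim _ c)//; apply: limr_le; first by apply/cvg_ex; eexists; exact: c.
  by apply: nearW => n; exact: fg.
have [|||||_ _] := @dominated_convergence d T R P setT measurableT
  (fun n t => (f_ n t)%:E) (EFin \o f) (EFin \o g).
- by move=> n; exact/measurable_EFinP.
- exact/measurable_EFinP.
- by apply: aeW => t _; apply: cvg_EFin; [exact: nearW|exact: f_f].
- exact: Lg.
- by apply: aeW => t n _; rewrite lee_fin fg.
rewrite ExE// => h.
have -> : (fun n => Ex (f_ n)) = (fine \o (fun n => (\int[P]_t (f_ n t)%:E)%E)).
  by apply/funext => n /=; rewrite ExE.
by have /fine_cvgP[_] := h.
Qed.

End Expectation.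

Section GaussExpectation.
Context {R : realType}.
Local Notation g := (@sgauss R).
Local Notation E := (Ex g).

Lemma L1_ge0 d (T : measurableType d) (P : probability T R) (f : T -> R) c :
  measurable_fun setT f ->
  (forall x, 0 <= f x) -> (\int[P]_x (f x)%:E)%E = c%:E -> L1 P f /\ Ex P f = c.
Proof.
move=> mf f0 fc; split; last by rewrite /Ex /Rintegral fc.
apply/integrableP; split; first exact/measurable_EFinP.
under eq_integral do rewrite /= ger0_norm//.
by rewrite fc ltry.
Qed.

Lemma measurable_gexp (c d : R) :
  measurable_fun setT (fun x : R => expR (- (c * x ^+ 2 / 2) + d * x)).
Proof.
apply: measurableT_comp => //; apply: measurable_funD.
  apply: measurableT_comp => //; apply: measurable_funM => //.
  by apply: measurable_funM => //; exact: measurable_funX.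
exact: measurable_funM.
Qed.

Lemma sgauss_quadratic1 (a b : R) : 0 < a ->
  let w := fun x : R => expR (- ((a - 1) * x ^+ 2 / 2) + b * x) in
  L1 g w /\ E w = (Num.sqrt a)^-1 * expR (b ^+ 2 / (2 * a)).
Proof.
move=> a0 w; apply: L1_ge0.
- exact: measurable_gexp.
- by move=> x; exact: expR_ge0.
have := @ge0_sgauss_quadratic R a b (fun=> 1%E) a0 (measurable_cst _) (fun=> lee01).
rewrite integral_cst//= probability_setT !mule1 => <-.
by apply: eq_integral => x _; rewrite mul1e.
Qed.

Lemma L1_expR (b : R) : L1 g (fun x => expR (b * x)) /\
  E (fun x => expR (b * x)) = expR (b ^+ 2 / 2).
Proof.
have [h1 h2] := @sgauss_quadratic1 1 b ltr01.
have e x : expR (- ((1 - 1) * x ^+ 2 / 2) + b * x) = expR (b * x).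
  by rewrite subrr !mul0r oppr0 add0r.
split; first by apply: L1_eq h1.
transitivity (E (fun x => expR (- ((1 - 1) * x ^+ 2 / 2) + b * x))).
  by apply: eq_Ex => x; rewrite e.
by rewrite h2 sqrtr1 invr1 mul1r mulr1.
Qed.

Lemma ge0_sgauss_opp (f : R -> \bar R) : measurable_fun setT f ->
  (forall x, 0 <= f x)%E -> (\int[g]_x f (- x)%R = \int[g]_x f x)%E.
Proof.
move=> mf f0.
have mN : measurable_fun setT (fun x : R => - x : R) by exact: measurableT_comp.
rewrite !ge0_integral_sgauss//; last exact: measurableT_comp.
set h := fun x : R => (f x * (normal_pdf 0 1 x)%:E)%E.
have -> : (fun x : R => (f (- x)%R * (normal_pdf 0 1 x)%:E)%E) = h \o -%R.
  by apply/funext => x; rewrite /h /= !sgauss_pdfE sqrrN.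
have mh : measurable_fun setT h.
  apply: emeasurable_funM => //.
  by apply/measurable_EFinP; exact: measurable_normal_pdf.
have h0 x : (0 <= h x)%E by rewrite mule_ge0// lee_fin normal_pdf_ge0.
transitivity (\int[pushforward (@lebesgue_measure R) (-%R : _ -> measurableTypeR R)]_x h x)%E.
  by rewrite ge0_integral_pushforward.
by apply: eq_measure_integral => A mA _; exact: lebesgue_measureN.
Qed.

Lemma sgauss_opp (f : R -> R) : measurable_fun setT f ->
  E (fun x => f (- x)) = E f.
Proof.
move=> mf; rewrite /Ex /Rintegral; congr fine.
have mN : measurable_fun setT (fun x : R => - x : R) by exact: measurableT_comp.
have mf' : measurable_fun setT (EFin \o f) by exact/measurable_EFinP.
rewrite integralE [RHS]integralE; congr (_ - _)%E.
- rewrite -[RHS]ge0_sgauss_opp//; last exact: measurable_funepos.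
  by apply: eq_integral => x _; rewrite ?funeposE ?funenegE.
- rewrite -[RHS]ge0_sgauss_opp//; last exact: measurable_funeneg.
  by apply: eq_integral => x _; rewrite ?funeposE ?funenegE.
Qed.

End GaussExpectation.

Section GaussConvolution.
Context {R : realType}.
Local Notation gm := (@sgauss R).

Lemma measurable_lin2 (s t : R) :
  measurable_fun setT (fun z : measurableTypeR R * measurableTypeR R => s * z.1 + t * z.2).
Proof.
apply: measurable_funD; first by apply: measurable_funM => //; exact: measurable_fst.
by apply: measurable_funM => //; exact: measurable_snd.
Qed.

Lemma measurable_expRM (b : R) : measurable_fun setT (fun x : R => expR (b * x)).
Proof. by apply: measurableT_comp => //; exact: measurable_funM. Qed.

Lemma ge0_sgauss_shift (b : R) (f : R -> \bar R) :
  measurable_fun setT f -> (forall x, 0 <= f x)%E ->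
  (\int[gm]_x (f x * (expR (b * x))%:E) =
   (expR (b ^+ 2 / 2))%:E * \int[gm]_x f (x + b)%R)%E.
Proof.
move=> mf f0; have h := @ge0_sgauss_quadratic R 1 b f ltr01 mf f0.
transitivity (\int[gm]_x (f x * (expR (- ((1 - 1) * x ^+ 2 / 2) + b * x))%:E))%E.
  by apply: eq_integral => x _; rewrite subrr !mul0r oppr0 add0r.
rewrite h sqrtr1 invr1 mul1r mulr1; congr (_ * _)%E.
by apply: eq_integral => x _; rewrite ?invr1 ?divr1 ?mulr1 addrC.
Qed.

(** With k = s/t one has s x + t y = t (y + k x). Shifting y moves k x into an exponential weight,
    Tonelli brings the integral over x inside, where it is explicit, and the weight left in y is
    removed by the quadratic formula with parameter 1/(1 + k^2). *)
Lemma ge0_sgauss_convolution (s t : R) (f : R -> \bar R) : 0 <= s -> 0 <= t ->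
  measurable_fun setT f -> (forall x, 0 <= f x)%E ->
  (\int[gm]_x \int[gm]_y f (s * x + t * y)%R =
   \int[gm]_x f (Num.sqrt (s ^+ 2 + t ^+ 2) * x)%R)%E.
Proof.
move=> s0 t0 mf f0.
have [->|tN] := eqVneq t 0.
  apply: eq_integral => x _.
  rewrite expr0n addr0 sqrtr_sqr ger0_norm//.
  under eq_integral do rewrite mul0r addr0.
  by rewrite integral_cst//= probability_setT mule1.
have {}t0 : 0 < t by rewrite lt_neqAle eq_sym tN.
set k := s / t.
have mft : measurable_fun setT (fun y : R => f (t * y)).
  by apply: measurableT_comp => //; exact: measurable_funM.
transitivity (\int[gm]_x \int[gm]_y
   (f (t * y)%R * (expR (- ((1 + k ^+ 2 - 1) * x ^+ 2 / 2) + (k * y) * x))%:E))%E.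
  apply: eq_integral => x _.
  have h := @ge0_sgauss_shift (k * x) (fun y => f (t * y)) mft (fun=> f0 _).
  transitivity ((expR (- ((k * x) ^+ 2 / 2)))%:E * ((expR ((k * x) ^+ 2 / 2))%:E *
     \int[gm]_x0 f (t * (x0 + k * x))%R))%E.
    rewrite muleA -EFinM -expRD addNr expR0 mul1e; apply: eq_integral => y _.
    congr f; rewrite /k; field.
    by rewrite gt_eqF.
  rewrite -h.
  rewrite -ge0_integralZl//=; last 2 first.
  - by apply: emeasurable_funM => //; apply/measurable_EFinP; exact: measurable_expRM.
  - by move=> y _; rewrite mule_ge0// lee_fin expR_ge0.
  apply: eq_integral => y _.
  rewrite muleCA -EFinM -expRD; congr (_ * (expR _)%:E)%E; ring.
rewrite (@fubini_tonelli _ _ (measurableTypeR R) (measurableTypeR R) R gm gm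
  (fun z => f (t * z.2)%R * (expR (- ((1 + k ^+ 2 - 1) * z.1 ^+ 2 / 2) + k * z.2 * z.1))%:E)%E); last 2 first.
- apply: emeasurable_funM.
    by apply: measurableT_comp => //; apply: measurableT_comp => //; exact: measurable_snd.
  apply/measurable_EFinP; apply: measurableT_comp => //; apply: measurable_funD.
    apply: measurableT_comp => //; apply: measurable_funM => //; apply: measurable_funM => //.
    by apply: measurable_funX; exact: measurable_fst.
  apply: measurable_funM; last exact: measurable_fst.
  by apply: measurable_funM => //; exact: measurable_snd.
- by move=> z; rewrite mule_ge0// lee_fin expR_ge0.
have a0 : 0 < 1 + k ^+ 2 by rewrite ltr_wpDr// sqr_ge0.
have aN : 1 + k ^+ 2 != 0 by rewrite gt_eqF.
have a'0 : 0 < (1 + k ^+ 2)^-1 by rewrite invr_gt0.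
transitivity (\int[gm]_y (f (t * y)%R * ((Num.sqrt (1 + k ^+ 2))^-1 *
   expR (- (((1 + k ^+ 2)^-1 - 1) * y ^+ 2 / 2) + 0 * y))%:E))%E.
  apply: eq_integral => y _ /=.
  have [L e] := @sgauss_quadratic1 R (1 + k ^+ 2) (k * y) a0.
  rewrite ge0_integralZl//=; last by apply/measurable_EFinP; exact: measurable_gexp.
  rewrite (ExE L) e; congr (_ * (_ * expR _)%:E)%E.
  by field.
have /= h := @ge0_sgauss_quadratic R (1 + k ^+ 2)^-1 0 (fun y => f (t * y)) a'0 mft (fun=> f0 _).
under eq_integral do rewrite EFinM muleCA.
rewrite ge0_integralZl//=; last 2 first.
- by apply: emeasurable_funM => //; apply/measurable_EFinP; exact: measurable_gexp.
- by move=> x _; rewrite mule_ge0// lee_fin expR_ge0.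
rewrite h expr0n mul0r expR0 mulr1 muleA -EFinM.
have sqN : Num.sqrt (1 + k ^+ 2) != 0 by rewrite gt_eqF// sqrtr_gt0.
rewrite sqrtrV ?ltW// invrK mulVf// mul1e.
apply: eq_integral => y _; congr f.
rewrite mul0r add0r mulrCA mulrC; congr (_ * _).
rewrite -{1}(ger0_norm (ltW t0)) -sqrtr_sqr -sqrtrM ?sqr_ge0//; congr Num.sqrt.
by rewrite /k; field.
Qed.

End GaussConvolution.

Section GaussVariable.
Context {R : realType} {d : measure_display} {T : measurableType d}.
Local Notation gm := (@sgauss R).

(** Prescribing integrals of nonnegative functions instead of a density puts the degenerate case v =
    0 on the same footing as the others. *)
Definition cgauss (P : probability T R) (Y : T -> R) (v : R) : Prop :=
  [/\ measurable_fun setT Y, 0 <= v &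
   forall f : R -> \bar R, measurable_fun setT f -> (forall x, 0 <= f x)%E ->
   (\int[P]_t f (Y t) = \int[gm]_x f (Num.sqrt v * x)%R)%E].

Variables (P : probability T R).

Lemma eq_cgauss Y Z v : Y =1 Z -> cgauss P Y v -> cgauss P Z v.
Proof. by move=> /funext ->. Qed.

Lemma cgauss_L1 Y v (f : R -> R) : cgauss P Y v -> measurable_fun setT f ->
  L1 gm (fun x => f (Num.sqrt v * x)) -> L1 P (fun t => f (Y t)).
Proof.
move=> [mY v0 hY] mf Lf; apply/integrableP; split.
  by apply/measurable_EFinP; exact: measurableT_comp.
rewrite /= (hY (fun x => `|(f x)%:E|%E)) => [||x]; last exact: abse_ge0.
  by case/integrableP : Lf.
by apply/measurable_EFinP; exact: measurableT_comp.
Qed.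

Lemma cgauss_Ex Y v (f : R -> R) : cgauss P Y v -> measurable_fun setT f ->
  Ex P (fun t => f (Y t)) = Ex gm (fun x => f (Num.sqrt v * x)).
Proof.
move=> [mY v0 hY] mf; rewrite /Ex /Rintegral; congr fine.
have mf' : measurable_fun setT (EFin \o f) by exact/measurable_EFinP.
rewrite integralE [RHS]integralE; congr (_ - _)%E.
- transitivity (\int[P]_t (EFin \o f)^\+%E (Y t))%E.
    by apply: eq_integral => x _; rewrite ?funeposE.
  rewrite (hY (EFin \o f)^\+%E)//; last exact: measurable_funepos.
  by apply: eq_integral => x _; rewrite ?funeposE.
- transitivity (\int[P]_t (EFin \o f)^\-%E (Y t))%E.
    by apply: eq_integral => x _; rewrite ?funenegE.
  rewrite (hY (EFin \o f)^\-%E)//; last exact: measurable_funeneg.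
  by apply: eq_integral => x _; rewrite ?funenegE.
Qed.

End GaussVariable.

Lemma cgauss_sum {R : realType} d1 d2 (T1 : measurableType d1) (T2 : measurableType d2)
    (P1 : probability T1 R) (P2 : probability T2 R) Y1 Y2 v1 v2 :
  cgauss P1 Y1 v1 -> cgauss P2 Y2 v2 ->
  cgauss (P1 \x P2)%E (fun z => Y1 z.1 + Y2 z.2) (v1 + v2).
Proof.
move=> [mY1 v10 h1] [mY2 v20 h2].
have mS : measurable_fun setT (fun z : T1 * T2 => Y1 z.1 + Y2 z.2).
  apply: measurable_funD; first by apply: measurableT_comp => //; exact: measurable_fst.
  by apply: measurableT_comp => //; exact: measurable_snd.
split=> //; first exact: addr_ge0.
move=> f mf f0.
rewrite fubini_tonelli1//; last exact: measurableT_comp.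
rewrite /fubini_F /=.
have mfs c : measurable_fun setT (fun x : R => f (c + x)).
  by apply: measurableT_comp => //; exact: measurable_funD.
under eq_integral => x _ do rewrite (h2 (fun y => f (Y1 x + y)))//.
pose h (u : R) := (\int[@sgauss R]_x f (u + Num.sqrt v2 * x)%R)%E.
have mh : measurable_fun setT h.
  apply: (@measurable_fun_fubini_tonelli_F _ _ (measurableTypeR R) (measurableTypeR R) R
    (@sgauss R) (fun z => f (z.1 + Num.sqrt v2 * z.2)%R)) => //.
  apply: measurableT_comp => //; apply: measurable_funD; first exact: measurable_fst.
  by apply: measurable_funM => //; exact: measurable_snd.
rewrite (h1 h)//; last by move=> x; exact: integral_ge0.
rewrite /h -{2}(sqr_sqrtr v10) -{2}(sqr_sqrtr v20).
exact: ge0_sgauss_convolution.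
Qed.

(** Bridge from the laws used to define Gaussian variables. The normal law depends on its deviation
    [s] only through the square, hence [|s|]; the Dirac law is the case s = 0. *)
Lemma cgauss_normal {R : realType} d (T : measurableType d) (P : probability T R)
    (Y : T -> R) (m s : R) : measurable_fun setT Y ->
  (forall A : set R, measurable A -> pushforward P Y A = gaussian_law m s A) ->
  forall f : R -> \bar R, measurable_fun setT f -> (forall x, 0 <= f x)%E ->
  (\int[P]_t f (Y t) = \int[@sgauss R]_x f (`|s| * x + m)%R)%E.
Proof.
move=> mY hY f mf f0.
pose Y' : T -> measurableTypeR R := Y.
transitivity (\int[pushforward P Y']_y f y)%E; first by rewrite ge0_integral_pushforward.
rewrite /gaussian_law in hY; have [s0|sN] := eqVneq s 0.
  rewrite s0 eqxx in hY.
  transitivity (\int[dirac (m : measurableTypeR R)]_y f y)%E.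
    by apply: eq_measure_integral => A mA _; exact: hY.
  rewrite integral_dirac// diracT mul1e.
  transitivity (\int[@sgauss R]_x cst (f m) x)%E.
    by rewrite integral_cst//= probability_setT mule1.
  by apply: eq_integral => x _; rewrite s0 normr0 mul0r add0r.
rewrite (negbTE sN) in hY.
transitivity (\int[@normal_prob R m s]_y f y)%E.
  by apply: eq_measure_integral => A mA _; exact: hY.
have n0 : 0 < `|s| by rewrite normr_gt0.
have maff : measurable_fun setT (fun x : R => `|s| * x + m).
  by apply: measurable_funD => //; exact: measurable_funM.
rewrite (ge0_integral_normal m s mf f0).
have mfa : measurable_fun setT (fun x : R => f (`|s| * x + m)) by exact: measurableT_comp.
rewrite [RHS](ge0_integral_sgauss mfa (fun=> f0 _)).
rewrite (@ge0_integral_affine R `|s| m)//; last 2 first.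
- by apply: emeasurable_funM => //; apply/measurable_EFinP; exact: measurable_normal_pdf.
- by move=> x; rewrite mule_ge0// lee_fin normal_pdf_ge0.
rewrite -ge0_integralZl//=; last 2 first.
- apply: emeasurable_funM; first exact: measurableT_comp.
  by apply/measurable_EFinP; apply: measurableT_comp => //; exact: measurable_normal_pdf.
- by move=> x _; rewrite mule_ge0// lee_fin normal_pdf_ge0.
apply: eq_integral => x _; rewrite muleCA -EFinM; congr (_ * _%:E)%E.
rewrite sgauss_pdfE normal_pdfE// /normal_fun /normal_peak mulrA; congr (_ * expR _).
  rewrite expr1n mul1r -mulrnAr sqrtrM ?sqr_ge0// sqrtr_sqr invfM mulrA divff ?mul1r//.
  by rewrite gt_eqF.
rewrite addrK exprMn real_normK ?num_real// -mulr_natr; field; exact: sN.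
Qed.

Section GaussMoments.
Context {R : realType}.
Local Notation gm := (@sgauss R).

Lemma le_of_small (a b c : R) : (forall k, 0 < k -> k < 1 -> a <= b + k * c) -> a <= b.
Proof.
move=> h; rewrite leNgt; apply/negP => ba.
have d0 : 0 < a - b by rewrite subr_gt0.
have c1 : 0 < `|c| + 1 by rewrite ltr_wpDl.
pose k := Num.min (1 / 2) ((a - b) / (`|c| + 1) / 2).
have k0 : 0 < k by rewrite lt_min !divr_gt0.
have k1 : k < 1 by rewrite gt_min; apply/orP; left; lra.
have := h _ k0 k1.
have kc : k * c <= (a - b) / 2.
  apply: (@le_trans _ _ (k * (`|c| + 1))).
    apply: ler_wpM2l; first exact: ltW.
    by rewrite (le_trans (ler_norm _))// lerDl.
  by rewrite -ler_pdivlMr// mulrAC ge_min lexx orbT.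
by lra.
Qed.

Lemma sgauss_normX_L1 (k : nat) : L1 gm (fun x => `|x| ^+ k).
Proof.
have [L1p _] := @L1_expR R 1; have [L1m _] := @L1_expR R (- 1).
apply: L1_dom (L1Z (k`!%:R) (L1D L1p L1m)).
  by apply: measurable_funX => //; exact: measurableT_comp.
move=> x; rewrite normrX normr_id mul1r mulN1r.
case: k => [|k].
  rewrite expr0 fact0 mul1r; have [x0|x0] := leP 0 x.
    rewrite -[leLHS]addr0 lerD ?expR_ge0//.
    by rewrite -expR0 ler_expR.
  by rewrite -[leLHS]add0r lerD ?expR_ge0// -expR0 ler_expR; lra.
have key (y : R) : 0 <= y -> y ^+ k.+1 <= (k.+1)`!%:R * expR y.
  move=> y0; rewrite mulrC -ler_pdivrMr ?ltr0n ?fact_gt0//.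
  by apply: le_trans (expR_ge1Dxn k y0); rewrite lerDr.
have [x0|x0] := leP 0 x.
  rewrite ger0_norm// (le_trans (key _ x0))// ler_wpM2l//.
  by rewrite lerDl expR_ge0.
rewrite ltr0_norm// (le_trans (key (- x) _))//; first by lra.
by rewrite ler_wpM2l// lerDr expR_ge0.
Qed.

Lemma sgauss_X_L1 (k : nat) : L1 gm (fun x : R => x ^+ k).
Proof.
apply: L1_dom (sgauss_normX_L1 k); first exact: measurable_funX.
by move=> x; rewrite normrX.
Qed.

Lemma sgauss_id_L1 : L1 gm (fun x : R => x).
Proof. exact: L1_eq (sgauss_X_L1 1). Qed.

Lemma sgauss_mean : Ex gm (fun x : R => x) = 0.
Proof.
have h := @sgauss_opp R (fun x : R => x) (@measurable_id _ _ _).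
have := ExN sgauss_id_L1; rewrite h => e.
by lra.
Qed.

(** The mean of exp(-k x^2/2) is 1/sqrt(1 + k). Both sides are expanded to first order in k, with
    errors of order k^2 controlled by the fourth moment, and k tends to 0. *)
Lemma sgauss_var : Ex gm (fun x : R => x ^+ 2) = 1.
Proof.
set m2 := Ex _ _; set m4 := Ex gm (fun x : R => x ^+ 4).
have L2 : L1 gm (fun x : R => x ^+ 2) by exact: sgauss_X_L1.
have L4 : L1 gm (fun x : R => x ^+ 4) by exact: sgauss_X_L1.
have expN (y : R) : 0 <= y -> 1 - y <= expR (- y) /\ expR (- y) <= 1 - y + y ^+ 2.
  move=> y0; split; first exact: expR_ge1Dx.
  rewrite expRN.
  have h1 : (1 + y / 2) ^+ 2 <= expR y.
    have -> : y = y / 2 + y / 2 by lra.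
    rewrite expRD -expr2 -(splitr y) lerXn2r ?nnegrE ?expR_ge0 ?expR_ge1Dx//.
    by rewrite addr_ge0// divr_ge0.
  have h2 : 0 < expR y by exact: expR_gt0.
  rewrite -[leLHS]mul1r ler_pdivrMr//.
  apply: (@le_trans _ _ ((1 - y + y ^+ 2) * (1 + y / 2) ^+ 2)); last first.
    by rewrite ler_wpM2l//; nra.
  rewrite -subr_ge0; have -> : (1 - y + y ^+ 2) * (1 + y / 2) ^+ 2 - 1 =
    y ^+ 2 / 4 + 3 / 4 * y ^+ 3 + y ^+ 4 / 4 by field.
  by rewrite !addr_ge0 ?mulr_ge0 ?exprn_ge0.
have sand (k : R) : 0 < k -> k < 1 ->
   1 - k / 2 * m2 <= (Num.sqrt (1 + k))^-1 <= 1 - k / 2 * m2 + (k / 2) ^+ 2 * m4.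
  move=> k0 k1; have a0 : 0 < 1 + k by lra.
  have [Lw Ew] := @sgauss_quadratic1 R (1 + k) 0 a0.
  have <- : Ex gm (fun x => expR (- (k / 2 * x ^+ 2))) = (Num.sqrt (1 + k))^-1.
    move: Ew; rewrite expr0n mul0r expR0 mulr1 => <-.
    by apply: eq_Ex => x; congr expR; field.
  have Lw' : L1 gm (fun x => expR (- (k / 2 * x ^+ 2))).
    by apply: L1_eq Lw => x; congr expR; field.
  have y0 (x : R) : 0 <= k / 2 * x ^+ 2 by rewrite mulr_ge0 ?sqr_ge0//; lra.
  have La : L1 gm (fun x : R => 1 - k / 2 * x ^+ 2).
    by apply: L1B; [exact: L1_cst|exact: L1Z].
  have Ea : Ex gm (fun x : R => 1 - k / 2 * x ^+ 2) = 1 - k / 2 * m2.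
    by rewrite ExB ?ExZ ?Ex_cst//; [exact: L1_cst|exact: L1Z].
  apply/andP; split.
    by rewrite -Ea; apply: le_Ex => // x; case: (expN _ (y0 x)).
  have Lb : L1 gm (fun x : R => (1 - k / 2 * x ^+ 2) + (k / 2) ^+ 2 * x ^+ 4).
    by apply: L1D => //; exact: L1Z.
  rewrite -Ea -ExZ// -ExD//; last exact: L1Z.
  apply: le_Ex => // x; case: (expN _ (y0 x)) => _; rewrite exprMn -exprM; exact.
have sq (k : R) : 0 < k -> k < 1 -> 1 - k / 2 <= (Num.sqrt (1 + k))^-1 <= 1 - k / 2 + k ^+ 2 / 2.
  move=> k0 k1; have a0 : 0 < 1 + k by lra.
  have s0 : 0 < Num.sqrt (1 + k) by rewrite sqrtr_gt0.
  have ss : Num.sqrt (1 + k) ^+ 2 = 1 + k by rewrite sqr_sqrtr// ltW.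
  apply/andP; split.
    rewrite -[leRHS]mul1r ler_pdivlMr// -ler_sqr ?nnegrE//; last by rewrite mulr_ge0//; lra.
    by rewrite exprMn ss expr1n; nra.
  rewrite -[leLHS]mul1r ler_pdivrMr// -ler_sqr ?nnegrE//; last by rewrite mulr_ge0//; nra.
  rewrite exprMn ss expr1n -subr_ge0.
  have -> : (1 - k / 2 + k ^+ 2 / 2) ^+ 2 * (1 + k) - 1 =
    k ^+ 2 / 4 + 3 / 4 * k ^+ 3 - k ^+ 4 / 4 + k ^+ 5 / 4 by field.
  have := exprn_ge0 2 (ltW k0); have := exprn_ge0 3 (ltW k0); have := exprn_ge0 5 (ltW k0).
  have : k ^+ 4 <= k ^+ 3 by rewrite [k ^+ 4]exprSr ler_piMr ?exprn_ge0// ltW.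
  lra.
apply/eqP; rewrite eq_le; apply/andP; split.
  apply: (@le_of_small _ _ (m4 / 2)) => k k0 k1.
  have /andP[_ h1] := sand k k0 k1; have /andP[h2 _] := sq k k0 k1.
  have h3 : k / 2 * m2 <= k / 2 * (1 + k * (m4 / 2)).
    have -> : k / 2 * (1 + k * (m4 / 2)) = k / 2 + (k / 2) ^+ 2 * m4 by field.
    by lra.
  by rewrite ler_pM2l in h3; [exact: h3|lra].
apply: (@le_of_small _ _ 1) => k k0 k1.
have /andP[h1 _] := sand k k0 k1; have /andP[_ h2] := sq k k0 k1.
have h3 : k / 2 * 1 <= k / 2 * (m2 + k * 1).
  have -> : k / 2 * (m2 + k * 1) = k / 2 * m2 + k ^+ 2 / 2 by field.
  by lra.
by rewrite ler_pM2l in h3; [exact: h3|lra].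
Qed.

End GaussMoments.

Section CGaussMoments.
Context {R : realType} {d : measure_display} {T : measurableType d}.
Variables (P : probability T R) (Y : T -> R) (v : R).
Hypothesis hY : cgauss P Y v.

Lemma cgauss_normX_L1 k : L1 P (fun t => `|Y t| ^+ k).
Proof.
apply: (cgauss_L1 (f := fun x => `|x| ^+ k) hY).
  by apply: measurable_funX => //; exact: measurableT_comp.
apply: L1_eq (L1Z (`|Num.sqrt v| ^+ k) (sgauss_normX_L1 k)) => x.
by rewrite normrM exprMn.
Qed.

Lemma cgauss_id_L1 : L1 P Y.
Proof.
case: hY => mY _ _; apply: L1_dom (cgauss_normX_L1 1) => // t.
Qed.

Lemma cgauss_mean : Ex P Y = 0.
Proof.
rewrite (cgauss_Ex (f := fun x => x) hY)// ExZ ?sgauss_mean ?mulr0//.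
exact: sgauss_id_L1.
Qed.

Lemma cgauss_var : Ex P (fun t => Y t ^+ 2) = v.
Proof.
rewrite (cgauss_Ex (f := fun x => x ^+ 2) hY); last exact: measurable_funX.
under [X in Ex _ X]funext do rewrite exprMn.
rewrite ExZ ?sgauss_var ?mulr1; last exact: sgauss_X_L1.
by rewrite sqr_sqrtr//; case: hY.
Qed.

End CGaussMoments.

(** * Centered Gaussian fields *)

Section GField.
Context {R : realType}.

(** [V] gives the variance of each linear combination. Carrying it as a function rather than as a
    covariance matrix makes sums, unions, relabellings and rescalings of fields simple operations on
    [V]. *)
Definition gfield d (T : measurableType d) (P : probability T R) (I : finType)
    (X : I -> T -> R) (V : (I -> R) -> R) : Prop :=
  forall a : I -> R, cgauss P (fun t => \sum_i a i * X i t) (V a).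

Definition dirac_coef (I : finType) (i : I) : I -> R := fun j => (i == j)%:R.

Lemma sum_dirac_coef (I : finType) (i : I) (x : I -> R) :
  \sum_j dirac_coef i j * x j = x i.
Proof.
rewrite (bigD1 i)//= /dirac_coef eqxx mul1r big1 ?addr0// => j ji.
by rewrite eq_sym (negbTE ji) mul0r.
Qed.

Section one_field.
Context d (T : measurableType d) (P : probability T R) (I : finType).
Variables (X : I -> T -> R) (V : (I -> R) -> R).
Hypothesis hX : gfield P X V.

Lemma gfield_cgauss i : cgauss P (X i) (V (dirac_coef i)).
Proof. by apply: eq_cgauss (hX (dirac_coef i)) => t; rewrite sum_dirac_coef. Qed.

Lemma gfield_cgaussB i j :
  cgauss P (fun t => X i t - X j t) (V (fun k => dirac_coef i k - dirac_coef j k)).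
Proof.
apply: eq_cgauss (hX _) => t.
under eq_bigr do rewrite mulrBl.
by rewrite sumrB !sum_dirac_coef.
Qed.

Lemma gfield_measurable i : measurable_fun setT (X i).
Proof. by case: (gfield_cgauss i). Qed.

Lemma gfield_L1 i : L1 P (X i).
Proof. exact: cgauss_id_L1 (gfield_cgauss i). Qed.

Lemma gfield_mean i : Ex P (X i) = 0.
Proof. exact: cgauss_mean (gfield_cgauss i). Qed.

Lemma eq_gfield (X' : I -> T -> R) (V' : (I -> R) -> R) :
  (forall i t, X i t = X' i t) -> (forall a, V a = V' a) -> gfield P X' V'.
Proof.
move=> XX VV a; rewrite -VV; apply: eq_cgauss (hX a) => t.
by apply: eq_bigr => i _; rewrite XX.
Qed.

Lemma gfield_map (J : finType) (iota : J -> I) :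
  gfield P (fun j => X (iota j)) (fun b => V (fun i => \sum_(j | iota j == i) b j)).
Proof.
move=> b; apply: eq_cgauss (hX _) => t.
under eq_bigr do rewrite big_distrl/=.
rewrite (exchange_big_dep xpredT)//=; apply: eq_bigr => j _.
by rewrite (big_pred1 (iota j)).
Qed.

Lemma gfield_scale (c : R) :
  gfield P (fun i t => c * X i t) (fun a => V (fun i => c * a i)).
Proof.
move=> a; apply: eq_cgauss (hX _) => t.
by apply: eq_bigr => i _; rewrite mulrAC mulrC mulrA.
Qed.

End one_field.

Section two_fields.
Context d1 (T1 : measurableType d1) (P1 : probability T1 R).
Context d2 (T2 : measurableType d2) (P2 : probability T2 R).

Lemma gfield_add (I : finType) (X : I -> T1 -> R) V (Y : I -> T2 -> R) W :
  gfield P1 X V -> gfield P2 Y W ->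
  gfield (P1 \x P2)%E (fun i z => X i z.1 + Y i z.2) (fun a => V a + W a).
Proof.
move=> hX hY a; apply: eq_cgauss (cgauss_sum (hX a) (hY a)) => z.
by rewrite -big_split/=; apply: eq_bigr => i _; rewrite mulrDr.
Qed.

Lemma gfield_union (I J : finType) (X : I -> T1 -> R) V (Y : J -> T2 -> R) W :
  gfield P1 X V -> gfield P2 Y W ->
  gfield (P1 \x P2)%E (fun k z => match k with inl i => X i z.1 | inr j => Y j z.2 end)
    (fun a => V (fun i => a (inl i)) + W (fun j => a (inr j))).
Proof.
move=> hX hY a; apply: eq_cgauss (cgauss_sum (hX _) (hY _)) => z.
by rewrite big_sumType.
Qed.

End two_fields.

(** The definition leaves mean and deviation of each combination Y free. They are identified by
    comparing the second moment of Y + c computed from the law with the one computed from the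
    covariances. Square integrability has to be extracted from the law beforehand. *)
Lemma gfield_of_gaussian_field d (T : measurableType d) (P : probability T R)
    (I : finType) (X : I -> {RV P >-> R}) (C : I -> I -> R) :
  gaussian_field X -> (forall i, ('E_P[X i] = 0)%E) ->
  (forall i j, ('E_P[fun t => (X i t * X j t)%R] = (C i j)%:E)%E) ->
  gfield P (fun i => X i : T -> R) (fun a => \sum_i \sum_j a i * a j * C i j).
Proof.
move=> gX cX covX.
have mX a : measurable_fun setT (fun t => \sum_i a i * X i t).
  by apply: measurable_sum => i; apply: measurable_funM.
have law a : exists m s : R, forall f : R -> \bar R, measurable_fun setT f ->
    (forall x, 0 <= f x)%E ->
    (\int[P]_t f (\sum_i a i * X i t)%R = \int[@sgauss R]_x f (`|s| * x + m)%R)%E.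
  have [m [s h]] := gX a; exists m, s; exact: cgauss_normal.
have L2 i : L1 P (fun t => X i t ^+ 2).
  apply/integrableP; split; first by apply/measurable_EFinP; exact: measurable_funX.
  have [m [s h]] := law (dirac_coef i).
  have := h (fun x => (x ^+ 2)%:E) => /=.
  under eq_integral do rewrite sum_dirac_coef.
  under [X in (_ -> _ -> _ = X) -> _]eq_integral do rewrite sqrrD.
  move=> h2.
  under eq_integral do rewrite /= ger0_norm ?sqr_ge0//.
  rewrite h2; last 2 first.
  - by apply/measurable_EFinP; exact: measurable_funX.
  - by move=> x; rewrite lee_fin sqr_ge0.
  rewrite (@ExE _ _ (measurableTypeR R) (@sgauss R) (fun x : R => (`|s| * x) ^+ 2 + `|s| * x * m *+ 2 + m ^+ 2)) ?ltry//.
  apply: L1D; last exact: L1_cst.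
  apply: L1D.
    by apply: L1_eq (L1Z (`|s| ^+ 2) (sgauss_X_L1 2)) => x; rewrite exprMn.
  apply: L1_eq (L1Z (`|s| * m *+ 2) sgauss_id_L1) => x.
  by rewrite mulrnAl mulrAC.
have L1X i : L1 P (X i).
  apply: L1_dom (L1D (L1_cst P 1) (L2 i)) => // t.
  have := sqr_ge0 (`|X i t| - 1/2); rewrite sqrrB real_normK ?num_real//; lra.
have L1XX i j : L1 P (fun t => X i t * X j t).
  apply: L1_dom (L1D (L2 i) (L2 j)); first exact: measurable_funM.
  move=> t; rewrite normrM; have := sqr_ge0 (`|X i t| - `|X j t|).
  have := sqr_ge0 `|X i t|; have := sqr_ge0 `|X j t|.
  by rewrite sqrrB !real_normK ?num_real//; lra.
have EX i : Ex P (X i) = 0.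
  have := cX i; rewrite unlock => h; apply: EFin_inj; rewrite -(ExE (L1X i)); exact: h.
have EXX i j : Ex P (fun t => X i t * X j t) = C i j.
  have := covX i j; rewrite unlock => h; apply: EFin_inj; rewrite -(ExE (L1XX i j)); exact: h.
move=> a; have [m [s h]] := law a.
pose Y t := \sum_i a i * X i t.
have transfer (f : R -> R) : measurable_fun setT f -> (forall x, 0 <= f x) ->
    L1 (@sgauss R) (fun x => f (`|s| * x + m)) ->
    Ex P (fun t => f (Y t)) = Ex (@sgauss R) (fun x => f (`|s| * x + m)).
  move=> mf f0 _; rewrite /Ex /Rintegral; congr fine.
  by apply: (h (EFin \o f)); [exact/measurable_EFinP|move=> x; rewrite lee_fin].
have LY : L1 P Y by apply: L1_sum => i; exact: L1Z.
have EY : Ex P Y = 0.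
  by rewrite Ex_sum => [|i]; [rewrite big1// => i _; rewrite ExZ// EX mulr0|exact: L1Z].
have LY2 : L1 P (fun t => Y t ^+ 2).
  apply: (@L1_eq _ _ _ _ (fun t => \sum_i \sum_j a i * a j * (X i t * X j t))).
    move=> t; rewrite /Y expr2 big_distrlr/=.
    by apply: eq_bigr => i _; apply: eq_bigr => j _; ring.
  by apply: L1_sum => i; apply: L1_sum => j; exact: L1Z.
have EY2 : Ex P (fun t => Y t ^+ 2) = \sum_i \sum_j a i * a j * C i j.
  transitivity (Ex P (fun t => \sum_i \sum_j a i * a j * (X i t * X j t))).
    apply: eq_Ex => t; rewrite /Y expr2 big_distrlr/=.
    by apply: eq_bigr => i _; apply: eq_bigr => j _; ring.
  rewrite Ex_sum => [|i]; last by apply: L1_sum => j; exact: L1Z.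
  apply: eq_bigr => i _; rewrite Ex_sum => [|j]; last exact: L1Z.
  by apply: eq_bigr => j _; rewrite ExZ// EXX.
have Lx := @sgauss_id_L1 R; have Lx2 := @sgauss_X_L1 R 2.
have sq c : L1 (@sgauss R) (fun x => (`|s| * x + m + c) ^+ 2) /\
    Ex (@sgauss R) (fun x => (`|s| * x + m + c) ^+ 2) = s ^+ 2 + (m + c) ^+ 2.
  have e (x : R) : `|s| ^+ 2 * x ^+ 2 + (2 * `|s| * (m + c)) * x + (m + c) ^+ 2 =
     (`|s| * x + m + c) ^+ 2 by ring.
  have La : L1 (@sgauss R) (fun x => `|s| ^+ 2 * x ^+ 2 + (2 * `|s| * (m + c)) * x).
    by apply: L1D; exact: L1Z.
  split.
    by apply: (@L1_eq _ _ (measurableTypeR R) (@sgauss R) (fun x : R => `|s| ^+ 2 * x ^+ 2 + (2 * `|s| * (m + c)) * x + (m + c) ^+ 2)) => //; apply: L1D => //; exact: L1_cst.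
  transitivity (Ex (@sgauss R) (fun x : R => `|s| ^+ 2 * x ^+ 2 + (2 * `|s| * (m + c)) * x + (m + c) ^+ 2)).
    by apply: eq_Ex => x; rewrite e.
  rewrite ExD ?Ex_cst ?ExD ?ExZ ?sgauss_var ?sgauss_mean//; last 3 first.
  - exact: L1Z.
  - exact: L1Z.
  - exact: L1_cst.
  by rewrite mulr0 addr0 mulr1 real_normK ?num_real.
have EYc c : Ex P (fun t => (Y t + c) ^+ 2) = s ^+ 2 + (m + c) ^+ 2.
  have [La <-] := sq c; apply: (transfer (fun x => (x + c) ^+ 2)) => [|x|].
  - by apply: measurable_funX; exact: measurable_funD.
  - exact: sqr_ge0.
  - exact: La.
have EYc' c : Ex P (fun t => (Y t + c) ^+ 2) = Ex P (fun t => Y t ^+ 2) + c ^+ 2.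
  transitivity (Ex P (fun t => Y t ^+ 2 + (2 * c * Y t + c ^+ 2))).
    by apply: eq_Ex => t; ring.
  have Lc := L1Z (2 * c) LY; have Lk := L1_cst P (c ^+ 2); have Ls := L1D Lc Lk.
  by rewrite (ExD LY2 Ls) (ExD Lc Lk) (ExZ _ LY) EY mulr0 add0r Ex_cst.
(* The values c = 0 and c = 1 give E Y^2 = s^2 + m^2 and E Y^2 + 1 = s^2 + (m + 1)^2. *)
have m0 : m = 0.
  have h0 := EYc 0; have h1 := EYc 1; rewrite EYc' in h0; rewrite EYc' in h1.
  by move: h0 h1; rewrite !addr0 expr0n expr1n addr0; nra.
have s2 : \sum_i \sum_j a i * a j * C i j = s ^+ 2.
  by have := EYc' 0; rewrite EYc m0 EY2 !addr0 expr0n !addr0.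
split=> //; first by rewrite s2 sqr_ge0.
move=> f mf f0; rewrite h//; apply: eq_integral => x _.
by rewrite m0 addr0 s2 sqrtr_sqr.
Qed.

End GField.

(** * Bernstein polynomials *)

Section Bernstein.
Context {R : realType}.

(** The Bernstein polynomial of degree n, that is the mean of f under the binomial law, conditioned
    on the first trial. In this form multiplication by the polynomial reduces to repeated
    multiplication by x and by 1 - x. *)
Fixpoint binom_mean (n : nat) (f : nat -> R) (x : R) : R :=
  if n is n'.+1 then
    x * binom_mean n' (fun k => f k.+1) x + (1 - x) * binom_mean n' f x
  else f 0%N.

Lemma binom_mean_cst n c x : binom_mean n (fun=> c) x = c.
Proof. by elim: n => //= n ->; ring. Qed.

Lemma binom_mean_lin n (a : R) f g x :
  binom_mean n (fun k => a * f k + g k) x = a * binom_mean n f x + binom_mean n g x.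
Proof. by elim: n f g => //= n ih f g; rewrite !ih; ring. Qed.

Lemma le_binom_mean n f g x : 0 <= x <= 1 -> (forall k, f k <= g k) ->
  binom_mean n f x <= binom_mean n g x.
Proof.
move=> /andP[x0 x1]; elim: n f g => //= n ih f g fg.
by apply: lerD; apply: ler_wpM2l; rewrite ?subr_ge0//; apply: ih.
Qed.

Lemma binom_mean_sq n c x :
  binom_mean n (fun k => (k%:R + c) ^+ 2) x =
  (n%:R * x + c) ^+ 2 + n%:R * x * (1 - x).
Proof.
elim: n c => [|n ih] c /=; first by ring.
have -> : (fun k : nat => (k.+1%:R + c) ^+ 2) = (fun k => (k%:R + (1 + c)) ^+ 2).
  by apply/funext => k; rewrite -natr1 addrA.
by rewrite !ih -natr1; ring.
Qed.

(** A bounded f continuous at x differs from f x by at most e/2 plus a multiple C of (y - x)^2, and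
    the binomial variance bounds the mean of the second part by C/n. *)
Lemma binom_mean_cvg (f : R -> R) (M x : R) : 0 <= x <= 1 ->
  (forall y, `|f y| <= M) -> {for x, continuous f} ->
  binom_mean n (fun k => f (k%:R / n%:R)) x @[n --> \oo] --> f x.
Proof.
move=> x01 fM cf; apply/cvgrPdist_le => e e0.
have e20 : 0 < e / 2 by rewrite divr_gt0.
have /cvgrPdist_le /(_ _ e20) /nbhs_ballP [d /= d0 hd] : f z @[z --> x] --> f x by [].
have M0 : 0 <= M by apply: le_trans (fM 0).
pose C := 2 * M / d ^+ 2.
have C0 : 0 <= C by rewrite divr_ge0// ?sqr_ge0 ?mulr_ge0.
have fxy y : `|f y - f x| <= e / 2 + C * (y - x) ^+ 2.
  have [dy|dy] := ltP `|x - y| d.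
    rewrite distrC (le_trans (hd _ dy))// lerDl mulr_ge0// sqr_ge0//.
  apply: (@le_trans _ _ (2 * M)).
    by rewrite mulr_natl mulr2n (le_trans (ler_normB _ _))// lerD.
  apply: (@le_trans _ _ (C * (y - x) ^+ 2)); last by rewrite lerDr divr_ge0// ltW.
  rewrite /C -mulrA ler_peMr ?mulr_ge0// mulrC ler_pdivlMr ?exprn_gt0// mul1r.
  by rewrite -[leRHS]real_normK ?num_real// distrC lerXn2r ?nnegrE// ltW.
clearbody C.
near=> n.
have n0 : (0 : R) < n%:R by near: n; exact: (nbhs_infty_gtr 0).
have -> : f x - binom_mean n (fun k => f (k%:R / n%:R)) x =
          - binom_mean n (fun k => 1 * f (k%:R / n%:R) + - f x) x.
  by rewrite binom_mean_lin binom_mean_cst; ring.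
have V : binom_mean n (fun k => C / n%:R ^+ 2 * (k%:R - n%:R * x) ^+ 2 + e / 2) x <= e.
  rewrite binom_mean_lin binom_mean_sq binom_mean_cst subrr expr0n add0r.
  suff : C / n%:R ^+ 2 * (n%:R * x * (1 - x)) <= e / 2 by lra.
  apply: (@le_trans _ _ (C / n%:R)).
    have -> : C / n%:R ^+ 2 * (n%:R * x * (1 - x)) = C / n%:R * (x * (1 - x)).
      by field; rewrite gt_eqF.
    rewrite ler_piMr ?divr_ge0//.
    by case/andP: x01 => *; nra.
  rewrite ler_pdivrMr// -ler_pdivrMl ?divr_gt0//.
  near: n; exact: nbhs_infty_ger.
have b k : `|1 * f (k%:R / n%:R) + - f x| <= C / n%:R ^+ 2 * (k%:R - n%:R * x) ^+ 2 + e / 2.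
  rewrite mul1r (le_trans (fxy _))// addrC lerD2r le_eqVlt; apply/orP; left; apply/eqP.
  by field; rewrite gt_eqF.
rewrite normrN ler_norml; apply/andP; split; last first.
  apply: le_trans V; apply: le_binom_mean => // k.
  by apply: le_trans (b k); exact: ler_norm.
rewrite lerNl -mulN1r -[leLHS]addr0 -(binom_mean_cst n 0 x) -binom_mean_lin.
apply: le_trans V; apply: le_binom_mean => // k.
by rewrite addr0 mulN1r (le_trans _ (b k))// -normrN ler_norm.
Unshelve. all: by end_near. Qed.

End Bernstein.

(** * Uniqueness of the mean log-sum-exp of a Gaussian field *)

Section Uniqueness.
Context {R : realType} (I : finType).
Context d1 (T1 : measurableType d1) (P1 : probability T1 R).
Context d2 (T2 : measurableType d2) (P2 : probability T2 R).
Variables (X1 : I -> T1 -> R) (X2 : I -> T2 -> R) (V : (I -> R) -> R).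
Hypotheses (hX1 : gfield P1 X1 V) (hX2 : gfield P2 X2 V).

Let mfun (F : (I -> R) -> R) : Prop :=
  measurable_fun setT (fun t => F (fun i => X1 i t)) /\
  measurable_fun setT (fun t => F (fun i => X2 i t)).

Let same (F : (I -> R) -> R) : Prop :=
  Ex P1 (fun t => F (fun i => X1 i t)) = Ex P2 (fun t => F (fun i => X2 i t)).

Let wave (a : I -> R) (b : R) (x : I -> R) : R := cos (\sum_i a i * x i + b).

(** Means must agree after multiplication by any cosine wave. With this extra factor the class
    contains the constants, by the one-dimensional laws, and is stable under linear combinations,
    products with waves and bounded limits. It is enlarged step by step until it contains
    truncations of the log-sum-exp. *)
Let good (M : R) (F : (I -> R) -> R) : Prop :=
  [/\ mfun F, (forall x, `|F x| <= M) & forall a b, same (fun x => F x * wave a b x)].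

Let mcos b : measurable_fun setT (fun u : R => cos (u + b)).
Proof.
apply: measurableT_comp; last exact: measurable_funD.
by apply: continuous_measurable_fun; exact: continuous_cos.
Qed.

Let m_wave a b : mfun (wave a b).
Proof.
split.
  by case: (hX1 a) => mY _ _; exact: (measurableT_comp (mcos b) mY).
by case: (hX2 a) => mY _ _; exact: (measurableT_comp (mcos b) mY).
Qed.

Let norm_wave a b x : `|wave a b x| <= 1.
Proof. by rewrite ler_norml cos_geN1 cos_le1. Qed.

Let mfunM F G : mfun F -> mfun G -> mfun (fun x => F x * G x).
Proof. by move=> [? ?] [? ?]; split; exact: measurable_funM. Qed.

Let mfunD F G : mfun F -> mfun G -> mfun (fun x => F x + G x).
Proof. by move=> [? ?] [? ?]; split; exact: measurable_funD. Qed.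

Let goodL1 M F a b : good M F -> L1 P1 (fun t => (F \* wave a b) (fun i => X1 i t)) /\
  L1 P2 (fun t => (F \* wave a b) (fun i => X2 i t)).
Proof.
move=> [mF FM _]; have [m1 m2] := mfunM mF (m_wave a b).
split; apply: L1_bounded => //= t; rewrite normrM (le_trans (ler_pM _ _ (FM _) (norm_wave _ _ _)))// ?mulr1.
Qed.

Let good_one : good 1 (fun=> 1).
Proof.
split; first by split; exact: measurable_cst.
  by move=> x; rewrite normr1.
move=> a b; rewrite /same /wave.
transitivity (Ex (@sgauss R) (fun u => cos (Num.sqrt (V a) * u + b))).
  rewrite -(cgauss_Ex (hX1 a) (mcos b)); by apply: eq_Ex => t; rewrite mul1r.
rewrite -(cgauss_Ex (hX2 a) (mcos b)); by apply: eq_Ex => t; rewrite mul1r.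
Qed.

Let good_zero : good 0 (fun=> 0).
Proof.
split; first by split; exact: measurable_cst.
  by move=> x; rewrite normr0.
move=> a b; rewrite /same; transitivity (0 : R).
  by rewrite -[RHS](Ex_cst P1); apply: eq_Ex => t; rewrite mul0r.
by rewrite -[LHS](Ex_cst P2); apply: eq_Ex => t; rewrite mul0r.
Qed.

Let good_lin M N c F G : good M F -> good N G -> good (`|c| * M + N) (fun x => c * F x + G x).
Proof.
move=> gF gG; have [mF FM sF] := gF; have [mG GM sG] := gG; split.
- by apply: mfunD => //; apply: mfunM => //; split; exact: measurable_cst.
- move=> x; rewrite (le_trans (ler_normD _ _))// normrM lerD//; exact: ler_wpM2l.
move=> a b; have [LF1 LF2] := goodL1 a b gF; have [LG1 LG2] := goodL1 a b gG.
rewrite /same.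
transitivity (c * Ex P1 (fun t => (F \* wave a b) (fun i => X1 i t)) +
   Ex P1 (fun t => (G \* wave a b) (fun i => X1 i t))).
  rewrite -ExZ// -ExD//; last exact: L1Z.
  by apply: eq_Ex => t /=; rewrite mulrDl mulrA.
rewrite [X in _ * X + _]sF [X in _ + X]sG -ExZ// -ExD//; last exact: L1Z.
by apply: eq_Ex => t /=; rewrite mulrDl mulrA.
Qed.

Let good_le M N F : good M F -> M <= N -> good N F.
Proof. by move=> [? h ?] MN; split=> // x; exact: le_trans (h x) MN. Qed.

Let good_eq M F G : F =1 G -> good M F -> good M G.
Proof. by move=> /funext ->. Qed.

(** A product of two cosines is half the sum of two cosines, with the arguments added and
    subtracted. *)
Let good_wave M F c e : good M F -> good M (fun x => F x * wave c e x).
Proof.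
move=> gF; have [mF FM sF] := gF; split.
- exact: mfunM.
- by move=> x; rewrite normrM (le_trans (ler_pM _ _ (FM _) (norm_wave _ _ _)))// mulr1.
move=> a b.
have e1 x : F x * wave c e x * wave a b x = 2^-1 * (F x * wave (fun i => c i + a i) (e + b) x) +
    2^-1 * (F x * wave (fun i => c i - a i) (e - b) x).
  rewrite /wave.
  have -> : \sum_i (c i + a i) * x i + (e + b) = (\sum_i c i * x i + e) + (\sum_i a i * x i + b).
    by under eq_bigr do rewrite mulrDl; rewrite big_split/=; ring.
  have -> : \sum_i (c i - a i) * x i + (e - b) = (\sum_i c i * x i + e) - (\sum_i a i * x i + b).
    by under eq_bigr do rewrite mulrBl; rewrite sumrB; ring.
  move: (\sum_i c i * x i + e) (\sum_i a i * x i + b) => A B.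
  by rewrite cosD cosB; field.
have [L1a L2a] := goodL1 (fun i => c i + a i) (e + b) gF.
have [L1b L2b] := goodL1 (fun i => c i - a i) (e - b) gF.
rewrite /same.
transitivity (2^-1 * Ex P1 (fun t => (F \* wave (fun i => c i + a i) (e + b)) (fun i => X1 i t)) +
   2^-1 * Ex P1 (fun t => (F \* wave (fun i => c i - a i) (e - b)) (fun i => X1 i t))).
  rewrite -!ExZ// -ExD; [|exact: L1Z|exact: L1Z].
  by apply: eq_Ex => t; rewrite e1.
rewrite [X in _ * X + _]sF [X in _ + _ * X]sF.
rewrite -!ExZ// -ExD; [|exact: L1Z|exact: L1Z].
by apply: eq_Ex => t; rewrite e1.
Qed.

Let good_lim M (F_ : nat -> (I -> R) -> R) F : (forall n, good M (F_ n)) ->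
  (forall x, F_ n x @[n --> \oo] --> F x) -> good M F.
Proof.
move=> gF cF.
have FM x : `|F x| <= M.
  have c : `|F_ n x| @[n --> \oo] --> `|F x| by apply: cvg_norm; exact: cF.
  rewrite -(cvg_lim _ c)//; apply: limr_le; first by apply/cvg_ex; eexists; exact: c.
  by apply: nearW => n; case: (gF n).
have mF : mfun F.
  split.
    apply: (measurable_fun_cvg (h := fun n t => F_ n (fun i => X1 i t))) => [n|t _].
      by case: (gF n) => -[].
    exact: cF.
  apply: (measurable_fun_cvg (h := fun n t => F_ n (fun i => X2 i t))) => [n|t _].
    by case: (gF n) => -[].
  exact: cF.
split => // a b.
have [m1 m2] := mfunM mF (m_wave a b).
have h1 : Ex P1 (fun t => F_ n (fun i => X1 i t) * wave a b (fun i => X1 i t)) @[n --> \oo] -->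
   Ex P1 (fun t => F (fun i => X1 i t) * wave a b (fun i => X1 i t)).
  apply: (Ex_dominated _ m1 _ (L1_cst P1 M)).
  - by move=> n; case: (gF n) => mn _ _; case: (mfunM mn (m_wave a b)).
  - by move=> t; apply: cvgMl; exact: cF.
  - move=> n t; case: (gF n) => _ FnM _.
    by rewrite normrM (le_trans (ler_pM _ _ (FnM _) (norm_wave _ _ _)))// mulr1.
have h2 : Ex P2 (fun t => F_ n (fun i => X2 i t) * wave a b (fun i => X2 i t)) @[n --> \oo] -->
   Ex P2 (fun t => F (fun i => X2 i t) * wave a b (fun i => X2 i t)).
  apply: (Ex_dominated _ m2 _ (L1_cst P2 M)).
  - by move=> n; case: (gF n) => mn _ _; case: (mfunM mn (m_wave a b)).
  - by move=> t; apply: cvgMl; exact: cF.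
  - move=> n t; case: (gF n) => _ FnM _.
    by rewrite normrM (le_trans (ler_pM _ _ (FnM _) (norm_wave _ _ _)))// mulr1.
have e n : Ex P1 (fun t => F_ n (fun i => X1 i t) * wave a b (fun i => X1 i t)) =
  Ex P2 (fun t => F_ n (fun i => X2 i t) * wave a b (fun i => X2 i t)).
  by case: (gF n) => _ _; apply.
have ee : (fun n => Ex P1 (fun t => F_ n (fun i => X1 i t) * wave a b (fun i => X1 i t))) =
   (fun n => Ex P2 (fun t => F_ n (fun i => X2 i t) * wave a b (fun i => X2 i t))).
  by apply/funext.
by rewrite ee in h1; rewrite /same -(cvg_lim _ h1)// -(cvg_lim _ h2).
Qed.

(* If multiplication by [u] with values in [0,1] preserves good functions, so does
   multiplication by any bounded continuous function of [u]. *)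
Let good_binom M F (u : (I -> R) -> R) (f : R -> R) (N : R) : 0 <= M -> 0 <= N ->
  (forall x, 0 <= u x <= 1) ->
  (forall G K, 0 <= K -> good K G -> good K (fun x => u x * G x)) ->
  (forall y, `|f y| <= N) -> (forall x, {for u x, continuous f}) ->
  good M F -> good (N * M) (fun x => f (u x) * F x).
Proof.
move=> M0 N0 u01 gu fN cf gF.
have step n (h : nat -> R) : (forall k, `|h k| <= N) ->
    good (N * M) (fun x => binom_mean n h (u x) * F x).
  move=> hN; have [mF FM _] := gF.
  suff : exists K, 0 <= K /\ good K (fun x => binom_mean n h (u x) * F x).
    move=> [K [_ [mB _ sB]]]; split => // x.
    rewrite normrM ler_pM// ler_norml; apply/andP; split.
      rewrite -(binom_mean_cst n (- N) (u x)); apply: le_binom_mean => // k.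
      by have := hN k; rewrite ler_norml => /andP[].
    rewrite -(binom_mean_cst n N (u x)); apply: le_binom_mean => // k.
    by have := hN k; rewrite ler_norml => /andP[].
  elim: n h hN => [|n ih] h hN /=.
    exists (`|h 0%N| * M + 0); split; first by rewrite addr0 mulr_ge0.
    by apply: good_eq (good_lin (h 0%N) gF good_zero) => x; rewrite addr0.
  have [K1 [K10 g1]] := ih (fun k => h k.+1) (fun k => hN _).
  have [K2 [K20 g2]] := ih h hN.
  have g1' := gu _ _ K10 g1; have g2' := gu _ _ K20 g2.
  exists (`|1| * K1 + (`|-1| * K2 + K2)); split.
    by rewrite !addr_ge0 ?mulr_ge0.
  apply: good_eq (good_lin 1 g1' (good_lin (-1) g2' g2)) => x; ring.
apply: (good_lim (F_ := fun n x => binom_mean n (fun k => f (k%:R / n%:R)) (u x) * F x)).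
  by move=> n; apply: step.
by move=> x; apply: cvgMl; apply: binom_mean_cvg.
Qed.

(** Coordinates can enter only through waves; the sine of x_i/L is mapped into [0,1] because
    [good_binom] asks for values there. *)
Let sine (L : R) (i : I) (x : I -> R) : R := (1 + sin (x i / L)) / 2.

Let sine01 L i x : 0 <= sine L i x <= 1.
Proof.
have := sin_geN1 (x i / L); have := sin_le1 (x i / L); rewrite /sine => h1 h2.
by apply/andP; split; lra.
Qed.

Let good_sine L i M F : 0 <= M -> good M F -> good M (fun x => sine L i x * F x).
Proof.
move=> M0 gF.
have gw := good_wave (fun j => dirac_coef i j / L) (- (pi / 2)) gF.
have := good_lin (1/2) gw (good_lin (1/2) gF good_zero).
move=> h; apply: good_eq (good_le h _); last first.
  by rewrite addr0 ger0_norm//; lra.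
move=> x; rewrite /sine /wave.
have -> : \sum_j dirac_coef i j / L * x j - pi / 2 = x i / L - pi / 2.
  by congr (_ - _); rewrite -(sum_dirac_coef i x) mulr_suml; apply: eq_bigr => j _; rewrite mulrAC.
by rewrite cosBpihalf; field.
Qed.

(** Since L asin(sin(x_i/L)) equals x_i as soon as L is large, a bounded continuous function of x_i
    is a pointwise limit of continuous functions of [sine]. *)
Let good_ridge i M F (h : R -> R) (N : R) : 0 <= M -> 0 <= N -> (forall y, `|h y| <= N) ->
  continuous h -> good M F -> good (N * M) (fun x => h (x i) * F x).
Proof.
move=> M0 N0 hN ch gF.
(* The truncation of 2 v - 1 to [-1/2, 1/2], written with absolute values. It keeps [asin] away from
   its endpoints and has no effect once L exceeds a multiple of |x_i|. *)
pose clamp (v : R) : R := (`|2 * v - 1 + 1/2| - `|2 * v - 1 - 1/2|) / 2.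
have clampE v : -(1/2) <= clamp v <= 1/2.
  have := ler_dist_dist (2 * v - 1 + 1/2) (2 * v - 1 - 1/2).
  have -> : 2 * v - 1 + 1/2 - (2 * v - 1 - 1/2) = 1 by lra.
  by rewrite normr1 ler_norml /clamp => /andP[? ?]; apply/andP; split; lra.
have clampK t : `|t| <= 1/4 -> clamp ((1 + t) / 2) = t.
  rewrite ler_norml => /andP[? ?]; rewrite /clamp.
  have -> : 2 * ((1 + t) / 2) - 1 = t by lra.
  by rewrite ger0_norm ?ler0_norm; lra.
have cclamp : continuous clamp.
  have ca (c v : R) : (2 * v - 1 + c) @[v --> v] --> 2 * v - 1 + c.
    apply: cvgD; last exact: cvg_cst.
    by apply: cvgB; [apply: cvgMr; exact: cvg_id|exact: cvg_cst].
  move=> v; rewrite /clamp; apply: cvgMl.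
  by apply: cvgB; apply: cvg_norm; exact: ca.
apply: (good_lim (F_ := fun n x => (h (n.+1%:R * asin (clamp (sine n.+1%:R i x)))) * F x)).
  move=> n; apply: (good_binom (u := sine n.+1%:R i)
    (f := fun v => h (n.+1%:R * asin (clamp v)))) => //.
  - by move=> G K K0; exact: good_sine.
  - move=> x; apply: continuous_comp; last exact: ch.
    apply: cvgMr; apply: continuous_comp; first exact: cclamp.
    by apply: continuous_asin; have /andP[? ?] := clampE (sine n.+1%:R i x); apply/andP; split; lra.
move=> x; apply: cvgMl; apply: (@cvg_trans _ (h (x i) @[n --> \oo])); last exact: cvg_cst.
apply: near_eq_cvg; near=> n; congr h.
have n0 : (0 : R) < n.+1%:R by [].
have xn : `|x i / n.+1%:R| <= 1/4.
  near: n; apply: (cvgr0_norm_le); last by [].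
  rewrite -[X in _ --> X](mulr0 (x i)); apply: cvgMr; exact: cvg_harmonic.
have cs : clamp (sine n.+1%:R i x) = sin (x i / n.+1%:R).
  apply: clampK; near: n; apply: (cvgr0_norm_le); last by [].
  rewrite -[X in _ --> X](@sin0 R); apply: continuous_cvg; first exact: continuous_sin.
  rewrite -[X in _ --> X](mulr0 (x i)); apply: cvgMr; exact: cvg_harmonic.
rewrite cs; have -> : asin (sin (x i / n.+1%:R)) = x i / n.+1%:R.
  apply: sinK; rewrite in_itv/=; move: xn; rewrite ler_norml => /andP[s1 s2].
  have p2 := pi_ge2 R; apply/andP; split; [apply: le_trans s1|apply: le_trans s2 _]; lra.
by rewrite mulrC divfK ?gt_eqF.
Unshelve. all: by end_near. Qed.

Variable b : R.
Hypothesis b0 : 0 <= b.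

(** Unlike the logarithm of S this is a product of functions of single coordinates, to which
    [good_ridge] applies factor by factor; ln S is recovered as ln(- ln Q). *)
Let Q (x : I -> R) : R := expR (- \sum_i expR (b * x i)).

Let good_Q M F : 0 <= M -> good M F -> good M (fun x => Q x * F x).
Proof.
move=> M0 gF.
suff h (s : seq I) : good M (fun x => expR (- \sum_(i <- s) expR (b * x i)) * F x).
  exact: h.
elim: s => [|i s ih].
  by apply: good_eq gF => x; rewrite big_nil oppr0 expR0 mul1r.
have hc : continuous (fun y : R => expR (- expR (b * y))).
  move=> y; apply: continuous_comp; last exact: continuous_expR.
  apply: cvgN; apply: continuous_comp; last exact: continuous_expR.
  by apply: cvgMr; exact: cvg_id.
have h1 y : `|expR (- expR (b * y))| <= 1 :> R.
  by rewrite ger0_norm ?expR_ge0// -[leRHS](@expR0 R) ler_expR oppr_le0 expR_ge0.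
have := good_ridge i M0 ler01 h1 hc ih; rewrite mul1r; apply: good_eq => x.
by rewrite mulrA -expRD big_cons opprD.
Qed.

Variable i0 : I.

Let S (x : I -> R) := \sum_i expR (b * x i).

Let S_gt0 x : 0 < S x.
Proof.
rewrite /S (bigD1 i0)//= ltr_pwDl ?expR_gt0//.
by apply: sumr_ge0 => i _; exact: expR_ge0.
Qed.

Let lnS_le x : `|ln (S x)| <= #|I|%:R + b * \sum_i `|x i|.
Proof.
have s0 : 0 <= \sum_i `|x i| by apply: sumr_ge0.
have sle i : `|x i| <= \sum_i `|x i|.
  by rewrite (bigD1 i)//= lerDl; apply: sumr_ge0.
rewrite ler_norml; apply/andP; split.
  rewrite -[leLHS](expRK) ler_ln ?posrE ?expR_gt0//.
  apply: (@le_trans _ _ (expR (b * x i0))).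
    rewrite ler_expR opprD; have : - (b * \sum_i `|x i|) <= b * x i0.
      rewrite -mulrN ler_wpM2l// lerNl (le_trans _ (sle i0))// -normrN ler_norm//.
    have : (0 : R) <= #|I|%:R by [].
    lra.
  by rewrite /S (bigD1 i0)//= lerDl; apply: sumr_ge0 => i _; exact: expR_ge0.
apply: (@le_trans _ _ (ln (expR (#|I|%:R + b * \sum_i `|x i|)))); last by rewrite expRK.
rewrite ler_ln ?posrE ?expR_gt0// expRD.
apply: (@le_trans _ _ (\sum_(i : I) expR (b * \sum_i `|x i|))).
  apply: ler_sum => i _; rewrite ler_expR ler_wpM2l// (le_trans (ler_norm _))//.
rewrite sumr_const -[leLHS]mulr_natl ler_wpM2r ?expR_ge0//.
by apply: le_trans (expR_ge1Dx _); rewrite lerDr.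
Qed.

(** The map v -> ln(- ln v) truncated to [-n, n]; the two inner maxima make it bounded and
    continuous on the whole line. *)
Let f (n : nat) (v : R) : R :=
  ln (Num.max (expR (- n%:R)) (- ln (Num.max (expR (- expR n%:R)) v))).

Let inner_le n (v : R) : - ln (Num.max (expR (- expR n%:R)) v) <= expR n%:R.
Proof.
rewrite lerNl -[leLHS]expRK ler_ln ?posrE ?expR_gt0//; last by rewrite lt_max expR_gt0.
by rewrite le_max lexx.
Qed.

Let f_le n v : `|f n v| <= n%:R.
Proof.
have e0 : 0 < Num.max (expR (- n%:R)) (- ln (Num.max (expR (- expR n%:R)) v)).
  by rewrite lt_max expR_gt0.
rewrite ler_norml; apply/andP; split.
  by rewrite -[leLHS]expRK ler_ln ?posrE ?expR_gt0// le_max lexx.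
rewrite -[leRHS]expRK ler_ln ?posrE ?expR_gt0// ge_max inner_le andbT.
by rewrite ler_expR; have : (0 : R) <= n%:R by []; lra.
Qed.

Let f_cont n : continuous (f n).
Proof.
move=> v; have e0 c w : 0 < Num.max (expR c) w :> R by rewrite lt_max expR_gt0.
have cmax (c : R) (g : R -> R) : {for v, continuous g} -> {for v, continuous (fun v : R => Num.max c (g v) : R)}.
  move=> cg; have -> : (fun v => Num.max c (g v)) = (fun v => (c + g v + `|c - g v|) / 2).
    by apply/funext => u; rewrite maxr_absE.
  apply: cvgMl; apply: cvgD; first by apply: cvgD => //; exact: cvg_cst.
  by apply: cvg_norm; apply: cvgB => //; exact: cvg_cst.
apply: continuous_comp; last exact: continuous_ln.
apply: (@cmax _ (fun v : R => - ln (Num.max (expR (- expR n%:R)) v))); apply: cvgN; apply: continuous_comp; last exact: continuous_ln.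
by apply: (@cmax _ (fun v : R => v)); exact: cvg_id.
Qed.

Let max_expR (u v : R) : Num.max (expR u) (expR v) = expR (Num.max u v).
Proof. by rewrite /Num.max ltr_expR; case: ifP. Qed.

Let fQ n x : f n (Q x) = Num.max (- n%:R) (Num.min n%:R (ln (S x))).
Proof.
rewrite /f /Q max_expR expRK -[\sum_i _]/(S x) -[S x in LHS]lnK ?posrE//.
have -> : - Num.max (- expR n%:R) (- expR (ln (S x))) = expR (Num.min n%:R (ln (S x))).
  by rewrite /Num.max /Num.min ltrN2 !ltr_expR; case: ltgtP => [||->]; rewrite opprK.
by rewrite max_expR expRK.
Qed.

Lemma Ex_log_sum_exp_unique :
  Ex P1 (fun t => ln (\sum_i expR (b * X1 i t))) = Ex P2 (fun t => ln (\sum_i expR (b * X2 i t))).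
Proof.
have Q01 x : 0 <= Q x <= 1.
  rewrite expR_ge0/= -[leRHS](@expR0 R) ler_expR oppr_le0.
  by apply: sumr_ge0 => i _; exact: expR_ge0.
have gf n : good n%:R (fun x => f n (Q x)).
  have := good_binom (M := 1) (F := fun=> 1) (u := Q) (f := f n) (N := n%:R) ler01 (ler0n _ n) Q01 (fun G K K0 => @good_Q K G K0)
     (f_le n) (fun x => @f_cont n (Q x)) good_one.
  by rewrite mulr1; apply: good_eq => x; rewrite mulr1.
have e n : Ex P1 (fun t => f n (Q (fun i => X1 i t))) = Ex P2 (fun t => f n (Q (fun i => X2 i t))).
  have [_ _ /(_ (fun=> 0) 0)] := gf n; rewrite /same /wave => h.
  transitivity (Ex P1 (fun t => f n (Q (fun i => X1 i t)) * cos (\sum_i 0 * X1 i t + 0))).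
    by apply: eq_Ex => t; rewrite big1 ?addr0 ?cos0 ?mulr1// => i _; rewrite mul0r.
  rewrite h; apply: eq_Ex => t; rewrite big1 ?addr0 ?cos0 ?mulr1// => i _; by rewrite mul0r.
have fle n x : `|f n (Q x)| <= #|I|%:R + b * \sum_i `|x i|.
  apply: le_trans (lnS_le x); rewrite fQ; have : (0 : R) <= n%:R by [].
  move: (ln (S x)) (n%:R : R) => l k k0; rewrite /Num.max /Num.min.
  have l1 := ler_norm l; have := ler_norm (- l); rewrite normrN => l2.
  by case: (ltP k l) => h1; case: ltP => h2; rewrite ler_norml; apply/andP; split; lra.
have fcvg x : f n (Q x) @[n --> \oo] --> ln (S x).
  apply: (@cvg_trans _ (ln (S x) @[n --> \oo])); last exact: cvg_cst.
  apply: near_eq_cvg; near=> n; rewrite fQ.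
  have : `|ln (S x)| <= n%:R by near: n; exact: nbhs_infty_ger.
  rewrite ler_norml => /andP[h1 h2].
  by rewrite min_r// max_r.
have D d (T : measurableType d) (P : probability T R) (X : I -> T -> R) (hX : gfield P X V) :
   L1 P (fun t => #|I|%:R + b * \sum_i `|X i t|).
  apply: L1D; first exact: L1_cst.
  by apply: L1Z; apply: L1_sum => i; apply: L1_norm; exact: gfield_L1 hX i.
have mS d (T : measurableType d) (P : probability T R) (X : I -> T -> R) (hX : gfield P X V) :
   measurable_fun setT (fun t => ln (S (fun i => X i t))).
  apply: measurableT_comp; first exact: measurable_ln.
  apply: measurable_sum => i; apply: measurableT_comp; first exact: measurable_expR.
  by apply: measurable_funM => //; exact: gfield_measurable hX i.
have h1 : Ex P1 (fun t => f n (Q (fun i => X1 i t))) @[n --> \oo] --> Ex P1 (fun t => ln (S (fun i => X1 i t))).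
  apply: (Ex_dominated _ (mS _ _ _ _ hX1) _ (D _ _ _ _ hX1)) => //.
  by move=> n; have [[] ] := gf n.
have h2 : Ex P2 (fun t => f n (Q (fun i => X2 i t))) @[n --> \oo] --> Ex P2 (fun t => ln (S (fun i => X2 i t))).
  apply: (Ex_dominated _ (mS _ _ _ _ hX2) _ (D _ _ _ _ hX2)) => //.
  by move=> n; have [[] ] := gf n.
have ee : (fun n => Ex P1 (fun t => f n (Q (fun i => X1 i t)))) = (fun n => Ex P2 (fun t => f n (Q (fun i => X2 i t)))).
  by apply/funext.
by rewrite ee in h1; rewrite -[LHS](cvg_lim _ h1)// -[RHS](cvg_lim _ h2).
Unshelve. all: by end_near. Qed.

End Uniqueness.

(** * Cumulant expansion of the log-sum-exp *)

Section exp_taylor.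
Context {R : realType}.

Lemma ge0_of_derive (f f' : R -> R) : (forall x : R, is_derive x 1 f (f' x)) ->
  (forall x, 0 <= x -> 0 <= f' x) -> forall x, 0 <= x -> f 0 <= f x.
Proof.
move=> df f'0 x x0.
have dr (y : R) : derivable f y 1 by have [] := df y.
apply: (ger0_derive1_ndecry (a := 0)) => //.
- move=> y; rewrite in_itv/= andbT => y0.
  have := df y => dfy; rewrite derive1E derive_val; exact/f'0/ltW.
- by apply: continuous_subspaceT => y; apply: differentiable_continuous; apply/derivable1_diffP.
Qed.

Lemma expR_ge2 (x : R) : 0 <= x -> 1 + x + x ^+ 2 / 2 <= expR x.
Proof.
move=> x0; rewrite -subr_ge0.
have := @ge0_of_derive (fun x => expR x - (1 + x + x ^+ 2 / 2)) (fun x => expR x - (1 + x)).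
move=> /(_ _ _ x x0) h; apply: le_trans (h _ _).
- by rewrite expR0 expr0n/=; lra.
- move=> y; apply: is_derive_eq; rewrite /GRing.scale/=. lra.
- by move=> y y0; rewrite subr_ge0 expR_ge1Dx.
Qed.

Lemma expRN_le2 (x : R) : 0 <= x -> expR (- x) <= 1 - x + x ^+ 2 / 2.
Proof.
move=> x0; rewrite expRN -div1r ler_pdivrMr ?expR_gt0//.
apply: (@le_trans _ _ ((1 - x + x ^+ 2 / 2) * (1 + x + x ^+ 2 / 2))).
  have -> : (1 - x + x ^+ 2 / 2) * (1 + x + x ^+ 2 / 2) = 1 + x ^+ 4 / 4 by field.
  by rewrite lerDl divr_ge0// exprn_even_ge0.
by apply: ler_wpM2l; [nra|exact: expR_ge2].
Qed.

Lemma expRN_ge3 (x : R) : 0 <= x -> 1 - x + x ^+ 2 / 2 - x ^+ 3 / 6 <= expR (- x).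
Proof.
move=> x0; rewrite -subr_ge0.
have := @ge0_of_derive (fun x => expR (- x) - (1 - x + x ^+ 2 / 2 - x ^+ 3 / 6))
   (fun x => 1 - x + x ^+ 2 / 2 - expR (- x)).
move=> /(_ _ _ x x0) h; apply: le_trans (h _ _).
- by rewrite oppr0 expR0 !expr0n/=; lra.
- move=> y; apply: is_derive_eq; rewrite /GRing.scale/=. lra.
- by move=> y y0; rewrite subr_ge0 expRN_le2.
Qed.

Lemma expR_taylor2 (z : R) : `|z| <= 1 -> `|expR z - (1 + z + z ^+ 2 / 2)| <= `|z| ^+ 3.
Proof.
have [z0|z0] := leP 0 z.
  rewrite (ger0_norm z0) => z1.
  have h2 := expR_ge2 z0; have h3 := expRN_ge3 z0.
  rewrite ger0_norm ?subr_ge0// lerBlDr.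
  rewrite -[leLHS]invrK -expRN -div1r ler_pdivrMr ?expR_gt0//.
  set u := z ^+ 3 + (1 + z + z ^+ 2 / 2).
  have u0 : 0 <= u by rewrite /u !addr_ge0// ?divr_ge0 ?exprn_ge0.
  apply: le_trans (ler_wpM2l u0 h3).
  have -> : u * (1 - z + z ^+ 2 / 2 - z ^+ 3 / 6) =
     1 + z ^+ 3 * (5 / 6 - 11 / 12 * z + 5 / 12 * z ^+ 2 - z ^+ 3 / 6) by rewrite /u; field.
  rewrite lerDl mulr_ge0 ?exprn_ge0//.
  have : z ^+ 3 <= z ^+ 2 by rewrite exprS ler_piMl// sqr_ge0.
  nra.
rewrite (ltr0_norm z0) => z1.
have z0' : 0 <= - z by lra.
have := expRN_le2 z0'; have := expRN_ge3 z0'.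
rewrite opprK sqrrN => h2 h3.
have c0 : 0 <= (- z) ^+ 3 by exact: exprn_ge0.
rewrite ler_norml; apply/andP; split; lra.
Qed.

(** Mean, half the variance and a cubic error. The constant is that of the trivial case t >= 1/8,
    where the left side is at most 2 t + t^2/2 <= 128 t^3 + 4 t^3. *)
Lemma log_sum_exp_taylor (I : finType) (p y : I -> R) (t : R) :
  (forall i, 0 <= p i) -> \sum_i p i = 1 -> (forall i, `|y i| <= t) ->
  `|ln (\sum_i p i * expR (y i)) - \sum_i p i * y i -
    (\sum_i p i * y i ^+ 2 - (\sum_i p i * y i) ^+ 2) / 2| <= 132 * t ^+ 3.
Proof.
move=> p0 p1 yt; set m := \sum_i p i * y i; set v := _ - m ^+ 2.
have avg_le (f : I -> R) c : (forall i, f i <= c) -> \sum_i p i * f i <= c.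
  move=> fc; rewrite -[leRHS]mul1r -p1 mulr_suml; apply: ler_sum => i _; exact: ler_wpM2l.
have avg_ge (f : I -> R) c : (forall i, c <= f i) -> c <= \sum_i p i * f i.
  move=> fc; rewrite -[leLHS]mul1r -p1 mulr_suml; apply: ler_sum => i _; exact: ler_wpM2l.
have yt2 i : - t <= y i <= t by rewrite -ler_norml.
have t0 : 0 <= t.
  case: (pickP (fun _ : I => true)) => [i _|no]; first by apply: le_trans (yt i).
  by move: p1; rewrite big_pred0// => /eqP; rewrite eq_sym oner_eq0.
have mt : - t <= m <= t.
  by rewrite avg_ge ?avg_le// => i; case/andP: (yt2 i).
have qt : 0 <= \sum_i p i * y i ^+ 2 <= t ^+ 2.
  rewrite avg_ge ?avg_le// => i; last exact: sqr_ge0.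
  by rewrite -[leLHS]real_normK ?num_real// lerXn2r ?nnegrE.
have mm : 0 <= m ^+ 2 <= t ^+ 2.
  rewrite sqr_ge0/= -[leLHS]real_normK ?num_real// lerXn2r ?nnegrE// ler_norml//.
have vt : - t ^+ 2 <= v <= t ^+ 2 by rewrite /v; lra.
have S0 : expR (- t) <= \sum_i p i * expR (y i) <= expR t.
  by rewrite avg_ge ?avg_le// => i; rewrite ler_expR; case/andP: (yt2 i).
have Sp : 0 < \sum_i p i * expR (y i) by case/andP: S0 => + _; apply: lt_le_trans; rewrite expR_gt0.
have lnS : - t <= ln (\sum_i p i * expR (y i)) <= t.
  case/andP: S0 => s1 s2; apply/andP; split.
    by rewrite -[leLHS]expRK ler_ln ?posrE ?expR_gt0.
  by rewrite -[leRHS]expRK ler_ln ?posrE ?expR_gt0.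
have [t8|t8] := leP (1 / 8) t.
  have h1 : t / 64 <= t ^+ 3.
    rewrite exprS ler_wpM2l// -[leLHS]div1r; have := lerXn2r 2 (_ : 1/8 \is Num.nneg) (_ : t \is Num.nneg) t8.
    by rewrite !nnegrE => /(_ _ t0) h; apply: le_trans (h _); lra.
  have h2 : t ^+ 2 / 8 <= t ^+ 3.
    by rewrite [t ^+ 3]exprSr ler_wpM2l ?sqr_ge0//; lra.
  rewrite ler_norml; move: lnS mt vt => /andP[? ?] /andP[? ?] /andP[? ?]; apply/andP; split; lra.
(* Centering at m + v/2 rather than at m makes the second-order Taylor sum exactly 1 + v^2/8, and
   v^2 is at most t^4. *)
pose z i := y i - m - v / 2.
have tt : t ^+ 2 <= t / 8 by rewrite expr2 ler_wpM2l//; lra.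
have zt i : `|z i| <= 3 * t.
  rewrite ler_norml /z; move: (yt2 i) mt vt => /andP[? ?] /andP[? ?] /andP[? ?]; apply/andP; split; lra.
pose S' := \sum_i p i * expR (z i).
have SE : \sum_i p i * expR (y i) = expR (m + v / 2) * S'.
  rewrite mulr_sumr; apply: eq_bigr => i _; rewrite mulrCA -expRD; congr (_ * expR _).
  by rewrite /z; ring.
have S'0 : 0 < S' by move: Sp; rewrite SE pmulr_rgt0 ?expR_gt0.
have E1 : \sum_i p i * (1 + z i + z i ^+ 2 / 2) = 1 + v ^+ 2 / 8.
  transitivity (\sum_i (p i * (1 - m - v / 2 + (m + v / 2) ^+ 2 / 2) + (p i * y i) * (1 - (m + v / 2))
     + (p i * y i ^+ 2) / 2)).
    by apply: eq_bigr => i _; rewrite /z; field.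
  rewrite !big_split/= -!mulr_suml p1 -/m.
  have -> : \sum_i p i * y i ^+ 2 = v + m ^+ 2 by rewrite /v; ring.
  by field.
have S'1 : `|S' - 1| <= 28 * t ^+ 3.
  have -> : S' - 1 = \sum_i p i * (expR (z i) - (1 + z i + z i ^+ 2 / 2)) + v ^+ 2 / 8.
    under eq_bigr do rewrite mulrBr; rewrite sumrB E1 -/S'; ring.
  rewrite (le_trans (ler_normD _ _))//.
  have h1 : `|\sum_i p i * (expR (z i) - (1 + z i + z i ^+ 2 / 2))| <= 27 * t ^+ 3.
    apply: le_trans (ler_norm_sum _ _ _) _.
    under eq_bigr do rewrite normrM (ger0_norm (p0 _)).
    apply: avg_le => i; have z1 : `|z i| <= 1 by apply: le_trans (zt i) _; lra.
    apply: le_trans (expR_taylor2 z1) _.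
    have -> : 27 * t ^+ 3 = (3 * t) ^+ 3 by ring.
    by rewrite lerXn2r// nnegrE mulr_ge0.
  have h2 : `|v ^+ 2 / 8| <= t ^+ 3.
    rewrite ger0_norm ?divr_ge0 ?sqr_ge0//.
    have h : v ^+ 2 <= t ^+ 4.
      have -> : t ^+ 4 = (t ^+ 2) ^+ 2 by ring.
      rewrite -[leLHS]real_normK ?num_real// lerXn2r ?nnegrE ?sqr_ge0// ler_norml//.
    have : t ^+ 4 <= t ^+ 3 by rewrite [t ^+ 4]exprS ler_piMl ?exprn_ge0//; lra.
    have : 0 <= t ^+ 3 by rewrite exprn_ge0.
    lra.
  by lra.
have t3 : t ^+ 3 <= 1 / 512.
  have -> : 1 / 512 = (1 / 8) ^+ 3 :> R by field.
  by rewrite lerXn2r// ?nnegrE ?(ltW t8)//; lra.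
have t30 : 0 <= t ^+ 3 by rewrite exprn_ge0.
rewrite SE lnM ?posrE ?expR_gt0// expRK.
have -> : m + v / 2 + ln S' - m - v / 2 = ln S' by ring.
move: S'1; rewrite ler_norml => /andP[s1 s2].
rewrite ler_norml; apply/andP; split; last first.
  have := @le_ln1Dx R (S' - 1); rewrite addrCA subrr addr0 => h; apply: le_trans (h _) _; lra.
have := @le_ln1Dx R (S'^-1 - 1); rewrite addrCA subrr addr0 lnV ?posrE// => h.
rewrite lerNl; apply: le_trans (h _) _.
  by rewrite ltrDr invr_gt0.
have -> : S'^-1 - 1 = (1 - S') / S' by field; rewrite gt_eqF.
rewrite ler_pdivrMr//; nra.
Qed.

End exp_taylor.

(** * The Sudakov-Fernique inequality *)

Section arithmetic.
Context {R : realFieldType}.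

Lemma lindeberg_step (a b l gx gy kx ky c : R) : gx <= gy ->
  - (132 * (c * ky)) <= b - l - 4^-1 * gy -> a - l - 4^-1 * gx <= 132 * (c * kx) ->
  a <= b + 132 * (kx + ky) * c.
Proof. by lra. Qed.

Lemma lindeberg_sum k (a b c x : R) : b <= a + x -> a <= c + k%:R * x -> b <= c + k.+1%:R * x.
Proof. by rewrite -[k.+1%:R]natr1; lra. Qed.

End arithmetic.

Section product_expectation.
Context {R : realType} d1 (T1 : measurableType d1) (P1 : probability T1 R).
Context d2 (T2 : measurableType d2) (P2 : probability T2 R).

Lemma Ex_prod (f : T1 -> R) (g : T2 -> R) : L1 P1 f -> L1 P2 g ->
  L1 (P1 \x P2)%E (fun z => f z.1 * g z.2) /\
  Ex (P1 \x P2)%E (fun z => f z.1 * g z.2) = Ex P1 f * Ex P2 g.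
Proof.
move=> Lf Lg.
have mfg : measurable_fun setT (fun z : T1 * T2 => f z.1 * g z.2).
  apply: measurable_funM.
    by apply: (measurableT_comp (L1_measurable Lf)); exact: measurable_fst.
  by apply: (measurableT_comp (L1_measurable Lg)); exact: measurable_snd.
have L : L1 (P1 \x P2)%E (fun z => f z.1 * g z.2).
  apply/integrableP; split; first exact/measurable_EFinP.
  rewrite fubini_tonelli1//=; last by apply/measurable_EFinP; exact: measurableT_comp.
  rewrite /fubini_F/=.
  have -> : (\int[P1]_x \int[P2]_y (`|f x * g y|)%:E = \int[P1]_x (`|f x| * Ex P2 (fun y => `|g y|))%:E)%E.
    apply: eq_integral => x _; rewrite -ExZ ?ExE//; last exact: L1_norm.
      by congr (_%:E); apply: eq_Ex => y; rewrite normrM.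
    by apply: L1_norm; exact: L1Z.
  rewrite ExE ?ltry//; apply: (@L1_eq _ _ _ _ (fun x => Ex P2 (fun y => `|g y|) * `|f x|)).
    by move=> x; rewrite mulrC.
  by apply: L1Z; exact: L1_norm.
split => //; apply: EFin_inj; rewrite -(ExE L) -integral12_prod_meas1// /fubini_F/=.
transitivity (\int[P1]_x (Ex P2 g * f x)%:E)%E.
  by apply: eq_integral => x _; rewrite mulrC -(ExZ _ Lg) ExE//; exact: L1Z.
by rewrite ExE ?ExZ 1?mulrC//; exact: L1Z.
Qed.

Lemma Ex_fst (f : T1 -> R) : L1 P1 f ->
  L1 (P1 \x P2)%E (fun z => f z.1) /\ Ex (P1 \x P2)%E (fun z => f z.1) = Ex P1 f.
Proof.
move=> Lf; have [h1 h2] := Ex_prod Lf (L1_cst P2 1).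
split; first by apply: L1_eq h1 => z; rewrite mulr1.
rewrite Ex_cst mulr1 in h2; rewrite -h2; apply: eq_Ex => z; by rewrite mulr1.
Qed.

Lemma Ex_snd (f : T2 -> R) : L1 P2 f ->
  L1 (P1 \x P2)%E (fun z => f z.2) /\ Ex (P1 \x P2)%E (fun z => f z.2) = Ex P2 f.
Proof.
move=> Lf; have [h1 h2] := Ex_prod (L1_cst P1 1) Lf.
split; first by apply: L1_eq h1 => z; rewrite mul1r.
rewrite Ex_cst mul1r in h2; rewrite -h2; apply: eq_Ex => z; by rewrite mul1r.
Qed.

End product_expectation.

Section log_sum_exp.
Context {R : realType} (I : finType) (i0 : I).

Definition lse (x : I -> R) : R := ln (\sum_i expR (x i)).

Lemma sum_expR_gt0 (x : I -> R) : 0 < \sum_i expR (x i).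
Proof.
rewrite (bigD1 i0)//= ltr_pwDl ?expR_gt0//.
by apply: sumr_ge0 => i _; exact: expR_ge0.
Qed.

Lemma lse_ge (x : I -> R) i : x i <= lse x.
Proof.
rewrite -[leLHS]expRK ler_ln ?posrE ?expR_gt0 ?sum_expR_gt0//.
by rewrite (bigD1 i)//= lerDl; apply: sumr_ge0 => j _; exact: expR_ge0.
Qed.

Lemma lse_le (x : I -> R) c : (forall i, x i <= c) -> lse x <= c + ln #|I|%:R.
Proof.
move=> xc; have I0 : (0 : R) < #|I|%:R by rewrite ltr0n; apply/card_gt0P; exists i0.
rewrite -[c in leRHS]expRK -lnM ?posrE ?expR_gt0// ler_ln ?posrE ?mulr_gt0 ?expR_gt0 ?sum_expR_gt0//.
apply: (@le_trans _ _ (\sum_(i : I) expR c)).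
  by apply: ler_sum => i _; rewrite ler_expR.
by rewrite sumr_const -[leLHS]mulr_natr.
Qed.

Lemma lse_norm (x : I -> R) : `|lse x| <= ln #|I|%:R + \sum_i `|x i|.
Proof.
have l0 : 0 <= ln #|I|%:R :> R.
  by rewrite ln_ge0// ler1n; apply/card_gt0P; exists i0.
have sle i : `|x i| <= \sum_i `|x i| by rewrite (bigD1 i)//= lerDl; apply: sumr_ge0.
rewrite ler_norml; apply/andP; split.
  apply: le_trans (lse_ge x i0); have := ler_norm (- x i0); rewrite normrN; have := sle i0; lra.
rewrite addrC; apply: lse_le => i; exact: le_trans (ler_norm _) (sle i).
Qed.

Lemma measurable_lse d (T : measurableType d) (X : I -> T -> R) :
  (forall i, measurable_fun setT (X i)) -> measurable_fun setT (fun t => lse (fun i => X i t)).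
Proof.
move=> mX; apply: measurableT_comp; first exact: measurable_ln.
by apply: measurable_sum => i; apply: measurableT_comp => //; exact: measurable_expR.
Qed.

Lemma L1_lse d (T : measurableType d) (P : probability T R) (X : I -> T -> R) :
  (forall i, L1 P (X i)) -> L1 P (fun t => lse (fun i => X i t)).
Proof.
move=> LX; apply: (@L1_dom _ _ _ _ _ (fun t => ln #|I|%:R + \sum_i `|X i t|)).
- by apply: measurable_lse => i; exact: L1_measurable (LX i).
- by move=> t; exact: lse_norm.
- by apply: L1D; [exact: L1_cst|apply: L1_sum => i; exact: L1_norm].
Qed.

Definition gibbs (x : I -> R) (i : I) : R := expR (x i) / \sum_j expR (x j).

Lemma gibbs_ge0 x i : 0 <= gibbs x i.
Proof. by rewrite divr_ge0 ?expR_ge0// ltW// sum_expR_gt0. Qed.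

Lemma gibbs_sum x : \sum_i gibbs x i = 1.
Proof. by rewrite -mulr_suml divff// gt_eqF// sum_expR_gt0. Qed.

Lemma gibbs_le1 x i : gibbs x i <= 1.
Proof. by rewrite -(gibbs_sum x) (bigD1 i)//= lerDl sumr_ge0// => j _; exact: gibbs_ge0. Qed.

Lemma lse_add x y : lse (fun i => x i + y i) = lse x + ln (\sum_i gibbs x i * expR (y i)).
Proof.
have h : \sum_i expR (x i + y i) = (\sum_i expR (x i)) * \sum_i gibbs x i * expR (y i).
  rewrite mulr_sumr; apply: eq_bigr => i _; rewrite expRD /gibbs mulrA mulrC.
  by rewrite mulrCA divff ?mulr1 1?mulrC// gt_eqF// sum_expR_gt0.
have : 0 < \sum_i expR (x i + y i) by exact: sum_expR_gt0.
by rewrite /lse h pmulr_rgt0 ?sum_expR_gt0// => h0; rewrite lnM ?posrE ?sum_expR_gt0.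
Qed.

(** Written over pairs, the Gibbs variance involves only increments of y, which are what
    Sudakov-Fernique compares. *)
Lemma gibbs_var x (y : I -> R) : let p := gibbs x in
  \sum_i p i * y i ^+ 2 - (\sum_i p i * y i) ^+ 2 = 2^-1 * \sum_i \sum_j p i * p j * (y i - y j) ^+ 2.
Proof.
move=> p; set m := \sum_i p i * y i; set q := \sum_i p i * y i ^+ 2.
have -> : \sum_i \sum_j p i * p j * (y i - y j) ^+ 2 = \sum_i (p i * q + p i * y i ^+ 2 - 2 * m * (p i * y i)).
  apply: eq_bigr => i _.
  transitivity (\sum_j (p i * (p j * y j ^+ 2) + p i * y i ^+ 2 * p j - 2 * (p i * y i) * (p j * y j))).
    by apply: eq_bigr => j _; ring.
  by rewrite sumrB big_split/= -!mulr_sumr gibbs_sum -/q -/m; ring.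
by rewrite sumrB big_split/= -!mulr_sumr -mulr_suml gibbs_sum -/q -/m; field.
Qed.

Lemma lse_taylor x y : `|lse (fun i => x i + y i) - lse x - \sum_i gibbs x i * y i -
   4^-1 * \sum_i \sum_j gibbs x i * gibbs x j * (y i - y j) ^+ 2| <= 132 * \sum_i `|y i| ^+ 3.
Proof.
pose k := [arg max_(i > i0) `|y i|]%O.
have yk i : `|y i| <= `|y k| by rewrite /k; case: arg_maxP => // j _ h; exact: h.
have := log_sum_exp_taylor (gibbs_ge0 x) (gibbs_sum x) yk.
rewrite gibbs_var lse_add => h.
have -> : lse x + ln (\sum_i gibbs x i * expR (y i)) - lse x - \sum_i gibbs x i * y i -
   4^-1 * (\sum_i \sum_j gibbs x i * gibbs x j * (y i - y j) ^+ 2) =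
  ln (\sum_i gibbs x i * expR (y i)) - \sum_i gibbs x i * y i -
  2^-1 * (\sum_i \sum_j gibbs x i * gibbs x j * (y i - y j) ^+ 2) / 2 by field.
apply: le_trans h _; rewrite ler_wpM2l// (bigD1 k)//= lerDl.
by apply: sumr_ge0 => i _; rewrite exprn_ge0.
Qed.

(** Effect of adding an independent centred field [A]: the first-order term has mean zero, and by
    independence the second-order term is a sum of nonnegative Gibbs weights of [X] times mean
    squared increments of [A], hence monotone in the latter. *)
Lemma Ex_lse_perturb d0 (T0 : measurableType d0) (P0 : probability T0 R) (X : I -> T0 -> R)
    d1 (T1 : measurableType d1) (P1 : probability T1 R) (A : I -> T1 -> R) V :
  (forall i, L1 P0 (X i)) -> gfield P1 A V ->
  `|Ex (P0 \x P1)%E (fun z => lse (fun i => X i z.1 + A i z.2)) - Ex P0 (fun t => lse (fun i => X i t)) -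
    4^-1 * \sum_i \sum_j Ex P0 (fun t => gibbs (fun k => X k t) i * gibbs (fun k => X k t) j) *
      Ex P1 (fun t => (A i t - A j t) ^+ 2)| <= 132 * \sum_i Ex P1 (fun t => `|A i t| ^+ 3).
Proof.
move=> LX gA.
pose p i t := gibbs (fun k => X k t) i.
have mp i : measurable_fun setT (p i).
  have -> : p i = (fun t => expR (X i t - lse (fun k => X k t))).
    by apply/funext => t; rewrite expRB lnK// posrE sum_expR_gt0.
  apply: measurableT_comp; first exact: measurable_expR.
  by apply: measurable_funB; [exact: L1_measurable|apply: measurable_lse => k; exact: L1_measurable].
have Lp i : L1 P0 (p i).
  by apply: (@L1_bounded _ _ _ P0 _ 1) => // t; rewrite ger0_norm ?gibbs_ge0 ?gibbs_le1.
have Lpp i j : L1 P0 (fun t => p i t * p j t).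
  apply: (@L1_bounded _ _ _ P0 _ 1); first exact: measurable_funM.
  move=> t; have pb k : 0 <= p k t <= 1 by rewrite gibbs_ge0 ?gibbs_le1.
  case/andP: (pb i) => a0 a1; case/andP: (pb j) => b0 b1.
  rewrite ger0_norm; last exact: mulr_ge0.
  by rewrite -[leRHS](mulr1 1); apply: ler_pM.
have LA i : L1 P1 (A i) by exact: gfield_L1 gA i.
have LA2 i j : L1 P1 (fun t => (A i t - A j t) ^+ 2).
  have := cgauss_normX_L1 (gfield_cgaussB gA i j) 2; apply: L1_eq => t.
  by rewrite real_normK ?num_real.
have LA3 i : L1 P1 (fun t => `|A i t| ^+ 3) by exact: cgauss_normX_L1 (gfield_cgauss gA i) 3.
have L0 := L1_lse LX.
have [Lf0 Ef0] := Ex_fst P1 L0.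
have LXA i : L1 (P0 \x P1)%E (fun z => X i z.1 + A i z.2).
  by apply: L1D; [have [] := Ex_fst P1 (LX i)|have [] := Ex_snd P0 (LA i)].
have Lf1 := L1_lse LXA.
pose m z := \sum_i p i z.1 * A i z.2.
have Lm : L1 (P0 \x P1)%E m by apply: L1_sum => i; have [] := Ex_prod (Lp i) (LA i).
have Em : Ex (P0 \x P1)%E m = 0.
  rewrite Ex_sum => [|i]; last by have [] := Ex_prod (Lp i) (LA i).
  apply: big1 => i _; have [_ ->] := Ex_prod (Lp i) (LA i).
  by rewrite (gfield_mean gA) mulr0.
pose q z := \sum_i \sum_j p i z.1 * p j z.1 * (A i z.2 - A j z.2) ^+ 2.
have Lq' i j : L1 (P0 \x P1)%E (fun z => p i z.1 * p j z.1 * (A i z.2 - A j z.2) ^+ 2).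
  by have [] := Ex_prod (Lpp i j) (LA2 i j).
have Lq : L1 (P0 \x P1)%E q by apply: L1_sum => i; apply: L1_sum => j; exact: Lq'.
have Eq : Ex (P0 \x P1)%E q = \sum_i \sum_j Ex P0 (fun t => p i t * p j t) * Ex P1 (fun t => (A i t - A j t) ^+ 2).
  rewrite Ex_sum => [|i]; last by apply: L1_sum => j; exact: Lq'.
  apply: eq_bigr => i _; rewrite Ex_sum => [|j]; last exact: Lq'.
  by apply: eq_bigr => j _; have [_ ->] := Ex_prod (Lpp i j) (LA2 i j).
have L3 : L1 (P0 \x P1)%E (fun z => 132 * \sum_i `|A i z.2| ^+ 3).
  by apply: L1Z; apply: L1_sum => i; have [] := Ex_snd P0 (LA3 i).
have <- : Ex (P0 \x P1)%E (fun z => 132 * \sum_i `|A i z.2| ^+ 3) = 132 * \sum_i Ex P1 (fun t => `|A i t| ^+ 3).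
  have LS i : L1 (P0 \x P1)%E (fun z => `|A i z.2| ^+ 3) by have [] := Ex_snd P0 (LA3 i).
  rewrite ExZ; last exact: L1_sum.
  by rewrite Ex_sum//; congr (_ * _); apply: eq_bigr => i _; have [_ ->] := Ex_snd P0 (LA3 i).
rewrite -Eq -Ef0 -[X in `|X|]addr0 -[X in `|_ + X|]Em.
have <- : Ex (P0 \x P1)%E (fun z => (lse (fun i => X i z.1 + A i z.2) - lse (fun i => X i z.1)) - m z - 4^-1 * q z) =
  Ex (P0 \x P1)%E (fun z => lse (fun i => X i z.1 + A i z.2)) - Ex (P0 \x P1)%E (fun z => lse (fun i => X i z.1)) -
   4^-1 * Ex (P0 \x P1)%E q + Ex (P0 \x P1)%E m.
  by rewrite (ExB (L1B (L1B Lf1 Lf0) Lm) (L1Z 4^-1 Lq)) (ExB (L1B Lf1 Lf0) Lm) (ExB Lf1 Lf0) (ExZ _ Lq) Em subr0 addr0.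
have LL : L1 (P0 \x P1)%E (fun z => (lse (fun i => X i z.1 + A i z.2) - lse (fun i => X i z.1)) - m z - 4^-1 * q z).
  by apply: L1B; [apply: L1B => //; exact: L1B|exact: L1Z].
apply: le_trans (ler_norm_Ex LL) _; apply: le_Ex => //; first exact: L1_norm.
by move=> z; exact: lse_taylor.
Qed.

End log_sum_exp.

Section SudakovFernique.
Context {R : realType} (I : finType) (i0 : I).

Lemma gfield_Vscale d (T : measurableType d) (P : probability T R) (X : I -> T -> R) V c a :
  gfield P X V -> V (fun i => c * a i) = c ^+ 2 * V a.
Proof.
move=> gX; rewrite -(cgauss_var (gX a)) -(cgauss_var (gX (fun i => c * a i))) -ExZ; last first.
  have := cgauss_normX_L1 (gX a) 2; apply: L1_eq => t; by rewrite real_normK ?num_real.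
apply: eq_Ex => t; rewrite -exprMn mulr_sumr; congr (_ ^+ 2).
by apply: eq_bigr => i _; rewrite mulrA.
Qed.

(** Stands in for equality in law: a combination of fields may be replaced by another one on a
    different product space as soon as the variances agree. *)
Lemma Ex_lse_unique d1 (T1 : measurableType d1) (P1 : probability T1 R) (X : I -> T1 -> R)
    d2 (T2 : measurableType d2) (P2 : probability T2 R) (Y : I -> T2 -> R) V W :
  gfield P1 X V -> gfield P2 Y W -> (forall a, V a = W a) ->
  Ex P1 (fun t => lse (fun i => X i t)) = Ex P2 (fun t => lse (fun i => Y i t)).
Proof.
move=> gX gY VW; have gX' := eq_gfield gX (fun i t => erefl) VW.
have := Ex_log_sum_exp_unique gX' gY ler01 i0.
have e d (T : measurableType d) (P : probability T R) (Z : I -> T -> R) :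
  Ex P (fun t => ln (\sum_i expR (1 * Z i t))) = Ex P (fun t => lse (fun i => Z i t)).
  by apply: eq_Ex => t; congr ln; apply: eq_bigr => i _; rewrite mul1r.
by rewrite (e _ _ P1 X) (e _ _ P2 Y).
Qed.

Context d1 (T1 : measurableType d1) (P1 : probability T1 R).
Context d2 (T2 : measurableType d2) (P2 : probability T2 R).
Variables (X : I -> T1 -> R) (Y : I -> T2 -> R).
Variables (V W : (I -> R) -> R).
Hypotheses (gX : gfield P1 X V) (gY : gfield P2 Y W).
Hypothesis XY : forall i j, Ex P1 (fun t => (X i t - X j t) ^+ 2) <= Ex P2 (fun t => (Y i t - Y j t) ^+ 2).

Let K := 132 * (\sum_i Ex P1 (fun t => `|X i t| ^+ 3) + \sum_i Ex P2 (fun t => `|Y i t| ^+ 3)).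

Let Z (s t : R) (i : I) (z : T1 * T2) : R := s * X i z.1 + t * Y i z.2.

Let gZ s t : gfield (P1 \x P2)%E (Z s t) (fun a => V (fun i => s * a i) + W (fun i => t * a i)).
Proof. exact: gfield_add (gfield_scale gX s) (gfield_scale gY t). Qed.

(** Lindeberg exchange: on top of a common field [U], variance h^2 of X is traded for variance h^2
    of Y. The second-order terms are ordered by hypothesis, so only the cubic errors are paid. *)
Let step (s t h : R) : 0 <= h -> 0 <= s -> 0 <= t ->
  Ex (P1 \x P2)%E (fun z => lse (fun i => Z (Num.sqrt (s + h ^+ 2)) (Num.sqrt t) i z)) <=
  Ex (P1 \x P2)%E (fun z => lse (fun i => Z (Num.sqrt s) (Num.sqrt (t + h ^+ 2)) i z)) + K * h ^+ 3.
Proof.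
move=> h0 s0 t0; set P := (P1 \x P2)%E; set U := Z (Num.sqrt s) (Num.sqrt t).
have LU i : L1 P (U i) by exact: gfield_L1 (gZ _ _) i.
have sc2 d (T : measurableType d) (Q : probability T R) (A : I -> T -> R) VA : gfield Q A VA ->
    forall i j, Ex Q (fun t => (h * A i t - h * A j t) ^+ 2) = h ^+ 2 * Ex Q (fun t => (A i t - A j t) ^+ 2).
  move=> gA i j; rewrite -ExZ; first by apply: eq_Ex => u; ring.
  have := cgauss_normX_L1 (gfield_cgaussB gA i j) 2; apply: L1_eq => u.
  by rewrite real_normK ?num_real.
have sc3 d (T : measurableType d) (Q : probability T R) (A : I -> T -> R) VA : gfield Q A VA ->
    \sum_i Ex Q (fun t => `|h * A i t| ^+ 3) = h ^+ 3 * \sum_i Ex Q (fun t => `|A i t| ^+ 3).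
  move=> gA; rewrite mulr_sumr; apply: eq_bigr => i _; rewrite -ExZ.
    by apply: eq_Ex => u; rewrite normrM exprMn (ger0_norm h0).
  exact: cgauss_normX_L1 (gfield_cgauss gA i) 3.
have e1 : Ex P (fun z => lse (fun i => Z (Num.sqrt (s + h ^+ 2)) (Num.sqrt t) i z)) =
    Ex (P \x P1)%E (fun z => lse (fun i => U i z.1 + h * X i z.2)).
  apply: (Ex_lse_unique (gZ _ _) (gfield_add (gZ _ _) (gfield_scale gX h))) => a.
  rewrite !(gfield_Vscale _ _ gX) !(gfield_Vscale _ _ gY) !sqr_sqrtr//; last by rewrite addr_ge0 ?sqr_ge0.
  ring.
have e2 : Ex P (fun z => lse (fun i => Z (Num.sqrt s) (Num.sqrt (t + h ^+ 2)) i z)) =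
    Ex (P \x P2)%E (fun z => lse (fun i => U i z.1 + h * Y i z.2)).
  apply: (Ex_lse_unique (gZ _ _) (gfield_add (gZ _ _) (gfield_scale gY h))) => a.
  rewrite !(gfield_Vscale _ _ gX) !(gfield_Vscale _ _ gY) !sqr_sqrtr//; last by rewrite addr_ge0 ?sqr_ge0.
  ring.
rewrite e1 e2.
have := Ex_lse_perturb i0 LU (gfield_scale gX h); rewrite ler_norml => /andP[_].
have := Ex_lse_perturb i0 LU (gfield_scale gY h); rewrite ler_norml => /andP[+ _].
rewrite (sc3 _ _ _ _ _ gX) (sc3 _ _ _ _ _ gY).
set GX := (X in _ - 4^-1 * X <= 132 * _); set GY := \sum_i \sum_j _.
have : GX <= GY.
  apply: ler_sum => i _; apply: ler_sum => j _ /=.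
  rewrite (sc2 _ _ _ _ _ gX) (sc2 _ _ _ _ _ gY).
  apply: ler_wpM2l; last by rewrite ler_wpM2l ?sqr_ge0.
  by apply: Ex_ge0 => u; rewrite mulr_ge0// gibbs_ge0.
exact: lindeberg_step.
Qed.

(** With m + 1 exchanges and h^2 = 1/(m + 1), the total error (m + 1) K h^3 is K h, which tends to
    0. *)
Lemma Ex_lse_le : Ex P1 (fun t => lse (fun i => X i t)) <= Ex P2 (fun t => lse (fun i => Y i t)).
Proof.
have K0 : 0 <= K.
  by rewrite mulr_ge0// addr_ge0// sumr_ge0// => i _; apply: Ex_ge0 => t; rewrite exprn_ge0.
pose phi (m k : nat) := Ex (P1 \x P2)%E (fun z => lse (fun i =>
  Z (Num.sqrt (k%:R / m.+1%:R)) (Num.sqrt ((m.+1 - k)%:R / m.+1%:R)) i z)).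
pose h (m : nat) : R := Num.sqrt (m.+1%:R)^-1.
have hh m : h m ^+ 2 = (m.+1%:R)^-1 by rewrite sqr_sqrtr.
have st m k : (k <= m.+1)%N -> phi m k <= phi m 0%N + k%:R * (K * h m ^+ 3).
  elim: k => [|k ih] km; first by rewrite mul0r addr0.
  have := @step (k%:R / m.+1%:R) ((m.+1 - k.+1)%:R / m.+1%:R) (h m).
  rewrite !sqrtr_ge0 !divr_ge0// hh => /(_ isT isT isT).
  have -> : k%:R / m.+1%:R + m.+1%:R^-1 = k.+1%:R / m.+1%:R :> R.
    by rewrite -[X in _ + X]mul1r -mulrDl natr1.
  have -> : (m.+1 - k.+1)%:R / m.+1%:R + m.+1%:R^-1 = (m.+1 - k)%:R / m.+1%:R :> R.
    rewrite -[X in _ + X]mul1r -mulrDl natr1; congr (_%:R / _); lia.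
  rewrite -/(phi m k.+1) -/(phi m k) => h1; have := ih (ltnW km).
  exact: lindeberg_sum h1.
have p1 m : phi m m.+1 = Ex P1 (fun t => lse (fun i => X i t)).
  apply: (Ex_lse_unique (gZ _ _) gX) => a.
  rewrite subnn mul0r sqrtr0 divff ?pnatr_eq0// sqrtr1 (gfield_Vscale _ _ gX) (gfield_Vscale _ _ gY).
  by ring.
have p2 m : phi m 0%N = Ex P2 (fun t => lse (fun i => Y i t)).
  apply: (Ex_lse_unique (gZ _ _) gY) => a.
  rewrite subn0 mul0r sqrtr0 divff ?pnatr_eq0// sqrtr1 (gfield_Vscale _ _ gX) (gfield_Vscale _ _ gY).
  by ring.
apply: (@le_of_small R _ _ K) => k k0 k1.
have [m] : exists m : nat, h m <= k.
  pose m := Num.bound (k ^- 2); exists m.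
  have hb : k ^- 2 < m.+1%:R.
    apply: (@lt_trans _ _ m%:R); last by rewrite ltr_nat.
    by apply: archi_boundP; rewrite invr_ge0 exprn_ge0 ?ltW.
  rewrite -(ler_pXn2r (n := 2)) ?nnegrE ?sqrtr_ge0 ?(ltW k0)// hh.
  rewrite invf_ple ?posrE ?exprn_gt0//; exact: ltW.
move=> hk; have := st m m.+1 (leqnn _); rewrite p1 p2 => h1; apply: le_trans h1 _.
rewrite lerD2l.
have -> : m.+1%:R * (K * h m ^+ 3) = K * h m.
  by rewrite [h m ^+ 3]exprSr hh; field.
by rewrite mulrC ler_wpM2r.
Qed.

End SudakovFernique.

Section SudakovFerniqueMax.
Context {R : realType}.

Definition fmax (I : finType) (i0 : I) (x : I -> R) : R := \big[Num.max/x i0]_i x i.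

Lemma fmax_ge (I : finType) (i0 : I) x i : x i <= fmax i0 x.
Proof. by rewrite /fmax (bigD1 i)//= le_max lexx. Qed.

Lemma fmax_le (I : finType) (i0 : I) x c : (forall i, x i <= c) -> fmax i0 x <= c.
Proof. by move=> xc; apply: (big_ind (fun z => z <= c)) => // u v uc vc; rewrite ge_max uc. Qed.

Lemma L1_fmax (I : finType) (i0 : I) d (T : measurableType d) (P : probability T R) (X : I -> T -> R) :
  (forall i, L1 P (X i)) -> L1 P (fun t => fmax i0 (fun i => X i t)).
Proof.
move=> LX; rewrite /fmax; elim: (index_enum I) => [|i s ih].
  by under [X in L1 _ X]funext do rewrite big_nil.
by under [X in L1 _ X]funext do rewrite big_cons; exact: L1_max.
Qed.

Lemma fmax_lse (I : finType) (i0 : I) (x : I -> R) : fmax i0 x <= lse x <= fmax i0 x + ln #|I|%:R.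
Proof.
apply/andP; split; first by apply: fmax_le => i; exact: lse_ge.
by apply: lse_le => // i; exact: fmax_ge.
Qed.

Lemma fmaxZ (I : finType) (i0 : I) (b : R) (x : I -> R) : 0 <= b ->
  fmax i0 (fun i => b * x i) = b * fmax i0 x.
Proof.
move=> b0; rewrite /fmax; elim: (index_enum I) => [|i s ih]; first by rewrite !big_nil.
by rewrite !big_cons ih maxr_pMr.
Qed.

(** At inverse temperature b = 1/k, the log-sum-exp of b x divided by b exceeds the maximum by at
    most k ln |I|; then k tends to 0. *)
Lemma sudakov_fernique_same (I : finType) (i0 : I)
    d1 (T1 : measurableType d1) (P1 : probability T1 R) (X : I -> T1 -> R) V
    d2 (T2 : measurableType d2) (P2 : probability T2 R) (Y : I -> T2 -> R) W :
  gfield P1 X V -> gfield P2 Y W ->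
  (forall i j, Ex P1 (fun t => (X i t - X j t) ^+ 2) <= Ex P2 (fun t => (Y i t - Y j t) ^+ 2)) ->
  Ex P1 (fun t => fmax i0 (fun i => X i t)) <= Ex P2 (fun t => fmax i0 (fun i => Y i t)).
Proof.
move=> gX gY XY; apply: (@le_of_small R _ _ (ln #|I|%:R)) => k k0 _.
pose b := k^-1; have b0 : 0 <= b by rewrite invr_ge0 ltW.
have sc d (T : measurableType d) (Q : probability T R) (A : I -> T -> R) VA : gfield Q A VA ->
    forall i j, Ex Q (fun t => (b * A i t - b * A j t) ^+ 2) = b ^+ 2 * Ex Q (fun t => (A i t - A j t) ^+ 2).
  move=> gA i j; rewrite -ExZ; first by apply: eq_Ex => u; ring.
  have := cgauss_normX_L1 (gfield_cgaussB gA i j) 2; apply: L1_eq => u.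
  by rewrite real_normK ?num_real.
have XYb i j : Ex P1 (fun t => (b * X i t - b * X j t) ^+ 2) <= Ex P2 (fun t => (b * Y i t - b * Y j t) ^+ 2).
  by rewrite (sc _ _ _ _ _ gX) (sc _ _ _ _ _ gY) ler_wpM2l ?sqr_ge0.
have gXb := gfield_scale gX b; have gYb := gfield_scale gY b.
have le := Ex_lse_le i0 gXb gYb XYb.
have LX := L1_fmax i0 (gfield_L1 gX); have LY := L1_fmax i0 (gfield_L1 gY).
have h1 : b * Ex P1 (fun t => fmax i0 (fun i => X i t)) <= Ex P1 (fun t => lse (fun i => b * X i t)).
  rewrite -ExZ//; apply: le_Ex; [exact: L1Z|exact: (L1_lse i0 (gfield_L1 gXb))|].
  by move=> t; rewrite -fmaxZ//; case/andP: (fmax_lse i0 (fun i => b * X i t)).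
have h2 : Ex P2 (fun t => lse (fun i => b * Y i t)) <= b * Ex P2 (fun t => fmax i0 (fun i => Y i t)) + ln #|I|%:R.
  rewrite -ExZ// -(Ex_cst P2 (ln #|I|%:R)) -ExD; [|exact: L1Z|exact: L1_cst].
  apply: le_Ex; [exact: (L1_lse i0 (gfield_L1 gYb))|by apply: L1D; [exact: L1Z|exact: L1_cst]|].
  by move=> t; rewrite -fmaxZ//; case/andP: (fmax_lse i0 (fun i => b * Y i t)).
have : b * Ex P1 (fun t => fmax i0 (fun i => X i t)) <= b * Ex P2 (fun t => fmax i0 (fun i => Y i t)) + ln #|I|%:R.
  by apply: le_trans h1 (le_trans le h2).
move=> /(ler_wpM2l (ltW k0)); rewrite mulrDr !mulrA.
by rewrite /b divff ?gt_eqF// !mul1r.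
Qed.

(** Pull the larger field back along [iota]; its maximum over the image is at most its maximum over
    [J]. *)
Lemma sudakov_fernique (I J : finType) (i0 : I) (j0 : J) (iota : I -> J)
    d1 (T1 : measurableType d1) (P1 : probability T1 R) (X : I -> T1 -> R) V
    d2 (T2 : measurableType d2) (P2 : probability T2 R) (Y : J -> T2 -> R) W :
  gfield P1 X V -> gfield P2 Y W ->
  (forall i j, Ex P1 (fun t => (X i t - X j t) ^+ 2) <=
     Ex P2 (fun t => (Y (iota i) t - Y (iota j) t) ^+ 2)) ->
  Ex P1 (fun t => fmax i0 (fun i => X i t)) <= Ex P2 (fun t => fmax j0 (fun j => Y j t)).
Proof.
move=> gX gY XY; have gYi := gfield_map gY iota.
apply: le_trans (sudakov_fernique_same i0 gX gYi XY) _.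
apply: le_Ex; [exact: L1_fmax (gfield_L1 gYi)|exact: L1_fmax (gfield_L1 gY)|].
by move=> t; apply: fmax_le => i; exact: (fmax_ge j0 (fun j => Y j t)).
Qed.

End SudakovFerniqueMax.

(** * The Green function of the killed walk *)

Section WalkCombinatorics.
Context {R : realType} (N : nat).

Definition interior_pt (z : int * int) : bool := (0 < z.1 < N%:Z - 1) && (0 < z.2 < N%:Z - 1).

Definition boundary_pt (z : int * int) : bool :=
  (0 <= z.1 <= N%:Z - 1) && (0 <= z.2 <= N%:Z - 1) && ~~ interior_pt z.

Lemma boundary_ptP z : reflect (box_boundary N z) (boundary_pt z).
Proof.
apply: (iffP andP) => [[h1 h2]|[h1 h2]]; split => //; first by move=> h; move: h2; rewrite /interior_pt h.
by apply/negP.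
Qed.

Lemma interior_nbr z e : interior_pt z -> e \in unit_steps -> interior_pt (z + e) || boundary_pt (z + e).
Proof.
case: z => a b; rewrite /boundary_pt /interior_pt !inE => /= h.
by case/or4P => /eqP -> /=; lia.
Qed.

Variable x : int * int.

(** The latest step heads the list, so recursion on lists peels off the last step of the walk. *)
Fixpoint walk_pos (s : seq (int * int)) : int * int := if s is e :: s' then walk_pos s' + e else x.

Fixpoint walk_inside (s : seq (int * int)) : bool :=
  if s is e :: s' then ~~ boundary_pt (walk_pos s' + e) && walk_inside s' else ~~ boundary_pt x.

Fixpoint walks (m : nat) : seq (seq (int * int)) :=
  if m is m'.+1 then [seq e :: s | e <- unit_steps, s <- walks m'] else [:: [::]].

Lemma walksS m : walks m.+1 = [seq e :: s | e <- unit_steps, s <- walks m].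
Proof. by []. Qed.

(** The probability that the walk is at y at time m without having met the boundary, as
    [inside_event_prob] confirms; the sum counts paths of unit steps. *)
Definition walk_mass (m : nat) (y : int * int) : R :=
  (4 ^+ m)^-1 * \sum_(s <- walks m) (walk_inside s && (walk_pos s == y))%:R.

Lemma walk_mass0 y : walk_mass 0 y = (~~ boundary_pt x && (x == y))%:R.
Proof. by rewrite /walk_mass /= big_seq1 expr0 invr1 mul1r. Qed.

Lemma walk_massS m y : walk_mass m.+1 y =
  (~~ boundary_pt y)%:R * (4^-1 * \sum_(e <- unit_steps) walk_mass m (y + e)).
Proof.
have sw : \sum_(e <- unit_steps) walk_mass m (y + e) = \sum_(e <- unit_steps) walk_mass m (y - e).
  by rewrite /unit_steps !big_cons !big_nil; rewrite [RHS]addrCA; congr (_ + _);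
     congr (_ + _); rewrite addrCA; congr (_ + (_ + _)).
rewrite sw /walk_mass walksS big_allpairs_dep -mulr_sumr exprS invfM -!mulrA.
rewrite [RHS]mulrCA; congr (_ * _); rewrite [RHS]mulrCA; congr (_ * _).
rewrite mulr_sumr; apply: eq_bigr => e _; rewrite mulr_sumr; apply: eq_bigr => s _ /=.
have -> : (walk_pos s + e == y) = (walk_pos s == y - e) by rewrite eq_sym -subr_eq eq_sym.
case: eqP => [->|]; last by rewrite !andbF mulr0.
by rewrite subrK !andbT; case: boundary_pt; case: walk_inside; rewrite /= ?mul0r ?mul1r ?mulr0.
Qed.

Lemma walk_mass_ge0 m y : 0 <= walk_mass m y.
Proof. by rewrite mulr_ge0 ?invr_ge0 ?exprn_ge0// sumr_ge0. Qed.

Lemma walk_mass_boundary m y : boundary_pt x -> walk_mass m y = 0.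
Proof.
move=> bx; rewrite /walk_mass big1 ?mulr0// => s _.
suff -> : walk_inside s = false by [].
by elim: s => [|e s ih] /=; rewrite ?bx// ih andbF.
Qed.

Hypothesis ix : interior_pt x.

Lemma walk_mass_out m y : ~~ interior_pt y -> walk_mass m y = 0.
Proof.
elim: m y => [|m ih] y ny; first by rewrite walk_mass0; case: eqP => [xy|]; rewrite ?andbF//; move: ny; rewrite -xy ix.
rewrite walk_massS; case: (boolP (boundary_pt y)) => [_|nb]; first by rewrite mul0r.
rewrite big_seq big1 ?mulr0// => e he; apply: ih; apply/negP => iz.
have he' : - e \in unit_steps by move: he; rewrite !inE => /or4P[] /eqP ->.
by have := interior_nbr iz he'; rewrite addrK (negbTE ny) (negbTE nb).
Qed.

Let v (y : int * int) : R := (y.1 * (N%:Z - 1 - y.1))%:~R.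

(** The function 2 [v] equals 1 plus its average over the four neighbours: it is the mean exit time
    from a strip. It is therefore a supersolution of the recursion of the partial sums, and the
    Green series converges. *)
Lemma partial_green_le M y : \sum_(m < M) walk_mass m y <= 2 * v y * (interior_pt y)%:R.
Proof.
elim: M y => [|M ih] y.
  rewrite big_ord0; case: (boolP (interior_pt y)) => iy; rewrite ?mulr0// mulr1 mulr_ge0// ler0z.
  by move: iy; rewrite /interior_pt => /andP[/andP[h1 h2] _]; rewrite mulr_ge0; lia.
case: (boolP (interior_pt y)) => iy; last by rewrite mulr0 big1// => m _; exact: walk_mass_out.
rewrite big_ord_recl; under eq_bigr do rewrite walk_massS.
rewrite mulr1 -!mulr_sumr exchange_big/=.
have nb : boundary_pt y = false by rewrite /boundary_pt iy andbF.
rewrite walk_mass0 nb mul1r.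
have h1 : (~~ boundary_pt x && (x == y))%:R <= 1 :> R by rewrite lern1 leq_b1.
have h2 : \sum_(e <- unit_steps) \sum_(m < M) walk_mass m (y + e) <= \sum_(e <- unit_steps) 2 * v (y + e).
  rewrite big_seq [leRHS]big_seq; apply: ler_sum => e he; apply: le_trans (ih _) _.
  have : 0 <= v (y + e).
    have := interior_nbr iy he; rewrite ler0z /boundary_pt /interior_pt => h.
    by apply: mulr_ge0; lia.
  by case: interior_pt; rewrite ?mulr1// mulr0 => ?; rewrite mulr_ge0.
have h3 : \sum_(e <- unit_steps) 2 * v (y + e) = 8 * v y - 4.
  rewrite /unit_steps !big_cons big_nil addr0 /v/= !addr0.
  rewrite !(intrM, intrD, intrN, rmorphB)/=; move: (_%:~R : R) => a; ring.
rewrite h3 in h2; lra.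
Qed.

Definition green_fun (y : int * int) : R := limn (fun M => \sum_(0 <= m < M) walk_mass m y).

Lemma green_fun_cvg y : (fun M => \sum_(0 <= m < M) walk_mass m y) @ \oo --> green_fun y.
Proof.
apply: nondecreasing_is_cvgn.
  by apply/nondecreasing_seqP => n; rewrite big_nat_recr//= lerDl walk_mass_ge0.
exists (2 * v y * (interior_pt y)%:R) => _ [M _ <-]; rewrite big_mkord; exact: partial_green_le.
Qed.

Lemma green_fun_ge0 y : 0 <= green_fun y.
Proof.
apply: limr_ge; first by apply/cvg_ex; eexists; exact: green_fun_cvg.
by apply: nearW => M; apply: sumr_ge0 => i _; exact: walk_mass_ge0.
Qed.

Lemma green_fun_out y : ~~ interior_pt y -> green_fun y = 0.
Proof.
move=> ny; rewrite /green_fun; have -> : (fun M => \sum_(0 <= m < M) walk_mass m y) = fun=> 0.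
  by apply/funext => M; apply: big1 => m _; exact: walk_mass_out.
exact: lim_cst.
Qed.

Lemma green_fun_eq y : interior_pt y ->
  green_fun y = (x == y)%:R + 4^-1 * \sum_(e <- unit_steps) green_fun (y + e).
Proof.
move=> iy.
have h1 : (fun M => \sum_(0 <= m < M.+1) walk_mass m y) @ \oo --> green_fun y.
  by have := @green_fun_cvg y; rewrite -cvg_shiftS.
have h2 : (fun M => \sum_(0 <= m < M.+1) walk_mass m y) @ \oo -->
   (x == y)%:R + 4^-1 * \sum_(e <- unit_steps) green_fun (y + e).
  have -> : (fun M => \sum_(0 <= m < M.+1) walk_mass m y) =
     (fun M => (x == y)%:R + 4^-1 * \sum_(e <- unit_steps) \sum_(0 <= m < M) walk_mass m (y + e)).
    apply/funext => M; rewrite big_nat_recl// walk_mass0 /boundary_pt ix andbF /=; congr (_ + _).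
    under eq_bigr do rewrite walk_massS /boundary_pt iy andbF mul1r.
    by rewrite -mulr_sumr exchange_big.
  apply: cvgD; first exact: cvg_cst.
  apply: cvgMr; rewrite /unit_steps !big_cons big_nil.
  have -> : (fun M => \sum_(e <- [:: (1, 0); (-1, 0); (0, 1); (0, -1)]) \sum_(0 <= m < M) walk_mass m (y + e)) =
    (fun M => \sum_(0 <= m < M) walk_mass m (y + (1, 0)) + (\sum_(0 <= m < M) walk_mass m (y + (-1, 0)) +
     (\sum_(0 <= m < M) walk_mass m (y + (0, 1)) + (\sum_(0 <= m < M) walk_mass m (y + (0, -1)) + 0)))).
    by apply/funext => M; rewrite !big_cons big_nil.
  do ?[apply: cvgD; first exact: green_fun_cvg]; exact: cvg_cst.
by rewrite -(cvg_lim _ h1)// -(cvg_lim _ h2).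
Qed.

End WalkCombinatorics.

(** * From the law of the walk to sums over paths *)

Section WalkLaw.
Context {R : realType} (dW : measure_display) (W : measurableType dW).
Context (P : probability W R) (x : int * int) (w : nat -> W -> int * int).
Hypothesis srw : simple_random_walk P x w.

Let measurable_increment m e : measurable [set t | increment w m t = e].
Proof.
have -> : [set t | increment w m t = e] =
    \bigcup_z ([set t | w m t = z] `&` [set t | w m.+1 t = z + e]).
  apply/seteqP; split => [t /= h|t [z _ [/= <-]]].
    by exists (w m t) => //; split => //=; rewrite -h /increment addrC subrK.
  by rewrite /increment => ->; rewrite addrC addKr.
apply: countable_bigcupT_measurable => [|z]; first exact: countableP.
by apply: measurableI; exact: srw_measurable srw _ _.
Qed.

Fixpoint cyl (s : seq (int * int)) : set W :=
  if s is e :: s' then [set t | increment w (size s') t = e] `&` cyl s' else [set t | w 0%N t = x].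

Let measurable_cyl s : measurable (cyl s).
Proof.
elim: s => [|e s ih] /=; first exact: srw_measurable srw _ _.
by apply: measurableI.
Qed.

Let cyl_pos s t : cyl s t -> w (size s) t = walk_pos x s.
Proof. by elim: s => [//|e s ih] /= [h /ih <-]; rewrite -h /increment addrC subrK. Qed.

Let cyl_inside N s t : cyl s t ->
  (forall k, (k <= size s)%N -> ~ box_boundary N (w k t)) <-> walk_inside N x s.
Proof.
elim: s => [|e s ih] /=.
  move=> h; split => [/(_ 0%N isT)|/negP nb k]; first by rewrite h => nb; apply/negP => /boundary_ptP.
  by rewrite leqn0 => /eqP ->; rewrite h => /boundary_ptP.
move=> [h cs]; have [ih1 ih2] := ih cs.
have wp : w (size s).+1 t = walk_pos x s + e by rewrite -(cyl_pos cs) -h /increment addrC subrK.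
split=> [H|/andP[/negP nb gs] k].
  apply/andP; split; last by apply: ih1 => k ks; apply: H; exact: leqW.
  by apply/negP => /boundary_ptP; rewrite -wp; apply: H.
rewrite leq_eqVlt => /orP[/eqP ->|ks]; last exact: ih2.
by rewrite wp => /boundary_ptP.
Qed.

Let cyl_inj s s' t : size s = size s' -> cyl s t -> cyl s' t -> s = s'.
Proof.
elim: s s' => [|e s ih] [|e' s'] //= [ss] [h1 h2] [h3 h4].
by rewrite -(ih _ ss h2 h4) -h1 -h3 ss.
Qed.

Let walks_size m s : s \in walks m -> size s = m /\ all (mem unit_steps) s.
Proof.
elim: m s => [|m ih] s; first by rewrite inE => /eqP ->.
by rewrite walksS => /allpairsP[[e s'] /= [he /ih[<- a] ->]]; split => //; apply/andP; split.
Qed.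

Let walks_uniq m : uniq (walks m).
Proof. by elim: m => [//|m ih]; apply: allpairs_uniq => // -[e s] [e' s'] _ _ [-> ->]. Qed.

Let cyl_prob s : all (mem unit_steps) s -> P (cyl s) = ((4^-1) ^+ size s)%:E.
Proof.
move=> hs; pose A i := [set nth 0 (rev s) i].
have e1 : cyl s = [set t | w 0%N t = x] `&` \bigcap_(i in [set` iota 0 (size s)]) (increment w i @^-1` A i).
  apply/seteqP; split.
    move=> t; rewrite /A; elim: s {hs A} => [|e s ih] /=.
      by move=> h; split.
    move=> [h /ih[h1 h2]]; split => // i hi; have : i \in iota 0 (size s).+1 by exact: hi.
    rewrite mem_iota add0n /= => his; rewrite /preimage /= rev_cons nth_rcons size_rev; move: his; rewrite ltnS leq_eqVlt => /orP[/eqP ->|his].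
      by rewrite ltnn eqxx.
    by rewrite his; apply: h2 => /=; rewrite mem_iota.
  move=> t; rewrite /A; elim: s {hs A} => [|e s ih] /=; first by case.
  move=> [h1 h2]; split.
    have hi : size s \in iota 0 (size s).+1 by rewrite mem_iota add0n /=.
    have := h2 (size s) hi; rewrite /preimage /=.
    by rewrite rev_cons nth_rcons size_rev ltnn eqxx.
  apply: ih; split => // i /=; rewrite mem_iota add0n /= => his.
  have hi : i \in iota 0 (size s).+1 by rewrite mem_iota add0n /= ltnS ltnW.
  have := h2 i hi; rewrite /preimage /=.
  by rewrite rev_cons nth_rcons size_rev his.
have mB : measurable (\bigcap_(i in [set` iota 0 (size s)]) (increment w i @^-1` A i)).
  rewrite bigcap_mkcond; apply: bigcapT_measurable => i.
  by case: ifP => _ //; exact: measurable_increment.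
have e2 : P (cyl s) = P (\bigcap_(i in [set` iota 0 (size s)]) (increment w i @^-1` A i)).
  have m0 : measurable [set t | w 0%N t = x] by exact: srw_measurable srw _ _.
  rewrite e1; set B := \bigcap_(i in _) _.
  symmetry; apply: (etrans (measureDI P mB m0)).
  rewrite [X in (X + _)%E](_ : _ = 0%E); first by rewrite add0e setIC.
    apply/eqP; rewrite eq_le measure_ge0 andbT.
    apply: (@le_trans _ _ (P (~` [set t | w 0%N t = x]))).
      apply: le_measure; rewrite ?inE; [exact: measurableD|exact: measurableC|by move=> t []].
    by rewrite probability_setC// (srw_start srw) subee.
rewrite e2 (srw_independent srw) ?iota_uniq//.
have -> : (\prod_(i <- iota 0 (size s)) P (increment w i @^-1` A i) = \prod_(i <- iota 0 (size s)) (4^-1)%:E)%E.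
  apply: eq_big_seq => i; rewrite mem_iota add0n /= => his.
  apply: (srw_uniform srw); have /allP := hs; apply.
  by rewrite -mem_rev mem_nth// size_rev.
move: (size s) => n {e1 e2 mB A hs}; elim: n => [|n ih]; first by rewrite big_nil expr0.
by rewrite -addn1 iotaD big_cat/= big_seq1 ih addn1 exprSr EFinM.
Qed.

Let sum_cyl_le m (r : seq (seq (int * int))) (E : set W) : measurable E -> uniq r ->
  (forall s, s \in r -> s \in walks m /\ cyl s `<=` E) ->
  ((\sum_(s <- r) (4^-1) ^+ m)%:E <= P E)%E.
Proof.
elim: r E => [|s r ih] E mE /=; first by rewrite big_nil.
move=> /andP[sr ur] H; rewrite big_cons EFinD.
have [sw sE] := H s (mem_head _ _).
rewrite (measureDI P mE (measurable_cyl s)) addeC; apply: leeD.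
  apply: ih => //; first exact: measurableD.
  move=> s' s'r; have [s'w s'E] := H s' (mem_behead (s := s :: r) s'r); split => // t ct.
  split; first exact: s'E.
  move=> cs; suff ss : s = s' by rewrite ss s'r in sr.
  by apply: (cyl_inj _ cs ct); rewrite (walks_size sw).1 (walks_size s'w).1.
have [sz sa] := walks_size sw; rewrite -sz -cyl_prob//.
by rewrite setIidr.
Qed.

Definition inside_event N m y : set W :=
  [set t | (forall k, (k <= m)%N -> ~ box_boundary N (w k t)) /\ w m t = y].

Lemma measurable_inside_event N m y : measurable (inside_event N m y).
Proof.
have mp (Q : int * int -> Prop) k : measurable [set t | Q (w k t)].
  have -> : [set t | Q (w k t)] = \bigcup_(z in [set z | Q z]) [set t | w k t = z].
    by apply/seteqP; split => [t /= h|t [z /= h] /= ->//]; exists (w k t).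
  rewrite bigcup_mkcond; apply: countable_bigcupT_measurable => [|z]; first exact: countableP.
  by case: ifP => _ //; exact: srw_measurable srw _ _.
have -> : inside_event N m y = (\bigcap_k [set t | (k <= m)%N -> ~ box_boundary N (w k t)]) `&` [set t | w m t = y].
  apply/seteqP; split => t [h1 h2]; split => // k; first by move=> _; exact: h1.
  exact: (h1 k I).
apply: measurableI; last exact: (mp (fun z => z = y)).
by apply: bigcapT_measurable => k; exact: (mp (fun z => (k <= m)%N -> ~ box_boundary N z)).
Qed.

(** Disjoint cylinders bound from below both the event and its complement, and the two bounds add up
    to 1, so both are equalities. Paths with other increments are thereby seen to carry no mass. *)
Lemma inside_event_prob N m y : P (inside_event N m y) = (walk_mass N x m y)%:E.
Proof.
have mE := measurable_inside_event N m y; set E := inside_event N m y in mE *.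
pose q s := walk_inside N x s && (walk_pos x s == y).
have hE s t : s \in walks m -> cyl s t -> E t <-> q s.
  move=> sw cs; have [sz _] := walks_size sw; have [g1 g2] := cyl_inside N cs; rewrite sz in g1 g2.
  have pt := cyl_pos cs; rewrite sz in pt.
  split => [[h1 h2]|/andP[h1 /eqP h2]]; first by rewrite /q g1//= -pt h2 eqxx.
  by split; [exact: g2|rewrite pt].
have l1 : ((\sum_(s <- [seq s <- walks m | q s]) (4^-1) ^+ m)%:E <= P E)%E.
  apply: sum_cyl_le => //; first exact: filter_uniq.
  by move=> s; rewrite mem_filter => /andP[qs sw]; split => // t ct; apply/(hE s).
have l2 : ((\sum_(s <- [seq s <- walks m | ~~ q s]) (4^-1) ^+ m)%:E <= P (~` E))%E.
  apply: sum_cyl_le => //; [exact: measurableC|exact: filter_uniq|].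
  move=> s; rewrite mem_filter => /andP[qs sw]; split => // t ct Et.
  by move/negP : qs; apply; apply/(hE s t).
have tot : \sum_(s <- [seq s <- walks m | q s]) (4^-1) ^+ m +
    \sum_(s <- [seq s <- walks m | ~~ q s]) (4^-1) ^+ m = 1 :> R.
  transitivity (\sum_(s <- walks m) (4^-1) ^+ m : R); first by rewrite [RHS](bigID q)/= !big_filter.
  rewrite big_const_seq count_predT iter_addr_0.
  have -> : size (walks m) = (4 ^ m)%N.
    by elim: m {E mE hE l1 l2 q} => [//|m ih]; rewrite walksS size_allpairs ih expnS.
  by rewrite -[LHS]mulr_natr natrX exprVn mulVf// expf_eq0 pnatr_eq0 andbF.
have wm : walk_mass N x m y = \sum_(s <- [seq s <- walks m | q s]) (4^-1) ^+ m :> R.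
  rewrite big_filter [RHS]big_mkcond /walk_mass mulr_sumr; apply: eq_bigr => s _.
  by rewrite -/(q s) exprVn; case: (q s); rewrite ?mulr1 ?mulr0.
have PE : P E = (fine (P E))%:E by rewrite fineK// fin_num_measure.
rewrite probability_setC// PE in l2; rewrite PE lee_fin in l1; rewrite -EFinB lee_fin in l2.
by rewrite PE; congr EFin; rewrite wm; apply/eqP; rewrite eq_le; apply/andP; split; lra.
Qed.

End WalkLaw.

Section Green.
Context {R : realType} (dW : measure_display) (W : measurableType dW).
Context (PW : int * int -> probability W R) (w : nat -> W -> int * int).
Hypothesis srw : forall x, simple_random_walk (PW x) x w.

Lemma lt_hitting_time N (path : nat -> int * int) m :
  (((m%:R)%:E : \bar R) < hitting_time R N path)%E = `[< forall k, (k <= m)%N -> ~ box_boundary N (path k) >].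
Proof.
apply/idP/asboolP => [h k km bk|h].
  move: h; rewrite ltNge => /negP; apply.
  apply: (@le_trans _ _ ((k%:R)%:E)); last by rewrite lee_fin ler_nat.
  by apply: ereal_inf_lbound; exists k.
apply: (@lt_le_trans _ _ ((m.+1%:R)%:E)); first by rewrite lte_fin ltr_nat.
apply: le_ereal_inf_tmp => _ [k /= bk <-]; rewrite lee_fin ler_nat ltnNge; apply/negP => km.
exact: h bk.
Qed.

Lemma green_series N x y :
  green PW w N x y = (\sum_(0 <= m <oo) (walk_mass N x m y)%:E)%E.
Proof.
rewrite /green.
transitivity (\int[PW x]_t \sum_(0 <= m <oo) (\1_(inside_event w N m y) t)%:E)%E.
  apply: eq_integral => t _; rewrite eseries_mkcond; apply: eq_eseriesr => m _.
  rewrite indicE lt_hitting_time; case: asboolP => h.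
    congr (((nat_of_bool _)%:R)%:E); apply/idP/idP => [/eqP h'|]; first by rewrite inE; split.
    by rewrite inE => -[_ ->].
  by rewrite memNset// => -[].
rewrite integral_nneseries//; last first.
  by move=> m; apply/measurable_EFinP; apply: measurable_indic; exact: measurable_inside_event (srw x) _ _ _.
apply: eq_eseriesr => m _; rewrite integral_indic ?setIT//; last exact: measurable_inside_event (srw x) _ _ _.
exact: inside_event_prob.
Qed.

Lemma green_interior N x y : interior_pt N x -> green PW w N x y = (green_fun N x y)%:E.
Proof.
move=> ix; rewrite green_series.
have c := green_fun_cvg (R := R) ix (y := y).
have c' : (fun M => (\sum_(0 <= m < M) walk_mass N x m y)%:E) @ \oo --> ((green_fun N x y : R)%:E).
  by apply: cvg_EFin; [exact: nearW|exact: c].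
rewrite -(cvg_lim _ c')//; congr (lim (_ @ \oo)); apply/funext => M.
by rewrite /= sumEFin.
Qed.

Lemma green_boundary N x y : boundary_pt N x -> green PW w N x y = 0%E.
Proof. by move=> bx; rewrite green_series eseries0// => m _ _; rewrite walk_mass_boundary. Qed.

End Green.

(** * Discrete potential theory in a box *)

Section LatticeGreen.
Context {R : realType}.
Implicit Types (u v F : int * int -> R) (z e : int * int).

Definition lap u z : R := u z - 4^-1 * \sum_(e <- unit_steps) u (z + e).

(** Interface between the walk and the analysis. Symmetry and positive semidefiniteness are
    available because the Green function is a covariance. *)
Record is_green (N : nat) (G : int * int -> int * int -> R) : Prop := IsGreen {
  green_out : forall x y, ~~ interior_pt N x -> G x y = 0 ;
  green_lap : forall x y, interior_pt N x -> interior_pt N y -> lap (G x) y = (x == y)%:R ;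
  green_sym : forall x y, G x y = G y x ;
  green_ge0 : forall x y, 0 <= G x y ;
  green_psd : forall b : site N -> R, 0 <= \sum_i \sum_j b i * b j * G (site_point i) (site_point j) }.

Lemma unit_stepsN e : e \in unit_steps -> - e \in unit_steps.
Proof. by rewrite !inE => /or4P[] /eqP ->. Qed.

Lemma lapE u z : lap u z = u z - 4^-1 * (u (z + (1, 0)) + u (z + (-1, 0)) + u (z + (0, 1)) + u (z + (0, -1))).
Proof. by rewrite /lap /unit_steps !big_cons big_nil addr0 !addrA. Qed.

Lemma lap_sum (I : finType) (c : I -> R) (f : I -> int * int -> R) z :
  lap (fun z => \sum_i c i * f i z) z = \sum_i c i * lap (f i) z.
Proof.
rewrite /lap exchange_big/= mulr_sumr -sumrB; apply: eq_bigr => i _.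
by rewrite -mulr_sumr mulrBr mulrCA.
Qed.

Lemma lapB u v z : lap (fun z => u z - v z) z = lap u z - lap v z.
Proof. by rewrite !lapE; ring. Qed.

Lemma site_interior N z : interior_pt N z -> exists i : site N, site_point i = z.
Proof.
case: z => a b; rewrite /interior_pt /= => h.
have ha : (`|a| < N)%N by lia.
have hb : (`|b| < N)%N by lia.
by exists (Ordinal ha, Ordinal hb); rewrite /site_point /=; congr pair; lia.
Qed.

Lemma site_boundary N z : boundary_pt N z -> exists i : site N, site_point i = z.
Proof.
case: z => a b; rewrite /boundary_pt /= => h.
have ha : (`|a| < N)%N by lia.
have hb : (`|b| < N)%N by lia.
by exists (Ordinal ha, Ordinal hb); rewrite /site_point /=; congr pair; lia.
Qed.

Lemma site_pointP N (i : site N) : interior_pt N (site_point i) || boundary_pt N (site_point i).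
Proof. by case: i => [[a ha] [b hb]]; rewrite /boundary_pt /interior_pt /=; lia. Qed.

Lemma site_nbr N z e : interior_pt N z -> e \in unit_steps -> exists i : site N, site_point i = z + e.
Proof. by move=> iz /(interior_nbr iz) /orP[/site_interior|/site_boundary]. Qed.

Lemma site_point_inj N : injective (@site_point N).
Proof. by move=> [i j] [i' j'] [/val_inj -> /val_inj ->]. Qed.

(** Adding eps z_1^2 makes the function strictly subharmonic, so its maximum over the box cannot be
    attained inside; the perturbation costs at most eps N^2. *)
Lemma max_principle N u c : (forall z, interior_pt N z -> lap u z <= 0) ->
  (forall z, boundary_pt N z -> u z <= c) -> forall z, interior_pt N z -> u z <= c.
Proof.
move=> hu hb z iz; apply: (@le_of_small R _ _ ((N%:R) ^+ 2)) => eps eps0 _.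
have [i0 pi0] := site_interior iz.
pose w (z : int * int) : R := u z + eps * (z.1%:~R) ^+ 2.
pose k := [arg max_(i > i0) w (site_point i)]%O.
have wk (i : site N) : w (site_point i) <= w (site_point k).
  rewrite /k; case: arg_maxP => // j _ h. exact: (h i isT).
have wz : u z <= w (site_point k).
  by apply: le_trans (wk i0); rewrite pi0 /w lerDl mulr_ge0 ?sqr_ge0 ?ltW.
apply: le_trans wz _.
have [ik|bk] := orP (site_pointP k); last first.
  rewrite /w; apply: lerD; first exact: hb.
  rewrite ler_wpM2l ?(ltW eps0)//.
  by case: (k) => [[a ha] [b hb']] /=; rewrite -!natrX ler_nat leq_exp2r// ltnW.
exfalso.
have nb e : e \in unit_steps -> w (site_point k + e) <= w (site_point k).
  by move=> he; have [j <-] := site_nbr ik he.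
have := nb (1, 0) isT; have := nb (-1, 0) isT; have := nb (0, 1) isT; have := nb (0, -1) isT.
have := hu _ ik; rewrite lapE /w /=.
rewrite !(addr0, rmorphD, rmorphN)/=; move: ((site_point k).1%:~R : R) => a.
nra.
Qed.

Lemma harmonic_bound N u c1 c2 : (forall z, interior_pt N z -> lap u z = 0) ->
  (forall z, boundary_pt N z -> c1 <= u z <= c2) -> forall z, interior_pt N z -> c1 <= u z <= c2.
Proof.
move=> hu hb z iz; apply/andP; split.
  rewrite -lerN2; apply: (@max_principle N (fun z => - u z)) => // y hy.
    by have := hu y hy; rewrite !lapE; lra.
  by rewrite lerN2; case/andP: (hb y hy).
apply: (@max_principle N u) => // y hy; first by rewrite hu.
by case/andP: (hb y hy).
Qed.

Section fixed_domain.
Variables (N : nat) (G : int * int -> int * int -> R).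
Hypothesis gG : is_green N G.

Lemma green_lap2 x y : interior_pt N x -> lap (G^~ y) x = (x == y)%:R * (interior_pt N y)%:R.
Proof.
move=> ix; case: (boolP (interior_pt N y)) => iy.
  rewrite mulr1 eq_sym -(green_lap gG iy ix); rewrite /lap; congr (_ - _ * _); first exact: green_sym gG _ _.
  by apply: eq_bigr => e _; exact: green_sym gG _ _.
have g0 z : G z y = 0 by rewrite (green_sym gG) (green_out gG).
by rewrite mulr0 lapE !g0; ring.
Qed.

Definition potential F x : R := \sum_(i : site N) F (site_point i) * G x (site_point i).

Lemma potential_out F x : ~~ interior_pt N x -> potential F x = 0.
Proof. by move=> nx; apply: big1 => i _; rewrite (green_out gG)// mulr0. Qed.

Lemma lap_potential F x : interior_pt N x -> lap (potential F) x = F x.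
Proof.
move=> ix; rewrite (lap_sum (fun i : site N => F (site_point i)) (fun i => G^~ (site_point i))).
have [k kx] := site_interior ix.
rewrite (bigD1 k)//= green_lap2// kx eqxx ix !mulr1 big1 ?addr0// => i ik.
rewrite green_lap2//; case: eqP => [xi|]; last by rewrite mul0r mulr0.
by move: ik; rewrite -(inj_eq (@site_point_inj N)) -xi kx eqxx.
Qed.

Lemma potential_lap v : (forall x, ~~ interior_pt N x -> v x = 0) ->
  forall x, potential (lap v) x = v x.
Proof.
move=> v0 x; case: (boolP (interior_pt N x)) => ix; last by rewrite potential_out// v0.
apply/eqP; rewrite -subr_eq0 eq_le andbC.
apply: (@harmonic_bound N (fun x => potential (lap v) x - v x) 0 0) => // z hz.
  by rewrite lapB lap_potential// subrr.
have nz : ~~ interior_pt N z by case/andP: hz.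
by rewrite potential_out// v0// subrr lexx.
Qed.

(* The net flow out of the super-level set [{G x >= G x z}] is at most four, and all its edges flow outwards. *)
Lemma green_edge_le x z e : interior_pt N x -> e \in unit_steps ->
  G x (z + e) < G x z -> G x z - G x (z + e) <= 4.
Proof.
move=> ix he gz; set g := G x in gz *.
have g0 y : 0 <= g y by exact: green_ge0 gG _ _.
have gout y : 0 < g y -> interior_pt N y.
  by apply: contraTT => ny; rewrite /g (green_sym gG) (green_out gG)// ltxx.
have gz0 : 0 < g z by apply: le_lt_trans gz.
have iz := gout _ gz0.
pose A : pred (site N) := fun i => g z <= g (site_point i).
have Ai i : A i -> interior_pt N (site_point i) by move=> h; apply: gout; exact: lt_le_trans gz0 h.
pose adj (i j : site N) := site_point j - site_point i \in unit_steps.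
have adjC i j : adj i j = adj j i.
  rewrite /adj -opprB; move: (site_point i - site_point j) => d.
  by apply/idP/idP => /unit_stepsN; rewrite ?opprK.
have nbsum i (f : int * int -> R) : interior_pt N (site_point i) ->
    \sum_(e <- unit_steps) f (site_point i + e) = \sum_(j | adj i j) f (site_point j).
  move=> ii; rewrite [RHS]big_mkcond /=.
  transitivity (\sum_(e <- unit_steps) \sum_(j : site N) (if site_point j == site_point i + e then f (site_point j) else 0)).
    rewrite big_seq [RHS]big_seq; apply: eq_bigr => d hd; have [k kd] := site_nbr ii hd.
    rewrite -big_mkcond (big_pred1 k) ?kd// => j /=.
    by rewrite -kd (inj_eq (@site_point_inj N)).
  rewrite exchange_big/=; apply: eq_bigr => j _.
  have E d : (site_point j == site_point i + d) = (d == site_point j - site_point i).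
    by rewrite [RHS]eq_sym subr_eq addrC.
  under eq_bigr do rewrite E.
  rewrite -big_mkcond big_const_seq iter_addr_0 /adj.
  have -> : count (pred1 (site_point j - site_point i)) unit_steps = (site_point j - site_point i \in unit_steps).
    by rewrite count_uniq_mem.
  by case: (_ \in _).
have S1 : \sum_(i | A i) lap g (site_point i) <= 1.
  have [k kx] := site_interior ix.
  apply: (@le_trans _ _ (\sum_(i | A i) (i == k)%:R)).
    apply: ler_sum => i Aii; rewrite (green_lap gG ix (Ai _ Aii)) -kx.
    by rewrite (inj_eq (@site_point_inj N)) eq_sym.
  rewrite big_mkcond (bigD1 k)//= big1 ?addr0; first by case: ifP; rewrite ?eqxx.
  by move=> i ik; rewrite (negbTE ik) if_same.
have S2 : \sum_(i | A i) \sum_(j | adj i j) (g (site_point i) - g (site_point j)) <= 4.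
  have -> : \sum_(i | A i) \sum_(j | adj i j) (g (site_point i) - g (site_point j)) = 4 * \sum_(i | A i) lap g (site_point i).
    rewrite mulr_sumr; apply: eq_bigr => i /Ai ii.
    by rewrite -(nbsum i (fun y => g (site_point i) - g y) ii) lapE /unit_steps !big_cons big_nil /=; field.
  by move: S1; move: (\sum_(i | A i) _) => s s1; lra.
have S3 : \sum_(i | A i) \sum_(j | adj i j) (g (site_point i) - g (site_point j)) =
   \sum_(i | A i) \sum_(j | adj i j && ~~ A j) (g (site_point i) - g (site_point j)).
  under eq_bigr do rewrite (bigID A)/=.
  rewrite big_split/= -[RHS]add0r; congr (_ + _).
  (* Edges with both ends in the level set are counted once in each direction, with opposite
     signs. *)
  set T := (LHS); suff : T = - T by lra.
  rewrite {2}/T (exchange_big_dep A)/=; last by move=> i j _ /andP[].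
  rewrite -sumrN; apply: eq_bigr => i Aii; rewrite -sumrN; apply: eq_big => [j|j _].
    by rewrite andbC adjC; case: (A j); rewrite /= ?andbF ?andbT // Aii ?andbT.
  by rewrite opprB.
rewrite S3 in S2; apply: le_trans S2.
have [k kz] := site_interior iz; have [l lz] := site_nbr iz he.
have Ak : A k by rewrite /A kz.
have kl : adj k l && ~~ A l.
  by rewrite /A /adj lz kz -ltNge gz andbT addrC addKr.
have pos i j : A i -> adj i j && ~~ A j -> 0 <= g (site_point i) - g (site_point j).
  by move=> Aii /andP[_]; rewrite -ltNge subr_ge0 => /ltW h; exact: le_trans Aii.
rewrite (bigD1 k)//= (bigD1 l)//= kz lz -addrA lerDl; apply: addr_ge0.
  by apply: sumr_ge0 => j /andP[h _]; rewrite -kz; exact: pos.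
by apply: sumr_ge0 => i /andP[h _]; apply: sumr_ge0 => j; exact: pos.
Qed.

Lemma green_grad x z e : e \in unit_steps -> `|G x z - G x (z + e)| <= 4.
Proof.
move=> he; case: (boolP (interior_pt N x)) => ix; last by rewrite !(green_out gG)// subrr normr0.
case: (ltrgtP (G x (z + e)) (G x z)) => h.
- exact: green_edge_le.
- by have := @green_edge_le x (z + e) (- e) ix (unit_stepsN he); rewrite addrK => /(_ h).
- by [].
Qed.

Lemma green_lip x y z : `|G x z - G x y| <= 4 * (`|z.1 - y.1| + `|z.2 - y.2|)%:~R.
Proof.
have P1 (p q : int) k : (p, q) *+ k = (p *+ k, q *+ k) :> (int * int)%type.
  by elim: k => [//|k ih]; rewrite !mulrSr ih.
have H (e : int * int) k z' : e \in unit_steps -> `|G x z' - G x (z' + e *+ k)| <= 4 * k%:R.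
  move=> he; elim: k => [|k ih]; first by rewrite mulr0n addr0 subrr normr0 mulr0.
  apply: le_trans (ler_distD (G x (z' + e *+ k)) _ _) _.
  rewrite mulrSr addrA -[k.+1%:R]natr1 mulrDr mulr1; apply: lerD => //; exact: green_grad.
have H1 (a : int) z' : `|G x z' - G x (z' + (a, 0))| <= 4 * (`|a|)%:~R.
  have [a0|a0] := leP 0 a.
    have := @H (1, 0) `|a|%N z' isT.
    have -> : (1, 0) *+ `|a|%N = (a, 0) :> (int * int)%type by rewrite P1 mul0rn natz; congr pair; lia.
    by rewrite -[`|a|%:R]/((`|a|%:Z)%:~R) abszE.
  have := @H (-1, 0) `|a|%N z' isT.
  have -> : (-1, 0) *+ `|a|%N = (a, 0) :> (int * int)%type by rewrite P1 mul0rn mulNrn natz; congr pair; lia.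
  by rewrite -[`|a|%:R]/((`|a|%:Z)%:~R) abszE.
have H2 (a : int) z' : `|G x z' - G x (z' + (0, a))| <= 4 * (`|a|)%:~R.
  have [a0|a0] := leP 0 a.
    have := @H (0, 1) `|a|%N z' isT.
    have -> : (0, 1) *+ `|a|%N = (0, a) :> (int * int)%type by rewrite P1 mul0rn natz; congr pair; lia.
    by rewrite -[`|a|%:R]/((`|a|%:Z)%:~R) abszE.
  have := @H (0, -1) `|a|%N z' isT.
  have -> : (0, -1) *+ `|a|%N = (0, a) :> (int * int)%type by rewrite P1 mul0rn mulNrn natz; congr pair; lia.
  by rewrite -[`|a|%:R]/((`|a|%:Z)%:~R) abszE.
rewrite distrC rmorphD mulrDr.
apply: le_trans (ler_distD (G x (y + (z.1 - y.1, 0))) _ _) _; apply: lerD; first exact: H1.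
have zE : z = (y + (z.1 - y.1, 0)) + (0, z.2 - y.2).
  by case: z y => a b [c d]; congr pair => /=; lia.
by have := H2 (z.2 - y.2) (y + (z.1 - y.1, 0)); rewrite -zE.
Qed.

(** The gradient bound is summed along a horizontal path to the side of the box, where [G] vanishes.
    This linear bound is crude but will only be multiplied by an error of order 1/N. *)
Lemma green_le x y : G x y <= 4 * N%:R.
Proof.
case: (boolP (interior_pt N y)) => iy; last first.
  by rewrite (green_sym gG) (green_out gG)// mulr_ge0.
have b0 : ~~ interior_pt N (0, y.2) by rewrite /interior_pt /=; lia.
have := green_lip x (0, y.2) y; have -> : G x (0, y.2) = 0 by rewrite (green_sym gG) (green_out gG).
rewrite subr0.
rewrite ger0_norm ?(green_ge0 gG)// => h; apply: le_trans h _.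
rewrite ler_wpM2l// -[N%:R]/((N%:Z)%:~R) ler_int /= subrr normr0 addr0 subr0.
by move: iy; rewrite /interior_pt; lia.
Qed.

Lemma potential_diff (x y : int * int) u : (exists i : site N, site_point i = x) -> (exists i : site N, site_point i = y) ->
  \sum_(i : site N) ((site_point i == x)%:R - (site_point i == y)%:R) * u (site_point i) = u x - u y.
Proof.
move=> [i ix] [j jy].
have S (k : site N) : \sum_(i : site N) (site_point i == site_point k)%:R * u (site_point i) = u (site_point k).
  rewrite (bigD1 k)//= eqxx mul1r big1 ?addr0// => l lk.
  by rewrite (inj_eq (@site_point_inj N)) (negbTE lk) mul0r.
by under eq_bigr do rewrite mulrBl; rewrite sumrB -ix -jy !S.
Qed.

End fixed_domain.

(* A variational comparison of dipole energies: if [Phi] is the potential of the dipole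
   [a = 1_X - 1_Y], then [Phi - phi] is the potential of a charge [b] that vanishes wherever
   [phi] does not, and [0 <= <b, H b>] is the claim. *)
Lemma dipole_mono M H (X Y : int * int) (phi : int * int -> R) : is_green M H ->
  (exists i : site M, site_point i = X) -> (exists i : site M, site_point i = Y) ->
  (forall z, ~~ interior_pt M z -> phi z = 0) ->
  (forall z, interior_pt M z -> phi z = 0 \/ lap phi z = (z == X)%:R - (z == Y)%:R) ->
  phi X - phi Y <= H X X + H Y Y - 2 * H X Y.
Proof.
move=> gH sx sy phi0 lapphi.
pose a z : R := (z == X)%:R - (z == Y)%:R.
pose Phi := potential M H a.
have Phi0 z : ~~ interior_pt M z -> Phi z = 0 by exact: potential_out gH _ _.
have PhiE z : Phi z = H z X - H z Y.
  by rewrite /Phi /potential; exact: (potential_diff (H z) sx sy).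
pose b z := lap (fun z => Phi z - phi z) z.
have Hb z : potential M H b z = Phi z - phi z.
  by apply: (potential_lap gH) => t nt; rewrite Phi0// phi0// subrr.
have := green_psd gH (fun i => b (site_point i)).
have -> : \sum_(i : site M) \sum_(j : site M) b (site_point i) * b (site_point j) * H (site_point i) (site_point j) =
    \sum_(i : site M) b (site_point i) * (Phi (site_point i) - phi (site_point i)).
  by apply: eq_bigr => i _; rewrite -Hb /potential mulr_sumr; apply: eq_bigr => j _; rewrite mulrA.
have -> : \sum_(i : site M) b (site_point i) * (Phi (site_point i) - phi (site_point i)) =
   \sum_(i : site M) (a (site_point i) * Phi (site_point i) - lap phi (site_point i) * Phi (site_point i)).
  apply: eq_bigr => i _; set z := site_point i.
  case: (boolP (interior_pt M z)) => iz; last by rewrite (Phi0 z)// (phi0 z)// subrr !mulr0 subrr.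
  have bz : b z = a z - lap phi z by rewrite /b lapB (lap_potential gH).
  by case: (lapphi z iz) => h; rewrite bz h ?subrr ?mul0r// subr0 mulrBl.
rewrite sumrB (potential_diff Phi sx sy).
have -> : \sum_(i : site M) lap phi (site_point i) * Phi (site_point i) = phi X - phi Y.
  rewrite -!(potential_lap gH phi0) /potential -sumrB; apply: eq_bigr => i _.
  by rewrite PhiE ![H (site_point i) _](green_sym gH) mulrBr.
rewrite !PhiE (green_sym gH Y X); lra.
Qed.

Lemma green_lapT N G x y : is_green N G -> interior_pt N y -> lap (G x) y = (x == y)%:R.
Proof.
move=> gG iy; case: (boolP (interior_pt N x)) => ix; first exact: (green_lap gG).
rewrite lapE !(green_out gG)//; case: eqP => [xy|_]; first by rewrite xy iy in ix.
by rewrite !addr0 mulr0 subr0.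
Qed.

Lemma lap_shift u o z : lap (fun z => u (z - o)) z = lap u (z - o).
Proof. by rewrite !lapE ![z - o + _]addrAC. Qed.

(** The trial function for [dipole_mono] is the dipole potential of the small box, translated and
    extended by zero: it has the right charge inside the small box and vanishes elsewhere. *)
Lemma green_domain_mono N M G H (o x y : int * int) : is_green N G -> is_green M H ->
  (forall z, interior_pt N z -> interior_pt M (z + o)) ->
  (exists i : site M, site_point i = x + o) -> (exists i : site M, site_point i = y + o) ->
  G x x + G y y - 2 * G x y <= H (x + o) (x + o) + H (y + o) (y + o) - 2 * H (x + o) (y + o).
Proof.
move=> gG gH NM sx sy.
have out w z : ~~ interior_pt N (z - o) -> G w (z - o) = 0 by move=> nz; rewrite (green_sym gG) (green_out gG).
have := @dipole_mono M H (x + o) (y + o) (fun z => G x (z - o) - G y (z - o)) gH sx sy.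
rewrite !addrK (green_sym gG y x) => h.
rewrite (_ : _ + _ - _ = G x x - G x y - (G x y - G y y)); last by ring.
apply: h => z.
  by move=> nz; rewrite !out ?subrr//; apply: contra nz => /NM; rewrite subrK.
move=> _; case: (boolP (interior_pt N (z - o))) => iz; last by left; rewrite !out// subrr.
right; rewrite lapB !lap_shift !(green_lapT _ gG iz).
by rewrite -[z == x + o]subr_eq -[z == y + o]subr_eq eq_sym [_ == y]eq_sym.
Qed.

(** Trial function for [dipole_mono]: [G x] on one box minus [G y] on the other. The separation
    hypotheses ensure that only one of the two terms enters the Laplacian at each interior point of
    a copy, so the trial energy is the sum of two separate ones. *)
Lemma green_two_copies N M G H (o x y : int * int) : is_green N G -> is_green M H ->
  (forall z, interior_pt N z -> interior_pt M z) -> (forall z, interior_pt N z -> interior_pt M (z + o)) ->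
  (forall z, interior_pt N z -> ~~ interior_pt N (z - o) /\ forall e, e \in unit_steps -> ~~ interior_pt N (z + e - o)) ->
  (forall z, interior_pt N (z - o) -> ~~ interior_pt N z /\ forall e, e \in unit_steps -> ~~ interior_pt N (z + e)) ->
  (exists i : site M, site_point i = x) -> (exists i : site M, site_point i = y + o) ->
  ~~ interior_pt N (x - o) -> ~~ interior_pt N (y + o) ->
  G x x + G y y <= H x x + H (y + o) (y + o) - 2 * H x (y + o).
Proof.
move=> gG gH N1 N2 far1 far2 sx sy nx ny.
have out w z : ~~ interior_pt N z -> G w z = 0 by move=> nz; rewrite (green_sym gG) (green_out gG).
have := @dipole_mono M H x (y + o) (fun z => G x z - G y (z - o)) gH sx sy.
rewrite addrK (out y (x - o))// (out x (y + o))// => h.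
rewrite (_ : _ + _ = G x x - 0 - (0 - G y y)); last by ring.
apply: h => z.
  move=> nz; rewrite !out ?subrr//; first by apply: contra nz => /N2; rewrite subrK.
  by apply: contra nz => /N1.
move=> _; case: (boolP (interior_pt N z)) => iz.
  have [f1 f2] := far1 z iz.
  right; rewrite lapB (green_lapT _ gG iz).
  have -> : lap (fun z => G y (z - o)) z = 0.
    by rewrite lapE !out ?f2// ?f1//; ring.
  rewrite eq_sym; congr (_ - _); case: eqP => // zy; by rewrite -zy iz in ny.
case: (boolP (interior_pt N (z - o))) => iz'; last by left; rewrite !out// subrr.
have [f1 f2] := far2 z iz'.
right; rewrite lapB lap_shift (green_lapT _ gG iz').
have -> : lap (G x) z = 0 by rewrite lapE !out ?f2//; ring.
rewrite -[z == y + o]subr_eq [_ == y]eq_sym; congr (_ - _).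
by case: eqP => // zx; rewrite -zx iz' in nx.
Qed.

End LatticeGreen.

(** * The potential kernel *)

Section LogKernel.
Context {R : realType}.
Implicit Types (z : int * int) (s t : seq (int * int)).

Definition normsq z : R := z.1%:~R ^+ 2 + z.2%:~R ^+ 2.

(** This is log |z| extended by 0 at the origin; elsewhere [normsq] is at least 1 and the maximum
    has no effect. *)
Definition logf z : R := ln (Num.max (normsq z) 1) / 2.

(** The charge distribution of -log |z|. It is concentrated near the origin with total mass [kappa],
    so log |z| plays the part of the potential kernel without any asymptotics for the walk. *)
Definition mu z : R := - lap logf z.

Lemma normsqE z : normsq z = (z.1 ^+ 2 + z.2 ^+ 2)%:~R.
Proof. by rewrite rmorphD !rmorphXn. Qed.

Lemma logf_ge0 z : 0 <= logf z.
Proof. by rewrite divr_ge0// ln_ge0// le_max lexx orbT. Qed.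

(** The logarithms at the four neighbours combine into that of a product, an explicit polynomial.
    With s = |z|^2 it differs from s^4 only by terms of order s^2, which is the cancellation behind
    the decay |z|^-4. *)
Lemma logf_prod z : 2 <= normsq z ->
  mu z = ln (((normsq z ^+ 2 - 1) ^+ 2 + 16 * (z.1%:~R ^+ 2 * z.2%:~R ^+ 2)) / normsq z ^+ 4) / 8.
Proof.
case: z => a b hs; have := hs; rewrite normsqE -[2]/((2%:Z)%:~R) ler_int /= => h2.
rewrite normsqE /= in hs *.
have nb (c d : int) : 1 <= c ^+ 2 + d ^+ 2 -> logf (c, d) = ln ((c ^+ 2 + d ^+ 2)%:~R : R) / 2.
  by move=> h; rewrite /logf normsqE /= max_l// -[1]/((1%:Z)%:~R) ler_int.
have s0 (c d : int) : 1 <= c ^+ 2 + d ^+ 2 -> (c ^+ 2 + d ^+ 2)%:~R \is @Num.pos R.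
  by move=> h; rewrite posrE ltr0z; lia.
have h1 : 1 <= a ^+ 2 + b ^+ 2 by lia.
have p1 : 1 <= (a + 1) ^+ 2 + b ^+ 2 by nia.
have p2 : 1 <= (a - 1) ^+ 2 + b ^+ 2 by nia.
have p3 : 1 <= a ^+ 2 + (b + 1) ^+ 2 by nia.
have p4 : 1 <= a ^+ 2 + (b - 1) ^+ 2 by nia.
have E (c d : int) : (a, b) + (c, d) = (a + c, b + d) by [].
rewrite /mu lapE !E !addr0 !nb//.
rewrite ln_div ?posrE; last 2 first.
- apply: ltr_wpDr; first by rewrite mulr_ge0// mulr_ge0 ?sqr_ge0.
  by apply: exprn_gt0; nra.
- by apply: exprn_gt0; lra.
have -> : (((a ^+ 2 + b ^+ 2)%:~R ^+ 2 - 1) ^+ 2 + 16 * (a%:~R ^+ 2 * b%:~R ^+ 2)) =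
   ((a + 1) ^+ 2 + b ^+ 2)%:~R * ((a - 1) ^+ 2 + b ^+ 2)%:~R * (a ^+ 2 + (b + 1) ^+ 2)%:~R * (a ^+ 2 + (b - 1) ^+ 2)%:~R :> R.
  have e1 : ((a + 1) ^+ 2 + b ^+ 2)%:~R = (a%:~R + 1) ^+ 2 + b%:~R ^+ 2 :> R by rewrite rmorphD !rmorphXn rmorphD.
  have e2 : ((a - 1) ^+ 2 + b ^+ 2)%:~R = (a%:~R - 1) ^+ 2 + b%:~R ^+ 2 :> R by rewrite rmorphD !rmorphXn rmorphB.
  have e3 : (a ^+ 2 + (b + 1) ^+ 2)%:~R = a%:~R ^+ 2 + (b%:~R + 1) ^+ 2 :> R by rewrite rmorphD !rmorphXn rmorphD.
  have e4 : (a ^+ 2 + (b - 1) ^+ 2)%:~R = a%:~R ^+ 2 + (b%:~R - 1) ^+ 2 :> R by rewrite rmorphD !rmorphXn rmorphB.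
  have e0 : (a ^+ 2 + b ^+ 2)%:~R = a%:~R ^+ 2 + b%:~R ^+ 2 :> R by rewrite rmorphD !rmorphXn.
  by rewrite e0 e1 e2 e3 e4; ring.
rewrite lnXn; last by have := s0 _ _ h1; rewrite posrE.
have q1 := s0 _ _ p1; have q2 := s0 _ _ p2; have q3 := s0 _ _ p3; have q4 := s0 _ _ p4.
rewrite lnM//; last by rewrite !rpredM.
rewrite lnM//; last by rewrite !rpredM.
rewrite lnM//.
by rewrite -mulr_natr; field.
Qed.

Lemma mu_far z : 2 <= normsq z -> `|mu z| <= (2 * normsq z ^+ 2)^-1.
Proof.
move=> h2; rewrite logf_prod//; set s := normsq z in h2 *.
set ab := z.1%:~R ^+ 2 * z.2%:~R ^+ 2.
have ab0 : 0 <= ab by rewrite mulr_ge0 ?sqr_ge0.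
have ab1 : 4 * ab <= s ^+ 2.
  rewrite /ab /s /normsq; have := sqr_ge0 (z.1%:~R ^+ 2 - z.2%:~R ^+ 2 : R).
  move: (z.1%:~R ^+ 2 : R) (z.2%:~R ^+ 2 : R) => u v; nra.
have s4 : 4 <= s ^+ 2 by nra.
have s2p : 0 < s ^+ 2 by lra.
have -> : s ^+ 4 = s ^+ 2 * s ^+ 2 by ring.
move: (s ^+ 2) s4 s2p ab1 => q q4 q0 qab.
set r := (X in ln X).
have r1 : r - 1 <= 3 / q.
  have -> : r - 1 = (1 - 2 * q + 16 * ab) / (q * q) by rewrite /r; field; rewrite gt_eqF.
  rewrite ler_pdivrMr ?mulr_gt0// (_ : 3 / q * (q * q) = 3 * q); first lra.
  by field; rewrite gt_eqF.
have r2 : 1 - r <= 2 / q.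
  have -> : 1 - r = (2 * q - 1 - 16 * ab) / (q * q) by rewrite /r; field; rewrite gt_eqF.
  rewrite ler_pdivrMr ?mulr_gt0// (_ : 2 / q * (q * q) = 2 * q); first lra.
  by field; rewrite gt_eqF.
have r3 : 1 / 2 <= r by rewrite /r ler_pdivlMr ?mulr_gt0//; nra.
have r0 : 0 < r by lra.
have qi : (2 * q)^-1 = 1 / q / 2 by field; rewrite gt_eqF.
have qi0 : 0 < q^-1 by rewrite invr_gt0.
rewrite qi ler_norml; apply/andP; split.
  have := @le_ln1Dx R (r^-1 - 1); rewrite addrCA subrr addr0 lnV ?posrE// => h.
  have : - ln r <= 4 / q.
    apply: le_trans (h _) _; first by rewrite ltrDr invr_gt0.
    have -> : r^-1 - 1 = (1 - r) / r by field; rewrite gt_eqF.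
    by rewrite ler_pdivrMr//; nra.
  lra.
have := @le_ln1Dx R (r - 1); rewrite addrCA subrr addr0 => h.
have : ln r <= 3 / q by apply: le_trans (h _) _ => //; lra.
lra.
Qed.

Let p (a : int) : R := (1 + `|a|%N%:R) * Num.sqrt (1 + `|a|%N%:R).

(** A product of summable one-dimensional weights with exponent 3/2. Up to a constant it dominates
    |z|^-3, and sums of it over squares factor. *)
Definition wt z : R := (p z.1 * p z.2)^-1.

Let p_gt0 a : 0 < p a.
Proof. by rewrite mulr_gt0 ?sqrtr_gt0// addr_gt0. Qed.

Definition wt_cst : R := 6 * 6.

Lemma wt_ge0 z : 0 <= wt z.
Proof. by rewrite invr_ge0 mulr_ge0// ltW. Qed.

Lemma mu_wt z : `|mu z| * (1 + `|z.1|%N%:R + `|z.2|%N%:R) <= 16 * wt z.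
Proof.
have [s2|s2] := leP 2 (normsq z).
  have ab (c : int) : (c%:~R : R) ^+ 2 = (`|c|%N%:R) ^+ 2.
    by rewrite -[in RHS]natrX -[X in _ = X]/(((`|c| ^ 2)%N%:Z)%:~R) -rmorphXn; congr (_%:~R); lia.
  have := mu_far s2; rewrite /wt /p.
  have aa (c : int) : (`|c|%N%:R : R) <= (`|c|%N%:R) ^+ 2.
    by rewrite -natrX ler_nat; case: absz => // k; rewrite expnS leq_pmulr.
  have := aa z.1; have := aa z.2; move: s2; rewrite /normsq !ab.
  have a0 : (0 : R) <= `|z.1|%N%:R by []. have b0 : (0 : R) <= `|z.2|%N%:R by [].
  move: (mu z) (`|z.1|%N%:R : R) (`|z.2|%N%:R : R) a0 b0 => m a b a0 b0.
  set s := a ^+ 2 + b ^+ 2 => s2 bb aa' hm.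
  have ss : Num.sqrt s ^+ 2 = s by rewrite sqr_sqrtr//; lra.
  set t := Num.sqrt s in ss *.
  have t0 : 0 <= t by rewrite sqrtr_ge0.
  have t1 : 1 <= t by nra.
  have tt : t ^+ 2 = a ^+ 2 + b ^+ 2 by rewrite ss.
  have ta : a <= t by rewrite -(ler_pXn2r (n := 2)) ?nnegrE// tt lerDl sqr_ge0.
  have tb : b <= t by rewrite -(ler_pXn2r (n := 2)) ?nnegrE// tt lerDr sqr_ge0.
  have l1 : 1 + a + b <= 3 * t by lra.
  have qa : Num.sqrt (1 + a) ^+ 2 = 1 + a by rewrite sqr_sqrtr//; lra.
  have qb : Num.sqrt (1 + b) ^+ 2 = 1 + b by rewrite sqr_sqrtr//; lra.
  set x := Num.sqrt (1 + a) in qa *; set y := Num.sqrt (1 + b) in qb *.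
  have x0 : 0 < x by rewrite sqrtr_gt0; lra.
  have y0 : 0 < y by rewrite sqrtr_gt0; lra.
  have xy : x * y <= 2 * t.
    rewrite -(ler_pXn2r (n := 2)) ?nnegrE ?mulr_ge0 ?(ltW x0) ?(ltW y0)//.
    rewrite exprMn qa qb exprMn ss /s; nra.
  have -> : (1 + a) * x * ((1 + b) * y) = (x * y) ^+ 3 by rewrite -qa -qb; ring.
  have xy3 : (x * y) ^+ 3 <= 8 * t ^+ 3.
    have -> : 8 * t ^+ 3 = (2 * t) ^+ 3 by ring.
    by rewrite lerXn2r// nnegrE mulr_ge0// ltW.
  have xyp : 0 < (x * y) ^+ 3 by rewrite exprn_gt0// mulr_gt0.
  rewrite ler_pdivlMr//.
  have m0 : 0 <= `|m| by [].
  have s0 : 0 < s by lra.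
  have hm' : `|m| * (2 * s ^+ 2) <= 1.
    by rewrite -ler_pdivlMr ?div1r// mulr_gt0// exprn_gt0.
  apply: (@le_trans _ _ (`|m| * (3 * t) * (8 * t ^+ 3))).
    by apply: ler_pM => //; [rewrite mulr_ge0//; lra|exact: ltW|rewrite ler_wpM2l].
  have -> : `|m| * (3 * t) * (8 * t ^+ 3) = 12 * (`|m| * (2 * s ^+ 2)) by rewrite -ss; ring.
  lra.
case: z s2 => a b; rewrite normsqE -[2]/((2%:Z)%:~R) ltr_int /= => s2.
have ha : (`|a| <= 1)%N by nia.
have hb : (`|b| <= 1)%N by nia.
have hab : (`|a| + `|b| <= 1)%N by nia.
have fle (c d : int) : c ^+ 2 + d ^+ 2 <= 4 -> logf (c, d) <= 1.
  move=> h; rewrite /logf ler_pdivrMr// mul1r -[leRHS]expRK ler_ln ?posrE ?expR_gt0//; last by rewrite lt_max ltr01 orbT.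
  rewrite ge_max; apply/andP; split; last by apply: le_trans (expR_ge1Dx _); lra.
  apply: (@le_trans _ _ 4); first by rewrite normsqE -[4]/((4%:Z)%:~R) ler_int.
  have e1 : 2 <= expR 1 :> R by apply: le_trans (expR_ge1Dx _); lra.
  by rewrite (_ : 2 = 1 + 1)// expRD; nra.
have m1 : `|mu (a, b)| <= 1.
  have E (c d : int) : (a, b) + (c, d) = (a + c, b + d) by [].
  rewrite /mu lapE !E !addr0.
  have := logf_ge0 (a, b); have := fle a b.
  have := logf_ge0 (a + 1, b); have := fle (a + 1) b; have := logf_ge0 (a - 1, b); have := fle (a - 1) b.
  have := logf_ge0 (a, b + 1); have := fle a (b + 1); have := logf_ge0 (a, b - 1); have := fle a (b - 1).
  do 5![move=> /(_ ltac:(nia)) ? ?].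
  by rewrite ler_norml; apply/andP; split; lra.
have l2 : 1 + `|a|%N%:R + `|b|%N%:R <= 2 :> R.
  by have := hab; rewrite -(ler_nat R) natrD; lra.
have pa (c : int) : (`|c| <= 1)%N -> p c <= 2 * Num.sqrt 2.
  move=> hc; rewrite /p.
  have h2 : 1 + `|c|%N%:R <= 2 :> R by have := hc; rewrite -(ler_nat R); lra.
  apply: ler_pM => //; last by rewrite ler_wsqrtr.
apply: (@le_trans _ _ 2).
  by rewrite -[leRHS]mul1r; apply: ler_pM => //; rewrite !addr_ge0.
rewrite ler_pdivlMr ?mulr_gt0 //.
have := pa a ha; have := pa b hb; have := p_gt0 a; have := p_gt0 b.
have : Num.sqrt 2 ^+ 2 = 2 :> R by rewrite sqr_sqrtr.
move: (Num.sqrt 2 : R) (p a) (p b) => q x y qq y0 x0 hy hx.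
apply: (@le_trans _ _ (2 * ((2 * q) * (2 * q)))).
  by rewrite ler_wpM2l//; apply: ler_pM => //; exact: ltW.
nra.
Qed.

Lemma sum_sub_le (T : eqType) (s t : seq T) (F : T -> R) : (forall y : T, 0 <= F y) -> uniq s -> {subset s <= t} ->
  \sum_(y <- s) F y <= \sum_(y <- t) F y.
Proof.
move=> F0; elim: s t => [|x s ih] t /=; first by rewrite big_nil sumr_ge0.
move=> /andP[xs us] st; have xt : x \in t by apply: st; rewrite mem_head.
rewrite (perm_big _ (perm_to_rem xt)) !big_cons lerD2l; apply: ih => // y ys.
have : y \in x :: rem x t by rewrite -(perm_mem (perm_to_rem xt)) st// inE ys orbT.
by rewrite inE => /orP[/eqP yx|//]; rewrite -yx ys in xs.
Qed.

Definition zrange (n : nat) : seq int := [seq k%:Z - n%:Z | k <- iota 0 (2 * n).+1].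

Lemma mem_zrange n (a : int) : (a \in zrange n) = (`|a| <= n)%N.
Proof.
apply/mapP/idP => [[k]|h]; first by rewrite mem_iota => hk ->; lia.
by exists (absz (a + n%:Z)); rewrite ?mem_iota; lia.
Qed.

Definition zbox n : seq (int * int) := [seq (a, b) | a <- zrange n, b <- zrange n].

Lemma mem_zbox n z : (z \in zbox n) = (`|z.1| <= n)%N && (`|z.2| <= n)%N.
Proof.
apply/allpairsP/idP => [[[a b] /= [ha hb ->]]|/andP[h1 h2]]; first by rewrite -!mem_zrange ha.
by exists z; rewrite !mem_zrange -surjective_pairing.
Qed.

Lemma zbox_uniq n : uniq (zbox n).
Proof.
have u : uniq (zrange n) by rewrite map_inj_uniq ?iota_uniq// => i j; lia.
by apply: allpairs_uniq => // -[a b] [c d] _ _ [-> ->].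
Qed.

Let psum n : \sum_(k <- iota 0 n) (p k%:Z)^-1 <= 3.
Proof.
suff h : \sum_(k <- iota 0 n.+1) (p k%:Z)^-1 <= 3 - 2 / Num.sqrt n.+1%:R.
  apply: le_trans (le_trans _ h) _; last by rewrite gerBl divr_ge0// sqrtr_ge0.
  rewrite -addn1 iotaD big_cat/= lerDl big_seq1 invr_ge0 ltW//; exact: p_gt0.
elim: n => [|n ih]; first by rewrite big_seq1 /p /= addr0 sqrtr1 mulr1 invr1; lra.
rewrite -addn1 iotaD big_cat/= big_seq1 add0n.
suff : (p n.+1%:Z)^-1 <= 2 / Num.sqrt n.+1%:R - 2 / Num.sqrt n.+2%:R by rewrite addn1; lra.
rewrite /p absz_nat nat1r.
have x2 : Num.sqrt n.+1%:R ^+ 2 = n.+1%:R :> R by rewrite sqr_sqrtr.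
have y2 : Num.sqrt n.+2%:R ^+ 2 = n.+2%:R :> R by rewrite sqr_sqrtr.
rewrite -{1}y2.
have x0 : 0 < Num.sqrt n.+1%:R :> R by rewrite sqrtr_gt0.
have y0 : 0 < Num.sqrt n.+2%:R :> R by rewrite sqrtr_gt0.
have yx : Num.sqrt n.+2%:R ^+ 2 = Num.sqrt n.+1%:R ^+ 2 + 1 :> R by rewrite x2 y2 -[in LHS]natr1.
move: (Num.sqrt n.+1%:R : R) (Num.sqrt n.+2%:R : R) x0 y0 yx => x y x0 y0 yx.
have xy : x < y by nra.
have -> : 2 / x - 2 / y = 2 * (y - x) / (x * y) by field; rewrite !gt_eqF.
rewrite ler_pdivlMr ?mulr_gt0// ler_pdivrMl ?mulr_gt0 ?exprn_gt0//.
have h : 1 <= (y - x) * (2 * y) by nra.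
have -> : y ^+ 2 * y * (2 * (y - x)) = y ^+ 2 * ((y - x) * (2 * y)) by ring.
apply: (@le_trans _ _ (y ^+ 2)); first by nra.
by rewrite ler_peMr// sqr_ge0.
Qed.

Let psumz n : \sum_(a <- zrange n) (p a)^-1 <= 6.
Proof.
rewrite /zrange big_map.
have -> : (2 * n).+1 = (n + n.+1)%N by lia.
rewrite iotaD big_cat/= add0n.
have e1 : \sum_(k <- iota n n.+1) (p (k%:Z - n%:Z))^-1 = \sum_(k <- iota 0 n.+1) (p k%:Z)^-1.
  rewrite -{1}[n]addn0 iotaDl big_map; apply: eq_bigr => k _; congr (p _)^-1; lia.
have e2 : \sum_(k <- iota 0 n) (p (k%:Z - n%:Z))^-1 <= \sum_(k <- iota 0 n.+1) (p k%:Z)^-1.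
  have -> : \sum_(k <- iota 0 n) (p (k%:Z - n%:Z))^-1 = \sum_(j <- [seq (n - k)%N | k <- iota 0 n]) (p j%:Z)^-1.
    rewrite big_map big_seq [RHS]big_seq; apply: eq_bigr => k; rewrite mem_iota => hk.
    by rewrite /p (_ : absz (k%:Z - n%:Z) = absz (n - k)%N%:Z)//; lia.
  apply: sum_sub_le => [j||j].
  - by rewrite invr_ge0 ltW// p_gt0.
  - rewrite map_inj_in_uniq ?iota_uniq// => i j; rewrite !mem_iota; lia.
  - by move/mapP => [k]; rewrite !mem_iota => hk ->; lia.
have := psum n.+1; move=> h3; have -> : 6 = 3 + 3 :> R by ring.
apply: lerD; first exact: le_trans e2 h3.
by apply: le_trans h3; rewrite -e1.
Qed.

Lemma wt_sum s : uniq s -> \sum_(z <- s) wt z <= wt_cst.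
Proof.
move=> us; pose n := (\sum_(z <- s) (`|z.1| + `|z.2|))%N.
have sn : {subset s <= zbox n}.
  move=> z zs; rewrite mem_zbox /n (big_rem z)//=; lia.
apply: le_trans (sum_sub_le wt_ge0 us sn) _.
rewrite /zbox big_allpairs_dep/=.
have -> : \sum_(a <- zrange n) \sum_(b <- zrange n) wt (a, b) = (\sum_(a <- zrange n) (p a)^-1) * (\sum_(b <- zrange n) (p b)^-1).
  rewrite mulr_suml; apply: eq_bigr => a _; rewrite mulr_sumr; apply: eq_bigr => b _.
  by rewrite /wt invfM.
rewrite /wt_cst.
by apply: ler_pM; try exact: psumz; apply: sumr_ge0 => a _; rewrite invr_ge0 ltW// p_gt0.
Qed.

Lemma mu_moment s : uniq s -> \sum_(z <- s) `|mu z| * (`|z.1|%N%:R + `|z.2|%N%:R) <= 16 * wt_cst.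
Proof.
move=> us; apply: (@le_trans _ _ (16 * \sum_(z <- s) wt z)); last by rewrite ler_wpM2l// wt_sum.
rewrite mulr_sumr; apply: ler_sum => z _; apply: le_trans (mu_wt z).
by rewrite ler_wpM2l// -addrA lerDr.
Qed.

Lemma mu_tail r s : uniq s -> (forall z, z \in s -> z \notin zbox r) ->
  \sum_(z <- s) `|mu z| <= 16 * wt_cst / r.+1%:R.
Proof.
move=> us hs; apply: (@le_trans _ _ (\sum_(z <- s) (16 / r.+1%:R) * wt z)).
  rewrite big_seq [leRHS]big_seq; apply: ler_sum => z zs.
  rewrite mulrAC ler_pdivlMr//; apply: le_trans (mu_wt z); rewrite ler_wpM2l//.
  rewrite -[1]/(1%:R) -!natrD ler_nat; move: (hs z zs); rewrite mem_zbox; lia.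
by rewrite -mulr_sumr mulrAC ler_wpM2r ?invr_ge0// ler_wpM2l// wt_sum.
Qed.

Let K n := \sum_(z <- zbox n) mu z.
Let T n := \sum_(z <- zbox n) `|mu z|.

Let zbox_sub m n : (m <= n)%N -> {subset zbox m <= zbox n}.
Proof. by move=> mn z; rewrite !mem_zbox => /andP[h1 h2]; rewrite (leq_trans h1)// (leq_trans h2). Qed.

Let T_le n : T n <= 16 * wt_cst.
Proof.
apply: (@le_trans _ _ (16 * \sum_(z <- zbox n) wt z)); last by rewrite ler_wpM2l// wt_sum// zbox_uniq.
rewrite mulr_sumr; apply: ler_sum => z _; apply: le_trans (mu_wt z).
by rewrite ler_peMr// -addrA lerDl addr_ge0.
Qed.

Let K_cvg : cvg (K n @[n --> \oo]).
Proof.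
have cT : cvg (T n @[n --> \oo]).
  apply: nondecreasing_is_cvgn => [m n mn|]; last by exists (16 * wt_cst) => _ [n _ <-]; exact: T_le.
  by apply: sum_sub_le => //; [exact: zbox_uniq|exact: zbox_sub].
have cKT : cvg ((K n + T n) @[n --> \oo]).
  apply: nondecreasing_is_cvgn => [m n mn|].
    rewrite /K /T -!big_split/=; apply: sum_sub_le; [|exact: zbox_uniq|exact: zbox_sub].
    by move=> z; have := ler_norm (- mu z); rewrite normrN; lra.
  exists (16 * wt_cst + 16 * wt_cst) => _ [n _ <-]; apply: lerD; last exact: T_le.
  apply: le_trans (T_le n); apply: ler_sum => z _; exact: ler_norm.
have -> : K = (fun n => (K n + T n) - T n) by apply/funext => n; rewrite addrK.
exact: is_cvgB.
Qed.

Definition kappa : R := limn K.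

Lemma mu_sum_kappa r s : uniq s -> {subset zbox r <= s} ->
  `|\sum_(z <- s) mu z - kappa| <= 16 * wt_cst / r.+1%:R.
Proof.
move=> us rs; pose n0 := (\sum_(z <- s) (`|z.1| + `|z.2|))%N.
have c : `|\sum_(z <- s) mu z - K n| @[n --> \oo] --> `|\sum_(z <- s) mu z - kappa|.
  apply: cvg_norm; apply: cvgB; [exact: cvg_cst|exact: K_cvg].
rewrite -(cvg_lim _ c)//; apply: limr_le; first by apply/cvg_ex; eexists; exact: c.
near=> n.
have sn : {subset s <= zbox n}.
  move=> z zs; have : (n0 <= n)%N by near: n; exact: nbhs_infty_ge.
  rewrite mem_zbox /n0 (big_rem z)//=; lia.
have -> : K n = \sum_(z <- s) mu z + \sum_(z <- [seq z <- zbox n | z \notin s]) mu z.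
  transitivity (\sum_(z <- zbox n | z \in s) mu z + \sum_(z <- zbox n | z \notin s) mu z).
    by rewrite /K (bigID (fun z => z \in s)).
  congr (_ + _); last by rewrite big_filter.
  rewrite -big_filter; apply: perm_big; apply: uniq_perm => //; first by rewrite filter_uniq// zbox_uniq.
  by move=> z; rewrite mem_filter; case: (boolP (z \in s)) => // /sn ->.
rewrite opprD addrA subrr add0r normrN; apply: le_trans (ler_norm_sum _ _ _) _.
apply: mu_tail; first by rewrite filter_uniq// zbox_uniq.
by move=> z; rewrite mem_filter => /andP[zs _]; apply: contra zs; exact: rs.
Unshelve. all: by end_near. Qed.

Definition bulk (N : nat) z : bool :=
  [&& N%:Z <= 8 * z.1, N%:Z <= 8 * (N%:Z - 1 - z.1), N%:Z <= 8 * z.2 & N%:Z <= 8 * (N%:Z - 1 - z.2)].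

Definition green_cst : R := 16 * wt_cst * 32 + 4 * (16 * wt_cst) + 7.

(** [H] adds to log |x - y| the potential of its own charge, so it is harmonic in x with boundary
    values ln N + O(1). In that potential, G x z is replaced by G x y, at the cost of the gradient
    bound times the first moment of [mu]; then the charge inside the box is replaced by [kappa], an
    error of order 1/N times G <= 4 N. *)
Lemma green_log N G x y : is_green N G -> interior_pt N x -> bulk N y -> interior_pt N y ->
  `|kappa * G x y + logf (x - y) - ln N%:R| <= green_cst.
Proof.
move=> gG ix /and4P[b1 b2 b3 b4] iy.
have N0 : (0 < N)%N by move: ix; rewrite /interior_pt; lia.
have Nr : (0 : R) < N%:R by rewrite ltr0n.
pose F z := mu (z - y).
pose H x := logf (x - y) + potential N G F x.
have lapH z : interior_pt N z -> lap H z = 0.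
  move=> iz; have e1 := lap_potential gG F iz.
  rewrite lapE /H; rewrite lapE in e1.
  have e2 : lap logf (z - y) = - F z by rewrite /F /mu opprK.
  by rewrite lapE -![z - y + _]addrAC in e2; lra.
have bdH z : boundary_pt N z -> ln N%:R - 7 <= H z <= ln N%:R + 1.
  move=> bz; have nz : ~~ interior_pt N z by case/andP: bz.
  rewrite /H (potential_out gG)// addr0 /logf.
  have s1 : (N%:R / 8) ^+ 2 <= normsq (z - y).
    have hi : N%:Z ^+ 2 <= 64 * ((z - y).1 ^+ 2 + (z - y).2 ^+ 2); last first.
      have : (N%:Z ^+ 2)%:~R <= (64 * ((z - y).1 ^+ 2 + (z - y).2 ^+ 2))%:~R :> R by rewrite ler_int.
      rewrite intrM -normsqE rmorphXn /= expr_div_n; move: (normsq _) => q; lra.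
    move: bz b1 b2 b3 b4; rewrite /boundary_pt /interior_pt; case: (z) (y) => a b [c d] /= h h1 h2 h3 h4.
    have : (8 * `|a - c| >= N)%N || (8 * `|b - d| >= N)%N by lia.
    by move=> /orP[] hh; nia.
  have s2 : normsq (z - y) <= 2 * N%:R ^+ 2.
    have hi : (z - y).1 ^+ 2 + (z - y).2 ^+ 2 <= 2 * N%:Z ^+ 2; last first.
      have : ((z - y).1 ^+ 2 + (z - y).2 ^+ 2)%:~R <= (2 * N%:Z ^+ 2)%:~R :> R by rewrite ler_int.
      by rewrite -normsqE rmorphM rmorphXn.
    move: bz b1 b2 b3 b4; rewrite /boundary_pt /interior_pt; case: (z) (y) => a b [c d] /= h h1 h2 h3 h4.
    have : (`|a - c| <= N)%N && (`|b - d| <= N)%N by lia.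
    by move=> /andP[] hh; nia.
  have lnN2 : ln (N%:R ^+ 2) = 2 * ln N%:R :> R by rewrite lnXn// mulr_natl.
  have m0 : 0 < Num.max (normsq (z - y)) 1 by rewrite lt_max ltr01 orbT.
  apply/andP; split.
    rewrite ler_pdivlMr//.
    have : ln ((N%:R / 8) ^+ 2) <= ln (Num.max (normsq (z - y)) 1).
      by rewrite ler_ln ?posrE ?exprn_gt0 ?divr_gt0// le_max s1.
    rewrite lnXn ?divr_gt0// ln_div ?posrE// -[_ *+ 2]mulr_natl.
    have := @le_ln1Dx R 7 ltac:(lra); rewrite (_ : 1 + 7 = 8)//.
    lra.
  rewrite ler_pdivrMr//.
  have : ln (Num.max (normsq (z - y)) 1) <= ln (2 * N%:R ^+ 2).
    rewrite ler_ln ?posrE ?mulr_gt0 ?exprn_gt0// ge_max s2/=.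
    by rewrite -natrX -natrM ler1n muln_gt0 expn_gt0 N0.
  rewrite lnM ?posrE ?exprn_gt0// lnN2.
  have := @le_ln1Dx R 1 ltac:(lra); rewrite (_ : 1 + 1 = 2)//.
  lra.
have /andP[h1 h2] := harmonic_bound lapH bdH ix.
pose s := [seq site_point i - y | i <- index_enum (site N)].
have us : uniq s.
  by rewrite map_inj_uniq ?index_enum_uniq// => i j /addIr; exact: site_point_inj.
pose r := (N %/ 8)%N.
have rs : {subset zbox r <= s}.
  move=> z; rewrite mem_zbox /r => hz.
  have : interior_pt N (z + y) || boundary_pt N (z + y).
    by move: hz b1 b2 b3 b4; rewrite /boundary_pt /interior_pt; case: (z) (y) => a b [c d] /= hz h3 h4 h5 h6; lia.
  move=> hh; have [i pi] : exists i : site N, site_point i = z + y.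
    by case/orP: hh => [/site_interior|/site_boundary].
  by apply/mapP; exists i; rewrite ?mem_index_enum// pi addrK.
have k1 := mu_sum_kappa us rs; rewrite /s big_map in k1.
have G0 := green_ge0 gG x y; have GN := green_le gG x y.
have E1 : `|(\sum_(i : site N) mu (site_point i - y) - kappa) * G x y| <= 16 * wt_cst * 32.
  rewrite normrM (ger0_norm G0); apply: (@le_trans _ _ (16 * wt_cst / r.+1%:R * (4 * N%:R))).
    by apply: ler_pM.
  have hN : N%:R <= 8 * r.+1%:R :> R by rewrite -natrM ler_nat /r; clear; lia.
  rewrite mulrAC ler_pdivrMr// -[leRHS]mulrA ler_wpM2l//; last by lra.
  by rewrite mulr_ge0// /wt_cst mulr_ge0.
have E2 : `|potential N G F x - (\sum_(i : site N) mu (site_point i - y)) * G x y| <= 4 * (16 * wt_cst).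
  rewrite /potential mulr_suml -sumrB; apply: le_trans (ler_norm_sum _ _ _) _.
  have := mu_moment us; rewrite /s big_map => hm.
  apply: le_trans _ (ler_wpM2l (ler0n R 4) hm).
  rewrite mulr_sumr; apply: ler_sum => i _; rewrite /F -mulrBr normrM mulrCA ler_wpM2l//.
  apply: le_trans (green_lip gG x y (site_point i)) _.
  by rewrite ler_wpM2l// rmorphD /= -!abszE.
move: E1 E2; rewrite /H in h1 h2; rewrite !ler_norml => /andP[e1 e2] /andP[e3 e4].
rewrite /green_cst; apply/andP; split; lra.
Qed.

(** Otherwise [kappa * G y y] would be nonpositive at the centre y of every box, while [green_log]
    bounds it below by ln N minus a constant. *)
Lemma kappa_gt0 (G : nat -> int * int -> int * int -> R) :
  (forall n, is_green n.+1 (G n)) -> 0 < kappa.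
Proof.
move=> gG; rewrite ltNge; apply/negP => k0.
pose n := (4 + Num.bound (expR green_cst))%N.
have n4 : (4 <= n)%N by exact: leq_addr.
have nb : (Num.bound (expR green_cst) <= n)%N by exact: leq_addl.
clearbody n; have [h ey] : exists h, (h + h <= n <= (h + h).+1)%N.
  by exists n./2; have := odd_double_half n; case: odd; lia.
pose y := (h%:Z, h%:Z).
have iy : interior_pt n.+1 y by rewrite /interior_pt /y /=; lia.
have by_ : bulk n.+1 y by rewrite /bulk /y /=; apply/and4P; split; lia.
have := green_log (gG n) iy by_ iy; rewrite subrr ler_norml => /andP[h1 _].
have l0 : logf 0 = 0 by rewrite /logf /normsq /= expr0n addr0 max_r// ln1 mul0r.
have := mulr_le0_ge0 k0 (green_ge0 (gG n) y y); rewrite l0 in h1.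
have : green_cst < ln n.+1%:R :> R.
  rewrite -[ltLHS]expRK ltr_ln ?posrE ?expR_gt0//.
  apply: (@lt_le_trans _ _ (Num.bound (expR green_cst))%:R); first by apply: archi_boundP; exact: expR_ge0.
  by rewrite ler_nat ltnW// ltnS.
lra.
Qed.

Lemma green_dist N G x y : is_green N G -> interior_pt N x -> interior_pt N y -> bulk N x -> bulk N y ->
  `|kappa * (G x x + G y y - 2 * G x y) - 2 * logf (x - y)| <= 4 * green_cst.
Proof.
move=> gG ix iy bx by_.
have l0 : logf 0 = 0 by rewrite /logf /normsq /= expr0n addr0 max_r// ln1 mul0r.
have := green_log gG ix bx ix; have := green_log gG iy by_ iy; have := green_log gG ix by_ iy.
rewrite !subrr l0 !ler_norml => /andP[? ?] /andP[? ?] /andP[? ?]; apply/andP; split; nra.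
Qed.

End LogKernel.

Section Fubini.
Context {R : realType} d1 (T1 : measurableType d1) (P1 : probability T1 R).
Context d2 (T2 : measurableType d2) (P2 : probability T2 R).

Lemma Ex_fubini (f : T1 * T2 -> R) : L1 (P1 \x P2)%E f ->
  (forall x, L1 P2 (fun y => f (x, y))) ->
  L1 P1 (fun x => Ex P2 (fun y => f (x, y))) /\
  Ex (P1 \x P2)%E f = Ex P1 (fun x => Ex P2 (fun y => f (x, y))).
Proof.
move=> Lf Lfx.
have e x : fubini_F P2 (EFin \o f) x = (Ex P2 (fun y => f (x, y)))%:E by rewrite /fubini_F -ExE.
have Lh : L1 P1 (fun x => Ex P2 (fun y => f (x, y))).
  have := integrable_fubini_F Lf; rewrite /L1; congr (_.-integrable _ _).
  by apply/funext => x; rewrite e.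
split => //; apply: EFin_inj; rewrite -(ExE Lf) -(ExE Lh) -integral12_prod_meas1//.
by apply: eq_integral => x _; rewrite e.
Qed.

End Fubini.

(** * Gaussian fields on binary trees *)

Section Trees.
Context {R : realType}.
Local Notation gm := (@sgauss R).

Fixpoint leaf (k : nat) : finType := if k is k'.+1 then (bool * leaf k')%type else unit.

Fixpoint leaf0 (k : nat) : leaf k := if k is k'.+1 return leaf k then (true, leaf0 k') else tt.

(** Levels are counted from the leaves, so two leaves differ by independent increments on the levels
    1 up to this height. *)
Fixpoint branch_height (k : nat) : leaf k -> leaf k -> nat :=
  if k is k'.+1 return leaf k -> leaf k -> nat then
    fun x y => if x.1 == y.1 then branch_height x.2 y.2 else k'.+1
  else fun _ _ => 0%N.

Variable sigma : nat -> R.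

(** The probability that the maximum exceeds x: each child of the root has its own increment of
    deviation [sigma k.+1], and the two subtrees are independent. *)
Fixpoint tree_tail (k : nat) (x : R) : R :=
  if k is k'.+1 then 1 - (1 - Ex gm (fun u => tree_tail k' (x - sigma k'.+1 * u))) ^+ 2
  else (x < 0)%R%:R.

Definition gauss_abs : R := Ex gm (fun u => `|u|).

(** Bounds the mean positive part of [a k] minus the maximum. If the second subtree exceeds its
    reference level, only increments and the change of [a] remain; otherwise the deficit of the
    first subtree is inherited, and independence makes this a product. *)
Fixpoint tree_deficit (a : nat -> R) (k : nat) : R :=
  if k is k'.+1 then (1 - tree_tail k' (a k')) * tree_deficit a k' + `|a k'.+1 - a k'| +
    2 * (`|sigma k'.+1| * gauss_abs)
  else `|a 0%N|.

Lemma lt_fmax (I : finType) (i0 : I) (c : R) (x : I -> R) : (c < fmax i0 x) = [exists i, c < x i].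
Proof.
apply/idP/existsP => [h|[i h]]; last exact: lt_le_trans h (fmax_ge _ _ _).
apply: contrapT => nh; move: h; rewrite ltNge => /negP; apply; apply: fmax_le => i.
by rewrite leNgt; apply/negP => h; apply: nh; exists i.
Qed.

Lemma gfield_zero (I : finType) d (T : measurableType d) (P : probability T R) :
  gfield P (fun (_ : I) (_ : T) => 0) (fun=> 0).
Proof.
move=> b; have e0 : \sum_i b i * 0 = 0 :> R by apply: big1 => i _; rewrite mulr0.
rewrite e0; split => //.
move=> f mf f0.
under [RHS]eq_integral do rewrite sqrtr0 mul0r.
transitivity (f 0%R * gm setT)%E; last by symmetry; exact: (integral_cst gm measurableT).
rewrite (integral_cst P measurableT); congr (_ * _)%E.
by transitivity (1%E : \bar R); [|symmetry]; exact: probability_setT.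
Qed.

Lemma gfield_const (I : finType) (s : R) : gfield gm (fun (_ : I) (u : measurableTypeR R) => s * u)
  (fun b : I -> R => (s * \sum_i b i) ^+ 2).
Proof.
move=> b.
have e : (fun u : measurableTypeR R => \sum_i b i * (s * u)) =1 (fun u => (s * \sum_i b i) * u).
  by move=> u; rewrite -mulr_suml mulrCA mulrA.
apply: (eq_cgauss (fun u => esym (e u))); split; [|exact: sqr_ge0|].
  exact: measurable_funM.
move=> f mf f0; rewrite sqrtr_sqr; set c := s * _.
case: (leP 0 c) => c0; first by rewrite ger0_norm.
rewrite ltr0_norm//.
have mg : measurable_fun setT (fun x : R => f (c * x)%R).
  by apply: (measurableT_comp mf); exact: measurable_funM.
have := ge0_sgauss_opp mg (fun x => f0 _) => /= <-.
by apply: eq_integral => x _; rewrite mulrN mulNr.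
Qed.

Lemma sqr_diff_L1 (I : finType) d (T : measurableType d) (P : probability T R) (X : I -> T -> R) V i j :
  gfield P X V -> L1 P (fun t => (X i t - X j t) ^+ 2).
Proof.
move=> gX; have := cgauss_normX_L1 (gfield_cgaussB gX i j) 2; apply: L1_eq => u.
by rewrite real_normK ?num_real.
Qed.

Lemma ind_L1 d (T : measurableType d) (P : probability T R) (X : T -> R) c :
  measurable_fun setT X -> L1 P (fun t => (c < X t)%R%:R).
Proof.
move=> mX; apply: (@L1_bounded _ _ _ P _ 1).
  have -> : (fun t => (c < X t)%R%:R) = (fun t => \1_(X @^-1` `]c, +oo[%classic) t : R).
    by apply/funext => t; rewrite indicE; congr (nat_of_bool _)%:R; apply/idP/idP;
       rewrite inE /= in_itv/= andbT.
  by apply: measurable_indic; rewrite -[X in measurable X]setTI; exact: mX.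
by move=> t; rewrite ger0_norm// lern1 leq_b1.
Qed.

Section one_subtree.
Context d (T : measurableType d) (P : probability T R) (s : R) (M : T -> R) (wM : R -> R).
Hypotheses (LM : L1 P M) (tM : forall c, Ex P (fun t => (c < M t)%R%:R) = wM c).

Let Q := (gm \x P)%E.

Let mY : measurable_fun setT (fun z : measurableTypeR R * T => s * z.1 + M z.2).
Proof.
apply: measurable_funD; first by apply: measurable_funM => //; exact: measurable_fst.
by apply: (measurableT_comp (L1_measurable LM)); exact: measurable_snd.
Qed.

Lemma subtree_tail c : Ex Q (fun z => (c < s * z.1 + M z.2)%R%:R) = Ex gm (fun u => wM (c - s * u)).
Proof.
have e (u : R) t : (c < s * u + M t) = (c - s * u < M t) by rewrite ltrBlDl.
have H u : L1 P (fun t => (c < s * u + M t)%R%:R).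
  apply: (@L1_eq _ _ _ P (fun t => (c - s * u < M t)%R%:R)) => [t|]; first by rewrite /= e.
  by apply: ind_L1; exact: (L1_measurable LM).
have [_ ->] := Ex_fubini (ind_L1 Q c mY) H.
by apply: eq_Ex => u; rewrite -tM; apply: eq_Ex => t; rewrite e.
Qed.

End one_subtree.

Lemma deficit_step (a a' F M1 M2 s1 s2 U : R) : s1 + M1 <= F -> s2 + M2 <= F -> 0 <= U -> a - M1 <= U ->
  Num.max (a' - F) 0 <= U * (1 - (a < M2)%R%:R) + `|a' - a| + (`|s1| + `|s2|).
Proof.
move=> m1 m2 U0 U1.
have n1 := ler_norm (- s1); have n2 := ler_norm (- s2); have n0 := ler_norm (a' - a).
have p1 : 0 <= `|s1| by []. have p2 : 0 <= `|s2| by []. have p0 : 0 <= `|a' - a| by [].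
rewrite !normrN in n1 n2; move: p1 p2 p0 n0 n1 n2.
move: (`|s1|) (`|s2|) (`|a' - a|) => p1 p2 p0 h1 h2 h0 n0 n1 n2.
by rewrite ge_max; case: (ltP a M2) => h; rewrite /= ?subrr ?subr0 ?mulr0 ?mulr1; apply/andP; split; lra.
Qed.

(** The space for height k + 1 is the square of the product of a Gaussian line with the space for
    height k. Independence is thus built in, and the recursions for tail and deficit follow from
    Fubini. *)
Lemma tree_exists (a : nat -> R) (k : nat) :
  exists d (T : measurableType d) (P : probability T R) (B : leaf k -> T -> R) V,
  [/\ gfield P B V, forall x, Ex P (fun t => B x t ^+ 2) = \sum_(i < k) sigma i.+1 ^+ 2,
   forall x y, Ex P (fun t => (B x t - B y t) ^+ 2) = 2 * \sum_(i < branch_height x y) sigma i.+1 ^+ 2,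
   forall c, Ex P (fun t => (c < fmax (leaf0 k) (fun x => B x t))%R%:R) = tree_tail k c &
   Ex P (fun t => Num.max (a k - fmax (leaf0 k) (fun x => B x t)) 0) <= tree_deficit a k].
Proof.
elim: k => [|k [d [T [P [B [V [gB sB vB tB dB]]]]]]].
  have f0 : fmax (leaf0 0) (fun _ : leaf 0 => 0 : R) = 0.
    by apply/eqP; rewrite eq_le (fmax_ge (leaf0 0) (fun=> 0) tt) andbT; apply: fmax_le.
  exists _, (measurableTypeR R), gm, (fun _ _ => 0), (fun=> 0); split.
  - exact: gfield_zero.
  - move=> x; rewrite big_ord0 -[RHS](Ex_cst gm).
    by apply: eq_Ex => u; rewrite expr0n.
  - move=> x y /=; rewrite big_ord0 mulr0.
    by under [X in Ex _ X]funext do rewrite subrr expr0n/=; exact: Ex_cst.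
  - by move=> c; under [X in Ex _ X]funext do rewrite f0; exact: Ex_cst.
  - under [X in Ex _ X]funext do rewrite f0 subr0.
    by rewrite Ex_cst /= ge_max normr_ge0 ler_norm.
pose s := sigma k.+1.
pose M t := fmax (leaf0 k) (fun x => B x t).
have LM : L1 P M by apply: L1_fmax; exact: gfield_L1 gB.
pose Q := (gm \x P)%E.
pose Y (x : leaf k) (z : measurableTypeR R * T) := s * z.1 + B x z.2.
have gY : gfield Q Y _ := gfield_add (@gfield_const (leaf k) s) gB.
pose QQ := (Q \x Q)%E.
have gZ := gfield_map (gfield_union gY gY) (fun x : leaf k.+1 => if x.1 then inl x.2 else inr x.2).
set Z := (X in gfield _ X _) in gZ.
have ZE b x z : Z (b, x) z = if b then Y x z.1 else Y x z.2 by rewrite /Z; case: b.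
have LYm : L1 Q (fun z => M z.2) by have [] := Ex_snd gm LM.
have LU : L1 gm (fun u => `|u|) by apply: L1_norm; exact: sgauss_id_L1.
have LQu : L1 Q (fun z => s * z.1).
  by have [] := Ex_fst P (L1Z s sgauss_id_L1).
have LY : L1 Q (fun z => s * z.1 + M z.2) by exact: L1D.
have mY := L1_measurable LY.
have lt_max c z : (c < fmax (leaf0 k.+1) (fun x => Z x z)) =
   (c < s * z.1.1 + M z.1.2) || (c < s * z.2.1 + M z.2.2).
  rewrite -!ltrBlDl /M !lt_fmax; apply/existsP/orP => [[[b x]]|[/existsP[x h]|/existsP[x h]]].
  - by rewrite ZE; case: b => h; [left|right]; apply/existsP; exists x; rewrite ltrBlDl.
  - by exists (true, x); rewrite ZE /Y -ltrBlDl.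
  - by exists (false, x); rewrite ZE /Y -ltrBlDl.
have E1 x' : L1 Q (fun z => Y x' z ^+ 2) /\ Ex Q (fun z => Y x' z ^+ 2) = \sum_(i < k.+1) sigma i.+1 ^+ 2.
  have LB2 : L1 P (fun t => B x' t ^+ 2).
    have := cgauss_normX_L1 (gfield_cgauss gB x') 2; apply: L1_eq => u; by rewrite real_normK ?num_real.
  have [La Ea] := Ex_fst P (L1Z (s ^+ 2) (@sgauss_X_L1 R 2)).
  have [Lb Eb] := Ex_prod (L1Z (2 * s) (@sgauss_id_L1 R)) (gfield_L1 gB x').
  have [Lc Ec] := Ex_snd gm LB2.
  have e z : Y x' z ^+ 2 = s ^+ 2 * z.1 ^+ 2 + (2 * s * z.1) * B x' z.2 + B x' z.2 ^+ 2 by rewrite /Y; ring.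
  split; first by apply: L1_eq (L1D (L1D La Lb) Lc) => z; rewrite e.
  under [X in Ex _ X]funext do rewrite e.
  rewrite (ExD (L1D La Lb) Lc) (ExD La Lb) Ea Eb Ec sB (gfield_mean gB) mulr0 addr0.
  by rewrite (ExZ _ (@sgauss_X_L1 R 2)) sgauss_var mulr1 big_ord_recr/= addrC.
do 2 eexists; exists QQ, Z; eexists; split; first exact: gZ.
- move=> [b x]; under [X in Ex _ X]funext do rewrite ZE.
  have [h1 <-] := E1 x; case: b.
    by have [_ ->] := Ex_fst Q h1.
  by have [_ ->] := Ex_snd Q h1.
- move=> [b x] [b' y] /=.
  have vY x' y' z : Y x' z - Y y' z = B x' z.2 - B y' z.2 by rewrite /Y; ring.
  have EY x' y' : L1 Q (fun z => (Y x' z - Y y' z) ^+ 2) /\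
      Ex Q (fun z => (Y x' z - Y y' z) ^+ 2) = 2 * \sum_(i < branch_height x' y') sigma i.+1 ^+ 2.
    split; first exact: sqr_diff_L1 gY.
    under [X in Ex _ X]funext do rewrite vY.
    by have [_ ->] := Ex_snd gm (sqr_diff_L1 x' y' gB).
  case: eqP => [<-|bb].
    case: b; under [X in Ex _ X]funext do rewrite !ZE.
      by have [h1 <-] := EY x y; have [_ ->] := Ex_fst Q h1.
    by have [h1 <-] := EY x y; have [_ ->] := Ex_snd Q h1.
  have cross x' y' : Ex QQ (fun z => (Y x' z.1 - Y y' z.2) ^+ 2) = 2 * \sum_(i < k.+1) sigma i.+1 ^+ 2.
    have [h1 e1] := E1 x'; have [h2 e2] := E1 y'.
    have [La Ea] := Ex_fst Q h1; have [Lc Ec] := Ex_snd Q h2.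
    have [Lb Eb] := Ex_prod (L1Z 2 (gfield_L1 gY x')) (gfield_L1 gY y').
    have e z : (Y x' z.1 - Y y' z.2) ^+ 2 = Y x' z.1 ^+ 2 - 2 * Y x' z.1 * Y y' z.2 + Y y' z.2 ^+ 2 by ring.
    under [X in Ex _ X]funext do rewrite e.
    by rewrite (ExD (L1B La Lb) Lc) (ExB La Lb) Ea Eb Ec e1 e2 (gfield_mean gY) mulr0 subr0 mulr_natl mulr2n.
  case: b b' bb => [] [] // _; under [X in Ex _ X]funext do rewrite !ZE; first exact: cross.
  rewrite -(cross y x); apply: eq_Ex => z; by rewrite -sqrrN opprB.
- move=> c.
  pose q := Ex gm (fun u => tree_tail k (c - s * u)).
  have qE : Ex Q (fun z => (c < s * z.1 + M z.2)%R%:R) = q by exact: (subtree_tail s LM tB c).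
  have Lq := ind_L1 Q c mY.
  have L1q : L1 Q (fun z => 1 - (c < s * z.1 + M z.2)%R%:R) by apply: L1B => //; exact: L1_cst.
  have [Lp Ep] := Ex_prod L1q L1q.
  have -> : (fun z => (c < fmax (leaf0 k.+1) (fun x => Z x z))%R%:R) =
     (fun z => 1 - (1 - (c < s * z.1.1 + M z.1.2)%R%:R) * (1 - (c < s * z.2.1 + M z.2.2)%R%:R)) :> (_ -> R).
    apply/funext => z; rewrite lt_max.
    by case: (_ < _); case: (_ < _); rewrite /= ?subrr ?subr0 ?mulr0 ?mul0r ?mulr1 ?subr0 ?subrr.
  rewrite ExB; [|exact: L1_cst|exact: Lp].
  by rewrite Ex_cst Ep ExB//; [rewrite Ex_cst qE /= -expr2|exact: L1_cst].
- pose U t := Num.max (a k - M t) 0.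
  have LUU : L1 P U by apply: L1_max; [apply: L1B => //; exact: L1_cst|exact: L1_cst].
  have LI : L1 P (fun t => 1 - (a k < M t)%R%:R).
    by apply: L1B; [exact: L1_cst|apply: ind_L1; exact: (L1_measurable LM)].
  have [LQ1 EQ1] := Ex_snd gm LUU; have [LQ2 EQ2] := Ex_snd gm LI.
  have [Lp Ep] := Ex_prod LQ1 LQ2.
  have [Lu Eu] := Ex_fst P (L1Z `|s| LU).
  have [Lu1 Eu1] := Ex_fst Q Lu; have [Lu2 Eu2] := Ex_snd Q Lu.
  have key z : Num.max (a k.+1 - fmax (leaf0 k.+1) (fun x => Z x z)) 0 <=
     U z.1.2 * (1 - (a k < M z.2.2)%R%:R) + `|a k.+1 - a k| + (`|s| * `|z.1.1| + `|s| * `|z.2.1|).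
    have m1 : s * z.1.1 + M z.1.2 <= fmax (leaf0 k.+1) (fun x => Z x z).
      rewrite leNgt -(orbF (_ < _)); apply/negP => /orP[]// h.
      by have := lt_max (fmax (leaf0 k.+1) (fun x => Z x z)) z; rewrite ltxx h.
    have m2 : s * z.2.1 + M z.2.2 <= fmax (leaf0 k.+1) (fun x => Z x z).
      rewrite leNgt; apply/negP => h.
      by have := lt_max (fmax (leaf0 k.+1) (fun x => Z x z)) z; rewrite ltxx h orbT.
    have U0 : 0 <= U z.1.2 by rewrite /U le_max lexx orbT.
    have U1 : a k - M z.1.2 <= U z.1.2 by rewrite /U le_max lexx.
    by rewrite -!normrM; exact: deficit_step m1 m2 U0 U1.
  have Lkey : L1 QQ (fun z => U z.1.2 * (1 - (a k < M z.2.2)%R%:R) + `|a k.+1 - a k| + (`|s| * `|z.1.1| + `|s| * `|z.2.1|)).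
    by apply: L1D; [apply: L1D => //; exact: L1_cst|exact: L1D].
  have LL : L1 QQ (fun z => Num.max (a k.+1 - fmax (leaf0 k.+1) (fun x => Z x z)) 0).
    apply: L1_max; last exact: L1_cst.
    by apply: L1B; [exact: L1_cst|apply: L1_fmax; exact: gfield_L1 gZ].
  apply: le_trans (le_Ex LL Lkey key) _.
  have -> : Ex QQ (fun z => U z.1.2 * (1 - (a k < M z.2.2)%R%:R) + `|a k.+1 - a k| + (`|s| * `|z.1.1| + `|s| * `|z.2.1|)) =
    Ex P U * (1 - tree_tail k (a k)) + `|a k.+1 - a k| + (`|s| * gauss_abs + `|s| * gauss_abs).
    rewrite (ExD (L1D Lp (L1_cst QQ _)) (L1D Lu1 Lu2)) (ExD Lp (L1_cst QQ _)) (ExD Lu1 Lu2) Ex_cst Ep Eu1 Eu2 Eu EQ1 EQ2.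
    rewrite (ExZ _ LU) (ExB (L1_cst P 1)); last by apply: ind_L1; exact: (L1_measurable LM).
    by rewrite Ex_cst tB.
  rewrite /= -/s.
  have w1 : 0 <= 1 - tree_tail k (a k).
    rewrite subr_ge0 -tB -[leRHS](Ex_cst P 1); apply: le_Ex; [by apply: ind_L1; exact: (L1_measurable LM)|exact: L1_cst|].
    by move=> t; rewrite lern1 leq_b1.
  have := ler_wpM2l w1 dB; rewrite -/U; lra.
Qed.

End Trees.

(** * Gaussian convolutions of signed profiles *)

Section GaussianIntegrals.
Context {R : realType}.
Local Notation gm := (@sgauss R).

Lemma sgauss_quadratic_int (a b : R) (f : R -> R) : 0 < a ->
  measurable_fun setT f -> L1 gm (fun x => f (b / a + x / Num.sqrt a)) ->
  L1 gm (fun x => f x * expR (- ((a - 1) * x ^+ 2 / 2) + b * x)) /\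
  Ex gm (fun x => f x * expR (- ((a - 1) * x ^+ 2 / 2) + b * x)) =
  (Num.sqrt a)^-1 * expR (b ^+ 2 / (2 * a)) * Ex gm (fun x => f (b / a + x / Num.sqrt a)).
Proof.
move=> a0 mf Lf.
set w := fun x : R => expR (- ((a - 1) * x ^+ 2 / 2) + b * x).
set c := (Num.sqrt a)^-1 * expR (b ^+ 2 / (2 * a)).
have c0 : 0 <= c by rewrite mulr_ge0 ?invr_ge0 ?sqrtr_ge0 ?expR_ge0.
have pos (g : R -> R) : measurable_fun setT g -> (forall x, 0 <= g x) ->
    L1 gm (fun x => g (b / a + x / Num.sqrt a)) ->
    L1 gm (fun x => g x * w x) /\ Ex gm (fun x => g x * w x) = c * Ex gm (fun x => g (b / a + x / Num.sqrt a)).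
  move=> mg g0 Lg; apply: L1_ge0.
  - by apply: measurable_funM => //; exact: measurable_gexp.
  - by move=> x; rewrite mulr_ge0 ?expR_ge0.
  - have mgE : measurable_fun setT (fun x : R => (g x)%:E) by apply/measurable_EFinP.
    have g0E (x : R) : (0 <= (g x)%:E)%E by rewrite lee_fin.
    have H := @ge0_sgauss_quadratic R a b (fun x => (g x)%:E) a0 mgE g0E.
    rewrite (ExE Lg) -EFinM in H; rewrite -H.
    by apply: eq_integral => x _; rewrite -EFinM.
pose fp x := Num.max (f x) 0; pose fn x := Num.max (- f x) 0.
have fE x : f x = fp x - fn x.
  rewrite /fp /fn; case: (leP 0 (f x)) => h; first by rewrite max_r ?subr0// oppr_le0.
  by rewrite max_l ?sub0r ?opprK// oppr_ge0 ltW.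
have mfp : measurable_fun setT fp by apply: measurable_maxr.
have mfn : measurable_fun setT fn by apply: measurable_maxr => //; exact: measurableT_comp.
have Lp : L1 gm (fun x => fp (b / a + x / Num.sqrt a)) by apply: L1_max => //; exact: L1_cst.
have Ln : L1 gm (fun x => fn (b / a + x / Num.sqrt a)).
  by apply: L1_max; [exact: (L1N Lf)|exact: L1_cst].
have [L1p E1] := pos fp mfp (fun x => ltac:(by rewrite le_max lexx orbT)) Lp.
have [L1n E2] := pos fn mfn (fun x => ltac:(by rewrite le_max lexx orbT)) Ln.
have e x : f x * w x = fp x * w x - fn x * w x by rewrite -mulrBl -fE.
split; first by apply: L1_eq (L1B L1p L1n) => x; rewrite e.
rewrite -[RHS]/(c * _).
under [X in Ex _ X]funext do rewrite e.
under [X in _ = c * Ex _ X]funext do rewrite fE.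
by rewrite (ExB L1p L1n) (ExB Lp Ln) E1 E2 mulrBr.
Qed.

Lemma sgauss_tilt (b : R) (f : R -> R) : measurable_fun setT f -> L1 gm (fun x => f (x + b)) ->
  L1 gm (fun x => f x * expR (b * x)) /\
  Ex gm (fun x => f x * expR (b * x)) = expR (b ^+ 2 / 2) * Ex gm (fun x => f (x + b)).
Proof.
move=> mf Lf.
have e x : b / 1 + x / Num.sqrt 1 = x + b by rewrite sqrtr1 !divr1 addrC.
have [|h1 h2] := @sgauss_quadratic_int 1 b f ltr01 mf.
  by apply: L1_eq Lf => x; rewrite e.
have e2 x : expR (- ((1 - 1) * x ^+ 2 / 2) + b * x) = expR (b * x) by rewrite subrr !mul0r oppr0 add0r.
split; first by apply: L1_eq h1 => x; rewrite e2.
move: h2; under eq_Ex do rewrite e2; move=> ->; rewrite sqrtr1 invr1 mul1r mulr1.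
by congr (_ * _); apply: eq_Ex => x; rewrite !mulr1 addrC.
Qed.

Let rho (t : R) := Num.sqrt (t / (t + 1)).

(** The amplitude factor (t/(t+1))^(3/2) is the origin of the 3/2 in the logarithmic correction:
    over k levels these factors multiply up to order k^(-3/2). *)
Lemma sgauss_lin_conv (t v : R) : 0 < t ->
  L1 gm (fun u => (v - u) * expR (- (v - u) ^+ 2 / (2 * t))) /\
  Ex gm (fun u => (v - u) * expR (- (v - u) ^+ 2 / (2 * t))) =
  Num.sqrt (t / (t + 1)) * expR (- v ^+ 2 / (2 * (t + 1))) * (v * (t / (t + 1))).
Proof.
move=> t0.
have a0 : 0 < (t + 1) / t by rewrite divr_gt0//; lra.
have mf : measurable_fun setT (fun u : R => expR (- v ^+ 2 / (2 * t)) * (v - u)).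
  by apply: measurable_funM => //; apply: measurable_funB.
have Lf : L1 gm (fun x => expR (- v ^+ 2 / (2 * t)) * (v - (v / t / ((t + 1) / t) + x / Num.sqrt ((t + 1) / t)))).
  apply: L1Z; apply: L1B; first exact: L1_cst.
  apply: L1D; first exact: L1_cst.
  by apply: L1_eq (L1Z (Num.sqrt ((t + 1) / t))^-1 (@sgauss_id_L1 R)) => x; rewrite mulrC.
have [h1 h2] := sgauss_quadratic_int a0 mf Lf.
have e u : expR (- v ^+ 2 / (2 * t)) * (v - u) * expR (- (((t + 1) / t - 1) * u ^+ 2 / 2) + v / t * u) =
    (v - u) * expR (- (v - u) ^+ 2 / (2 * t)).
  rewrite mulrAC mulrC -expRD; congr (_ * expR _); field; lra.
split; first by apply: L1_eq h1 => u; rewrite e.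
transitivity (Ex gm (fun u => expR (- v ^+ 2 / (2 * t)) * (v - u) * expR (- (((t + 1) / t - 1) * u ^+ 2 / 2) + v / t * u))).
  by apply: eq_Ex => u; rewrite e.
rewrite h2 ExZ; last first.
  apply: L1B; first exact: L1_cst.
  apply: L1D; first exact: L1_cst.
  by apply: L1_eq (L1Z (Num.sqrt ((t + 1) / t))^-1 (@sgauss_id_L1 R)) => x; rewrite mulrC.
have Lx : L1 gm (fun x : R => x / Num.sqrt ((t + 1) / t)).
  by apply: L1_eq (L1Z (Num.sqrt ((t + 1) / t))^-1 (@sgauss_id_L1 R)) => x; rewrite mulrC.
rewrite (ExB (L1_cst gm v) (L1D (L1_cst gm (v / t / ((t + 1) / t))) Lx)) (ExD (L1_cst gm _) Lx) !Ex_cst.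
have -> : Ex gm (fun x : R => x / Num.sqrt ((t + 1) / t)) = 0.
  transitivity (Ex gm (fun x : R => (Num.sqrt ((t + 1) / t))^-1 * x)).
    by apply: eq_Ex => x; rewrite mulrC.
  by rewrite (ExZ _ (@sgauss_id_L1 R)) sgauss_mean mulr0.
rewrite -sqrtrV ?invf_div; last exact: ltW.
rewrite addr0 -!mulrA; congr (_ * _); rewrite [LHS]mulrA -expRD.
congr (expR _ * _); field; lra.
Qed.

Lemma sgauss_exp_conv (t v : R) : 0 < t ->
  L1 gm (fun u => expR (- (v - u)) * expR (- (v - u) ^+ 2 / (2 * t))) /\
  Ex gm (fun u => expR (- (v - u)) * expR (- (v - u) ^+ 2 / (2 * t))) =
  Num.sqrt (t / (t + 1)) * expR (- v ^+ 2 / (2 * (t + 1))) *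
    expR (- (v * (t / (t + 1))) + t / (2 * (t + 1))).
Proof.
move=> t0.
have a0 : 0 < (t + 1) / t by rewrite divr_gt0//; lra.
have [h1 h2] := @sgauss_quadratic_int _ (v / t + 1) (fun=> expR (- v - v ^+ 2 / (2 * t))) a0
  (@measurable_cst _ _ _ _ _ _) (L1_cst gm _).
have e u : expR (- v - v ^+ 2 / (2 * t)) * expR (- (((t + 1) / t - 1) * u ^+ 2 / 2) + (v / t + 1) * u) =
    expR (- (v - u)) * expR (- (v - u) ^+ 2 / (2 * t)).
  rewrite -!expRD; congr expR; field; lra.
split; first by apply: L1_eq h1 => u; rewrite e.
transitivity (Ex gm (fun u => expR (- v - v ^+ 2 / (2 * t)) * expR (- (((t + 1) / t - 1) * u ^+ 2 / 2) + (v / t + 1) * u))).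
  by apply: eq_Ex => u; rewrite e.
rewrite h2 Ex_cst -sqrtrV ?invf_div; last exact: ltW.
rewrite -!mulrA; congr (_ * _); rewrite -!expRD; congr expR; field; lra.
Qed.

Lemma conv_bounded (h : R -> R) (K s : R) : measurable_fun setT h -> (forall x, `|h x| <= K) ->
  measurable_fun setT (fun x : R => Ex gm (fun u : R => h (x - s * u))).
Proof.
move=> mh hK.
have m2 : measurable_fun setT (fun z : measurableTypeR R * measurableTypeR R => h (z.1 - s * z.2)).
  apply: (measurableT_comp mh); have := measurable_lin2 1 (- s).
  by congr measurable_fun; apply/funext => z; rewrite mul1r mulNr.
have L2 : L1 (gm \x gm)%E (fun z => h (z.1 - s * z.2)) by apply: (@L1_bounded _ _ _ _ _ K).
have L1x x : L1 gm (fun y => h (x - s * y)).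
  apply: (@L1_bounded _ _ _ _ _ K) => //; apply: (measurableT_comp mh).
  by apply: measurable_funB => //; exact: measurable_funM.
have [+ _] := Ex_fubini L2 L1x; exact: L1_measurable.
Qed.

Lemma tree_tail_bounds (sigma : nat -> R) k :
  measurable_fun setT (tree_tail sigma k) /\ forall x, 0 <= tree_tail sigma k x <= 1.
Proof.
elim: k => [|k [mk bk]]; split.
- have -> : tree_tail sigma 0 = (fun x => \1_(`]-oo, 0%R[%classic) x : R).
    by apply/funext => x; rewrite indicE /=; congr (nat_of_bool _)%:R; apply/idP/idP; rewrite inE /= in_itv.
  exact: measurable_indic.
- by move=> x /=; rewrite ler0n lern1 leq_b1.
- have nk x : `|tree_tail sigma k x| <= 1 by case/andP: (bk x) => h1 h2; rewrite ger0_norm.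
  apply: measurable_funB => //; apply: measurable_funX; apply: measurable_funB => //.
  exact: conv_bounded nk.
- move=> x /=; set a := Ex _ _.
  have L : L1 gm (fun u => tree_tail sigma k (x - sigma k.+1 * u)).
    apply: (@L1_bounded _ _ _ _ _ 1).
      apply: (measurableT_comp mk); by apply: measurable_funB => //; exact: measurable_funM.
    by move=> u; case/andP: (bk (x - sigma k.+1 * u)) => h1 h2; rewrite ger0_norm.
  have a0 : 0 <= a by apply: Ex_ge0 => u; case/andP: (bk (x - sigma k.+1 * u)).
  have a1 : a <= 1.
    rewrite -(Ex_cst gm 1); apply: le_Ex => //; first exact: L1_cst.
    by move=> u; case/andP: (bk (x - sigma k.+1 * u)).
  apply/andP; split; nra.
Qed.

Lemma tree_tail_L1 (sigma : nat -> R) k (f : R -> R) : measurable_fun setT f ->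
  L1 gm (fun u => tree_tail sigma k (f u)).
Proof.
move=> mf; have [mk bk] := tree_tail_bounds sigma k; apply: (@L1_bounded _ _ _ _ _ 1).
  exact: (measurableT_comp mk).
by move=> u; case/andP: (bk (f u)) => h1 h2; rewrite ger0_norm.
Qed.

End GaussianIntegrals.

(** * Upper bound for the tree maximum *)

Section UpperTail.
Context {R : realType}.
Local Notation gm := (@sgauss R).

(** Chosen so that 2 exp(-lam^2/2) = 1: the doubling at a branching exactly pays for advancing by
    [lam]. *)
Definition lam : R := Num.sqrt (2 * ln 2).

Lemma ln2_bounds : 1 / 2 <= ln (2 : R) <= 1.
Proof.
apply/andP; split.
  have := @le_ln1Dx R (- (1 / 2)) ltac:(lra).
  by rewrite (_ : 1 + - (1 / 2) = 2^-1); [rewrite lnV ?posrE//; lra|lra].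
have := @le_ln1Dx R 1 ltac:(lra); rewrite (_ : 1 + 1 = 2)//.
Qed.

Lemma lam_sqr : lam ^+ 2 = 2 * ln 2.
Proof. by rewrite sqr_sqrtr//; have := ln2_bounds; lra. Qed.

Lemma lam_bounds : 1 <= lam <= 2.
Proof.
have := ln2_bounds; have := lam_sqr; have : 0 <= lam by rewrite sqrtr_ge0.
by move: lam (ln 2 : R) => l m h0 h1 h2; apply/andP; split; nra.
Qed.

Lemma expR_lam : expR (- (lam ^+ 2 / 2)) = 1 / 2.
Proof.
rewrite lam_sqr (_ : - (2 * ln 2 / 2) = - ln 2); last by field.
by rewrite expRN lnK ?posrE// div1r.
Qed.

Let u := tree_tail (fun=> 1 : R).

(** The shift by 16 makes the square root at least 4, which leaves room in the elementary
    inequalities. *)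
Definition time_up (k : nat) : R := k%:R + 16.
Definition front_up (k : nat) : R := lam * k%:R - 3 / (2 * lam) * ln (time_up k).

Lemma succ_sqrt_bounds (x x' : R) : 4 <= x -> x' ^+ 2 = x ^+ 2 + 1 -> 0 <= x' -> x <= x' <= x + 1 / 2 * x^-1.
Proof.
move=> x4 xx x'0; have xi : x^-1 * x = 1 by rewrite mulVf// gt_eqF//; lra.
have xi0 : 0 < x^-1 by rewrite invr_gt0; lra.
by apply/andP; split; nra.
Qed.

Lemma exp_small (z : R) : 11 <= z -> expR (- z) <= 1 / 72.
Proof.
move=> z11; apply: le_trans (_ : (1 + z + z ^+ 2 / 2)^-1 <= _).
  by rewrite expRN lef_pV2 ?posrE ?expR_gt0 ?expR_ge2//; nra.
by rewrite div1r lef_pV2 ?posrE//; nra.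
Qed.

(* Absorbs the contribution of the region behind the barrier in the slack of the bracket. *)
Lemma tail_absorb (x t D v : R) : 4 <= x -> t = x ^+ 2 + 2 * x -> 9 <= v -> 48 * expR (10 * lam + 30) <= D ->
  expR (10 * lam + v / 2 * 10 - v / 2 * v + (v / 2) ^+ 2 / 2) +
  3 * (D * (x / (x + 1)) ^+ 3) * expR (v / 2 * (1 - v) + (v / 2) ^+ 2 / 2) <=
  D * (x / (x + 1)) ^+ 3 * (1 / 2) * expR (- v ^+ 2 / (2 * (t + 1))) * (1 / 3 * expR (- v)).
Proof.
move=> x4 te v9 hD.
have D0 : 0 < D by apply: lt_le_trans hD; rewrite mulr_gt0 ?expR_gt0.
have t24 : 24 <= t by rewrite te; nra.
set r := (x / (x + 1)) ^+ 3.
have r1 : 1 / 2 <= r.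
  have : 4 / 5 <= x / (x + 1) by rewrite ler_pdivlMr; lra.
  rewrite /r; move: (x / (x + 1)) => y y45.
  have : (4 / 5) ^+ 3 <= y ^+ 3 by rewrite lerXn2r// nnegrE; lra.
  by apply: le_trans; lra.
have q1 : expR (- v ^+ 2 / 16 - v) <= expR (- v ^+ 2 / (2 * (t + 1))) * expR (- v).
  rewrite -expRD ler_expR lerD2r !mulNr lerN2 ler_wpM2l ?sqr_ge0// lef_pV2 ?posrE; lra.
set Q := expR (- v ^+ 2 / (2 * (t + 1))) in q1 *.
have c2 : expR (v / 2 * (1 - v) + (v / 2) ^+ 2 / 2) <= 1 / 72 * (Q * expR (- v)).
  apply: (@le_trans _ _ (1 / 72 * expR (- v ^+ 2 / 16 - v))); last by rewrite ler_wpM2l.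
  have h : 11 <= 5 / 16 * v ^+ 2 - 3 / 2 * v by nra.
  have := exp_small h => h2.
  apply: (@le_trans _ _ (expR (- (5 / 16 * v ^+ 2 - 3 / 2 * v)) * expR (- v ^+ 2 / 16 - v))).
    by rewrite -expRD ler_expR; lra.
  by rewrite ler_wpM2r ?expR_ge0.
have c1 : expR (10 * lam + v / 2 * 10 - v / 2 * v + (v / 2) ^+ 2 / 2) <= D / 48 * (Q * expR (- v)).
  apply: (@le_trans _ _ (D / 48 * expR (- v ^+ 2 / 16 - v))); last first.
    by rewrite ler_wpM2l// divr_ge0// ltW.
  apply: (@le_trans _ _ (expR (10 * lam + 30) * expR (- v ^+ 2 / 16 - v))).
    have := sqr_ge0 (v - 48 / 5) => hv.
    by rewrite -expRD ler_expR; nra.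
  by rewrite ler_wpM2r ?expR_ge0// ler_pdivlMr// mulrC.
have DQ0 : 0 <= D * (Q * expR (- v)) by rewrite !mulr_ge0 ?expR_ge0// ltW.
apply: (@le_trans _ _ (D / 48 * (Q * expR (- v)) + 3 * (D * r) * (1 / 72 * (Q * expR (- v))))).
  apply: lerD => //; rewrite ler_wpM2l// mulr_ge0// mulr_ge0 ?(ltW D0)//; lra.
have -> : D * r * (1 / 2) * Q * (1 / 3 * expR (- v)) = r * (D * (Q * expR (- v))) / 6 by field.
have -> : D / 48 * (Q * expR (- v)) + 3 * (D * r) * (1 / 72 * (Q * expR (- v))) =
  D * (Q * expR (- v)) / 48 + r * (D * (Q * expR (- v))) / 24 by field.
move: (D * (Q * expR (- v))) DQ0 => X X0; nra.
Qed.

Lemma rho_bounds (x t : R) : 4 <= x -> t = x ^+ 2 + 2 * x ->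
  1 / 2 <= Num.sqrt (t / (t + 1)) ^+ 3 <= expR (- (3 / 2) / (t + 1)).
Proof.
move=> x4 te.
have t24 : 24 <= t by rewrite te; nra.
have q : t / (t + 1) = 1 - (t + 1)^-1 by field; lra.
have q1 : 24 / 25 <= t / (t + 1) by rewrite ler_pdivlMr; lra.
have r2 : Num.sqrt (t / (t + 1)) ^+ 2 = t / (t + 1) by rewrite sqr_sqrtr//; lra.
have r0 : 0 <= Num.sqrt (t / (t + 1)) by rewrite sqrtr_ge0.
apply/andP; split; first by move: (Num.sqrt _) r2 r0 => r r2 r0; nra.
have h : Num.sqrt (t / (t + 1)) <= expR (- (1 / 2) / (t + 1)).
  rewrite -(ler_pXn2r (n := 2)) ?nnegrE ?expR_ge0// r2 q expr2 -expRD.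
  have -> : - (1 / 2) / (t + 1) + - (1 / 2) / (t + 1) = - (t + 1)^-1 by field; lra.
  exact: expR_ge1Dx.
have -> : - (3 / 2) / (t + 1) = 3%:R * (- (1 / 2) / (t + 1)) by field; lra.
by rewrite expRM_natl lerXn2r ?nnegrE ?expR_ge0.
Qed.

(** Compares the profile after one step, of width t + 1, with that of the next level, of width t',
    seen from a front moved by d. Using x^2 + 2 x instead of x^2 as width leaves the excess h = 2
    (x' - x), which pays for the move as d^2/(2 h). All losses are of order x^-3 and telescope as
    18/x - 18/x'. *)
Lemma gauss_factor (x x' t t' v d : R) : 4 <= x -> x' ^+ 2 = x ^+ 2 + 1 -> 0 <= x' ->
  t = x ^+ 2 + 2 * x -> t' = x' ^+ 2 + 2 * x' -> 0 <= d <= 3 / 2 * x ^- 2 ->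
  Num.sqrt (t / (t + 1)) ^+ 3 * (x / (x + 1)) ^+ 3 * (x' / x) ^+ 3 * expR (- v ^+ 2 / (2 * (t + 1))) <=
  expR (18 * (x^-1 - x'^-1)) * (x' / (x' + 1)) ^+ 3 * expR (- (v + d) ^+ 2 / (2 * t')).
Proof.
move=> x4 xx x'0 te te' /andP[d0 d1]; have /andP[x1 x2] := succ_sqrt_bounds x4 xx x'0.
have xp : 0 < x by lra.
have x'p : 0 < x' by lra.
have t24 : 24 <= t by rewrite te; nra.
pose h := 2 * (x' - x).
have tt : t' = t + 1 + h by rewrite te' te /h xx; ring.
have hp : 0 < h by rewrite /h; nra.
have hx : h * (x + x') = 2 by rewrite /h; nra.
have h0 : 0 <= expR (18 * (x^-1 - x'^-1)) by exact: expR_ge0.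
have /andP[_ rb] := rho_bounds x4 te.
have e1 : ((x' + 1) / (x + 1)) ^+ 3 <= expR (3 / 2 * (1 + h) / (t + 1)).
  have c : (x' + 1) / (x + 1) <= expR (1 / 2 * (1 + h) / (t + 1)).
    rewrite -(ler_pXn2r (n := 2)) ?nnegrE ?expR_ge0 ?divr_ge0//; try lra.
    rewrite expr2 [leRHS]expr2 -expRD.
    have -> : 1 / 2 * (1 + h) / (t + 1) + 1 / 2 * (1 + h) / (t + 1) = (1 + h) / (t + 1) by field; lra.
    apply: le_trans (expR_ge1Dx _).
    have -> : (x' + 1) / (x + 1) * ((x' + 1) / (x + 1)) = 1 + (1 + h) / (t + 1); last by [].
      have -> : t + 1 = (x + 1) ^+ 2 by rewrite te; ring.
      have -> : h = (x' + 1) ^+ 2 - (x + 1) ^+ 2 - 1 by rewrite /h; move: xx; nra.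
      by field; lra.
  have -> : 3 / 2 * (1 + h) / (t + 1) = 3%:R * (1 / 2 * (1 + h) / (t + 1)) by field; lra.
  rewrite expRM_natl lerXn2r ?nnegrE ?expR_ge0// divr_ge0//; lra.
have e2 : - v ^+ 2 / (2 * (t + 1)) <= - (v + d) ^+ 2 / (2 * t') + d ^+ 2 / (2 * h).
  rewrite -subr_ge0.
  have -> : - (v + d) ^+ 2 / (2 * t') + d ^+ 2 / (2 * h) - - v ^+ 2 / (2 * (t + 1)) =
     (h * v - (t + 1) * d) ^+ 2 / (2 * h * (t + 1) * t').
    by rewrite tt; field; rewrite !gt_eqF//; lra.
  by rewrite divr_ge0 ?sqr_ge0// !mulr_ge0//; lra.
have e3 : d ^+ 2 / (2 * h) + 3 / 2 * h / (t + 1) <= 18 * (x^-1 - x'^-1).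
  have xi0 : 0 < x^-1 by rewrite invr_gt0.
  have xi : x * x^-1 = 1 by rewrite divff// gt_eqF.
  have yi0 : 0 < x'^-1 by rewrite invr_gt0.
  have yi : x' * x'^-1 = 1 by rewrite divff// gt_eqF.
  have i1 : x^-1 - x'^-1 = h / (2 * x * x') by rewrite /h; field; rewrite !gt_eqF.
  have hge : x^-1 * (4 / 5) <= h.
    have : h * (x + x') <= h * (x * (5 / 2)) by rewrite ler_wpM2l ?(ltW hp)//; nra.
    rewrite hx => hh; rewrite mulrC -ler_pdivlMr// invrK; lra.
  have p1 : d ^+ 2 / (2 * h) <= 45 / 32 * x^-1 ^+ 3.
    rewrite ler_pdivrMr; last by lra.
    have : d ^+ 2 <= (3 / 2 * x ^- 2) ^+ 2 by rewrite lerXn2r ?nnegrE//; lra.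
    have -> : (3 / 2 * x ^- 2) ^+ 2 = 9 / 4 * x^-1 ^+ 4 by field; rewrite gt_eqF.
    move=> /le_trans; apply.
    have -> : 9 / 4 * x^-1 ^+ 4 = 45 / 32 * x^-1 ^+ 3 * (2 * (x^-1 * (4 / 5))) by field; rewrite gt_eqF.
    by rewrite ler_wpM2l ?mulr_ge0 ?exprn_ge0 ?(ltW xi0)// ler_wpM2l.
  have p2 : 3 / 2 * h / (t + 1) <= 3 / 2 * x^-1 ^+ 3.
    rewrite ler_pdivrMr; last by lra.
    have hle : h <= x^-1 by rewrite -[leRHS]mul1r ler_pdivlMr//; nra.
    apply: (@le_trans _ _ (3 / 2 * x^-1)); first by rewrite ler_wpM2l.
    have -> : 3 / 2 * x^-1 ^+ 3 * (t + 1) = 3 / 2 * x^-1 * (x^-1 ^+ 2 * (t + 1)) by ring.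
    rewrite ler_peMr//; first by rewrite mulr_ge0// ltW.
    have : 1 = x^-1 ^+ 2 * x ^+ 2 by rewrite -exprMn mulVf ?gt_eqF// expr1n.
    have : 0 <= x^-1 ^+ 2 by exact: sqr_ge0.
    rewrite te; nra.
  have p3 : 8 / 45 * x^-1 ^+ 3 <= x^-1 - x'^-1.
    rewrite i1 ler_pdivlMr ?mulr_gt0//; apply: le_trans hge.
    have -> : 8 / 45 * x^-1 ^+ 3 * (2 * x * x') = 16 / 45 * x^-1 * (x^-1 * x') by field; rewrite gt_eqF.
    have : x^-1 * x' <= 9 / 4 * 1.
      rewrite mulrC ler_pdivrMr//; nra.
    nra.
  have : 0 <= x^-1 ^+ 3 by rewrite exprn_ge0// ltW.
  lra.
have -> : Num.sqrt (t / (t + 1)) ^+ 3 * (x / (x + 1)) ^+ 3 * (x' / x) ^+ 3 * expR (- v ^+ 2 / (2 * (t + 1))) =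
   (x' / (x' + 1)) ^+ 3 * (Num.sqrt (t / (t + 1)) ^+ 3 * ((x' + 1) / (x + 1)) ^+ 3 * expR (- v ^+ 2 / (2 * (t + 1)))).
  by field; rewrite !gt_eqF//; lra.
rewrite [leRHS]mulrAC [leRHS]mulrC; apply: ler_wpM2l; first by rewrite exprn_ge0// divr_ge0//; lra.
apply: (@le_trans _ _ (expR (- (3 / 2) / (t + 1)) * expR (3 / 2 * (1 + h) / (t + 1)) * expR (- v ^+ 2 / (2 * (t + 1))))).
  rewrite ler_wpM2r ?expR_ge0//; apply: ler_pM => //; rewrite exprn_ge0 ?sqrtr_ge0// divr_ge0//; lra.
rewrite -!expRD ler_expR.
have -> : - (3 / 2) / (t + 1) + 3 / 2 * (1 + h) / (t + 1) = 3 / 2 * h / (t + 1) by field; lra.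
lra.
Qed.

End UpperTail.

Section BarrierArithmetic.
Context {R : realType}.

Lemma barrier_time_ge (x t : R) : 4 <= x -> t = x ^+ 2 + 2 * x -> 24 <= t.
Proof. by move=> x4 ->; nra. Qed.

Lemma ratio_bounds (t : R) : 24 <= t -> 0 <= t / (t + 1) <= 1.
Proof. by move=> t24; rewrite divr_ge0 ?ler_pdivrMr; lra. Qed.

(** Subtracting exp(-y) from y makes the profile a strict supersolution: after one step at least 4/3
    of the subtracted term is present, and the surplus exp(-v)/3 absorbs what comes from behind the
    barrier. *)
Lemma barrier_bracket (t v : R) : 24 <= t -> 9 <= v ->
  v * (t / (t + 1)) - expR (- (v * (t / (t + 1))) + t / (2 * (t + 1))) <= t / (t + 1) * (v - 4 / 3 * expR (- v)).
Proof.
move=> t24 v9; have /andP[t0 t1] := ratio_bounds t24.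
have x1 : expR (- v) <= expR (- (v * (t / (t + 1)))) by rewrite ler_expR lerN2 ler_piMr//; lra.
have x2 : 4 / 3 <= expR (t / (2 * (t + 1))).
  apply: le_trans (expR_ge1Dx _); have : 12 / 25 <= t / (2 * (t + 1)) by rewrite ler_pdivlMr; lra.
  lra.
rewrite expRD; have e0 := expR_ge0 (- v).
have : expR (- v) * (4 / 3) <= expR (- (v * (t / (t + 1)))) * expR (t / (2 * (t + 1))) by apply: ler_pM => //; lra.
move: (expR (- (v * _)) * _) => Y hY.
have : t / (t + 1) * (4 / 3 * expR (- v)) <= 1 * (4 / 3 * expR (- v)) by rewrite ler_wpM2r// mulr_ge0.
lra.
Qed.

End BarrierArithmetic.

Section UpperTailInduction.
Context {R : realType}.
Local Notation gm := (@sgauss R).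
Local Notation lam := (@lam R).

Let u := tree_tail (fun=> 1 : R).

Let X (k : nat) : R := Num.sqrt (time_up k).

Let X2 k : X k ^+ 2 = time_up k.
Proof. by rewrite sqr_sqrtr// addr_ge0. Qed.

Let X0 k : 0 <= X k. Proof. exact: sqrtr_ge0. Qed.

Let X4 k : 4 <= X k.
Proof.
rewrite -(ler_pXn2r (n := 2)) ?nnegrE// X2 /time_up; have : (0 : R) <= k%:R by []; lra.
Qed.

Let XS k : X k.+1 ^+ 2 = X k ^+ 2 + 1.
Proof. by rewrite !X2 /time_up -[k.+1%:R]natr1; ring. Qed.

Let T k := X k ^+ 2 + 2 * X k.

Variable K : R.

(** Increases with k and stays below K; the ratio of consecutive values is exactly the telescoping
    loss in [gauss_factor]. *)
Let D k := K * expR (- (18 / X k)).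

(** The supersolution without its factor exp(-lam y). As T k + 1 = (X k + 1)^2, the cube of X/(X +
    1) adapts the normalisation time^(3/2) that comes from the front to the width [T k]. *)
Let bound k y := D k * (X k / (X k + 1)) ^+ 3 * ((y - expR (- y)) * expR (- y ^+ 2 / (2 * T k))).

Let delta k := front_up k + lam - front_up k.+1 : R.

Lemma lam_gt0 : 0 < lam. Proof. by case/andP: (@lam_bounds R) => h _; apply: lt_le_trans h. Qed.

Let deltaE k : delta k = 3 / (2 * lam) * ln (time_up k.+1 / time_up k).
Proof.
have tp j : (time_up j : R) \is Num.pos by rewrite posrE /time_up ltr_wpDl.
rewrite ln_div// /delta /front_up -[k.+1%:R]natr1; ring.
Qed.

Let delta_bounds k : 0 <= delta k <= 3 / 2 * X k ^- 2.
Proof.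
have lp := lam_gt0; have /andP[l1 _] := @lam_bounds R.
have t0 : (0 : R) < time_up k by rewrite -X2; have := X4 k; nra.
have e : time_up k.+1 / time_up k = 1 + (time_up k)^-1 :> R.
  by rewrite /time_up -[k.+1%:R]natr1 in t0 *; field; lra.
have i0 : 0 < (time_up k)^-1 :> R by rewrite invr_gt0.
have lnle := @le_ln1Dx R (time_up k)^-1 ltac:(lra).
have ln0 : 0 <= ln (1 + (time_up k)^-1) :> R by rewrite ln_ge0; lra.
rewrite deltaE e X2; apply/andP; split; first by rewrite mulr_ge0// divr_ge0//; lra.
apply: ler_pM => //; first by rewrite divr_ge0//; lra.
by rewrite ler_pdivrMr; lra.
Qed.

Let exp_delta k : expR (lam * delta k) = (X k.+1 / X k) ^+ 3.
Proof.
have lp := lam_gt0.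
have p k' : 0 < X k' by have := X4 k'; lra.
rewrite deltaE -!X2 -expr_div_n lnXn ?divr_gt0//.
have -> : lam * (3 / (2 * lam) * (ln (X k.+1 / X k) *+ 2)) = 3%:R * ln (X k.+1 / X k).
  by rewrite -mulr_natr; field; lra.
by rewrite expRM_natl lnK// posrE divr_gt0.
Qed.

Hypothesis hK : 48 * expR (10 * lam + 30) * expR (18 / 4) <= K.

Let D_ge k : 48 * expR (10 * lam + 30) <= D k.
Proof.
have e0 : 0 < expR (18 / 4) :> R by rewrite expR_gt0.
apply: (@le_trans _ _ (K * expR (- (18 / 4)))).
  by rewrite expRN ler_pdivlMr.
rewrite ler_wpM2l//; first by apply: le_trans hK; rewrite !mulr_ge0 ?expR_ge0.
by rewrite ler_expR lerN2 ler_wpM2l// lef_pV2 ?posrE; have := X4 k; lra.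
Qed.

Let D_gt0 k : 0 < D k. Proof. by apply: lt_le_trans (D_ge k); rewrite mulr_gt0 ?expR_gt0. Qed.

Let u_le1 k y : u k y <= 1. Proof. by have [_ h] := tree_tail_bounds (fun=> 1 : R) k; case/andP: (h y). Qed.
Let m_u k : measurable_fun setT (u k). Proof. by case: (tree_tail_bounds (fun=> 1 : R) k). Qed.

(* The rate [b] is optimised for each target point. *)
Let majorant k b y := bound k y + expR (10 * lam + b * (10 - y)) +
  3 * (D k * (X k / (X k + 1)) ^+ 3) * expR (b * (1 - y)).

Let A k := D k * (X k / (X k + 1)) ^+ 3.

Let A_ge0 k : 0 <= A k.
Proof. by rewrite mulr_ge0 ?exprn_ge0 ?divr_ge0 ?(ltW (D_gt0 k))// addr_ge0. Qed.

(** For y >= 10 the first term of [majorant] suffices. For smaller y the tail is bounded by 1, which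
    the second term dominates, while the third compensates the negative values that [bound] can take
    when y < 1. *)
Let majorantP k b y : 1 <= b -> (forall y, 10 <= y -> u k (front_up k + y) <= expR (- (lam * y)) * bound k y) ->
  u k (front_up k + y) <= expR (- (lam * y)) * majorant k b y.
Proof.
move=> b1 ih; have A0 := A_ge0 k; rewrite /A in A0; have lp := lam_gt0.
have e1 := expR_ge0 (10 * lam + b * (10 - y)); have e2 := expR_ge0 (b * (1 - y)).
case: (leP 10 y) => y10.
  apply: le_trans (ih y y10) _; rewrite ler_wpM2l ?expR_ge0// /majorant -addrA lerDl addr_ge0// mulr_ge0// mulr_ge0//.
apply: le_trans (u_le1 _ _) _.
rewrite -(@expRxMexpNx_1 R (lam * y)) mulrC ler_wpM2l ?expR_ge0// /majorant.
have h1 : expR (lam * y) <= expR (10 * lam + b * (10 - y)) by rewrite ler_expR; nra.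
suff h2 : 0 <= bound k y + 3 * (D k * (X k / (X k + 1)) ^+ 3) * expR (b * (1 - y)) by lra.
rewrite /bound; set a := D k * _ in A0 *.
set q := expR (- y ^+ 2 / _).
have q1 : 0 <= q <= 1.
  rewrite expR_ge0/= -[leRHS]expR0 ler_expR mulNr oppr_le0 divr_ge0 ?sqr_ge0//.
  by rewrite mulr_ge0// /T addr_ge0 ?sqr_ge0 ?mulr_ge0.
have -> : a * ((y - expR (- y)) * q) + 3 * a * expR (b * (1 - y)) = a * ((y - expR (- y)) * q + 3 * expR (b * (1 - y))) by ring.
apply: mulr_ge0 => //.
case/andP: q1 => q0 q1.
case: (leP 1 y) => y1.
  have : expR (- y) <= 1 by rewrite -[leRHS]expR0 ler_expR; lra.
  by move=> ?; rewrite addr_ge0 ?mulr_ge0//; lra.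
have h3 : expR (1 - y) <= expR (b * (1 - y)) by rewrite ler_expR ler_peMl//; lra.
have h4 : expR (- y) <= expR (1 - y) by rewrite ler_expR; lra.
have h5 : - y <= expR (1 - y) by have := expR_ge1Dx (1 - y); lra.
have h6 : 0 <= expR (1 - y) by exact: expR_ge0.
nra.
Qed.

Let conv_majorant k b v : L1 gm (fun w => majorant k b (v - w)) /\
  Ex gm (fun w => majorant k b (v - w)) =
    A k * (Num.sqrt (T k / (T k + 1)) * expR (- v ^+ 2 / (2 * (T k + 1))) *
      (v * (T k / (T k + 1)) - expR (- (v * (T k / (T k + 1))) + T k / (2 * (T k + 1))))) +
    expR (10 * lam + b * 10 - b * v + b ^+ 2 / 2) + 3 * A k * expR (b * (1 - v) + b ^+ 2 / 2).
Proof.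
have T0 : 0 < T k by rewrite /T; have := X4 k; nra.
have [L1a E1] := sgauss_lin_conv v T0; have [L1b E2] := sgauss_exp_conv v T0.
have [L1e E3] := @L1_expR R b.
have e w : majorant k b (v - w) = A k * ((v - w) * expR (- (v - w) ^+ 2 / (2 * T k)) -
    expR (- (v - w)) * expR (- (v - w) ^+ 2 / (2 * T k))) +
    (expR (10 * lam + b * 10 - b * v) + 3 * A k * expR (b * (1 - v))) * expR (b * w).
  have e1 : expR (10 * lam + b * (10 - (v - w))) = expR (10 * lam + b * 10 - b * v) * expR (b * w).
    by rewrite -expRD; congr expR; ring.
  have e2 : expR (b * (1 - (v - w))) = expR (b * (1 - v)) * expR (b * w).
    by rewrite -expRD; congr expR; ring.
  by rewrite /majorant e1 e2 /bound -/(A k); ring.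
have Lx := L1D (L1Z (A k) (L1B L1a L1b)) (L1Z (expR (10 * lam + b * 10 - b * v) + 3 * A k * expR (b * (1 - v))) L1e).
split; first by apply: L1_eq Lx => w; rewrite e.
under [X in Ex _ X]funext do rewrite e.
rewrite (ExD (L1Z (A k) (L1B L1a L1b)) (L1Z _ L1e)) (ExZ _ (L1B L1a L1b)) (ExZ _ L1e) (ExB L1a L1b) E1 E2 E3.
by rewrite !(expRD _ (b ^+ 2 / 2)); ring.
Qed.

(** The square in the recursion is dropped, leaving a factor 2 that tilting by [lam] cancels. The
    free rate b of [majorant] is set to v/2. *)
Let u_step k v : 9 <= v -> (forall y, 10 <= y -> u k (front_up k + y) <= expR (- (lam * y)) * bound k y) ->
  u k.+1 (front_up k + lam + v) <= expR (- (lam * v)) *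
   (A k * Num.sqrt (T k / (T k + 1)) ^+ 3 * expR (- v ^+ 2 / (2 * (T k + 1))) * (v - expR (- v))).
Proof.
move=> v9 ih; set a := Ex gm (fun w => u k (front_up k + lam + v - 1 * w)).
have b1 : 1 <= v / 2 by lra.
have La : L1 gm (fun w => u k (front_up k + lam + v - 1 * w)).
  by apply: tree_tail_L1; apply: measurable_funB => //; exact: measurable_funM.
have [Lm Em] := conv_majorant k (v / 2) v.
have mm : measurable_fun setT (fun w : R => majorant k (v / 2) (v + lam - w)).
  have mv : measurable_fun setT (fun w : R => v + lam - w) by exact: measurable_funB.
  have mn : measurable_fun setT (fun w : R => - (v + lam - w)) by exact: measurableT_comp.
  have mE (f : R -> R) : measurable_fun setT f -> measurable_fun setT (fun w : R => expR (f w)).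
    by move=> mf; apply: measurableT_comp => //; exact: measurable_expR.
  apply: measurable_funD; [apply: measurable_funD|].
  - apply: measurable_funM => //; apply: measurable_funM; first by apply: measurable_funB => //; exact: mE.
    apply: mE; apply: measurable_funM => //; apply: measurableT_comp => //; exact: measurable_funX.
  - apply: mE; apply: measurable_funD => //; apply: measurable_funM => //; exact: measurable_funB.
  - apply: measurable_funM => //; apply: mE; apply: measurable_funM => //; exact: measurable_funB.
have Lt : L1 gm (fun w => majorant k (v / 2) (v + lam - (w + lam))).
  by apply: L1_eq Lm => w; congr majorant; ring.
have [L2 E2] := sgauss_tilt mm Lt.
have aM : a <= 1 / 2 * (expR (- (lam * v)) * Ex gm (fun w => majorant k (v / 2) (v - w))).
  have -> : Ex gm (fun w => majorant k (v / 2) (v - w)) = Ex gm (fun w => majorant k (v / 2) (v + lam - (w + lam))).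
    by apply: eq_Ex => w; congr majorant; ring.
  have -> : 1 / 2 * (expR (- (lam * v)) * Ex gm (fun w => majorant k (v / 2) (v + lam - (w + lam)))) =
     Ex gm (fun w => expR (- (lam * (v + lam))) * (majorant k (v / 2) (v + lam - w) * expR (lam * w))).
    rewrite (ExZ _ L2) E2 !mulrA -expRD -(@expR_lam R) -expRD.
    by congr (expR _ * _); field.
  apply: le_Ex => //; first exact: L1Z.
  move=> w; rewrite mul1r -addrA -addrA; have := majorantP (v + lam - w) b1 ih.
  rewrite (_ : v + lam - w = lam + (v - w)); last by ring.
  move=> /le_trans; apply; rewrite mulrCA -expRD mulrC (_ : - (lam * (v + lam)) + lam * w = - (lam * (lam + (v - w))))//; ring.
have uE : u k.+1 (front_up k + lam + v) = 1 - (1 - a) ^+ 2 by [].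
have a2 : u k.+1 (front_up k + lam + v) <= 2 * a by rewrite uE -subr_ge0 (_ : _ - _ = a ^+ 2) ?sqr_ge0//; ring.
apply: le_trans a2 _.
apply: (@le_trans _ _ (expR (- (lam * v)) * Ex gm (fun w => majorant k (v / 2) (v - w)))); first by lra.
rewrite ler_wpM2l ?expR_ge0// Em.
have tE : T k = X k ^+ 2 + 2 * X k by [].
have tabs := tail_absorb (X4 k) tE v9 (D_ge k).
have /andP[rl _] := rho_bounds (X4 k) tE.
have T24 : 24 <= T k by exact: barrier_time_ge (X4 k) tE.
have r2 : Num.sqrt (T k / (T k + 1)) ^+ 2 = T k / (T k + 1) by rewrite sqr_sqrtr//; case/andP: (ratio_bounds T24).
have r0 : 0 <= Num.sqrt (T k / (T k + 1)) by rewrite sqrtr_ge0.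
have q0 := expR_ge0 (- v ^+ 2 / (2 * (T k + 1))).
have A0 := A_ge0 k.
rewrite -/(A k) in tabs.
have br := barrier_bracket T24 v9.
set q := expR (- v ^+ 2 / (2 * (T k + 1))) in q0 tabs *.
set rho := Num.sqrt _ in rl r2 r0 *.
apply: (@le_trans _ _ (A k * (rho * q * (T k / (T k + 1) * (v - 4 / 3 * expR (- v)))) + A k * (1 / 2) * q * (1 / 3 * expR (- v)))).
  rewrite -addrA; apply: lerD; last first.
    by rewrite mulrA in tabs; apply: le_trans tabs; rewrite !mulrA.
  by rewrite ler_wpM2l// ler_wpM2l// mulr_ge0.
rewrite -r2.
have -> : A k * (rho * q * (rho ^+ 2 * (v - 4 / 3 * expR (- v)))) = A k * q * (rho ^+ 3 * (v - expR (- v))) - A k * q * expR (- v) / 3 * rho ^+ 3 by field.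
have -> : A k * rho ^+ 3 * q * (v - expR (- v)) = A k * q * (rho ^+ 3 * (v - expR (- v))) by ring.
have -> : A k * (1 / 2) * q * (1 / 3 * expR (- v)) = A k * q * expR (- v) / 6 by field.
have Aq : 0 <= A k * q * expR (- v) by apply: mulr_ge0; [exact: mulr_ge0|exact: expR_ge0].
have := ler_wpM2l Aq rl.
move: (A k * q * (rho ^+ 3 * (v - expR (- v)))) (A k * q * expR (- v)) Aq => Z Y Y0; lra.
Qed.

Hypothesis hK0 : expR (lam * (3 / (2 * lam) * ln 16)) * expR ((3 / (2 * lam) * ln 16) ^+ 2) * expR (18 / 4) <= K.

Let u_bound k y : 10 <= y -> u k (front_up k + y) <= expR (- (lam * y)) * bound k y.
Proof.
have lp := lam_gt0.
elim: k y => [|k ih] y y10; last first.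
  have /andP[d0 d1] := delta_bounds k; have x4 := X4 k.
  have d2 : delta k <= 1.
    apply: le_trans d1 _; rewrite -exprVn.
    have : (X k)^-1 <= 4^-1 by rewrite lef_pV2 ?posrE//; lra.
    have : 0 <= (X k)^-1 by rewrite invr_ge0.
    by move: (X k)^-1 => z z0 z1; nra.
  pose v := y - delta k.
  have v9 : 9 <= v by rewrite /v; lra.
  have := u_step v9 ih.
  have -> : front_up k + lam + v = front_up k.+1 + y by rewrite /v /delta; ring.
  move=> /le_trans; apply.
  have -> : expR (- (lam * v)) = expR (- (lam * y)) * (X k.+1 / X k) ^+ 3.
    by rewrite -exp_delta -expRD; congr expR; rewrite /v; ring.
  rewrite -mulrA ler_wpM2l ?expR_ge0//.
  have gf := gauss_factor v x4 (XS k) (X0 k.+1) (erefl (T k)) (erefl (T k.+1)) (delta_bounds k).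
  have yv : v - expR (- v) <= y - expR (- y).
    have : expR (- y) <= expR (- v) by rewrite ler_expR /v; lra.
    by rewrite /v; lra.
  have v0 : 0 <= v - expR (- v).
    have : expR (- v) <= 1 by rewrite -[leRHS]expR0 ler_expR; lra.
    lra.
  have -> : (X k.+1 / X k) ^+ 3 * (A k * Num.sqrt (T k / (T k + 1)) ^+ 3 * expR (- v ^+ 2 / (2 * (T k + 1))) * (v - expR (- v))) =
    D k * (Num.sqrt (T k / (T k + 1)) ^+ 3 * (X k / (X k + 1)) ^+ 3 * (X k.+1 / X k) ^+ 3 * expR (- v ^+ 2 / (2 * (T k + 1)))) * (v - expR (- v)).
    by rewrite /A; ring.
  have -> : bound k.+1 y = D k * (expR (18 * ((X k)^-1 - (X k.+1)^-1)) * (X k.+1 / (X k.+1 + 1)) ^+ 3 * expR (- (v + delta k) ^+ 2 / (2 * T k.+1))) * (y - expR (- y)).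
    have -> : v + delta k = y by rewrite /v subrK.
    have -> : D k * (expR (18 * ((X k)^-1 - (X k.+1)^-1)) * (X k.+1 / (X k.+1 + 1)) ^+ 3 * expR (- y ^+ 2 / (2 * T k.+1))) * (y - expR (- y)) =
       D k * expR (18 * ((X k)^-1 - (X k.+1)^-1)) * (X k.+1 / (X k.+1 + 1)) ^+ 3 * ((y - expR (- y)) * expR (- y ^+ 2 / (2 * T k.+1))) by ring.
    rewrite /bound; congr (_ * _ * _); rewrite /D -mulrA -expRD; congr (_ * expR _); ring.
  apply: ler_pM => //; last by rewrite ler_wpM2l// ltW.
  have n1 : 0 <= X k / (X k + 1) by rewrite divr_ge0 ?addr_ge0 ?X0.
  have n2 : 0 <= X k.+1 / X k by rewrite divr_ge0 ?X0.
  apply: mulr_ge0; first exact: ltW (D_gt0 k).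
  by apply: mulr_ge0; [apply: mulr_ge0; [apply: mulr_ge0|]|]; rewrite ?expR_ge0 ?exprn_ge0 ?sqrtr_ge0.
(* Height 0: the maximum is 0 and the front stands at -Y0, so only y <= Y0 matters, and there the
   second condition on K makes the bound at least 1. *)
have hK1 := hK0; set Y0 := 3 / (2 * lam) * ln 16 in hK1.
have f0 : front_up 0 = - Y0 by rewrite /front_up /time_up mulr0 !add0r.
have b0 : 0 <= bound 0 y.
  have : expR (- y) <= 1 by rewrite -[leRHS]expR0 ler_expR; lra.
  move=> ?; rewrite /bound; apply: mulr_ge0; first exact: A_ge0.
  by rewrite mulr_ge0 ?expR_ge0//; lra.
rewrite f0 /u /=; case: ltP => h; last by rewrite mulr_ge0 ?expR_ge0.
have yY : y <= Y0 by lra.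
have x4 : X 0 = 4.
  by rewrite /X /time_up add0r (_ : 16 = 4 ^+ 2); [rewrite sqrtr_sqr ger0_norm|ring].
have KE : expR (- (lam * Y0)) * expR (- Y0 ^+ 2) * (K * expR (- (18 / 4))) >= 1.
  rewrite !expRN mulrC -!mulrA -!invfM ler_pdivlMr ?mulr_gt0 ?expR_gt0// mul1r.
  by apply: le_trans hK1; rewrite le_eqVlt; apply/orP; left; apply/eqP; ring.
apply: le_trans KE _; rewrite /bound /D x4.
have -> : expR (- (lam * y)) * (K * expR (- (18 / 4)) * (4 / (4 + 1)) ^+ 3 * ((y - expR (- y)) * expR (- y ^+ 2 / (2 * T 0)))) =
  expR (- (lam * y)) * (expR (- y ^+ 2 / (2 * T 0)) * (64 / 125 * (y - expR (- y)))) * (K * expR (- (18 / 4))) by field.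
have K0 : 0 <= K by apply: le_trans hK0; rewrite !mulr_ge0 ?expR_ge0.
rewrite ler_wpM2r ?mulr_ge0 ?expR_ge0//; apply: ler_pM; rewrite ?expR_ge0//.
  by rewrite ler_expR lerN2 ler_wpM2l// ltW.
rewrite -[leLHS]mulr1; apply: ler_pM; rewrite ?expR_ge0//; last first.
  have : expR (- y) <= 1 by rewrite -[leRHS]expR0 ler_expR; lra.
  lra.
rewrite ler_expR mulNr lerN2 ler_pdivrMr; last by rewrite /T x4; lra.
rewrite /T x4; nra.
Qed.

Lemma tree_upper_tail k y : 10 <= y -> u k (front_up k + y) <= K * (y * expR (- (lam * y))).
Proof.
move=> y10; apply: le_trans (u_bound k y10) _.
rewrite mulrC mulrA ler_wpM2r ?expR_ge0// /bound.
have K0 : 0 <= K by apply: le_trans hK0; rewrite !mulr_ge0 ?expR_ge0.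
have x4 := X4 k.
have e1 : expR (- (18 / X k)) <= 1 by rewrite -[leRHS]expR0 ler_expR oppr_le0 divr_ge0.
have e2 : (X k / (X k + 1)) ^+ 3 <= 1.
  by rewrite -[leRHS](expr1n _ 3) lerXn2r ?nnegrE ?divr_ge0 ?addr_ge0 ?ler_pdivrMr//; lra.
have e3 : expR (- y ^+ 2 / (2 * T k)) <= 1.
  rewrite -[leRHS]expR0 ler_expR mulNr oppr_le0 divr_ge0 ?sqr_ge0// mulr_ge0//.
  by rewrite /T addr_ge0 ?sqr_ge0 ?mulr_ge0.
have e4 : expR (- y) <= 1 by rewrite -[leRHS]expR0 ler_expR; lra.
have e5 := expR_ge0 (- y).
rewrite /D; apply: ler_pM.
- by rewrite mulr_ge0 ?exprn_ge0 ?divr_ge0 ?addr_ge0 ?X0// mulr_ge0 ?expR_ge0.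
- by rewrite mulr_ge0 ?expR_ge0//; lra.
- rewrite -[leRHS]mulr1; apply: ler_pM => //; [by rewrite mulr_ge0 ?expR_ge0|by rewrite exprn_ge0 ?divr_ge0 ?addr_ge0|].
  by rewrite ler_piMr.
- by rewrite -[leRHS]mulr1; apply: ler_pM => //; rewrite ?expR_ge0//; lra.
Qed.

End UpperTailInduction.

(** * Mean of the tree maximum, from above *)

Section UpperMean.
Context {R : realType}.
Local Notation lam := (@lam R).

Lemma expR_tail_sum (J : nat) : \sum_(j < J) ((10 + j%:R) * expR (- (lam * (10 + j%:R)))) <= (60 : R).
Proof.
have /andP[l1 _] := @lam_bounds R.
have h j : (10 + j%:R) * expR (- (lam * (10 + j%:R))) <= 20 * expR (- (1 / 2)) ^+ j :> R.
  have j0 : (0 : R) <= j%:R by [].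
  rewrite -expRM_natr.
  apply: (@le_trans _ _ ((10 + j%:R) * expR (- (10 + j%:R)))).
    by rewrite ler_wpM2l ?addr_ge0// ler_expR; nra.
  have e1 : 10 + j%:R <= 2 * expR ((10 + j%:R) / 2) :> R by have := expR_ge1Dx ((10 + j%:R) / 2 : R); lra.
  apply: (@le_trans _ _ (2 * expR ((10 + j%:R) / 2) * expR (- (10 + j%:R)))).
    by rewrite ler_wpM2r ?expR_ge0.
  rewrite -mulrA -expRD; apply: ler_pM; rewrite ?expR_ge0//; first by lra.
  by rewrite ler_expR; lra.
apply: (@le_trans _ _ (\sum_(j < J) 20 * expR (- (1 / 2)) ^+ j)); first by apply: ler_sum => j _; exact: h.
rewrite -mulr_sumr.
have q : expR (- (1 / 2)) <= 2 / 3 :> R.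
  by rewrite expRN invf_ple ?posrE ?expR_gt0//; apply: le_trans (expR_ge1Dx _); lra.
have q0 := expR_ge0 (- (1 / 2) : R); move: (expR (- (1 / 2)) : R) q q0 => r r1 r0.
have h' : \sum_(j < J) r ^+ j <= 3 - 3 * r ^+ J.
  elim: J => [|J ih]; first by rewrite big_ord0 expr0; lra.
  by rewrite big_ord_recr/= exprSr; have := exprn_ge0 J r0; move: (r ^+ J) ih => z ih z0; nra.
have := exprn_ge0 J r0; lra.
Qed.

(** The excess of the mean over the front is bounded by a sum of tails over unit steps; the
    remainder after J steps vanishes by dominated convergence. *)
Lemma tree_upper : exists C : R, forall n, exists d (T : measurableType d) (P : probability T R)
  (B : leaf n -> T -> R) V, [/\ gfield P B V,
   forall x y, Ex P (fun t => (B x t - B y t) ^+ 2) = 2 * (branch_height x y)%:R &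
   Ex P (fun t => fmax (leaf0 n) (fun x => B x t)) <= front_up n + C].
Proof.
pose K := 48 * expR (10 * lam + 30) * expR (18 / 4) +
  expR (lam * (3 / (2 * lam) * ln 16)) * expR ((3 / (2 * lam) * ln 16) ^+ 2) * expR (18 / 4) : R.
have K1 : 48 * expR (10 * lam + 30) * expR (18 / 4) <= K by rewrite lerDl !mulr_ge0 ?expR_ge0.
have K2 : expR (lam * (3 / (2 * lam) * ln 16)) * expR ((3 / (2 * lam) * ln 16) ^+ 2) * expR (18 / 4) <= K.
  by rewrite lerDr !mulr_ge0 ?expR_ge0.
have K0 : 0 <= K by apply: le_trans K1; rewrite !mulr_ge0 ?expR_ge0.
exists (10 + 60 * K) => n.
have [d [T [P [B [V [gB _ vB tB _]]]]]] := tree_exists (fun=> 1 : R) (fun=> 0) n.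
exists d, T, P, B, V; split => //.
  move=> x y; rewrite vB; congr (2 * _).
  by under eq_bigr do rewrite expr1n; rewrite sumr_const card_ord.
pose M t := fmax (leaf0 n) (fun x => B x t).
have LM : L1 P M by apply: L1_fmax; exact: gfield_L1 gB.
pose m := front_up n : R.
have LR c : L1 P (fun t => Num.max (M t - c) 0).
  by apply: L1_max; [apply: L1B => //; exact: L1_cst|exact: L1_cst].
have tail J : Ex P M <= m + 10 + 60 * K + Ex P (fun t => Num.max (M t - (m + 10 + J%:R)) 0).
  have pt t : M t <= m + 10 + (\sum_(j < J) (m + (10 + j%:R) < M t)%R%:R + Num.max (M t - (m + 10 + J%:R)) 0).
    elim: J => [|J ih]; first by rewrite big_ord0 add0r addr0 -lerBlDl le_max lexx.
    apply: le_trans ih _; rewrite big_ord_recr/=.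
    move: (\sum_(_ < J) _) => S.
    suff : Num.max (M t - (m + 10 + J%:R)) 0 <= (m + (10 + J%:R) < M t)%R%:R + Num.max (M t - (m + 10 + J.+1%:R)) 0 by lra.
    rewrite ge_max; case: (ltP (m + (10 + J%:R)) (M t)) => h; rewrite /= ?add0r.
      have m1 : M t - (m + 10 + J.+1%:R) <= Num.max (M t - (m + 10 + J.+1%:R)) 0 by rewrite le_max lexx.
      have m2 : 0 <= Num.max (M t - (m + 10 + J.+1%:R)) 0 by rewrite le_max lexx orbT.
      by rewrite -[J.+1%:R]natr1 in m1 m2 *; apply/andP; split; lra.
    rewrite !le_max lexx orbT andbT; apply/orP; right; lra.
  have LI j : L1 P (fun t => (m + (10 + j%:R) < M t)%R%:R) by apply: ind_L1; exact: L1_measurable LM.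
  have LS : L1 P (fun t => \sum_(j < J) (m + (10 + j%:R) < M t)%R%:R) by apply: L1_sum => j; exact: LI.
  apply: (@le_trans _ _ (Ex P (fun t => m + 10 + (\sum_(j < J) (m + (10 + j%:R) < M t)%R%:R + Num.max (M t - (m + 10 + J%:R)) 0)))).
    apply: le_Ex => //; apply: L1D; [exact: L1_cst|exact: L1D].
  rewrite (ExD (L1_cst P (m + 10)) (L1D LS (LR _))) Ex_cst (ExD LS (LR _)) addrA lerD2r lerD2l Ex_sum; last by move=> j; exact: LI.
  apply: (@le_trans _ _ (\sum_(j < J) K * ((10 + j%:R) * expR (- (lam * (10 + j%:R)))))).
    apply: ler_sum => j _; rewrite tB.
    by apply: (tree_upper_tail K1 K2); rewrite lerDl.
  by rewrite -mulr_sumr mulrC ler_wpM2r// expR_tail_sum.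
have cv : (fun J : nat => Ex P (fun t => Num.max (M t - (m + 10 + J%:R)) 0)) @ \oo --> Ex P (fun=> 0).
  apply: (@Ex_dominated _ _ _ P _ _ (fun t => `|M t| + `|m + 10|)).
  - by move=> J; exact: L1_measurable (LR _).
  - exact: measurable_cst.
  - move=> t; apply: (@cvg_trans _ ((fun=> 0 : R) @ \oo)); last exact: cvg_cst.
    apply: near_eq_cvg; near=> J; rewrite max_r//.
    have : `|M t| + `|m + 10| <= J%:R by near: J; exact: nbhs_infty_ger.
    by have := ler_norm (M t); have := ler_norm (- (m + 10)); rewrite normrN; lra.
  - by apply: L1D; [exact: L1_norm|exact: L1_cst].
  - move=> J t; have J0 : (0 : R) <= J%:R by [].
    have := ler_norm (M t); have := ler_norm (- (m + 10)); rewrite normrN => h1 h2.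
    rewrite ger0_norm ?le_max ?lexx ?orbT// ge_max; apply/andP; split; last by rewrite addr_ge0.
    lra.
rewrite Ex_cst in cv.
rewrite -/M -/m addrA; apply/ler_addgt0Pr => e e0.
have /cvgrPdist_le/(_ e e0) [J _ hJ] := cv.
have := hJ J (leqnn J); rewrite sub0r normrN => h.
apply: le_trans (tail J) _; rewrite lerD2l; apply: le_trans h; exact: ler_norm.
Unshelve. all: by end_near. Qed.

End UpperMean.

(** * Lower bound for the tree maximum *)

Section KilledKernel.
Context {R : realType}.
Local Notation gm := (@sgauss R).

Definition lin_gauss (th y : R) : R := y * expR (- (th * y ^+ 2)).

Lemma lin_gaussN th y : lin_gauss th (- y) = - lin_gauss th y.
Proof. by rewrite /lin_gauss sqrrN mulNr. Qed.

Lemma measurable_lin_gauss th : measurable_fun setT (lin_gauss th).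
Proof.
apply: measurable_funM => //; apply: measurableT_comp => //.
by apply: measurableT_comp => //; apply: measurable_funM => //; exact: measurable_funX.
Qed.

Lemma lin_gauss_bounded th y : 0 < th -> `|lin_gauss th y| <= th^-1 + 1.
Proof.
move=> th0; rewrite /lin_gauss normrM (ger0_norm (expR_ge0 _)) expRN ler_pdivrMr ?expR_gt0//.
have e : 1 + th * y ^+ 2 <= expR (th * y ^+ 2) by exact: expR_ge1Dx.
have t0 : 0 < th^-1 by rewrite invr_gt0.
have tt : th^-1 * (th * y ^+ 2) = y ^+ 2 by rewrite mulrA mulVf ?mul1r ?gt_eqF.
have yy : `|y| ^+ 2 = y ^+ 2 by rewrite real_normK ?num_real.
apply: (@le_trans _ _ ((th^-1 + 1) * (1 + th * y ^+ 2))); last by rewrite ler_wpM2l// addr_ge0// ltW.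
have := mulr_ge0 (ltW th0) (sqr_ge0 y); have := sqr_ge0 (`|y| - 1).
rewrite mulrDl mul1r mulrDr mulr1 tt -yy; move: (`|y|) => q; move: (th * _) => w; nra.
Qed.

Lemma lin_gauss_ge0 th y : 0 <= y -> 0 <= lin_gauss th y.
Proof. by move=> y0; rewrite mulr_ge0 ?expR_ge0. Qed.

(** With th = 1/(2 t) this is t/(t + s^2), the ratio of the variances before and after a step of
    deviation s. *)
Definition damping (s th : R) : R := (1 + 2 * s ^+ 2 * th)^-1.

Lemma lin_gauss_conv (s th z : R) : 0 < s -> 0 < th ->
  L1 gm (fun u => lin_gauss th (z - s * u)) /\
  Ex gm (fun u => lin_gauss th (z - s * u)) =
    damping s th * Num.sqrt (damping s th) * lin_gauss (th * damping s th) z.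
Proof.
move=> s0 th0.
have t0 : 0 < (2 * th * s ^+ 2)^-1 by rewrite invr_gt0 !mulr_gt0// exprn_gt0.
have [L E] := sgauss_lin_conv (z / s) t0.
have sn : s != 0 by rewrite gt_eqF.
have tn : th != 0 by rewrite gt_eqF.
have e u : lin_gauss th (z - s * u) =
    s * ((z / s - u) * expR (- (z / s - u) ^+ 2 / (2 * (2 * th * s ^+ 2)^-1))).
  rewrite /lin_gauss mulrA; congr (_ * expR _); first by rewrite mulrBr mulrCA divff// mulr1.
  by field; rewrite tn sn.
split; first by apply: L1_eq (L1Z s L) => u; rewrite e.
transitivity (s * Ex gm (fun u => (z / s - u) * expR (- (z / s - u) ^+ 2 / (2 * (2 * th * s ^+ 2)^-1)))).
  by rewrite -(ExZ _ L); apply: eq_Ex => u; rewrite e.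
have dn : 1 + 2 * s ^+ 2 * th != 0 by rewrite gt_eqF// addr_gt0// !mulr_gt0// exprn_gt0.
have q : (2 * th * s ^+ 2)^-1 / ((2 * th * s ^+ 2)^-1 + 1) = damping s th.
  rewrite /damping; field; rewrite tn sn /= ?dn//=.
rewrite E q /lin_gauss.
have -> : - (z / s) ^+ 2 / (2 * ((2 * th * s ^+ 2)^-1 + 1)) = - (th * damping s th * z ^+ 2).
  rewrite /damping; field; rewrite tn sn /= ?dn//=.
by field.
Qed.

(** The ratio of the Brownian kernel killed at 0 to the free one, for a step from z to y of variance
    s^2: the probability that the bridge stays positive. With this choice of truncation the
    evolution of odd profiles is explicit. *)
Definition kill (s z y : R) : R := (0 < y)%R%:R * (1 - expR (- (2 * z * y / s ^+ 2))).

Lemma kill_bounds (s z y : R) : 0 <= z -> 0 <= kill s z y <= 1.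
Proof.
move=> z0; rewrite /kill; case: ltP => y0; last by rewrite mul0r lexx ler01.
have h : expR (- (2 * z * y / s ^+ 2)) <= 1.
  by rewrite -[leRHS]expR0 ler_expR oppr_le0 divr_ge0 ?sqr_ge0// !mulr_ge0// ltW.
have := expR_ge0 (- (2 * z * y / s ^+ 2)); rewrite mul1r; lra.
Qed.

Lemma measurable_gt0 : measurable_fun setT (fun y : R => (0 < y)%R%:R : R).
Proof.
have -> : (fun y : R => (0 < y)%R%:R) = (fun y => \1_(`]0, +oo[%classic) y : R).
  by apply/funext => y; rewrite indicE; congr (nat_of_bool _)%:R; apply/idP/idP; rewrite inE /= in_itv/= andbT.
exact: measurable_indic.
Qed.

Lemma measurable_kill (s z : R) : measurable_fun setT (kill s z).
Proof.
apply: measurable_funM; first exact: measurable_gt0.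
apply: measurable_funB => //; apply: measurableT_comp => //; apply: measurableT_comp => //.
by apply: measurable_funM => //; exact: measurable_funM.
Qed.

Lemma measurable_affine (z s : R) : measurable_fun setT (fun u : R => z - s * u).
Proof. by apply: measurable_funB => //; exact: measurable_funM. Qed.

(* Reflection principle: killing at the origin is the odd extension. *)
Lemma kill_odd (s z M : R) (h : R -> R) : 0 < s -> measurable_fun setT h -> (forall y, h (- y) = - h y) ->
  (forall y, `|h y| <= M) ->
  Ex gm (fun u => kill s z (z - s * u) * h (z - s * u)) = Ex gm (fun u => h (z - s * u)).
Proof.
move=> s0 mh oh hM.
have M0 : 0 <= M by apply: le_trans (hM 0).
have sn : s != 0 by rewrite gt_eqF.
pose k y : R := (0 < y)%R%:R * h y.
have mk : measurable_fun setT k by apply: measurable_funM => //; exact: measurable_gt0.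
have kM y : `|k y| <= M.
  by rewrite /k; case: (0 < y)%R; rewrite ?mul1r// mul0r normr0.
have ma (f : R -> R) (a b : R) : measurable_fun setT f -> measurable_fun setT (fun u : R => f (a - b * u)).
  by move=> mf; apply: (measurableT_comp mf); exact: measurable_affine.
have Lb (f : R -> R) (a b : R) : measurable_fun setT f -> (forall y, `|f y| <= M) -> L1 gm (fun u => f (a - b * u)).
  by move=> mf fM; apply: (@L1_bounded _ _ _ _ _ M) => //; exact: ma.
have Lt : L1 gm (fun x => k (z - s * (x + 2 * z / s))).
  by apply: L1_eq (Lb k (- z) s mk kM) => x; congr k; field.
have [T1 T2] := @sgauss_tilt R (2 * z / s) (fun u => k (z - s * u)) (ma _ _ _ mk) Lt.
have e u : kill s z (z - s * u) * h (z - s * u) =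
    k (z - s * u) - expR (- (2 * z ^+ 2 / s ^+ 2)) * (k (z - s * u) * expR (2 * z / s * u)).
  rewrite mulrCA -expRD /kill (_ : - (2 * z ^+ 2 / s ^+ 2) + 2 * z / s * u = - (2 * z * (z - s * u) / s ^+ 2)); last by field.
  by rewrite /k; ring.
transitivity (Ex gm (fun u => k (z - s * u) - expR (- (2 * z ^+ 2 / s ^+ 2)) * (k (z - s * u) * expR (2 * z / s * u)))).
  by apply: eq_Ex => u; rewrite e.
have Lk := Lb _ z s mk kM.
rewrite (ExB Lk (L1Z _ T1)) (ExZ _ T1) T2 mulrA -expRD.
have -> : - (2 * z ^+ 2 / s ^+ 2) + (2 * z / s) ^+ 2 / 2 = 0 by field.
rewrite expR0 mul1r.
have -> : Ex gm (fun x => k (z - s * (x + 2 * z / s))) = Ex gm (fun u => k (- (z - s * u))).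
  have := @sgauss_opp R (fun u => k (- z - s * u)) (ma k (- z) s mk) => h1.
  transitivity (Ex gm (fun u => k (- z - s * u))); first by apply: eq_Ex => x; congr k; field.
  by rewrite -h1; apply: eq_Ex => x; congr k; ring.
have mn : measurable_fun setT (fun y : R => k (- y)) by have := ma k 0 1 mk; congr measurable_fun; apply/funext => y; rewrite mul1r sub0r.
rewrite -(ExB Lk (Lb (fun y => k (- y)) z s mn (fun y => kM (- y)))); apply: eq_Ex => u.
move: (z - s * u) => y; rewrite /k oppr_gt0 oh.
case: (ltgtP y 0) => [y0|y0|->]; rewrite ?mul0r ?mul1r; [by rewrite sub0r opprK|by rewrite subr0|].
have := oh 0; rewrite oppr0; lra.
Qed.

(** Girsanov for one level: removing the drift c s costs exp(-c^2/2), produces exp(-(c/s) z) at the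
    new position and lowers the rate l to l - c/s. *)
Lemma kill_drift (s c l z M : R) (h : R -> R) : 0 < s -> 0 <= z -> 0 <= l -> measurable_fun setT h ->
  (forall y, `|h y| <= M) ->
  L1 gm (fun u => kill s z (z + c * s - s * u) * (expR (- (l * (z + c * s - s * u))) * h (z + c * s - s * u))) /\
  L1 gm (fun u => kill s z (z - s * u) * (expR (- ((l - c / s) * (z - s * u))) * h (z - s * u))) /\
  Ex gm (fun u => kill s z (z + c * s - s * u) * (expR (- (l * (z + c * s - s * u))) * h (z + c * s - s * u))) =
  expR (- (c ^+ 2 / 2)) * expR (- (c / s * z)) *
    Ex gm (fun u => kill s z (z - s * u) * (expR (- ((l - c / s) * (z - s * u))) * h (z - s * u))).
Proof.
move=> s0 z0 l0 mh hM.
have M0 : 0 <= M by apply: le_trans (hM 0).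
have sn : s != 0 by rewrite gt_eqF.
pose F y := kill s z y * (expR (- (l * y)) * h y).
have mF : measurable_fun setT F.
  apply: measurable_funM; first exact: measurable_kill.
  apply: measurable_funM => //; have := @measurable_expRM R (- l).
  by congr measurable_fun; apply/funext => y; rewrite mulNr.
have FM y : `|F y| <= M.
  rewrite /F normrM; have /andP[k0 k1] := @kill_bounds s z y z0.
  rewrite (ger0_norm k0); case: (ltP 0 y) => y0; last first.
    by rewrite /kill ltNge y0 /= !mul0r.
  rewrite -[leRHS]mul1r; apply: ler_pM => //; rewrite normrM (ger0_norm (expR_ge0 _)) -[leRHS]mul1r.
  by apply: ler_pM; rewrite ?expR_ge0// -[leRHS]expR0 ler_expR oppr_le0 mulr_ge0// ltW.
have Lb a : L1 gm (fun u => F (a - s * u)).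
  by apply: (@L1_bounded _ _ _ _ _ M) => //; apply: (measurableT_comp mF); exact: measurable_affine.
have Lt : L1 gm (fun x => F (z - s * (x - c))).
  by apply: L1_eq (Lb (z + c * s)) => x; congr F; ring.
have mFa : measurable_fun setT (fun u => F (z - s * u)).
  by apply: (measurableT_comp mF); exact: measurable_affine.
have [T1 T2] := @sgauss_tilt R (- c) _ mFa Lt.
have e u : expR (c / s * z) * (F (z - s * u) * expR (- c * u)) =
   kill s z (z - s * u) * (expR (- ((l - c / s) * (z - s * u))) * h (z - s * u)).
  rewrite /F (_ : expR (- ((l - c / s) * (z - s * u))) = expR (- (l * (z - s * u))) * (expR (c / s * z) * expR (- c * u))); last first.
    by rewrite -!expRD; congr expR; field.
  ring.
split; first exact: Lb.
split; first by apply: L1_eq (L1Z (expR (c / s * z)) T1) => u; exact: e.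
transitivity (Ex gm (fun x => F (z - s * (x - c)))); first by apply: eq_Ex => x; rewrite /F (_ : z - s * (x - c) = z + c * s - s * x)//; ring.
transitivity (expR (- (c ^+ 2 / 2)) * expR (- (c / s * z)) * (expR (c / s * z) * Ex gm (fun u => F (z - s * u) * expR (- c * u)))).
  rewrite T2 sqrrN; set E0 := Ex _ _.
  rewrite !mulrA -!expRD (_ : - (c ^+ 2 / 2) - c / s * z + c / s * z + c ^+ 2 / 2 = 0) ?expR0 ?mul1r//; ring.
by congr (_ * _); rewrite -(ExZ _ T1); apply: eq_Ex => u; exact: e.
Qed.

(** Optimising over t recovers the Cauchy-Schwarz bound from the family of linear bounds; the linear
    ones can be integrated against a kernel, the quotient cannot. *)
Lemma sqr_le_of_quadratic (F S a : R) : 0 <= S -> 0 <= F -> 0 <= a ->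
  (forall t, 2 * t * F - t ^+ 2 * S <= a) -> F ^+ 2 <= a * S.
Proof.
move=> S0 F0 a0 H; move: S0; rewrite le_eqVlt => /orP[/eqP e|S0].
  move: F0; rewrite le_eqVlt => /orP[/eqP <-|F0]; first by rewrite -e mulr0 expr0n.
  have := H ((a + 1) / F); rewrite -e mulr0 subr0 -mulrA divfK ?gt_eqF//; lra.
have := H (F / S).
have -> : 2 * (F / S) * F - (F / S) ^+ 2 * S = F ^+ 2 / S by field; rewrite gt_eqF.
by rewrite ler_pdivrMr.
Qed.

(** Branching: two independent copies with first moment F and second moment S give 2 F and 2 S + 2
    F^2. Lowering the first moment to f <= 2 F lowers the charge for the cross term to f^2/2. *)
Lemma second_moment_combine (a F S f t : R) : 0 <= a <= 1 -> 0 <= f <= 2 * F -> 0 <= S -> F ^+ 2 <= a * S ->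
  2 * t * f - t ^+ 2 * (2 * S + f ^+ 2 / 2) <= 1 - (1 - a) ^+ 2.
Proof.
move=> /andP[a0 a1] /andP[f0 fF] S0 h.
have -> : 1 - (1 - a) ^+ 2 = 2 * a - a ^+ 2 by ring.
have fF2 : f ^+ 2 <= 4 * (a * S).
  have : f ^+ 2 <= (2 * F) ^+ 2 by rewrite lerXn2r ?nnegrE//; lra.
  by rewrite exprMn; lra.
set y := t * f.
have yS : y ^+ 2 <= 4 * (a * (t ^+ 2 * S)).
  by rewrite /y exprMn (_ : 4 * (a * (t ^+ 2 * S)) = t ^+ 2 * (4 * (a * S))) ?ler_wpM2l ?sqr_ge0//; ring.
have -> : 2 * t * f - t ^+ 2 * (2 * S + f ^+ 2 / 2) = 2 * y - 2 * (t ^+ 2 * S) - y ^+ 2 / 2 by rewrite /y; field.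
have : 0 <= t ^+ 2 * S by rewrite mulr_ge0 ?sqr_ge0.
move: (t ^+ 2 * S) y yS => w y yS w0.
case: (ltP 0 a) => ap; last first.
  have a_eq : a = 0 by lra.
  by rewrite a_eq in yS *; rewrite mul0r mulr0 in yS; have := sqr_ge0 y; nra.
(* [2a/(1+a) = max_q 4 q - 2 q^2 (1+a)/a], taken at [q = y/2]. *)
have h1 : 2 * y - y ^+ 2 / 2 - y ^+ 2 / (2 * a) <= 2 * a - a ^+ 2.
  rewrite -subr_ge0.
  have -> : 2 * a - a ^+ 2 - (2 * y - y ^+ 2 / 2 - y ^+ 2 / (2 * a)) =
    ((y * (1 + a) - 2 * a) ^+ 2 + 2 * a ^+ 2 * (a * (1 - a))) / (2 * a * (1 + a)).
    by field; rewrite !gt_eqF//; lra.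
  by rewrite divr_ge0 ?addr_ge0 ?sqr_ge0 ?mulr_ge0//; lra.
have : y ^+ 2 / (2 * a) <= 2 * w by rewrite ler_pdivrMr; lra.
lra.
Qed.

(** One generation of the truncated second moment. The factor in the bound on [p'] and the slack up
    to [th'] pay for the level variances being unequal, which makes the incoming rate l differ from
    the optimal c/s. [H] is odd so that its killed evolution is the free one. *)
Lemma barrier_step (w H : R -> R) (s c l x z A p th de M H' : R) :
  measurable_fun setT w -> (forall y, 0 <= w y <= 1) ->
  measurable_fun setT H -> (forall y, H (- y) = - H y) -> (forall y, `|H y| <= M) -> (forall y, 0 <= y -> 0 <= H y) ->
  0 < s -> 0 < c -> 0 <= l - c / s -> 0 < z -> 0 <= A -> 0 <= p -> 0 < th -> 0 < de ->
  (forall y t, 0 < y -> 2 * t * (A * expR (- (l * y)) * (p * lin_gauss th y)) - t ^+ 2 * (A * expR (- (l * y)) * H y) <= w (x + y)) ->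
  let A' := 2 * expR (- (c ^+ 2 / 2)) * A in
  let r := damping s (th + de) in
  forall p' th', 0 <= p' <= p * expR (- ((l - c / s) ^+ 2 / (4 * de))) * (r * Num.sqrt r) -> (th + de) * r <= th' ->
  let f' := A' * expR (- (c / s * z)) * (p' * lin_gauss th' z) in
  Ex gm (fun u => H (z - s * u)) + A' * expR (- (c / s * z)) * (p' * lin_gauss th' z) ^+ 2 / 2 <= H' ->
  forall t, 2 * t * f' - t ^+ 2 * (A' * expR (- (c / s * z)) * H') <=
    1 - (1 - Ex gm (fun u => w (x + (z + c * s) - s * u))) ^+ 2.
Proof.
move=> mw w01 mH oH HM H0 s0 c0 al0 z0 A0 p0 th0 de0 IH A' r p' th' /andP[p'0 p'p] thth f' hH' t.
have l0 : 0 <= l by have := divr_ge0 (ltW c0) (ltW s0); lra.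
set a := Ex gm _.
have Lw : L1 gm (fun u => w (x + (z + c * s) - s * u)).
  apply: (@L1_bounded _ _ _ _ _ 1).
    by apply: (measurableT_comp mw); exact: measurable_affine.
  by move=> u; case/andP: (w01 (x + (z + c * s) - s * u)) => h1 h2; rewrite ger0_norm.
have a01 : 0 <= a <= 1.
  apply/andP; split.
    by apply: Ex_ge0 => u; case/andP: (w01 (x + (z + c * s) - s * u)).
  rewrite -(Ex_cst gm 1); apply: le_Ex => //; first exact: L1_cst.
  by move=> u; case/andP: (w01 (x + (z + c * s) - s * u)).
have bG y : `|lin_gauss th y| <= th^-1 + 1 by exact: lin_gauss_bounded.
have [Lg1 [Lg2 Eg]] := @kill_drift s c l z _ _ s0 (ltW z0) l0 (measurable_lin_gauss th) bG.
have [LH1 [LH2 EH]] := @kill_drift s c l z _ _ s0 (ltW z0) l0 mH HM.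
set gF := Ex gm (fun u => kill s z (z - s * u) * _) in Eg.
set gS := Ex gm (fun u => kill s z (z - s * u) * _) in EH.
set kc := expR (- (c ^+ 2 / 2)) * expR (- (c / s * z)) in Eg EH.
have kc0 : 0 <= kc by rewrite mulr_ge0 ?expR_ge0.
(* With al = l - c/s, the inequality al y <= al^2/(4 de) + de y^2 absorbs the excess rate in the
   Gaussian, at the price of raising [th] to [th + de]. *)
have QF : expR (- ((l - c / s) ^+ 2 / (4 * de))) * ((r * Num.sqrt r) * lin_gauss ((th + de) * r) z) <= gF.
  have thd : 0 < th + de by rewrite addr_gt0.
  have [_ Ec] := @lin_gauss_conv s (th + de) z s0 thd.
  rewrite -/r in Ec; rewrite -Ec.
  have bG2 y : `|lin_gauss (th + de) y| <= (th + de)^-1 + 1 by exact: lin_gauss_bounded.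
  rewrite -(@kill_odd s z _ _ s0 (measurable_lin_gauss _) (lin_gaussN _) bG2).
  have Lk : L1 gm (fun u => kill s z (z - s * u) * lin_gauss (th + de) (z - s * u)).
    apply: (@L1_bounded _ _ _ _ _ ((th + de)^-1 + 1)).
      apply: measurable_funM; [apply: (measurableT_comp (measurable_kill s z))|apply: (measurableT_comp (measurable_lin_gauss _))]; exact: measurable_affine.
    move=> u; rewrite normrM; have /andP[k0 k1] := @kill_bounds s z (z - s * u) (ltW z0).
    by rewrite (ger0_norm k0) -[leRHS]mul1r; apply: ler_pM.
  rewrite -(ExZ _ Lk); apply: le_Ex => //; first exact: L1Z.
  move=> u; move: (z - s * u) => y; rewrite mulrCA; case: (ltP 0 y) => y0; last first.
    by rewrite /kill ltNge y0 /= !mul0r.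
  apply: ler_wpM2l; first by case/andP: (@kill_bounds s z y (ltW z0)).
  rewrite /lin_gauss mulrCA [leRHS]mulrCA ler_wpM2l ?(ltW y0)// -!expRD ler_expR.
  set al := l - c / s.
  have : 0 <= (al - 2 * de * y) ^+ 2 / (4 * de) by rewrite divr_ge0 ?sqr_ge0 ?mulr_ge0// ltW.
  have -> : (al - 2 * de * y) ^+ 2 / (4 * de) = al ^+ 2 / (4 * de) - al * y + de * y ^+ 2 by field; rewrite gt_eqF.
  lra.
have QS : gS <= Ex gm (fun u => H (z - s * u)).
  rewrite -(@kill_odd s z _ _ s0 mH oH HM); apply: le_Ex => //.
    apply: (@L1_bounded _ _ _ _ _ M).
      apply: measurable_funM; [apply: (measurableT_comp (measurable_kill s z))|apply: (measurableT_comp mH)]; exact: measurable_affine.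
    move=> u; rewrite normrM; have /andP[k0 k1] := @kill_bounds s z (z - s * u) (ltW z0).
    by rewrite (ger0_norm k0) -[leRHS]mul1r; apply: ler_pM.
  move=> u; move: (z - s * u) => y; case: (ltP 0 y) => y0; last by rewrite /kill ltNge y0 /= !mul0r.
  apply: ler_wpM2l; first by case/andP: (@kill_bounds s z y (ltW z0)).
  rewrite ler_piMl//; first by rewrite H0// ltW.
  by rewrite -[leRHS]expR0 ler_expR oppr_le0 mulr_ge0// ltW.
have gS0 : 0 <= gS.
  apply: Ex_ge0 => u; move: (z - s * u) => y; case: (ltP 0 y) => y0; last by rewrite /kill ltNge y0 /= !mul0r.
  apply: mulr_ge0; first by case/andP: (@kill_bounds s z y (ltW z0)).
  by apply: mulr_ge0; [exact: expR_ge0|exact: H0 (ltW y0)].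
pose F := A * p * (kc * gF); pose S := A * (kc * gS).
have quad t' : 2 * t' * F - t' ^+ 2 * S <= a.
  rewrite /F /S -Eg -EH.
  have -> : forall e1 e2 : R, 2 * t' * (A * p * e1) - t' ^+ 2 * (A * e2) = (2 * t' * (A * p)) * e1 - (t' ^+ 2 * A) * e2 by move=> *; ring.
  rewrite -(ExZ _ Lg1) -(ExZ _ LH1) -(ExB (L1Z _ Lg1) (L1Z _ LH1)).
  apply: le_Ex => //; first by apply: L1B; exact: L1Z.
  move=> u; rewrite (_ : x + (z + c * s) - s * u = x + (z + c * s - s * u)); last by ring.
  move: (z + c * s - s * u) => y.
  case: (ltP 0 y) => y0; last first.
    rewrite {1 2}/kill ltNge y0 /= !mul0r !mulr0 subrr; by case/andP: (w01 (x + y)).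
  have /andP[k0 k1] := @kill_bounds s z y (ltW z0).
  have := IH y t' y0; have /andP[w0 w1] := w01 (x + y).
  have -> : 2 * t' * (A * p) * (kill s z y * (expR (- (l * y)) * lin_gauss th y)) - t' ^+ 2 * A * (kill s z y * (expR (- (l * y)) * H y)) =
    kill s z y * (2 * t' * (A * expR (- (l * y)) * (p * lin_gauss th y)) - t' ^+ 2 * (A * expR (- (l * y)) * H y)) by ring.
  move: (kill s z y) k0 k1 (w (x + y)) w0 w1 => k k0 k1 W W0 W1 h.
  by apply: le_trans (ler_wpM2l k0 h) _; rewrite ler_piMl.
have r0 : 0 <= r.
  rewrite /r /damping invr_ge0; apply: addr_ge0 => //.
  by apply: mulr_ge0; [rewrite mulr_ge0 ?sqr_ge0|exact/ltW/addr_gt0].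
have lz0 : 0 <= lin_gauss ((th + de) * r) z by rewrite lin_gauss_ge0// ltW.
have lz1 : 0 <= lin_gauss th' z by rewrite lin_gauss_ge0// ltW.
have lz2 : lin_gauss th' z <= lin_gauss ((th + de) * r) z.
  by rewrite /lin_gauss ler_wpM2l ?(ltW z0)// ler_expR lerN2 ler_wpM2r ?sqr_ge0.
have f'F : 0 <= f' <= 2 * F.
  rewrite /f' /A'; apply/andP; split.
    by apply: mulr_ge0; [rewrite !mulr_ge0 ?expR_ge0|exact: mulr_ge0].
  apply: (@le_trans _ _ (2 * expR (- (c ^+ 2 / 2)) * A * expR (- (c / s * z)) *
    (p * expR (- ((l - c / s) ^+ 2 / (4 * de))) * (r * Num.sqrt r) * lin_gauss ((th + de) * r) z))).
    by rewrite ler_wpM2l ?mulr_ge0 ?expR_ge0// ler_pM.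
  have -> : 2 * expR (- (c ^+ 2 / 2)) * A * expR (- (c / s * z)) *
    (p * expR (- ((l - c / s) ^+ 2 / (4 * de))) * (r * Num.sqrt r) * lin_gauss ((th + de) * r) z) =
    2 * (A * p * (kc * (expR (- ((l - c / s) ^+ 2 / (4 * de))) * (r * Num.sqrt r * lin_gauss ((th + de) * r) z)))) by rewrite /kc; ring.
  by rewrite ler_wpM2l// ler_wpM2l ?mulr_ge0// ler_wpM2l.
have F0 : 0 <= F by case/andP: f'F; lra.
have S0 : 0 <= S by rewrite mulr_ge0// mulr_ge0.
have hFS : F ^+ 2 <= a * S by apply: sqr_le_of_quadratic => //; case/andP: a01.
have := @second_moment_combine a F S f' t a01 f'F S0 hFS.
apply: le_trans; rewrite lerD2l lerN2 ler_wpM2l ?sqr_ge0//.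
have -> : A' * expR (- (c / s * z)) * H' = 2 * A * kc * H' by rewrite /A' /kc; ring.
have -> : 2 * S + f' ^+ 2 / 2 = 2 * A * kc * (gS + A' * expR (- (c / s * z)) * (p' * lin_gauss th' z) ^+ 2 / 2).
  by rewrite /S /f' /A' /kc; field.
rewrite ler_wpM2l ?mulr_ge0//; apply: le_trans hH'; by rewrite lerD2r.
Qed.

End KilledKernel.

(** * One-level inequalities for width and amplitude of the barrier profile *)

Section BarrierProfile.
Context {R : realType}.

(** Slightly less than the true variance y^2. The gap y/6 grows with y, which frees a positive [de]
    at each level to absorb the change of rate. *)
Definition profile_var (y : R) : R := y ^+ 2 - y / 6.

Lemma profile_var_bounds (y : R) : 1 / 2 <= y -> 2 / 3 * y ^+ 2 <= profile_var y <= y ^+ 2 /\ 1 / 6 <= profile_var y.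
Proof. by move=> y2; rewrite /profile_var; split; [apply/andP; split|]; nra. Qed.

Lemma sqrt_step_bounds (y y' s2 : R) : 1 / 2 <= y -> 0 <= y' -> y' ^+ 2 = y ^+ 2 + s2 -> 1 / 2 <= s2 <= 1 ->
  [/\ y < y', y' <= 3 * y, y' - y <= 4 * profile_var y & 1 <= 4 * y' * (y' - y)].
Proof.
move=> y2 y'0 e /andP[s1 s2b]; have [/andP[v1 v2] v6] := profile_var_bounds y2.
have yy : y < y' by rewrite -(ltr_pXn2r (n := 2)) ?nnegrE//; lra.
split => //.
- by rewrite -(ler_pXn2r (n := 2)) ?nnegrE//; nra.
- rewrite lerBlDr -(ler_pXn2r (n := 2)) ?nnegrE//; last by lra.
  rewrite e; have : 1 <= 8 * y * profile_var y + 16 * profile_var y ^+ 2 by nra.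
  have -> : (4 * profile_var y + y) ^+ 2 = y ^+ 2 + (8 * y * profile_var y + 16 * profile_var y ^+ 2) by ring.
  lra.
- have : y' ^+ 2 - y ^+ 2 = (y' - y) * (y' + y) by ring.
  nra.
Qed.

Lemma expRN_le_1B (x : R) : 0 <= x <= 2 / 3 -> expR (- (3 * x)) <= 1 - x.
Proof.
move=> /andP[x0 x1]; have x1p : 0 < 1 - x by lra.
rewrite expRN -[leRHS]invrK lef_pV2 ?posrE ?expR_gt0 ?invr_gt0//.
apply: le_trans (_ : 1 + x / (1 - x) <= _).
  by rewrite le_eqVlt; apply/orP; left; apply/eqP; field; lra.
apply: le_trans (expR_ge1Dx _) _; rewrite ler_expR ler_pdivrMr//; nra.
Qed.

(** Near the leaves the rate changes by at most K/y'^4. Both this mismatch and the missing variance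
    then lose a multiple of (y' - y)/(y y') in the exponent, which telescopes as 1/y - 1/y'. *)
Lemma bottom_step (K y y' s2 al : R) : 2 <= K -> 1 / 2 <= y -> 0 <= y' -> y' ^+ 2 = y ^+ 2 + s2 -> 1 / 2 <= s2 <= 1 ->
  0 <= al -> al * y' ^+ 4 <= K ->
  let v := profile_var y in let w := profile_var y' - s2 in let de := (w^-1 - v^-1) / 2 in
  [/\ 0 < w, 0 < de & expR (50 * K ^+ 2 / y' - 50 * K ^+ 2 / y) <= expR (- (al ^+ 2 / (4 * de))) * (w / v * Num.sqrt (w / v))].
Proof.
move=> K2 y2 y'0 ey hs al0 hal v w de.
have [/andP[v1 v2] v6] := profile_var_bounds y2.
have [yy y3 e4 e1] := sqrt_step_bounds y2 y'0 ey hs.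
rewrite -/v in v1 v2 v6 e4.
have y0 : 0 < y by lra.
have y'p : 0 < y' by lra.
have v0 : 0 < v by lra.
have wE : w = v - (y' - y) / 6 by rewrite /w /v /profile_var ey; field.
have w3 : v / 3 <= w by rewrite wE; lra.
have w0 : 0 < w by lra.
have wv : w < v by rewrite wE; lra.
have de0 : 0 < de by rewrite divr_gt0// subr_gt0 ltf_pV2 ?posrE.
split => //.
set e := y' - y in e4 e1 wE *.
have e0 : 0 < e by rewrite /e subr_gt0.
have dE : (4 * de)^-1 = 3 * v * w / e.
  have vwe : v - w = e / 6 by rewrite wE; ring.
  have -> : e = 6 * (v - w) by rewrite vwe; field.
  by rewrite /de; field; rewrite !gt_eqF//; lra.
have b1 : al ^+ 2 / (4 * de) <= 48 * K ^+ 2 * (e / (y * y')).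
  have h1 : al ^+ 2 / (4 * de) <= 3 * (al * v) ^+ 2 / e.
    rewrite dE mulrA ler_wpM2r ?invr_ge0 ?(ltW e0)//.
    have -> : 3 * (al * v) ^+ 2 = al ^+ 2 * (3 * v * v) by ring.
    by rewrite ler_wpM2l ?sqr_ge0// ler_wpM2l ?(ltW wv)//; lra.
  apply: le_trans h1 _; rewrite ler_pdivrMr//.
  have h2 : al * v <= K / y' ^+ 2.
    rewrite ler_pdivlMr ?exprn_gt0//; apply: le_trans hal.
    rewrite -mulrA ler_wpM2l//; have -> : y' ^+ 4 = y' ^+ 2 * y' ^+ 2 by ring.
    by rewrite ler_wpM2r ?sqr_ge0//; apply: le_trans v2 _; rewrite lerXn2r ?nnegrE ?(ltW y0)// ltW.
  have h3 : (al * v) ^+ 2 <= K ^+ 2 / y' ^+ 4.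
    have -> : K ^+ 2 / y' ^+ 4 = (K / y' ^+ 2) ^+ 2 by field; rewrite gt_eqF.
    by rewrite lerXn2r ?nnegrE//; [rewrite mulr_ge0// ltW|rewrite divr_ge0 ?sqr_ge0//; lra].
  apply: (@le_trans _ _ (3 * (K ^+ 2 / y' ^+ 4))); first by rewrite ler_wpM2l.
  have h4 : 1 <= 16 * y' ^+ 2 * e ^+ 2.
    have -> : 16 * y' ^+ 2 * e ^+ 2 = (4 * y' * e) ^+ 2 by ring.
    by rewrite -[leLHS](expr1n _ 2) lerXn2r ?nnegrE// !mulr_ge0 // ltW.
  have h5 : y / y' <= 1 by rewrite ler_pdivrMr// mul1r ltW.
  apply: (@le_trans _ _ (3 * K ^+ 2 / y' ^+ 4 * (16 * y' ^+ 2 * e ^+ 2))).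
    have z : 0 <= 3 * K ^+ 2 / y' ^+ 4 by rewrite divr_ge0 ?exprn_ge0// mulr_ge0 ?sqr_ge0.
    by rewrite mulrA ler_peMr.
  have -> : 3 * K ^+ 2 / y' ^+ 4 * (16 * y' ^+ 2 * e ^+ 2) = 48 * K ^+ 2 * e ^+ 2 / (y' * y') by field; rewrite gt_eqF.
  have -> : 48 * K ^+ 2 * (e / (y * y')) * e = 48 * K ^+ 2 * e ^+ 2 / (y * y') by field; rewrite !gt_eqF.
  have z : 0 <= 48 * K ^+ 2 * e ^+ 2 by rewrite mulr_ge0 ?sqr_ge0// mulr_ge0 ?sqr_ge0.
  by apply: (ler_wpM2l z); rewrite lef_pV2 ?posrE ?mulr_gt0// ler_wpM2r// ltW.
have b2 : expR (- (9 / 2 * (e / (6 * v)))) <= w / v * Num.sqrt (w / v).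
  have x01 : 0 <= e / (6 * v) <= 2 / 3.
    by rewrite divr_ge0 ?ler_pdivrMr ?mulr_gt0 ?mulr_ge0 ?(ltW e0) ?(ltW v0)//; lra.
  have := expRN_le_1B x01; have -> : 1 - e / (6 * v) = w / v by rewrite wE; field; rewrite gt_eqF.
  set x := e / _ => hx.
  have -> : - (9 / 2 * x) = - (3 * x) + (- (3 * x) / 2) by field.
  rewrite expRD; apply: ler_pM; rewrite ?expR_ge0//.
  rewrite -(ler_pXn2r (n := 2)) ?nnegrE ?expR_ge0 ?sqrtr_ge0// sqr_sqrtr; last by rewrite divr_ge0// ltW.
  by rewrite expr2 -expRD -splitr.
have b3 : 9 / 2 * (e / (6 * v)) <= 27 / 8 * (e / (y * y')).
  have -> : 9 / 2 * (e / (6 * v)) = 3 / 4 * (e / v) by field; rewrite gt_eqF.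
  have : v^-1 <= 9 / 2 * (y * y')^-1.
    have yy0 : 0 < y * y' by rewrite mulr_gt0.
    rewrite -div1r ler_pdivrMr// mulrAC ler_pdivlMr// mul1r.
    have : y * y' <= 3 * y ^+ 2 by nra.
    lra.
  move=> /(ler_wpM2l (ltW e0)); lra.
have -> : 50 * K ^+ 2 / y' - 50 * K ^+ 2 / y = - (50 * K ^+ 2 * (e / (y * y'))) by rewrite /e; field; rewrite !gt_eqF.
apply: le_trans (ler_wpM2l (expR_ge0 _) b2); rewrite -expRD ler_expR.
have : 0 <= e / (y * y') by rewrite divr_ge0 ?mulr_ge0// ltW.
have : 2 <= K ^+ 2 by nra.
move: b1 b3; move: (al ^+ 2 / _) (9 / 2 * _) (e / (y * y')) (K ^+ 2) => a1 a2 X Q; nra.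
Qed.

Lemma top_step (K x x' s2 al thm : R) : 0 <= K -> 4 <= x -> 0 <= x' -> x' ^+ 2 = x ^+ 2 + 1 -> 0 <= s2 <= 3 / 2 -> 0 <= al -> al * x ^+ 4 <= K ->
  0 <= thm ->
  let de := x ^- 3 - x' ^- 3 in let r := (1 + 2 * s2 * (thm + x ^- 3))^-1 in
  [/\ 0 < de, 0 <= r <= 1 & expR (- (9 / 2 * thm) - (K ^+ 2 + 14) / x + (K ^+ 2 + 14) / x') <= expR (- (al ^+ 2 / (4 * de))) * (r * Num.sqrt r)].
Proof.
move=> K0 x4 x'0 ex /andP[s0 s1] al0 hal t0 de r.
have xp : 0 < x by lra.
have xx : x < x' by rewrite -(ltr_pXn2r (n := 2)) ?nnegrE//; lra.
have x1 : x' <= 26 / 25 * x by rewrite -(ler_pXn2r (n := 2)) ?nnegrE//; nra.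
have x'p : 0 < x' by lra.
have xi3 : 0 < x ^- 3 by rewrite invr_gt0 exprn_gt0.
have d1 : (x' - x) * (x' + x) = 1 by rewrite (_ : (x' - x) * (x' + x) = x' ^+ 2 - x ^+ 2); [lra|ring].
have d2 : 25 / 51 * x^-1 <= x' - x.
  have xi : x * x^-1 = 1 by rewrite divff// gt_eqF.
  have xi0 : 0 < x^-1 by rewrite invr_gt0.
  have : x^-1 = (x' - x) * ((x' + x) / x) by rewrite mulrA d1 mul1r.
  have : (x' + x) / x <= 51 / 25 by rewrite ler_pdivrMr//; lra.
  move: ((x' + x) / x) => q hq hx.
  have : (x' - x) * q <= (x' - x) * (51 / 25) by rewrite ler_wpM2l// subr_ge0 ltW.
  lra.
have de5 : x ^- 5 <= de.
  have xn : x != 0 by rewrite gt_eqF.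
  have x'n : x' != 0 by rewrite gt_eqF.
  have -> : de = (x' - x) * (x' ^+ 2 + x' * x + x ^+ 2) / (x ^+ 3 * x' ^+ 3) by rewrite /de; field; rewrite xn x'n.
  rewrite ler_pdivlMr ?mulr_gt0 ?exprn_gt0//.
  have -> : x ^- 5 * (x ^+ 3 * x' ^+ 3) = x^-1 * ((x' / x) ^+ 3 * x ^+ 2) by field.
  have h1 : (x' / x) ^+ 3 <= (26 / 25) ^+ 3.
    by rewrite lerXn2r ?nnegrE ?divr_ge0 ?ler_pdivrMr// ltW.
  apply: (@le_trans _ _ (x^-1 * (9 / 8 * x ^+ 2))).
    by rewrite ler_wpM2l ?invr_ge0 ?(ltW xp)// ler_wpM2r ?sqr_ge0//; apply: le_trans h1 _; lra.
  apply: (@le_trans _ _ (25 / 51 * x^-1 * (3 * x ^+ 2))).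
    have -> : 25 / 51 * x^-1 * (3 * x ^+ 2) = x^-1 * (75 / 51 * x ^+ 2) by field.
    by rewrite ler_wpM2l ?invr_ge0 ?(ltW xp)// ler_wpM2r ?sqr_ge0//; lra.
  by apply: ler_pM => //; rewrite ?mulr_ge0 ?invr_ge0 ?sqr_ge0 ?(ltW xp)//; nra.
have x5 : 0 < x ^- 5 by rewrite invr_gt0 exprn_gt0.
have de0 : 0 < de by apply: lt_le_trans de5.
have q0 : 0 <= 2 * s2 * (thm + x ^- 3) by rewrite !mulr_ge0// addr_ge0// ltW.
have r0 : 0 < r by rewrite invr_gt0; lra.
split => //; first by rewrite ltW//= invf_le1; lra.
have b1 : al ^+ 2 / (4 * de) <= K ^+ 2 / 4 * x ^- 3.
  rewrite ler_pdivrMr ?mulr_gt0//.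
  apply: (@le_trans _ _ (K ^+ 2 * x ^- 8)).
    have : al <= K * x ^- 4 by rewrite ler_pdivlMr ?exprn_gt0.
    move=> h; have -> : K ^+ 2 * x ^- 8 = (K * x ^- 4) ^+ 2 by field; rewrite gt_eqF.
    by rewrite lerXn2r ?nnegrE// mulr_ge0// invr_ge0 exprn_ge0// ltW.
  have -> : K ^+ 2 * x ^- 8 = K ^+ 2 / 4 * x ^- 3 * (4 * x ^- 5) by field; rewrite gt_eqF.
  by rewrite ler_wpM2l ?mulr_ge0 ?(ltW xi3)// ler_wpM2l.
have b2 : expR (- (9 / 2 * (thm + x ^- 3))) <= r * Num.sqrt r.
  set q := thm + x ^- 3 in q0 *.
  have hq : expR (- (3 * q)) <= r.
    have q1 : 0 < 1 + 2 * s2 * q by lra.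
    rewrite expRN /r -/q lef_pV2 ?posrE ?expR_gt0//.
    apply: le_trans (expR_ge1Dx _); rewrite lerD2l ler_wpM2r//; last by lra.
    by rewrite addr_ge0// ltW.
  have -> : - (9 / 2 * q) = - (3 * q) + (- (3 * q) / 2) by field.
  rewrite expRD; apply: ler_pM; rewrite ?expR_ge0//.
  rewrite -(ler_pXn2r (n := 2)) ?nnegrE ?expR_ge0 ?sqrtr_ge0// sqr_sqrtr; last exact: ltW.
  by rewrite expr2 -expRD -splitr.
apply: le_trans (ler_wpM2l (expR_ge0 _) b2); rewrite -expRD ler_expR.
have b3 : 1 / 3 * x ^- 3 <= x^-1 - x'^-1.
  have -> : x^-1 - x'^-1 = (x' - x) / (x * x') by field; rewrite !gt_eqF.
  rewrite ler_pdivlMr ?mulr_gt0//; apply: le_trans d2.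
  have -> : 1 / 3 * x ^- 3 * (x * x') = 1 / 3 * (x' / x) * x^-1 by field; rewrite gt_eqF.
  rewrite ler_wpM2r ?invr_ge0 ?(ltW xp)//.
  have : x' / x <= 26 / 25 by rewrite ler_pdivrMr.
  lra.
have KK : 0 <= K ^+ 2 by exact: sqr_ge0.
move: b1 b3; move: (x ^- 3) xi3 (al ^+ 2 / (4 * de)) x^-1 x'^-1 (K ^+ 2) KK => X X0 Y Z Z' Q Q0; nra.
Qed.

Lemma rate_diff (s s' d d' c : R) : 1 / 2 <= s ^+ 2 -> 0 <= s -> 1 / 2 <= s' ^+ 2 -> 0 <= s' ->
  s ^+ 2 = 1 - d -> s' ^+ 2 = 1 - d' -> d' <= d -> 0 <= c <= 2 ->
  0 <= c / s - c / s' <= 4 * (d - d').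
Proof.
move=> h1 s0 h1' s0' e e' dd /andP[c0 c2].
have q (t : R) : 1 / 2 <= t ^+ 2 -> 0 <= t -> 1 / 2 < t by move=> *; nra.
have sp := q s h1 s0; have sp' := q s' h1' s0'.
have ss : 1 / 2 <= s * s'.
  rewrite -(ler_pXn2r (n := 2)) ?nnegrE ?mulr_ge0//; rewrite exprMn; nra.
have -> : c / s - c / s' = c * ((d - d') / (s * s' * (s + s'))).
  have -> : d - d' = s' ^+ 2 - s ^+ 2 by lra.
  by field; rewrite !gt_eqF//; lra.
have D0 : 1 / 2 <= s * s' * (s + s') by nra.
have i0 : 0 <= (d - d') / (s * s' * (s + s')) by rewrite divr_ge0//; lra.
have i1 : (d - d') / (s * s' * (s + s')) <= 2 * (d - d').
  rewrite ler_pdivrMr; last by lra.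
  have : 0 <= d - d' by lra.
  move: (d - d') (s * s' * _) D0 => a b; nra.
apply/andP; split; first exact: mulr_ge0.
have : 0 <= d - d' by lra.
move: (_ / _) i0 i1 => X X0 X1; nra.
Qed.

End BarrierProfile.

Section ThreeHalves.
Context {R : realType}.

Definition p32 (x : R) : R := x * Num.sqrt x.

Lemma p32_ge0 x : 0 <= x -> 0 <= p32 x.
Proof. by move=> x0; rewrite mulr_ge0 ?sqrtr_ge0. Qed.

Lemma p32_gt0 x : 0 < x -> 0 < p32 x.
Proof. by move=> x0; rewrite mulr_gt0 ?sqrtr_gt0. Qed.

Lemma le_p32 x y : 0 <= x -> x <= y -> p32 x <= p32 y.
Proof. by move=> x0 xy; apply: ler_pM; rewrite ?sqrtr_ge0// ler_wsqrtr. Qed.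

Lemma p32M x y : 0 <= x -> p32 (x * y) = p32 x * p32 y.
Proof. by move=> x0; rewrite /p32 sqrtrM//; ring. Qed.

Lemma p32V x : 0 <= x -> p32 x^-1 = (p32 x)^-1.
Proof. by move=> x0; rewrite /p32 sqrtrV// invfM. Qed.

Lemma p32_sqr x : 0 <= x -> p32 (x ^+ 2) = x ^+ 3.
Proof. by move=> x0; rewrite /p32 sqrtr_sqr ger0_norm// -exprSr. Qed.

Lemma p32_inv_sum (k : nat) : \sum_(1 <= i < k.+1) p32 i%:R^-1 <= 3 :> R.
Proof.
suff : \sum_(1 <= i < k.+2) p32 i%:R^-1 <= 3 - 2 / Num.sqrt k.+1%:R :> R.
  rewrite big_nat_recr//= => h.
  have h1 : 0 <= p32 k.+1%:R^-1 :> R by rewrite p32_ge0.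
  have h2 : 0 <= 2 / Num.sqrt k.+1%:R :> R by rewrite divr_ge0 ?sqrtr_ge0.
  lra.
elim: k => [|k ih]; first by rewrite big_nat1 invr1 /p32 sqrtr1; lra.
rewrite big_nat_recr//=.
have e : Num.sqrt k.+2%:R ^+ 2 = Num.sqrt k.+1%:R ^+ 2 + 1 :> R by rewrite !sqr_sqrtr// -[k.+2%:R]natr1.
have x0 : 0 < Num.sqrt k.+1%:R :> R by rewrite sqrtr_gt0.
have y0 : 0 < Num.sqrt k.+2%:R :> R by rewrite sqrtr_gt0.
have -> : p32 k.+2%:R^-1 = Num.sqrt k.+2%:R ^- 3 :> R by rewrite p32V// /p32 -{1}(@sqr_sqrtr R k.+2%:R)// -exprSr.
suff h (x y : R) : 0 < x -> 0 < y -> y ^+ 2 = x ^+ 2 + 1 -> y ^- 3 <= 2 / x - 2 / y by have := h _ _ x0 y0 e; lra.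
move=> {}x0 {}y0 {}e.
have xy : x < y by rewrite -(ltr_pXn2r (n := 2)) ?nnegrE ?(ltW x0) ?(ltW y0)//; lra.
have -> : 2 / x - 2 / y = 2 / (x * y * (x + y)).
  have d : (y - x) * (x + y) = 1 by rewrite (_ : (y - x) * (x + y) = y ^+ 2 - x ^+ 2); [lra|ring].
  by rewrite -[X in X / (_ * _ * _)]mulr1 -d; field; rewrite !gt_eqF//; lra.
rewrite ler_pdivlMr; last by rewrite !mulr_gt0// addr_gt0.
rewrite mulrC ler_pdivrMr ?exprn_gt0//.
have -> : y ^+ 3 = y * y * y by ring.
have : x * (x + y) <= y * (2 * y) by apply: ler_pM; lra.
nra.
Qed.

(* Convolution of the inverse 3/2 powers: one of the two factors is always at least [(k+1)/2]. *)
Lemma p32_conv_sum (k : nat) : (0 < k)%N ->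
  \sum_(1 <= i < k.+1) p32 i%:R^-1 * p32 (k.+1 - i)%:R^-1 <= 18 * p32 k%:R^-1 :> R.
Proof.
move=> k0.
have K0 : 0 < k%:R :> R by rewrite ltr0n.
have h i : (1 <= i < k.+1)%N -> p32 i%:R^-1 * p32 (k.+1 - i)%:R^-1 <= 3 * p32 k%:R^-1 * (p32 i%:R^-1 + p32 (k.+1 - i)%:R^-1) :> R.
  move=> /andP[i1 ik].
  have j1 : (0 < k.+1 - i)%N by rewrite subn_gt0.
  have ij : (k < i + i \/ k < (k.+1 - i) + (k.+1 - i))%N by lia.
  have p3 (j : nat) : (0 < j)%N -> (k < j + j)%N -> p32 j%:R^-1 <= 3 * p32 k%:R^-1 :> R.
    move=> j0 kj; apply: (@le_trans _ _ (p32 (2 * k%:R^-1))).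
      apply: le_p32; first by rewrite invr_ge0.
      have J0 : 0 < j%:R :> R by rewrite ltr0n.
      rewrite -div1r ler_pdivrMr// mulrAC ler_pdivlMr// mul1r -natrM ler_nat; lia.
    rewrite p32M// ler_wpM2r ?p32_ge0 ?invr_ge0//.
    by rewrite /p32; have := sqr_sqrtr (ler0n R 2); have := sqrtr_ge0 (2 : R); move: (Num.sqrt 2) => q q0 q2; nra.
  have a0 : 0 <= p32 i%:R^-1 :> R by rewrite p32_ge0 ?invr_ge0.
  have b0 : 0 <= p32 (k.+1 - i)%:R^-1 :> R by rewrite p32_ge0 ?invr_ge0.
  have c0 : 0 <= p32 k%:R^-1 :> R by rewrite p32_ge0 ?invr_ge0.
  by case: ij => hh; have := p3 _ _ hh => /(_ ltac:(lia)) q; nra.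
apply: (@le_trans _ _ (\sum_(1 <= i < k.+1) 3 * p32 k%:R^-1 * (p32 i%:R^-1 + p32 (k.+1 - i)%:R^-1))).
  by rewrite big_nat [leRHS]big_nat; apply: ler_sum.
rewrite -mulr_sumr big_split/=.
have -> : \sum_(1 <= i < k.+1) p32 (k.+1 - i)%:R^-1 = \sum_(1 <= i < k.+1) p32 i%:R^-1 :> R.
  by rewrite [RHS]big_nat_rev/=; apply: eq_big_nat => i _; rewrite add1n.
have := p32_inv_sum k; have : 0 <= p32 k%:R^-1 :> R by rewrite p32_ge0 ?invr_ge0.
by move: (\sum_(_ <= _ < _) _) (p32 _) => S Q; nra.
Qed.

Lemma inv_sqr_sum (n : nat) : \sum_(q < n) q.+1%:R ^- 2 <= 2 :> R.
Proof.
suff : \sum_(q < n.+1) q.+1%:R ^- 2 <= 2 - n.+1%:R^-1 :> R.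
  rewrite big_ord_recr/= => h.
  have h1 : 0 <= n.+1%:R ^- 2 :> R by rewrite invr_ge0 exprn_ge0.
  have h2 : 0 <= n.+1%:R^-1 :> R by rewrite invr_ge0.
  apply: (@le_trans _ _ (2 - n.+1%:R^-1)); last by rewrite gerBl.
  by apply: le_trans h; rewrite lerDl.
elim: n => [|n ih]; first by rewrite big_ord_recr big_ord0/= expr1n invr1; lra.
rewrite big_ord_recr/=.
suff : n.+2%:R ^- 2 <= n.+1%:R^-1 - n.+2%:R^-1 :> R.
  by move=> h; apply: le_trans (lerD ih h) _; rewrite addrA subrK.
rewrite -[n.+2%:R]natr1; have : 0 < n.+1%:R :> R by [].
move: (n.+1%:R) => x x0.
have -> : x^-1 - (x + 1)^-1 = (x * (x + 1))^-1 by field; rewrite !gt_eqF//; lra.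
by rewrite lef_pV2 ?posrE ?exprn_gt0 ?mulr_gt0//; nra.
Qed.

End ThreeHalves.

(** * Profiles dominating the source of the second moment *)

Section Evolution.
Context {R : realType}.
Local Notation gm := (@sgauss R).

(** The profile of variance v after independent steps of total variance V, normalised so that a
    further convolution only adds to V. *)
Definition evolved (v V z : R) : R := p32 (v / (v + V)) * lin_gauss (1 / (2 * (v + V))) z.

Lemma evolved0 v z : 0 < v -> evolved v 0 z = lin_gauss (1 / (2 * v)) z.
Proof. by move=> v0; rewrite /evolved addr0 divff ?gt_eqF// /p32 sqrtr1 !mul1r. Qed.

Lemma evolved_conv (v V s z : R) : 0 < v -> 0 <= V -> 0 < s ->
  L1 gm (fun u => evolved v V (z - s * u)) /\ Ex gm (fun u => evolved v V (z - s * u)) = evolved v (V + s ^+ 2) z.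
Proof.
move=> v0 V0 s0.
have w0 : 0 < v + V by lra.
have s20 : 0 < s ^+ 2 by rewrite exprn_gt0.
have th0 : 0 < 1 / (2 * (v + V)) by rewrite divr_gt0// mulr_gt0.
have [L E] := lin_gauss_conv z s0 th0.
split; first exact: L1Z.
rewrite (ExZ _ L) E /evolved.
have dE : damping s (1 / (2 * (v + V))) = (v + V) / (v + V + s ^+ 2).
  by rewrite /damping; field; rewrite !gt_eqF//; lra.
rewrite dE -/(p32 _) mulrA -p32M; last by rewrite divr_ge0// ltW.
congr (p32 _ * lin_gauss _ _); field; rewrite !gt_eqF//; lra.
Qed.

Lemma evolvedN v V z : evolved v V (- z) = - evolved v V z.
Proof. by rewrite /evolved lin_gaussN mulrN. Qed.

Lemma evolved_ge0 v V z : 0 < v -> 0 <= V -> 0 <= z -> 0 <= evolved v V z.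
Proof. by move=> v0 V0 z0; rewrite mulr_ge0 ?lin_gauss_ge0// p32_ge0// divr_ge0//; lra. Qed.

Lemma measurable_evolved v V : measurable_fun setT (evolved v V).
Proof. by apply: measurable_funM => //; exact: measurable_lin_gauss. Qed.

Lemma evolved_bounded v V z : 0 < v -> 0 <= V -> `|evolved v V z| <= 2 * (v + V) + 1.
Proof.
move=> v0 V0; have w0 : 0 < v + V by lra.
rewrite /evolved normrM ger0_norm ?p32_ge0 ?divr_ge0 ?(ltW v0) ?(ltW w0)//.
have h := @lin_gauss_bounded R (1 / (2 * (v + V))) z ltac:(by rewrite divr_gt0// mulr_gt0).
rewrite invf_div divr1 in h; rewrite -[leRHS]mul1r; apply: ler_pM => //.
  by rewrite p32_ge0// divr_ge0// ltW.
apply: (@le_trans _ _ (p32 1)); last by rewrite /p32 sqrtr1 mulr1.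
by apply: le_p32; rewrite ?divr_ge0 ?ler_pdivrMr ?(ltW v0) ?(ltW w0)//; lra.
Qed.

Lemma evolved1_le v V : 0 < v -> 0 <= V -> evolved v V 1 <= p32 (v / (v + V)).
Proof.
move=> v0 V0; have w0 : 0 < v + V by lra.
rewrite /evolved ler_piMr//; first by rewrite p32_ge0// divr_ge0// ltW.
by rewrite /lin_gauss mul1r -[leRHS]expR0 ler_expR oppr_le0 mulr_ge0 ?sqr_ge0// divr_ge0// mulr_ge0// ltW.
Qed.

(** Dominates exp(-l z) times a squared profile. That square is not odd, so it is replaced by a
    combination of odd profiles of variances (q+1)^2, whose evolution is explicit. The power 5 beats
    the growth (q+1)^3 coming from [p32] of the variance by a summable margin. *)
Definition source (n : nat) (u V z : R) : R :=
  \sum_(q < n) q.+1%:R ^- 5 * evolved (q.+1%:R ^+ 2) V z + n%:R ^- 5 * evolved u V z.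

Definition source_cst : R := 4 * (expR 1 * 10 ^+ 5).

Lemma expRN_half_le (x : R) : 0 < x -> expR (- (x / 2)) <= 10 ^+ 5 * x ^- 5.
Proof.
move=> x0; rewrite expRN -[leRHS]invrK lef_pV2 ?posrE ?expR_gt0 ?invr_gt0 ?mulr_gt0 ?invr_gt0 ?exprn_gt0//.
have -> : (10 ^+ 5 * x ^- 5)^-1 = (x / 10) ^+ 5 by rewrite invfM invrK expr_div_n mulrC.
have -> : x / 2 = 5%:R * (x / 10) by field.
by rewrite expRM_natl lerXn2r ?nnegrE ?expR_ge0 ?divr_ge0 ?(ltW x0)//; have := expR_ge1Dx (x / 10); lra.
Qed.

(** Only the term with q the integer part of z is kept, and exp(-z/2) beats the fifth power; for z
    >= n the last term, with the Gaussian of [th] itself, takes over. In [source_cst], 4 comes from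
    z <= 4 exp(z/4), 10^5 from exp(-x/2) <= (10/x)^5, and e from two factors exp(1/2). *)
Lemma source_ge (n : nat) (l th z : R) : (0 < n)%N -> 3 / 4 <= l -> 0 < th -> 0 < z ->
  expR (- (l * z)) * lin_gauss th z ^+ 2 <= source_cst * source n (1 / (2 * th)) 0 z.
Proof.
move=> n0 l34 th0 z0.
have u0 : 0 < 1 / (2 * th) by rewrite divr_gt0// mulr_gt0.
have uE : 1 / (2 * (1 / (2 * th))) = th by field; rewrite gt_eqF.
have h1 : expR (- (l * z)) * z <= 4 * expR (- (z / 2)).
  have a : z <= 4 * expR (z / 4) by have := expR_ge1Dx (z / 4); lra.
  apply: (@le_trans _ _ (expR (- (l * z)) * (4 * expR (z / 4)))); first by rewrite ler_wpM2l ?expR_ge0.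
  by rewrite mulrCA -expRD ler_wpM2l// ler_expR; nra.
have q2 : lin_gauss th z ^+ 2 = z * (z * expR (- (th * z ^+ 2)) * expR (- (th * z ^+ 2))) by rewrite /lin_gauss; ring.
set g := expR (- (th * z ^+ 2)) in q2.
have g0 : 0 <= g by exact: expR_ge0.
have g1 : g <= 1 by rewrite -[leRHS]expR0 ler_expR oppr_le0 mulr_ge0 ?sqr_ge0 ?ltW.
have term_ge0 (q : 'I_n) : 0 <= q.+1%:R ^- 5 * evolved (q.+1%:R ^+ 2) 0 z.
  by rewrite mulr_ge0 ?invr_ge0 ?exprn_ge0// evolved_ge0 ?exprn_gt0// ltW.
have last_ge0 : 0 <= n%:R ^- 5 * evolved (1 / (2 * th)) 0 z.
  by rewrite mulr_ge0 ?invr_ge0 ?exprn_ge0// evolved_ge0// ltW.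
suff h2 : expR 1 * 10 ^+ 5 * source n (1 / (2 * th)) 0 z >= expR (- (z / 2)) * (z * g * g).
  rewrite q2 mulrA; apply: (@le_trans _ _ (4 * expR (- (z / 2)) * (z * g * g))).
    by rewrite ler_wpM2r// !mulr_ge0// ltW.
  by rewrite /source_cst -[leRHS]mulrA -[leLHS]mulrA ler_wpM2l.
have /andP[t1 t2] := truncn_itv (ltW z0); set q := Num.truncn z in t1 t2.
have e1 : 1 <= expR 1 :> R by rewrite -[leLHS]expR0 ler_expR.
case: (ltnP q n) => qn; last first.
  have zn : n%:R <= z by apply: le_trans t1; rewrite ler_nat.
  have N0 : 0 < n%:R :> R by rewrite ltr0n.
  apply: (@le_trans _ _ (expR 1 * 10 ^+ 5 * (n%:R ^- 5 * evolved (1 / (2 * th)) 0 z))); last first.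
    by rewrite ler_wpM2l ?mulr_ge0 ?expR_ge0 ?exprn_ge0// /source lerDr sumr_ge0.
  rewrite evolved0// uE /lin_gauss -/g.
  have h3 : expR (- (z / 2)) <= 10 ^+ 5 * n%:R ^- 5.
    by apply: le_trans (expRN_half_le N0); rewrite ler_expR; lra.
  rewrite (mulrA _ (n%:R ^- 5)) -(mulrA (expR 1)); apply: ler_pM; rewrite ?expR_ge0 ?mulr_ge0 ?(ltW z0)//.
    apply: le_trans h3 _; rewrite ler_peMl// mulr_ge0 ?invr_ge0 ?exprn_ge0//.
  by rewrite ler_piMr// mulr_ge0// ltW.
apply: (@le_trans _ _ (expR 1 * 10 ^+ 5 * (q.+1%:R ^- 5 * evolved (q.+1%:R ^+ 2) 0 z))); last first.
  rewrite ler_wpM2l ?mulr_ge0 ?expR_ge0 ?exprn_ge0// /source (bigD1 (Ordinal qn))//=.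
  by rewrite -addrA lerDl addr_ge0// sumr_ge0.
rewrite evolved0 ?exprn_gt0// /lin_gauss.
have q0 : 0 < q.+1%:R :> R by [].
have h3 : expR (- (z / 2)) <= expR (1 / 2) * (10 ^+ 5 * q.+1%:R ^- 5).
  apply: le_trans (ler_wpM2l (expR_ge0 _) (expRN_half_le q0)).
  by rewrite -expRD ler_expR -[q.+1%:R]natr1; lra.
have h4 : 1 <= expR (1 / 2) * expR (- (1 / (2 * q.+1%:R ^+ 2) * z ^+ 2)).
  rewrite -expRD -[leLHS]expR0 ler_expR.
  have : z ^+ 2 <= q.+1%:R ^+ 2 by rewrite lerXn2r ?nnegrE ?(ltW z0) ?(ltW t2).
  move=> zq; rewrite subr_ge0 mulrAC mul1r ler_pdivrMr ?mulr_gt0 ?exprn_gt0//.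
  by rewrite mul1r mulrA mulVf ?mul1r.
set G := expR (- (1 / _ * _)) in h4 *.
have -> : expR 1 * 10 ^+ 5 * (q.+1%:R ^- 5 * (z * G)) = expR (1 / 2) * (10 ^+ 5 * q.+1%:R ^- 5) * (z * (expR (1 / 2) * G)).
  have -> : expR 1 = expR (1 / 2) * expR (1 / 2) :> R by rewrite -expRD; congr expR; field.
  ring.
apply: ler_pM; rewrite ?expR_ge0 ?mulr_ge0 ?(ltW z0)//.
rewrite -mulrA ler_wpM2l ?(ltW z0)//; apply: le_trans h4; nra.
Qed.

Lemma source1_le (n : nat) (u V : R) : (0 < n)%N -> 0 < u -> 0 <= V ->
  source n u V 1 <= 2 * p32 (1 + V)^-1 + n%:R ^- 5.
Proof.
move=> n0 u0 V0.
have V1 : 0 < 1 + V by lra.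
apply: lerD; last first.
  rewrite ler_piMr ?invr_ge0 ?exprn_ge0//; apply: le_trans (evolved1_le u0 V0) _.
  apply: (@le_trans _ _ (p32 1)); last by rewrite /p32 sqrtr1 mulr1.
  by apply: le_p32; rewrite ?divr_ge0 ?ler_pdivrMr//; lra.
apply: (@le_trans _ _ (\sum_(q < n) q.+1%:R ^- 2 * p32 (1 + V)^-1)); last first.
  by rewrite -mulr_suml ler_wpM2r ?inv_sqr_sum// p32_ge0// invr_ge0 ltW.
apply: ler_sum => q _.
have q1 : 1 <= q.+1%:R :> R by rewrite ler1n.
have q0 : 0 < q.+1%:R :> R by [].
have q20 : 0 < q.+1%:R ^+ 2 :> R by rewrite exprn_gt0.
apply: (@le_trans _ _ (q.+1%:R ^- 5 * (p32 (q.+1%:R ^+ 2) * p32 (1 + V)^-1))).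
  rewrite ler_wpM2l ?invr_ge0 ?exprn_ge0//; apply: le_trans (evolved1_le q20 V0) _.
  rewrite -p32M ?sqr_ge0//; apply: le_p32; first by rewrite divr_ge0// ?addr_ge0// ltW.
  have qV : 0 < q.+1%:R ^+ 2 + V by lra.
  rewrite ler_wpM2l ?(ltW q20)// lef_pV2 ?posrE//.
  by rewrite lerD2r -[leLHS](expr1n _ 2) lerXn2r ?nnegrE.
rewrite p32_sqr ?(ltW q0)// mulrA ler_wpM2r ?p32_ge0 ?invr_ge0 ?(ltW V1)//.
by rewrite le_eqVlt; apply/orP; left; apply/eqP; field; rewrite gt_eqF.
Qed.

Lemma source_conv (n : nat) (u V s z : R) : 0 < u -> 0 <= V -> 0 < s ->
  L1 gm (fun t => source n u V (z - s * t)) /\ Ex gm (fun t => source n u V (z - s * t)) = source n u (V + s ^+ 2) z.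
Proof.
move=> u0 V0 s0.
have h (q : nat) : L1 gm (fun t => q.+1%:R ^- 5 * evolved (q.+1%:R ^+ 2) V (z - s * t)) /\
    Ex gm (fun t => q.+1%:R ^- 5 * evolved (q.+1%:R ^+ 2) V (z - s * t)) = q.+1%:R ^- 5 * evolved (q.+1%:R ^+ 2) (V + s ^+ 2) z.
  have q0 : 0 < q.+1%:R ^+ 2 :> R by rewrite exprn_gt0.
  have [L E] := evolved_conv z q0 V0 s0; split; first exact: L1Z.
  by rewrite (ExZ _ L) E.
have [Lu Eu] := evolved_conv z u0 V0 s0.
have LS : L1 gm (fun t => \sum_(q < n) q.+1%:R ^- 5 * evolved (q.+1%:R ^+ 2) V (z - s * t)).
  by apply: L1_sum => q; case: (h q).
split; first by apply: L1D => //; exact: L1Z.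
rewrite /source (ExD LS (L1Z _ Lu)) (ExZ _ Lu) Eu Ex_sum; last by move=> q; case: (h q).
by congr (_ + _); apply: eq_bigr => q _; case: (h q).
Qed.

Lemma sourceN n u V z : source n u V (- z) = - source n u V z.
Proof.
rewrite /source evolvedN mulrN opprD -sumrN; congr (_ + _).
by apply: eq_bigr => q _; rewrite evolvedN mulrN.
Qed.

Lemma source_ge0 n u V z : 0 < u -> 0 <= V -> 0 <= z -> 0 <= source n u V z.
Proof.
move=> u0 V0 z0; rewrite addr_ge0 ?sumr_ge0// => [q _|]; rewrite mulr_ge0 ?invr_ge0 ?exprn_ge0// evolved_ge0//.
Qed.

Lemma measurable_source n u V : measurable_fun setT (source n u V).
Proof.
apply: measurable_funD; last by apply: measurable_funM => //; exact: measurable_evolved.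
by apply: measurable_sum => q; apply: measurable_funM => //; exact: measurable_evolved.
Qed.

Lemma source_bounded n u V : 0 < u -> 0 <= V -> exists M, forall z, `|source n u V z| <= M.
Proof.
move=> u0 V0.
exists (\sum_(q < n) q.+1%:R ^- 5 * (2 * (q.+1%:R ^+ 2 + V) + 1) + n%:R ^- 5 * (2 * (u + V) + 1)) => z.
apply: le_trans (ler_normD _ _) _; apply: lerD.
  apply: le_trans (ler_norm_sum _ _ _) _; apply: ler_sum => q _.
  rewrite normrM ger0_norm ?invr_ge0 ?exprn_ge0// ler_wpM2l ?invr_ge0 ?exprn_ge0// evolved_bounded//.
by rewrite normrM ger0_norm ?invr_ge0 ?exprn_ge0// ler_wpM2l ?invr_ge0 ?exprn_ge0// evolved_bounded.
Qed.

End Evolution.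

(** * Level variances, rates, amplitudes and widths *)

Section Schedule.
Context {R : realType}.
Variable m : nat.
Hypothesis m0 : (0 < m)%N.

(* Variance deficit of level [i.+1]: summable squares, antisymmetric, and with partial sums growing like [8 ln i]. *)
Definition var_deficit (i : nat) : R := 8 / (i%:R + 16) - 8 / (((m + m).-1 - i)%N%:R + 16).

Definition level_sd (k : nat) : R := Num.sqrt (1 - var_deficit k.-1).

Lemma var_deficit_bounds i : - (1 / 2) <= var_deficit i <= 1 / 2.
Proof.
have h (j : nat) : 0 <= 8 / (j%:R + 16 : R) <= 1 / 2.
  have j0 : (0 : R) <= j%:R by [].
  by apply/andP; split; [rewrite divr_ge0// addr_ge0|rewrite ler_pdivrMr; lra].
rewrite /var_deficit; have := h i; have := h ((m + m).-1 - i)%N.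
by move: (8 / _) (8 / _) => x y /andP[? ?] /andP[? ?]; apply/andP; split; lra.
Qed.

Lemma level_sd_sqr k : level_sd k ^+ 2 = 1 - var_deficit k.-1.
Proof. by rewrite sqr_sqrtr//; have := var_deficit_bounds k.-1; lra. Qed.

Lemma level_sd_sqr_bounds k : 1 / 2 <= level_sd k ^+ 2 <= 3 / 2.
Proof. by rewrite level_sd_sqr; have := var_deficit_bounds k.-1; lra. Qed.

Lemma level_sd_bounds k : 7 / 10 <= level_sd k <= 5 / 4.
Proof.
have := level_sd_sqr_bounds k; have : 0 <= level_sd k by exact: sqrtr_ge0.
by move: (level_sd k) => s s0 /andP[a b]; apply/andP; split; nra.
Qed.

Lemma level_sd_gt0 k : 0 < level_sd k.
Proof. by have := level_sd_bounds k; lra. Qed.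

Lemma var_deficit_ge0 i : (i < m)%N -> 0 <= var_deficit i.
Proof.
move=> im; rewrite subr_ge0 ler_wpM2l// lef_pV2 ?posrE ?ltr_wpDl// lerD2r ler_nat; lia.
Qed.

Lemma var_deficit_step k : (0 < k < m + m)%N ->
  0 <= var_deficit k.-1 - var_deficit k <=
  8 / ((k%:R + 15) * (k%:R + 15)) + 8 / ((((m + m).-1 - k)%N%:R + 16) * (((m + m).-1 - k)%N%:R + 16)).
Proof.
move=> /andP[k0 km]; rewrite /var_deficit.
have -> : ((m + m).-1 - k.-1)%N = ((m + m).-1 - k).+1 by lia.
have kE : k%:R = k.-1%:R + 1 :> R by rewrite natr1 prednK.
rewrite kE -[((_ - _).+1)%:R]natr1.
have i0 : 0 <= k.-1%:R :> R by []. have j0 : 0 <= ((m + m).-1 - k)%N%:R :> R by [].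
move: (k.-1%:R) i0 (((m + m).-1 - k)%N%:R) j0 => a a0 b b0.
have h (x : R) : 0 <= x -> 0 <= 8 / (x + 16) - 8 / (x + 1 + 16) <= 8 / ((x + 16) * (x + 16)).
  move=> x0; have -> : 8 / (x + 16) - 8 / (x + 1 + 16) = 8 / ((x + 16) * (x + 17)) by field; rewrite !gt_eqF//; lra.
  apply/andP; split; first by rewrite divr_ge0// mulr_ge0// addr_ge0.
  by rewrite ler_wpM2l// lef_pV2 ?posrE ?mulr_gt0//; try lra; rewrite ler_wpM2l//; lra.
have /andP[h1 h2] := h a a0; have /andP[h3 h4] := h b b0.
have -> : a + 1 + 15 = a + 16 by lra.
apply/andP; split; lra.
Qed.

Fact half_rest_ge k : (k < m)%N -> (k <= (m + m).-1 - k)%N. Proof. lia. Qed.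

Fact half_rest_lt k : (m <= k < m + m)%N -> ((m + m).-1 - k < k)%N. Proof. lia. Qed.

(** Variance accumulated on levels 2 to k, started at 1/4 so that the profile begins with [pvar]
    equal to 1/6. *)
Definition clock (k : nat) : R := 1 / 4 + \sum_(1 <= i < k) level_sd i.+1 ^+ 2.

Lemma clockS k : (0 < k)%N -> clock k.+1 = clock k + level_sd k.+1 ^+ 2.
Proof. by move=> k0; rewrite /clock big_nat_recr//= addrA. Qed.

Lemma clock1 : clock 1 = 1 / 4.
Proof. by rewrite /clock big_geq// addr0. Qed.

Lemma clock_ge k : (0 < k)%N -> k%:R / 2 - 1 / 4 <= clock k.
Proof.
elim: k => // -[|k] ih _; first by rewrite clock1; lra.
rewrite clockS//; have := ih isT; have /andP[h _] := level_sd_sqr_bounds k.+2.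
rewrite -[k.+2%:R]natr1; lra.
Qed.

Lemma clock_le k : (0 < k <= m)%N -> clock k <= k%:R.
Proof.
elim: k => // -[|k] ih /andP[_ km]; first by rewrite clock1; lra.
rewrite clockS//; have := ih ltac:(lia); have := @var_deficit_ge0 k.+1 km.
rewrite level_sd_sqr -[k.+2%:R]natr1 /=; lra.
Qed.

Lemma clock_incr i k : (0 < i <= k)%N -> (k - i)%:R / 2 <= clock k - clock i.
Proof.
move=> /andP[i0 ik]; rewrite -(subnKC ik) addKn.
elim: (k - i)%N => [|j ih]; first by rewrite addn0; lra.
rewrite addnS clockS ?ltn_addr//; have /andP[h _] := level_sd_sqr_bounds (i + j).+1.
rewrite -[j.+1%:R]natr1; lra.
Qed.

Definition ysq (k : nat) : R := Num.sqrt (clock k).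

Lemma clock_gt0 k : (0 < k)%N -> 1 / 4 <= clock k.
Proof. move=> k0; have := clock_ge k0; have : 1 <= k%:R :> R by rewrite ler1n.
lra. Qed.

Lemma ysq_sqr k : (0 < k)%N -> ysq k ^+ 2 = clock k.
Proof. by move=> k0; rewrite sqr_sqrtr//; have := clock_gt0 k0; lra. Qed.

Lemma ysq_ge k : (0 < k)%N -> 1 / 2 <= ysq k.
Proof.
move=> k0; rewrite -(ler_pXn2r (n := 2)) ?nnegrE ?sqrtr_ge0// ysq_sqr//.
by have := clock_gt0 k0; lra.
Qed.

Definition pvar k := profile_var (ysq k).

Lemma pvar_bounds k : (0 < k)%N -> k%:R / 6 <= pvar k <= clock k /\ 1 / 6 <= pvar k.
Proof.
move=> k0; have [/andP[h1 h2] h3] := profile_var_bounds (ysq_ge k0).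
rewrite ysq_sqr// in h1 h2; have := clock_ge k0; have : 1 <= k%:R :> R by rewrite ler1n.
rewrite /pvar; split => //; apply/andP; split; lra.
Qed.

Lemma pvar1 : pvar 1 = 1 / 6.
Proof.
rewrite /pvar /profile_var ysq_sqr// clock1 /ysq clock1.
have -> : 1 / 4 = (1 / 2) ^+ 2 :> R by field.
by rewrite sqrtr_sqr ger0_norm; lra.
Qed.

Variable c : R.
Hypothesis hc : 19 / 20 <= c <= 2.

(** The exponential tilt under which level k advances by c [level_sd k]; every level then has the
    same cost exp(-c^2/2). *)
Definition rate (k : nat) : R := c / level_sd k.

Lemma rate_bounds k : 3 / 4 <= rate k <= 4.
Proof.
have /andP[c1 c2] := hc; have := level_sd_bounds k; rewrite /rate; move: (level_sd k) => s /andP[s1 s2].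
by apply/andP; split; [rewrite ler_pdivlMr|rewrite ler_pdivrMr]; lra.
Qed.

(** Rates decrease because the deficits do. The change is of order k^-2 near the leaves and (2m -
    k)^-2 near the root, which the fourth power of the corresponding square root turns into a
    constant, as [bottom_step] and [top_step] require. *)
Lemma rate_step k : (0 < k < m + m)%N ->
  0 <= rate k - rate k.+1 /\
  ((k < m)%N -> (rate k - rate k.+1) * ysq k.+1 ^+ 4 <= 64) /\
  ((m <= k)%N -> (rate k - rate k.+1) * Num.sqrt (((m + m).-1 - k)%N%:R + 16) ^+ 4 <= 64).
Proof.
move=> km; have /andP[d0 d1] := var_deficit_step km; case/andP: (km) => k0 k2m.
have /andP[a0 a1] : 0 <= rate k - rate k.+1 <= 4 * (var_deficit k.-1 - var_deficit k).
  have /andP[s1 _] := level_sd_sqr_bounds k; have /andP[s2 _] := level_sd_sqr_bounds k.+1.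
  apply: (rate_diff s1 (sqrtr_ge0 _) s2 (sqrtr_ge0 _) (level_sd_sqr k) (level_sd_sqr k.+1)).
    by move: d0; rewrite subr_ge0.
  by have /andP[c1 c2] := hc; apply/andP; split; lra.
have inv (x q z : R) : 15 <= x -> 0 <= q -> q <= x * x -> 0 <= z -> z <= 8 / (x * x) -> z * q <= 8.
  move=> x15 q0 qx z0 zx; have xx : 0 < x * x by rewrite mulr_gt0; lra.
  apply: (@le_trans _ _ (8 / (x * x) * (x * x))); first by apply: ler_pM.
  by rewrite divfK ?gt_eqF.
have j0 : (0 : R) <= ((m + m).-1 - k)%N%:R by [].
have k0' : (0 : R) <= k%:R by [].
set u := 8 / ((k%:R + 15) * (k%:R + 15)) in d1.
set j := ((m + m).-1 - k)%N%:R in d1 j0 *.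
set u' := 8 / ((j + 16) * (j + 16)) in d1.
have u0 : 0 <= u by rewrite divr_ge0// mulr_ge0//; lra.
have u'0 : 0 <= u' by rewrite divr_ge0// mulr_ge0//; lra.
split => //; split => hk.
  have y4 : ysq k.+1 ^+ 4 <= (k%:R + 15) * (k%:R + 15).
    rewrite (_ : ysq k.+1 ^+ 4 = (ysq k.+1 ^+ 2) * (ysq k.+1 ^+ 2)); last by ring.
    have := @clock_le k.+1 hk; have := clock_gt0 (ltn0Sn k); rewrite ysq_sqr// -[k.+1%:R]natr1 => h1 h2.
    by apply: ler_pM; lra.
  have y0 : 0 <= ysq k.+1 ^+ 4 by rewrite exprn_ge0 ?sqrtr_ge0.
  have jk : k%:R <= j :> R by rewrite /j ler_nat half_rest_ge.
  have uu : u' <= 8 / ((k%:R + 15) * (k%:R + 15)).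
    by rewrite ler_wpM2l// lef_pV2 ?posrE ?mulr_gt0//; try lra; apply: ler_pM; lra.
  have i1 := inv (k%:R + 15) _ u ltac:(lra) y0 y4 u0 (lexx _).
  have i2 := inv (k%:R + 15) _ u' ltac:(lra) y0 y4 u'0 uu.
  apply: (@le_trans _ _ (4 * (u + u') * ysq k.+1 ^+ 4)); last by lra.
  by rewrite ler_wpM2r//; lra.
have x4 : Num.sqrt (j + 16) ^+ 4 = (j + 16) * (j + 16).
  have -> : Num.sqrt (j + 16) ^+ 4 = (Num.sqrt (j + 16) ^+ 2) * (Num.sqrt (j + 16) ^+ 2) by ring.
  by rewrite sqr_sqrtr//; lra.
have jj0 : 0 <= (j + 16) * (j + 16) by rewrite mulr_ge0; lra.
have jk : j + 1 <= k%:R :> R by rewrite /j natr1 ler_nat half_rest_lt// hk.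
have uu : u <= 8 / ((j + 16) * (j + 16)).
  by rewrite ler_wpM2l// lef_pV2 ?posrE ?mulr_gt0//; try lra; apply: ler_pM; lra.
have i1 := inv (j + 16) _ u ltac:(lra) jj0 (lexx _) u0 uu.
have i2 := inv (j + 16) _ u' ltac:(lra) jj0 (lexx _) u'0 (lexx _).
rewrite x4; apply: (@le_trans _ _ (4 * (u + u') * ((j + 16) * (j + 16)))); last by lra.
by rewrite ler_wpM2r//; lra.
Qed.

Variable P0 : R.
Hypothesis P00 : 0 < P0.

Definition bot_cst : R := 50 * 64 ^+ 2.
Definition top_cst : R := 64 ^+ 2 + 14.

Lemma bot_cst_ge0 : 0 <= bot_cst. Proof. by rewrite mulr_ge0 ?sqr_ge0. Qed.
Lemma top_cst_ge0 : 0 <= top_cst. Proof. by rewrite addr_ge0 ?sqr_ge0. Qed.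

Definition rest (k : nat) : R := Num.sqrt ((m + m - k)%N%:R + 16).

Definition amp_low k : R := P0 * expR (bot_cst / ysq k) / p32 (pvar k).

Definition thin_mid : R := 1 / (2 * pvar m).

Definition amp_high k : R := amp_low m * expR (- (9 / 2 * thin_mid * (k - m)%:R) - top_cst / rest k).

(** Below level m the amplitude decays like k^(-3/2) as the profile spreads. Above, the width is
    frozen near that of level m, and the at most m remaining levels, at cost 9/2 [thin_mid] each,
    lose only a bounded factor, so the amplitude stays of order m^(-3/2). *)
Definition amp k : R := if (k < m)%N then amp_low k else amp_high k.

Definition thin k : R := if (k < m)%N then 1 / (2 * pvar k) else thin_mid + rest k ^- 3.

Lemma pvar_gt0 k : (0 < k)%N -> 0 < pvar k.
Proof. by move=> k0; have [_] := pvar_bounds k0; lra. Qed.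

Lemma rest_ge k : 4 <= rest k.
Proof.
rewrite -(ler_pXn2r (n := 2)) ?nnegrE ?sqrtr_ge0// sqr_sqrtr ?addr_ge0//.
have : (0 : R) <= (m + m - k)%N%:R by [].
lra.
Qed.

Lemma rest_gt0 k : 0 < rest k. Proof. by have := rest_ge k; lra. Qed.

Lemma amp_low_gt0 k : (0 < k)%N -> 0 < amp_low k.
Proof. by move=> k0; apply: divr_gt0; [rewrite mulr_gt0 ?expR_gt0|exact/p32_gt0/pvar_gt0]. Qed.

Lemma amp_gt0 k : (0 < k)%N -> 0 < amp k.
Proof. by move=> k0; rewrite /amp; case: ifP => _; [|apply: mulr_gt0; last exact: expR_gt0]; exact: amp_low_gt0. Qed.

Lemma thin_mid_gt0 : 0 < thin_mid.
Proof. by rewrite divr_gt0 ?mulr_gt0 ?pvar_gt0. Qed.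

Lemma thin_gt0 k : (0 < k)%N -> 0 < thin k.
Proof.
move=> k0; rewrite /thin; case: ifP => _; first by rewrite divr_gt0 ?mulr_gt0 ?pvar_gt0.
by rewrite addr_gt0 ?thin_mid_gt0// invr_gt0 exprn_gt0 ?rest_gt0.
Qed.

Lemma amp_high_mid : amp_high m <= amp_low m.
Proof.
rewrite ler_piMr ?(ltW (amp_low_gt0 m0))// subnn mulr0 oppr0 add0r -[leRHS]expR0 ler_expR oppr_le0 divr_ge0 ?top_cst_ge0//.
exact/ltW/rest_gt0.
Qed.

(** Supplies [barrier_step] with [de] and with its conditions on [p'] and [th']: through
    [bottom_step] for k < m, through [top_step] above. *)
Lemma profile_step k : (0 < k < m + m)%N -> exists2 de, 0 < de &
  let r := damping (level_sd k.+1) (thin k + de) in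
  amp k.+1 <= amp k * expR (- ((rate k - rate k.+1) ^+ 2 / (4 * de))) * (r * Num.sqrt r) /\
  (thin k + de) * r <= thin k.+1.
Proof.
move=> km; case/andP: (km) => k0 k2m; have [a0 [ab at_]] := rate_step km.
have s2 := level_sd_sqr_bounds k.+1.
case: (ltnP k m) => hk; last first.
  set j := ((m + m).-1 - k)%N in at_; have at1 := at_ hk.
  have eqj : (m + m - k.+1)%N = j by rewrite /j; lia.
  have eqj1 : (m + m - k)%N = j.+1 by rewrite /j; lia.
  have xx : rest k ^+ 2 = rest k.+1 ^+ 2 + 1.
    rewrite /rest eqj eqj1 !sqr_sqrtr ?addr_ge0// -[j.+1%:R]natr1; lra.
  have s2' : 0 <= level_sd k.+1 ^+ 2 <= 3 / 2 by case/andP: s2 => s1 ->; rewrite andbT; lra.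
  have at2 : (rate k - rate k.+1) * rest k.+1 ^+ 4 <= 64 by rewrite /rest eqj.
  have [de0 /andP[r0 r1] key] := top_step (ler0n R 64) (rest_ge k.+1) (ltW (rest_gt0 k)) xx s2' a0 at2 (ltW thin_mid_gt0).
  exists (rest k.+1 ^- 3 - rest k ^- 3) => //=.
  have thE : thin k + (rest k.+1 ^- 3 - rest k ^- 3) = thin_mid + rest k.+1 ^- 3.
    by rewrite /thin ltnNge hk /=; ring.
  rewrite /damping thE; split; last first.
    rewrite /thin ltnNge (leqW hk) /= ler_piMr// addr_ge0 ?(ltW thin_mid_gt0)// invr_ge0 exprn_ge0//.
    exact/ltW/rest_gt0.
  rewrite /amp !ltnNge hk (leqW hk) /= -[leRHS]mulrA.
  apply: le_trans (ler_wpM2l _ key); last by rewrite mulr_ge0 ?expR_ge0// ltW// amp_low_gt0.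
  rewrite -/top_cst /amp_high -[leRHS]mulrA -expRD; apply: ler_wpM2l; first exact: ltW (amp_low_gt0 m0).
  rewrite ler_expR subSn// -[(k - m).+1%:R]natr1; move: (top_cst / _) (top_cst / _) => z z'; lra.
have s2' : 1 / 2 <= level_sd k.+1 ^+ 2 <= 1.
  case/andP: s2 => -> _; rewrite /= level_sd_sqr; have := var_deficit_ge0 hk; rewrite /=; lra.
have yy : ysq k.+1 ^+ 2 = ysq k ^+ 2 + level_sd k.+1 ^+ 2 by rewrite !ysq_sqr// clockS.
have [w0 de0 key] := bottom_step (ltac:(by rewrite ler_nat) : (2 : R) <= 64) (ysq_ge k0) (sqrtr_ge0 _) yy s2' a0 (ab hk).
rewrite -/(pvar k) -/(pvar k.+1) in w0 de0 key.
exists (((pvar k.+1 - level_sd k.+1 ^+ 2)^-1 - (pvar k)^-1) / 2) => //=.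
have v0 := pvar_gt0 k0; have v1 := pvar_gt0 (ltn0Sn k).
set w := pvar k.+1 - _ in w0 de0 key *.
have thE : thin k + (w^-1 - (pvar k)^-1) / 2 = 1 / (2 * w).
  by rewrite /thin hk; field; rewrite !gt_eqF.
have rE : damping (level_sd k.+1) (1 / (2 * w)) = w / pvar k.+1.
  have -> : pvar k.+1 = w + level_sd k.+1 ^+ 2 by rewrite /w subrK.
  have q0 : 0 < w + level_sd k.+1 ^+ 2 by rewrite /w subrK.
  by rewrite /damping; field; rewrite !gt_eqF.
rewrite thE rE; split; last first.
  have -> : 1 / (2 * w) * (w / pvar k.+1) = 1 / (2 * pvar k.+1) by field; rewrite !gt_eqF.
  rewrite /thin; case: ltnP => h //; have -> : k.+1 = m by apply/eqP; rewrite eqn_leq h hk.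
  by rewrite lerDl invr_ge0 exprn_ge0// ltW// rest_gt0.
have ampS : amp k.+1 <= amp_low k.+1.
  rewrite /amp; case: ltnP => h //; have -> : k.+1 = m by apply/eqP; rewrite eqn_leq h hk.
  exact: amp_high_mid.
apply: le_trans ampS _; rewrite /amp hk.
have -> : w / pvar k.+1 * Num.sqrt (w / pvar k.+1) = p32 (w / pvar k) * p32 (pvar k) / p32 (pvar k.+1).
  rewrite -p32M ?divr_ge0 ?(ltW w0) ?(ltW v0)// divfK ?gt_eqF// -p32V ?(ltW v1)// -p32M ?(ltW w0)//.
rewrite /amp_low; have q0 := p32_gt0 v0; have q1 := p32_gt0 v1.
set E := expR (- _) in key *; rewrite -/(p32 _) in key.
have -> : P0 * expR (bot_cst / ysq k) / p32 (pvar k) * E * (p32 (w / pvar k) * p32 (pvar k) / p32 (pvar k.+1)) =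
  P0 * (expR (bot_cst / ysq k) * (E * p32 (w / pvar k))) / p32 (pvar k.+1) by field; rewrite !gt_eqF.
rewrite ler_wpM2r ?invr_ge0 ?(ltW q1)// ler_wpM2l ?(ltW P00)//.
apply: le_trans (ler_wpM2l (expR_ge0 _) key); rewrite -expRD ler_expR.
by rewrite -/bot_cst; move: (bot_cst / _) (bot_cst / _) => z z'; lra.
Qed.

Definition amp_cst : R := P0 * expR (2 * bot_cst) * p32 12.

Lemma amp_le k : (0 < k <= m + m)%N -> amp k <= amp_cst * p32 k%:R^-1.
Proof.
move=> /andP[k0 km].
have low i : (0 < i)%N -> (k <= i + i)%N -> amp_low i <= amp_cst * p32 k%:R^-1.
  move=> i0 ki; have [/andP[v1 _] _] := pvar_bounds i0.
  have K0 : 0 < k%:R :> R by rewrite ltr0n.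
  have kv : k%:R / 12 <= pvar i.
    have : k%:R <= i%:R + i%:R :> R by rewrite -natrD ler_nat.
    lra.
  rewrite /amp_low /amp_cst -3!mulrA ler_wpM2l ?(ltW P00)//.
  apply: ler_pM; rewrite ?expR_ge0 ?invr_ge0 ?p32_ge0 ?(ltW (pvar_gt0 i0))//.
    rewrite ler_expR mulrC ler_wpM2r ?bot_cst_ge0// -[leRHS]invrK lef_pV2 ?posrE ?invr_gt0//.
      by have := ysq_ge i0; lra.
    by have := ysq_ge i0; lra.
  rewrite -p32M// -p32V ?(ltW (pvar_gt0 i0))//; apply: le_p32; first by rewrite invr_ge0 ltW// pvar_gt0.
  rewrite -invf_div lef_pV2 ?posrE ?pvar_gt0 ?divr_gt0//.
rewrite /amp; case: ltnP => h; first by apply: low => //; lia.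
apply: (@le_trans _ _ (amp_low m)); last by apply: low => //; lia.
rewrite ler_piMr ?(ltW (amp_low_gt0 m0))// -[leRHS]expR0 ler_expR.
have h1 : 0 <= 9 / 2 * thin_mid * (k - m)%:R by apply: mulr_ge0 => //; apply: mulr_ge0 => //; exact: ltW thin_mid_gt0.
have h2 : 0 <= top_cst / rest k by rewrite divr_ge0 ?top_cst_ge0// ltW// rest_gt0.
lra.
Qed.

Lemma amp_ge k : (m <= k <= m + m)%N -> P0 * expR (- (27 / 2) - top_cst) * p32 m%:R^-1 <= amp k.
Proof.
move=> /andP[km k2m]; rewrite /amp ltnNge km /= /amp_high.
have M0 : 0 < m%:R :> R by rewrite ltr0n.
have [/andP[v1 v2] _] := pvar_bounds m0; have cm := @clock_le m ltac:(lia).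
have v0 := pvar_gt0 m0.
have tm : thin_mid * (k - m)%:R <= 3.
  have : (k - m)%:R <= m%:R :> R by rewrite ler_nat; lia.
  move=> hkm; apply: (@le_trans _ _ (thin_mid * m%:R)); first by rewrite ler_wpM2l// ltW// thin_mid_gt0.
  by rewrite /thin_mid mulrAC mul1r ler_pdivrMr ?mulr_gt0//; lra.
have rm : top_cst / rest k <= top_cst.
  rewrite ler_piMr ?top_cst_ge0// invf_le1 ?rest_gt0//; have := rest_ge k; lra.
rewrite mulrAC; apply: ler_pM; rewrite ?mulr_ge0 ?expR_ge0 ?p32_ge0 ?invr_ge0 ?(ltW P00) ?(ltW M0)//; last first.
  by rewrite ler_expR; move: rm; move: (top_cst / _) => z; move: top_cst => z' rm; lra.
rewrite /amp_low -mulrA ler_wpM2l ?(ltW P00)// -[leLHS]mul1r; apply: ler_pM; rewrite ?p32_ge0 ?invr_ge0 ?(ltW M0)//.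
  by rewrite -[leLHS]expR0 ler_expR divr_ge0 ?sqrtr_ge0// bot_cst_ge0.
rewrite -p32V ?(ltW v0)//; apply: le_p32; first by rewrite invr_ge0 ltW.
rewrite lef_pV2 ?posrE//; lra.
Qed.

Lemma thin_le k : (m <= k)%N -> thin k <= 4.
Proof.
move=> km; rewrite /thin ltnNge km /=; have [_ v6] := pvar_bounds m0; have r4 := rest_ge k.
have : thin_mid <= 3 by rewrite /thin_mid ler_pdivrMr; lra.
have : rest k ^- 3 <= 1 by rewrite invf_le1 ?exprn_gt0 ?exprn_ege1//; lra.
lra.
Qed.

End Schedule.

(** * Uniform positive probability of reaching the front *)

Section TailFloor.
Context {R : realType}.
Local Notation gm := (@sgauss R).

Definition gauss_floor : R := Ex gm (fun u => kill 1 1 (1 - 1 * u) * lin_gauss 2 (1 - 1 * u)).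

Lemma gauss_floor_gt0 : 0 < gauss_floor.
Proof.
rewrite /gauss_floor (@kill_odd R 1 1 (2^-1 + 1))//; last first.
- by move=> y; exact: lin_gauss_bounded.
- by move=> y; exact: lin_gaussN.
- exact: measurable_lin_gauss.
have [_ ->] := @lin_gauss_conv R 1 2 1 ltr01 (ltr0n R 2).
have d0 : 0 < damping 1 2 :> R by rewrite invr_gt0 addr_gt0// !mulr_gt0// exprn_gt0.
by apply: mulr_gt0; [apply: mulr_gt0; rewrite ?sqrtr_gt0|rewrite /lin_gauss mul1r expR_gt0].
Qed.

(** Start of the induction. Tilting by y/s + 1 puts the mean one unit beyond the target; what
    remains is a fixed positive integral times exp(-3 y^2), the Gaussian of the profile at level 1,
    where [thin] is 3. *)
Lemma gauss_tail_floor (s x y : R) : 0 < s -> 1 / 2 <= s ^+ 2 -> 0 < y -> x <= y ->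
  gauss_floor * expR (- (3 * y ^+ 2)) <= Ex gm (fun u => (x - s * u < 0)%R%:R).
Proof.
move=> s0 s2 y0 xy.
have mlt (h : R -> R) : measurable_fun setT h -> measurable_fun setT (fun u : R => (h u < 0)%R%:R : R).
  move=> mh; have -> : (fun u : R => (h u < 0)%R%:R) = (fun y => \1_(`]-oo, 0%R[%classic) y : R) \o h.
    by apply/funext => u /=; rewrite indicE; congr (nat_of_bool _)%:R; apply/idP/idP; rewrite inE /= in_itv.
  by apply: measurableT_comp => //; exact: measurable_indic.
have sn : s != 0 by rewrite gt_eqF.
set Y := y / s; have Y0 : 0 < Y by rewrite divr_gt0.
have Y2 : Y ^+ 2 <= 2 * y ^+ 2.
  rewrite /Y expr_div_n ler_pdivrMr ?exprn_gt0//; have := sqr_ge0 y; nra.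
pose b := Y + 1.
pose f u : R := (Y + u < 0)%R%:R * expR (b * u).
have mf : measurable_fun setT f.
  apply: measurable_funM; last exact: measurable_expRM.
  by apply: mlt; exact: measurable_funD.
have f1 u : `|f u| <= 1.
  rewrite /f; case: ltP => h; last by rewrite mul0r normr0.
  by rewrite mul1r ger0_norm ?expR_ge0// -[leRHS]expR0 ler_expR /b; nra.
have Lf : L1 gm (fun u => f (u + - b)).
  by apply: (@L1_bounded _ _ _ _ _ 1) => //; apply: (measurableT_comp mf); exact: measurable_funD.
have [L E] := sgauss_tilt mf Lf.
have LG : L1 gm (fun u => (x - s * u < 0)%R%:R).
  apply: (@L1_bounded _ _ _ _ _ 1); first by apply: mlt; exact: measurable_affine.
  by move=> u; rewrite ger0_norm// lern1 leq_b1.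
have mG : measurable_fun setT (fun u : R => (x - s * - u < 0)%R%:R : R).
  by apply: mlt; have := measurable_affine x (- s); congr measurable_fun; apply/funext => u; rewrite mulrN mulNr.
have -> : Ex gm (fun u => (x - s * u < 0)%R%:R) = Ex gm (fun u => (x - s * - u < 0)%R%:R).
  rewrite (@sgauss_opp R (fun u => (x - s * u < 0)%R%:R))//.
  by apply: mlt; exact: measurable_affine.
apply: (@le_trans _ _ (Ex gm (fun u => f u * expR (- b * u)))); last first.
  apply: le_Ex => //.
    apply: (@L1_bounded _ _ _ _ _ 1) => //.
    by move=> u; rewrite ger0_norm// lern1 leq_b1.
  move=> u; rewrite /f -mulrA -expRD mulNr subrr expR0 mulr1 ler_nat.
  case: (ltP (Y + u) 0) => // h; suff -> : x - s * - u < 0 by [].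
    have : s * (Y + u) < 0 by rewrite pmulr_rlt0.
    by rewrite mulrDr /Y mulrCA divff// mulr1; lra.
rewrite E -(ExZ _ Lf) /gauss_floor mulrC.
have Lk : L1 gm (fun u => kill 1 1 (1 - 1 * u) * lin_gauss 2 (1 - 1 * u)).
  apply: (@L1_bounded _ _ _ _ _ (2^-1 + 1)).
    apply: measurable_funM; [apply: (measurableT_comp (measurable_kill 1 1))|apply: (measurableT_comp (measurable_lin_gauss 2))]; exact: measurable_affine.
  move=> u; rewrite normrM; have /andP[k0 k1] := @kill_bounds R 1 1 (1 - 1 * u) ler01.
  by rewrite (ger0_norm k0) -[leRHS]mul1r; apply: ler_pM => //; exact: lin_gauss_bounded.
rewrite -(ExZ _ Lk); apply: le_Ex; [exact: L1Z|exact: L1Z|].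
move=> u; rewrite /f /b mul1r.
have -> : (Y + (u + - (Y + 1)) < 0) = (0 < 1 - u) by apply/idP/idP => ?; lra.
set v := 1 - u; case: (ltP 0 v) => v0; last by rewrite /kill ltNge v0 /= !mul0r !mulr0.
have /andP[k0 k1] := @kill_bounds R 1 1 v ler01.
rewrite mul1r -expRD.
apply: (@le_trans _ _ (expR (- (3 * y ^+ 2)) * (1 * expR (- v ^+ 2)))).
  rewrite ler_wpM2l ?expR_ge0//; apply: ler_pM => //; first by rewrite lin_gauss_ge0// ltW.
  have : v <= expR (v ^+ 2) by apply: le_trans (expR_ge1Dx _); nra.
  move=> h; rewrite /lin_gauss; apply: (@le_trans _ _ (expR (v ^+ 2) * expR (- (2 * v ^+ 2)))).
    by rewrite ler_wpM2r ?expR_ge0.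
  by rewrite -expRD ler_expR; lra.
rewrite mul1r -expRD ler_expR.
have -> : (- (Y + 1)) ^+ 2 / 2 + (Y + 1) * (u + - (Y + 1)) = - (Y + 1) ^+ 2 / 2 + (Y + 1) * u by field.
have -> : u = 1 - v by rewrite /v; ring.
have := sqr_ge0 (v - (Y + 1) / 2); have := sqr_ge0 (Y - 1 / 3); nra.
Qed.

Variables (m : nat) (c P0 : R).
Hypotheses (m1 : (1 < m)%N) (hc : 19 / 20 <= c <= 2) (P00 : 0 < P0).
Let m0 : (0 < m)%N := ltnW m1.

Definition growth : R := 2 * expR (- (c ^+ 2 / 2)).
Definition front k : R := \sum_(i < k) c * level_sd m i.+1.

Hypothesis hA : forall k, (0 < k <= m + m)%N -> growth ^+ k <= 5 * p32 k%:R.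
Hypothesis hP0 : 4 * amp m P0 1 <= gauss_floor.

Definition src_cst : R := source_cst * (5 / 2 * amp_cst P0 ^+ 2).

(** Bounds the second moment by splitting level: a pair of paths that separates at level i
    contributes a source created there and evolved to level k. The weight is growth^i of order
    i^(3/2) times the squared amplitude of order i^-3, that is i^(-3/2). *)
Definition barrier_sq (k : nat) (z : R) : R :=
  amp m P0 1 * evolved (1 / (2 * thin m 1)) (clock m k - clock m 1) z +
  \sum_(2 <= i < k.+1) src_cst * p32 i%:R^-1 * source (m + m) (1 / (2 * thin m i)) (clock m k - clock m i) z.

Lemma src_cst_ge0 : 0 <= src_cst.
Proof.
by apply: mulr_ge0; [rewrite mulr_ge0// mulr_ge0 ?expR_ge0 ?exprn_ge0|rewrite mulr_ge0 ?sqr_ge0].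
Qed.

Lemma thin1 : thin m 1 = 3 :> R.
Proof. by rewrite /thin m1 pvar1//; field. Qed.

Let tvar_gt0 i : (0 < i)%N -> 0 < 1 / (2 * thin m i) :> R.
Proof. by move=> i0; rewrite divr_gt0 ?mulr_gt0 ?thin_gt0. Qed.

Let A_gt0 k : (0 < k)%N -> 0 < amp m P0 k. Proof. exact: amp_gt0. Qed.

Let clock_diff i k : (0 < i <= k)%N -> 0 <= clock m k - clock m i :> R.
Proof. by move=> ik; apply: le_trans (clock_incr m ik); rewrite divr_ge0. Qed.

Lemma growth_gt0 : 0 < growth. Proof. by rewrite mulr_gt0 ?expR_gt0. Qed.

Lemma barrier_sqN k z : barrier_sq k (- z) = - barrier_sq k z.
Proof.
rewrite /barrier_sq evolvedN mulrN [RHS]opprD; congr (_ + _); rewrite -sumrN.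
by apply: eq_bigr => i _; rewrite sourceN mulrN.
Qed.

Let in_range i k (P : nat -> Prop) : (2 <= i < k.+1)%N -> (0 < i <= k)%N.
Proof. by move=> /andP[i2 ik]; rewrite (ltnW i2). Qed.

Lemma barrier_sq_ge0 k z : (0 < k)%N -> 0 <= z -> 0 <= barrier_sq k z.
Proof.
move=> k0 z0; apply: addr_ge0.
  apply: mulr_ge0; first exact: ltW (A_gt0 _).
  by apply: evolved_ge0 => //; [exact: tvar_gt0|exact: clock_diff].
rewrite big_nat; apply: sumr_ge0 => i /(in_range (fun=> True)) ik.
apply: mulr_ge0; first by rewrite mulr_ge0 ?src_cst_ge0// p32_ge0// invr_ge0.
by apply: source_ge0 => //; [apply: tvar_gt0; case/andP: ik|exact: clock_diff].
Qed.

Lemma measurable_barrier_sq k : measurable_fun setT (barrier_sq k).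
Proof.
apply: measurable_funD; first by apply: measurable_funM => //; exact: measurable_evolved.
by apply: measurable_sum => i; apply: measurable_funM => //; exact: measurable_source.
Qed.

Lemma barrier_sq_bounded k : (0 < k)%N -> exists M, forall z, `|barrier_sq k z| <= M.
Proof.
move=> k0.
have h (s : seq nat) : {in s, forall i, (2 <= i < k.+1)%N} -> exists M, forall z,
    `|\sum_(i <- s) src_cst * p32 i%:R^-1 * source (m + m) (1 / (2 * thin m i)) (clock m k - clock m i) z| <= M.
  elim: s => [|i s ih] hs; first by exists 0 => z; rewrite big_nil normr0.
  have [|M hM] := ih; first by move=> j js; apply: hs; rewrite inE js orbT.
  have ik := in_range (fun=> True) (hs i (mem_head _ _)).
  have i0 : (0 < i)%N by case/andP: ik.
  have [M' hM'] := source_bounded (m + m) (tvar_gt0 i0) (clock_diff ik).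
  exists (`|src_cst * p32 i%:R^-1| * M' + M) => z.
  rewrite big_cons; apply: le_trans (ler_normD _ _) _; apply: lerD => //.
  by rewrite normrM ler_wpM2l.
have [|M hM] := h (index_iota 2 k.+1); first by move=> i; rewrite mem_index_iota.
exists (`|amp m P0 1| * (2 * (1 / (2 * thin m 1) + (clock m k - clock m 1)) + 1) + M) => z.
apply: le_trans (ler_normD _ _) _; apply: lerD; last exact: hM.
rewrite normrM ler_wpM2l//; apply: evolved_bounded; [exact: tvar_gt0|exact: clock_diff].
Qed.

Lemma barrier_sq_step k z : (0 < k)%N ->
  barrier_sq k.+1 z = Ex gm (fun u => barrier_sq k (z - level_sd m k.+1 * u)) +
    src_cst * p32 k.+1%:R^-1 * source (m + m) (1 / (2 * thin m k.+1)) 0 z.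
Proof.
move=> k0; have s0 := level_sd_gt0 m k.+1 : 0 < level_sd m k.+1 :> R.
have [L1a E1] := evolved_conv z (tvar_gt0 (ltn0Sn 0)) (clock_diff (k0 : (0 < 1 <= k)%N)) s0.
have h i : (2 <= i < k.+1)%N ->
    L1 gm (fun u => src_cst * p32 i%:R^-1 * source (m + m) (1 / (2 * thin m i)) (clock m k - clock m i) (z - level_sd m k.+1 * u)) /\
    Ex gm (fun u => src_cst * p32 i%:R^-1 * source (m + m) (1 / (2 * thin m i)) (clock m k - clock m i) (z - level_sd m k.+1 * u)) =
      src_cst * p32 i%:R^-1 * source (m + m) (1 / (2 * thin m i)) (clock m k.+1 - clock m i) z.
  move=> /(in_range (fun=> True)) ik; have i0 : (0 < i)%N by case/andP: ik.
  have [L E] := source_conv (m + m) z (tvar_gt0 i0) (clock_diff ik) s0.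
  split; first exact: L1Z.
  by rewrite (ExZ _ L) E clockS// addrAC.
have hs (s : seq nat) : {in s, forall i, (2 <= i < k.+1)%N} ->
    L1 gm (fun u => \sum_(i <- s) src_cst * p32 i%:R^-1 * source (m + m) (1 / (2 * thin m i)) (clock m k - clock m i) (z - level_sd m k.+1 * u)) /\
    Ex gm (fun u => \sum_(i <- s) src_cst * p32 i%:R^-1 * source (m + m) (1 / (2 * thin m i)) (clock m k - clock m i) (z - level_sd m k.+1 * u)) =
      \sum_(i <- s) src_cst * p32 i%:R^-1 * source (m + m) (1 / (2 * thin m i)) (clock m k.+1 - clock m i) z.
  elim: s => [|i s ih] his.
    split; first by apply: L1_eq (L1_cst gm 0) => u; rewrite big_nil.
    by rewrite big_nil -[RHS](Ex_cst gm); apply: eq_Ex => u; rewrite big_nil.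
  have [|L E] := ih; first by move=> j js; apply: his; rewrite inE js orbT.
  have [L' E'] := h i (his i (mem_head _ _)).
  split; first by apply: L1_eq (L1D L' L) => u; rewrite big_cons.
  by rewrite big_cons -E -E' -(ExD L' L); apply: eq_Ex => u; rewrite big_cons.
have [|L E] := hs (index_iota 2 k.+1); first by move=> i; rewrite mem_index_iota.
rewrite /barrier_sq (ExD (L1Z _ L1a) L) (ExZ _ L1a) E E1 [in LHS]big_nat_recr//= subrr addrA.
by congr (_ * evolved _ _ _ + _ + _); rewrite clockS// addrAC.
Qed.

(** The offset -4 makes level 1 true, since the front there is at most 5/2. At that level both
    moments are the same function F, and 2 t F - t^2 F <= F. *)
Lemma barrier_induction k : (0 < k <= m + m)%N -> forall y t, 0 < y ->
  2 * t * (growth ^+ k * expR (- (rate m c k * y)) * (amp m P0 k * lin_gauss (thin m k) y)) -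
  t ^+ 2 * (growth ^+ k * expR (- (rate m c k * y)) * barrier_sq k y) <= tree_tail (level_sd m) k (front k - 4 + y).
Proof.
elim: k => // -[_ _|k ih /andP[_ km]] y t y0.
  rewrite /barrier_sq big_geq// addr0 subrr evolved0 ?tvar_gt0//.
  have -> : 1 / (2 * (1 / (2 * thin m 1))) = 3 :> R by rewrite thin1; field.
  rewrite thin1 expr1 /front big_ord1.
  have s2 : 1 / 2 <= (level_sd m 1 : R) ^+ 2 <= 3 / 2 by exact: level_sd_sqr_bounds.
  have sb : 7 / 10 <= (level_sd m 1 : R) <= 5 / 4 by exact: level_sd_bounds.
  have xy : c * level_sd m 1 - 4 + y <= y.
    have /andP[c1 c2] := hc; have /andP[sb1 sb2] := sb.
    have : c * level_sd m 1 <= 2 * (5 / 4) by apply: ler_pM; lra.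
    lra.
  have := gauss_tail_floor (level_sd_gt0 m 1) (ltac:(by case/andP: s2)) y0 xy.
  rewrite /=; set a := Ex gm _ => ha.
  have a1 : a <= 1.
    rewrite -(Ex_cst gm 1); apply: le_Ex; [|exact: L1_cst|by move=> u; rewrite lern1 leq_b1].
    by apply: (tree_tail_L1 (level_sd m) 0); exact: measurable_affine.
  have a0 : 0 <= a by apply: Ex_ge0.
  have aa : a <= 1 - (1 - a) ^+ 2 by nra.
  apply: le_trans aa; apply: le_trans ha.
  set F := growth * _ * _.
  have FE : 2 * t * F - t ^+ 2 * F <= F.
    have F0 : 0 <= F.
      apply: mulr_ge0; first by rewrite mulr_ge0 ?expR_ge0 ?(ltW growth_gt0).
      by apply: mulr_ge0; [exact: ltW (A_gt0 _)|apply: lin_gauss_ge0; exact: ltW].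
    have -> : 2 * t * F - t ^+ 2 * F = F - (t - 1) ^+ 2 * F by ring.
    by rewrite gerBl mulr_ge0 ?sqr_ge0.
  apply: le_trans FE _; rewrite /F.
  have g2 : growth <= 2 by rewrite ler_piMr// -[leRHS]expR0 ler_expR oppr_le0 divr_ge0 ?sqr_ge0.
  have rb := rate_bounds m hc 1.
  have ey : expR (- (rate m c 1 * y)) * y <= 2.
    have h1 : expR (- (rate m c 1 * y)) <= expR (- (3 / 4 * y)) by rewrite ler_expR lerN2 ler_wpM2r// ?(ltW y0)//; case/andP: rb.
    apply: (@le_trans _ _ (expR (- (3 / 4 * y)) * (2 * expR (3 / 4 * y)))).
      apply: ler_pM => //; rewrite ?expR_ge0 ?(ltW y0)//; have := expR_ge1Dx (3 / 4 * y); lra.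
    by rewrite mulrCA -expRD addNr expR0 mulr1.
  have e3 := expR_ge0 (- (3 * y ^+ 2)).
  have A0 := ltW (A_gt0 (ltn0Sn 0)).
  have -> : growth * expR (- (rate m c 1 * y)) * (amp m P0 1 * lin_gauss 3 y) =
    (growth * amp m P0 1 * (expR (- (rate m c 1 * y)) * y)) * expR (- (3 * y ^+ 2)) by rewrite /lin_gauss; ring.
  rewrite ler_wpM2r//; apply: le_trans hP0.
  have -> : 4 * amp m P0 1 = 2 * amp m P0 1 * 2 by ring.
  apply: ler_pM => //; first by rewrite mulr_ge0 ?(ltW growth_gt0).
    by rewrite mulr_ge0 ?expR_ge0// ltW.
  by rewrite ler_wpM2r.
have k0 : (0 < k.+1)%N by [].
have kr : (0 < k.+1 < m + m)%N by [].
have [de de0 [pstep tstep]] := profile_step m0 hc P00 kr.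
have [a0 _] := rate_step m0 hc kr.
have [M hM] := barrier_sq_bounded k0.
have [mw w01] := tree_tail_bounds (level_sd m : nat -> R) k.+1.
have c0 : 0 < c by case/andP: hc; lra.
have p'b : 0 <= amp m P0 k.+2 <= amp m P0 k.+1 * expR (- ((rate m c k.+1 - c / level_sd m k.+2) ^+ 2 / (4 * de))) *
   (damping (level_sd m k.+2) (thin m k.+1 + de) * Num.sqrt (damping (level_sd m k.+2) (thin m k.+1 + de))).
  by rewrite (ltW (A_gt0 _))//=; exact: pstep.
have IH := ih (ltnW km).
have key := barrier_step mw w01 (measurable_barrier_sq k.+1) (barrier_sqN k.+1) hM (fun y h => barrier_sq_ge0 k0 h)
  (level_sd_gt0 m k.+2) c0 a0 y0 (exprn_ge0 k.+1 (ltW growth_gt0)) (ltW (A_gt0 k0)) (thin_gt0 m0 k0) de0 IH p'b tstep.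
have srcb : Ex gm (fun u => barrier_sq k.+1 (y - level_sd m k.+2 * u)) +
   2 * expR (- (c ^+ 2 / 2)) * growth ^+ k.+1 * expR (- (c / level_sd m k.+2 * y)) * (amp m P0 k.+2 * lin_gauss (thin m k.+2) y) ^+ 2 / 2 <=
   barrier_sq k.+2 y.
  rewrite barrier_sq_step// lerD2l -/growth -exprS -/(rate m c k.+2).
  have /andP[r34 _] := rate_bounds m hc k.+2.
  have m20 : (0 < m + m)%N by rewrite addn_gt0 m0.
  have src := source_ge m20 r34 (thin_gt0 m0 (ltn0Sn k.+1)) y0.
  have gA := @hA k.+2 ltac:(by []).
  have pA := @amp_le R m m0 c hc P0 P00 k.+2 ltac:(by []).
  have q0 : 0 < p32 k.+2%:R :> R by rewrite p32_gt0.
  have qi : p32 k.+2%:R^-1 = (p32 k.+2%:R)^-1 :> R by rewrite p32V.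
  have ap0 := ltW (A_gt0 (ltn0Sn k.+1)).
  rewrite qi in pA *; set S := source _ _ _ _ in src *.
  set e := expR (- (rate m c k.+2 * y)) in src *.
  set L := lin_gauss _ _ in src *.
  have gp : growth ^+ k.+2 * amp m P0 k.+2 ^+ 2 <= 5 * amp_cst P0 ^+ 2 / p32 k.+2%:R.
    have -> : 5 * amp_cst P0 ^+ 2 / p32 k.+2%:R = (5 * p32 k.+2%:R) * (amp_cst P0 / p32 k.+2%:R) ^+ 2 by field; rewrite gt_eqF.
    apply: ler_pM => //; rewrite ?sqr_ge0 ?exprn_ge0 ?(ltW growth_gt0)//.
    by rewrite lerXn2r ?nnegrE//; exact: le_trans pA.
  have -> : growth ^+ k.+2 * e * (amp m P0 k.+2 * L) ^+ 2 / 2 = growth ^+ k.+2 * amp m P0 k.+2 ^+ 2 * (e * L ^+ 2) / 2 by ring.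
  have -> : src_cst / p32 k.+2%:R * S = 5 * amp_cst P0 ^+ 2 / p32 k.+2%:R * (source_cst * S) / 2 by rewrite /src_cst; field; rewrite gt_eqF.
  rewrite ler_wpM2r ?invr_ge0//; apply: ler_pM => //.
    by rewrite mulr_ge0 ?sqr_ge0 ?exprn_ge0 ?(ltW growth_gt0).
  by rewrite mulr_ge0 ?sqr_ge0 ?expR_ge0.
have := key _ srcb t.
rewrite -/growth -exprS -/(rate m c k.+2) => /le_trans; apply.
rewrite [tree_tail _ k.+2 _]/= /front [in leRHS]big_ord_recr/= -/(front k.+1).
have e : front k.+1 - 4 + (y + c * level_sd m k.+2) = front k.+1 + c * level_sd m k.+2 - 4 + y by ring.
by rewrite e.
Qed.

(** The sum over splitting levels convolves i^(-3/2) with (k+1-i)^(-3/2), which is again of order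
    k^(-3/2). The constant 111 is 6 times 18 from this convolution plus 3 from the terms with
    (2m)^-5. *)
Lemma barrier_sq1_le k : (0 < k <= m + m)%N -> barrier_sq k 1 <= (amp m P0 1 + 111 * src_cst) * p32 k%:R^-1.
Proof.
move=> /andP[k0 km].
have K0 : 0 < k%:R :> R by rewrite ltr0n.
have K1 : 1 <= k%:R :> R by rewrite ler1n.
have A0 := ltW (A_gt0 (ltn0Sn 0)).
have kk : (0 < 1 <= k)%N by [].
rewrite mulrDl; apply: lerD.
  rewrite ler_wpM2l//; apply: le_trans (evolved1_le (tvar_gt0 (ltn0Sn 0)) (clock_diff kk)) _.
  rewrite thin1; have := clock_incr m kk : _ <= _ :> R; rewrite natrB// => W.
  have W0 : 0 <= clock m k - clock m 1 :> R := clock_diff kk.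
  move: (clock m k - clock m 1 : R) W0 W => w w0 hw.
  apply: le_p32; first by rewrite divr_ge0//; lra.
  have -> : 1 / (2 * 3) / (1 / (2 * 3) + w) = (1 + 6 * w)^-1 by field; rewrite !gt_eqF//; lra.
  by rewrite lef_pV2 ?posrE//; lra.
have p2 : p32 2 <= 3 :> R.
  by rewrite /p32; have := sqr_sqrtr (ler0n R 2); have := sqrtr_ge0 (2 : R); move: (Num.sqrt 2) => q q0 q2; nra.
have N0 : 0 < (m + m)%:R :> R by rewrite ltr0n addn_gt0 m0.
have n5 : (m + m)%:R ^- 5 <= p32 k%:R^-1 :> R.
  rewrite p32V// lef_pV2 ?posrE ?exprn_gt0 ?p32_gt0//.
  have nk : k%:R <= (m + m)%:R :> R by rewrite ler_nat.
  apply: (@le_trans _ _ (k%:R ^+ 2)).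
    rewrite /p32 expr2 ler_wpM2l// -[leRHS](@sqr_sqrtr R)// expr2 ler_peMr ?sqrtr_ge0//.
    by rewrite -[leLHS](sqrtr1 R) ler_wsqrtr.
  apply: (@le_trans _ _ ((m + m)%:R ^+ 2)); first by rewrite lerXn2r ?nnegrE.
  by rewrite ler_weXn2l// ler1n addn_gt0 m0.
apply: (@le_trans _ _ (\sum_(2 <= i < k.+1) src_cst * (6 * (p32 i%:R^-1 * p32 (k.+1 - i)%:R^-1) + p32 i%:R^-1 * (m + m)%:R ^- 5))).
  rewrite big_nat [leRHS]big_nat; apply: ler_sum => i hi.
  have ik := in_range (fun=> True) hi; case/andP: (ik) => i0 ik'.
  rewrite -mulrA ler_wpM2l ?src_cst_ge0//.
  have pi0 : 0 <= p32 i%:R^-1 :> R by rewrite p32_ge0// invr_ge0.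
  have m20 : (0 < m + m)%N by rewrite addn_gt0 m0.
  apply: le_trans (ler_wpM2l pi0 (source1_le m20 (tvar_gt0 i0) (clock_diff ik))) _.
  have W := clock_incr m ik : _ <= clock m k - clock m i :> R.
  set j := (k.+1 - i)%N; have jE : (k - i)%:R + 1 = j%:R :> R by rewrite natr1 -subSn.
  have J0 : 0 < j%:R :> R by rewrite -jE ltr_wpDl.
  have h : p32 (1 + (clock m k - clock m i))^-1 <= 3 * p32 j%:R^-1 :> R.
    apply: (@le_trans _ _ (p32 (2 * j%:R^-1))).
      have W0 := clock_diff ik.
      apply: le_p32; first by rewrite invr_ge0; lra.
      rewrite -invf_div lef_pV2 ?posrE ?divr_gt0//; last by lra.
      by rewrite ler_pdivrMr// -jE; lra.
    by rewrite p32M// ler_wpM2r// p32_ge0// invr_ge0 ltW.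
  have -> : 6 * ((p32 i%:R^-1 : R) * p32 j%:R^-1) + p32 i%:R^-1 * (m + m)%:R ^- 5 = p32 i%:R^-1 * (2 * (3 * p32 j%:R^-1) + (m + m)%:R ^- 5) by ring.
  by rewrite ler_wpM2l// lerD2r ler_wpM2l.
rewrite -mulr_sumr [leRHS](_ : _ = src_cst * (111 * p32 k%:R^-1)); last by ring.
rewrite ler_wpM2l ?src_cst_ge0// big_split/= -mulr_sumr -mulr_suml.
have s1 : \sum_(2 <= i < k.+1) p32 i%:R^-1 * p32 (k.+1 - i)%:R^-1 <= 18 * p32 k%:R^-1 :> R.
  apply: le_trans (p32_conv_sum k0); rewrite [leRHS]big_ltn//= lerDr mulr_ge0 ?p32_ge0 ?invr_ge0//.
have s2 : \sum_(2 <= i < k.+1) p32 i%:R^-1 <= 3 :> R.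
  by apply: le_trans (p32_inv_sum k); rewrite [leRHS]big_ltn//= lerDr p32_ge0 ?invr_ge0.
have z5 : 0 <= (m + m)%:R ^- 5 :> R by rewrite invr_ge0 exprn_ge0.
apply: (@le_trans _ _ (6 * (18 * p32 k%:R^-1) + 3 * p32 k%:R^-1)).
  apply: lerD; first by rewrite ler_wpM2l.
  apply: (@le_trans _ _ (3 * (m + m)%:R ^- 5)); first by rewrite ler_wpM2r.
  by rewrite ler_wpM2l.
by rewrite le_eqVlt; apply/orP; left; apply/eqP; ring.
Qed.

(** One unit above the barrier the first moment is at least f0 and the second at most s0; the choice
    t = f0/s0 gives f0^2/s0. *)
Lemma tree_tail_floor k a1 : (m <= k <= m + m)%N -> 0 < a1 -> a1 * p32 m%:R <= growth ^+ k ->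
  (a1 * (P0 * expR (- (27 / 2) - top_cst)) * expR (- 8)) ^+ 2 / (5 * (amp m P0 1 + 111 * src_cst)) <=
  tree_tail (level_sd m) k (front k - 3).
Proof.
move=> /andP[mk km] a10 ga.
have k0 : (0 < k)%N by exact: leq_trans mk.
have kr : (0 < k <= m + m)%N by rewrite k0.
have A1 := A_gt0 (ltn0Sn 0).
set f0 := a1 * _ * _; set s0 := 5 * _.
have s00 : 0 < s0 by rewrite mulr_gt0// ltr_pwDl// mulr_ge0 ?src_cst_ge0.
have := barrier_induction kr (f0 / s0) ltr01; rewrite (_ : front k - 4 + 1 = front k - 3); last by ring.
apply: le_trans.
set f := growth ^+ k * _ * _; set s := growth ^+ k * _ * _.
have f00 : 0 < f0 by rewrite !mulr_gt0 ?expR_gt0.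
have M0 : 0 < m%:R :> R by rewrite ltr0n.
have rb := rate_bounds m hc k.
have hf : f0 <= f.
  have hp := @amp_ge R m m0 c hc P0 P00 k ltac:(by rewrite mk).
  have h1 : expR (- 4) <= expR (- (rate m c k * 1)) :> R by rewrite ler_expR mulr1; lra.
  have h2 : expR (- 4) <= lin_gauss (thin m k) 1 :> R.
    by rewrite /lin_gauss mul1r ler_expR expr1n mulr1; have := @thin_le R m m0 k mk; lra.
  have pm : p32 m%:R * p32 m%:R^-1 = 1 :> R by rewrite p32V// divff// gt_eqF// p32_gt0.
  have -> : f0 = (a1 * p32 m%:R) * expR (- 4) * ((P0 * expR (- (27 / 2) - top_cst) * p32 m%:R^-1) * expR (- 4)).
    rewrite /f0; have -> : expR (- 8) = expR (- 4) * expR (- 4) :> R by rewrite -expRD; congr expR; ring.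
    move: pm; move: (p32 m%:R) (p32 m%:R^-1) => q q' qq.
    have -> : a1 * q * expR (-4) * (P0 * expR (- (27 / 2) - top_cst) * q' * expR (-4)) = (q * q') * (a1 * (P0 * expR (- (27 / 2) - top_cst)) * (expR (-4) * expR (-4))) by ring.
    by rewrite qq mul1r.
  have p0 : 0 <= p32 m%:R :> R by rewrite p32_ge0.
  have p1 : 0 <= p32 m%:R^-1 :> R by rewrite p32_ge0// invr_ge0.
  apply: ler_pM; [by rewrite !mulr_ge0 ?expR_ge0// ltW|by rewrite !mulr_ge0 ?expR_ge0// ltW| |].
    by apply: ler_pM => //; rewrite ?expR_ge0 ?mulr_ge0// ltW.
  by apply: ler_pM => //; rewrite ?expR_ge0 ?mulr_ge0 ?expR_ge0// ltW.
have hs : s <= s0.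
  have q0 : 0 < p32 k%:R :> R by rewrite p32_gt0// ltr0n.
  have e1 : expR (- (rate m c k * 1)) <= 1 by rewrite -[leRHS]expR0 ler_expR mulr1; lra.
  have b0 : 0 <= barrier_sq k 1 by exact: barrier_sq_ge0.
  have b1 := barrier_sq1_le kr.
  have g0 : 0 <= growth ^+ k by rewrite exprn_ge0 ?(ltW growth_gt0).
  apply: (@le_trans _ _ (5 * p32 k%:R * 1 * ((amp m P0 1 + 111 * src_cst) * p32 k%:R^-1))).
    apply: ler_pM => //; first by rewrite mulr_ge0 ?expR_ge0.
    by apply: (ler_pM g0 (expR_ge0 _) (hA kr) e1).
  rewrite p32V ?ler0n// /s0 le_eqVlt; apply/orP; left; apply/eqP; field; rewrite gt_eqF//.
have t0 : 0 < f0 / s0 by rewrite divr_gt0.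
apply: (@le_trans _ _ (2 * (f0 / s0) * f0 - (f0 / s0) ^+ 2 * s0)).
  by rewrite le_eqVlt; apply/orP; left; apply/eqP; field; rewrite gt_eqF.
apply: lerB; first by rewrite ler_wpM2l// mulr_ge0// ltW.
by rewrite ler_wpM2l ?sqr_ge0.
Qed.

End TailFloor.

(** * Mean of the tree maximum, from below *)

Section LowerMean.
Context {R : realType}.
Local Notation lam := (@lam R).

Lemma ln_le_sqrt (x : R) : 0 < x -> ln x <= 2 * Num.sqrt x.
Proof.
move=> x0; have s0 : 0 < Num.sqrt x by rewrite sqrtr_gt0.
have -> : ln x = 2 * ln (Num.sqrt x).
  by rewrite -{1}(sqr_sqrtr (ltW x0)) lnXn// mulr_natl.
rewrite ler_wpM2l//; have := ln_sublinear s0; exact: ltW.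
Qed.

Lemma p32_expR (x : R) : 0 < x -> p32 x = expR (3 / 2 * ln x).
Proof.
move=> x0; have e : expR (ln x) = x by rewrite lnK ?posrE.
have h : Num.sqrt x = expR (ln x / 2).
  have -> : x = expR (ln x / 2) ^+ 2 by rewrite expr2 -expRD -splitr e.
  by rewrite sqrtr_sqr ger0_norm ?expR_ge0// expr2 -expRD -splitr expRK.
by rewrite /p32 h -{1}e -expRD; congr expR; field.
Qed.

(** Chosen so that n times the slope is lam n - 3/(2 lam) ln n. The growth factor then exceeds 1
    just enough for its n-th power to have order n^(3/2), which balances the decay of the
    amplitude. *)
Definition slope (n : nat) : R := lam - 3 / (2 * lam) * (ln n%:R / n%:R).

Lemma slope_bounds n : 60 ^+ 2 <= n%:R :> R -> 19 / 20 <= slope n <= 2.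
Proof.
move=> n60; have /andP[l1 l2] := @lam_bounds R.
have n0 : 0 < n%:R :> R by apply: lt_le_trans n60; rewrite exprn_gt0.
have s60 : 60 <= Num.sqrt n%:R :> R.
  by rewrite -(ler_pXn2r (n := 2)) ?nnegrE ?sqrtr_ge0// sqr_sqrtr// ltW.
have s2 : Num.sqrt n%:R ^+ 2 = n%:R :> R by rewrite sqr_sqrtr// ltW.
have ln0 : 0 <= ln n%:R :> R by apply: ln_ge0; nra.
have q0 : 0 <= ln n%:R / n%:R :> R by rewrite divr_ge0// ltW.
have q1 : ln n%:R / n%:R <= 1 / 30 :> R.
  rewrite ler_pdivrMr//; apply: le_trans (ln_le_sqrt n0) _.
  by rewrite -[in leRHS]s2; nra.
have g0 : 0 <= 3 / (2 * lam) by rewrite divr_ge0//; lra.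
have g1 : 3 / (2 * lam) <= 3 / 2 by rewrite ler_pdivrMr; lra.
have h0 : 0 <= 3 / (2 * lam) * (ln n%:R / n%:R) by exact: mulr_ge0.
have h1 : 3 / (2 * lam) * (ln n%:R / n%:R) <= 3 / 2 * (1 / 30) by apply: ler_pM.
by rewrite /slope; apply/andP; split; lra.
Qed.

Lemma growth_slope n : growth (slope n) = expR (3 / 2 * (ln n%:R / n%:R) - (3 / (2 * lam) * (ln n%:R / n%:R)) ^+ 2 / 2).
Proof.
have /andP[l1 l2] := @lam_bounds R.
rewrite /growth; have e2 : 2 = expR (lam ^+ 2 / 2) :> R.
  by have := @expR_lam R; rewrite expRN => e; rewrite -[RHS]invrK e div1r invrK.
rewrite {1}e2 -expRD; congr expR; rewrite /slope; move: (ln n%:R / n%:R) => q.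
have ln0 : lam != 0 by rewrite gt_eqF//; lra.
by field.
Qed.

(** The key inequality is k ln n / n <= 1 + ln k for k <= n: the growth stays compatible with
    k^(3/2) along the whole path, not only at its end. *)
Lemma growth_le n k : (0 < k <= n)%N -> growth (slope n) ^+ k <= 5 * p32 k%:R :> R.
Proof.
move=> /andP[k0 kn].
have K0 : 0 < k%:R :> R by rewrite ltr0n.
have N0 : 0 < n%:R :> R by rewrite ltr0n (leq_trans k0).
have kN : k%:R <= n%:R :> R by rewrite ler_nat.
have e5 : expR (3 / 2) <= 5 :> R.
  have h : expR (1 / 8) <= 8 / 7 :> R.
    rewrite -[leLHS]invrK -expRN -[leRHS]invrK lef_pV2 ?posrE ?expR_gt0 ?invr_gt0//.
    apply: le_trans (expR_ge1Dx _); lra.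
  have -> : 3 / 2 = 12%:R * (1 / 8) :> R by field.
  rewrite expRM_natl; apply: (@le_trans _ _ ((8 / 7) ^+ 12)); last by lra.
  by rewrite lerXn2r ?nnegrE ?expR_ge0.
rewrite growth_slope p32_expR// -expRM_natl.
apply: (@le_trans _ _ (expR (3 / 2 + 3 / 2 * ln k%:R))); last by rewrite expRD ler_wpM2r ?expR_ge0.
rewrite ler_expR.
have h : k%:R * (ln n%:R / n%:R) <= 1 + ln k%:R :> R.
  have lk0 : 0 <= ln k%:R :> R by rewrite ln_ge0// ler1n.
  have e : ln n%:R = ln k%:R + ln (n%:R / k%:R) :> R by rewrite ln_div ?posrE//; ring.
  have q0 : 0 < n%:R / k%:R :> R by rewrite divr_gt0.
  have l1 : ln (n%:R / k%:R) <= n%:R / k%:R :> R by apply/ltW/ln_sublinear.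
  have kn1 : k%:R / n%:R <= 1 :> R by rewrite ler_pdivrMr// mul1r.
  have kn0 : 0 <= k%:R / n%:R :> R by rewrite divr_ge0// ltW.
  have -> : k%:R * (ln n%:R / n%:R) = k%:R / n%:R * ln (n%:R / k%:R) + k%:R / n%:R * ln k%:R :> R by rewrite e; field; rewrite gt_eqF.
  apply: lerD; last by rewrite ler_piMl.
  apply: (@le_trans _ _ (k%:R / n%:R * (n%:R / k%:R))); first by rewrite ler_wpM2l.
  by rewrite mulrA divfK ?gt_eqF// divff ?gt_eqF.
have : 0 <= k%:R * ((3 / (2 * lam) * (ln n%:R / n%:R)) ^+ 2 / 2) by rewrite mulr_ge0 ?divr_ge0 ?sqr_ge0// ltW.
rewrite mulrBr [k%:R * (3 / 2 * _)]mulrCA; move: (k%:R * (_ / 2)) (k%:R * (ln _ / _)) h => a b; lra.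
Qed.

Lemma growth_ge n k : (0 < k <= n)%N -> (n - k)%:R <= Num.sqrt n%:R :> R ->
  expR (- 8) * p32 n%:R <= growth (slope n) ^+ k.
Proof.
move=> /andP[k0 kn] hk; have /andP[l1 l2] := @lam_bounds R.
have N1 : 1 <= n%:R :> R by rewrite ler1n (leq_trans k0).
have N0 : 0 < n%:R :> R by lra.
have ln0 : 0 <= ln n%:R :> R by exact: ln_ge0.
have lns := ln_le_sqrt N0; have s2 := sqr_sqrtr (ltW N0).
have s0 : 0 <= Num.sqrt n%:R :> R by exact: sqrtr_ge0.
rewrite growth_slope p32_expR// -expRM_natl -expRD ler_expR.
have kE : k%:R = n%:R - (n - k)%:R :> R by rewrite natrB//; ring.
set s := Num.sqrt n%:R in hk lns s2 s0; set L := ln n%:R in ln0 lns *.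
have h1 : (n - k)%:R * (L / n%:R) <= 2.
  rewrite mulrA ler_pdivrMr// -s2.
  apply: (@le_trans _ _ (s * (2 * s))); first by apply: ler_pM.
  by rewrite le_eqVlt; apply/orP; left; apply/eqP; ring.
have h2 : k%:R * ((3 / (2 * lam) * (L / n%:R)) ^+ 2 / 2) <= 9 / 2.
  have g0 : 0 <= 3 / (2 * lam) by rewrite divr_ge0//; lra.
  have g1 : 3 / (2 * lam) <= 3 / 2 by rewrite ler_pdivrMr; lra.
  have q0 : 0 <= L / n%:R by rewrite divr_ge0// ltW.
  have q2 : n%:R * (L / n%:R) ^+ 2 <= 4.
    have -> : n%:R * (L / n%:R) ^+ 2 = L ^+ 2 / n%:R by field; rewrite gt_eqF.
    rewrite ler_pdivrMr// -s2; have : L ^+ 2 <= (2 * s) ^+ 2 by rewrite lerXn2r ?nnegrE// mulr_ge0.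
    by rewrite exprMn; lra.
  have kq : k%:R * (L / n%:R) ^+ 2 <= 4.
    by apply: le_trans q2; rewrite ler_wpM2r ?sqr_ge0// ler_nat.
  have gg : (3 / (2 * lam)) ^+ 2 <= 9 / 4 by nra.
  have -> : k%:R * ((3 / (2 * lam) * (L / n%:R)) ^+ 2 / 2) = (3 / (2 * lam)) ^+ 2 * (k%:R * (L / n%:R) ^+ 2) / 2 by ring.
  rewrite ler_pdivrMr//; apply: (@le_trans _ _ (9 / 4 * 4)); last by lra.
  by apply: ler_pM => //; rewrite ?sqr_ge0// mulr_ge0 ?sqr_ge0.
rewrite mulrBr [k%:R * (3 / 2 * _)]mulrCA.
have e : k%:R * (L / n%:R) = L - (n - k)%:R * (L / n%:R) by rewrite kE mulrBl mulrC divfK ?gt_eqF.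
rewrite e; move: ((n - k)%:R * _) (k%:R * _) h1 h2 => a b; lra.
Qed.

(** From sqrt(1 - d) >= 1 - d/2 - d^2/2: the linear terms cancel by antisymmetry and the squares are
    summable, so the modified variances move the front by a constant only. *)
Lemma level_sd_sum m : (m + m)%:R - 256 <= \sum_(i < m + m) level_sd m i.+1 :> R.
Proof.
have pt (d s : R) : - (1 / 2) <= d <= 1 / 2 -> 0 <= s -> s ^+ 2 = 1 - d -> 1 - d / 2 - d ^+ 2 / 2 <= s.
  move=> /andP[d1 d2] s0 e; case: (leP (1 - d / 2 - d ^+ 2 / 2) 0) => h; first by apply: le_trans h s0.
  rewrite -(ler_pXn2r (n := 2)) ?nnegrE ?(ltW h)// e.
  have -> : (1 - d / 2 - d ^+ 2 / 2) ^+ 2 = 1 - d - d ^+ 2 * (3 / 4 - d / 2 - d ^+ 2 / 4) by field.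
  have : 0 <= d ^+ 2 * (3 / 4 - d / 2 - d ^+ 2 / 4) by rewrite mulr_ge0 ?sqr_ge0//; nra.
  lra.
have s (j : nat) : 0 < (j%:R + 16 : R) by rewrite ltr_wpDl.
have rev (f : nat -> R) : \sum_(i < m + m) f ((m + m).-1 - i)%N = \sum_(i < m + m) f i.
  rewrite [RHS](reindex_inj rev_ord_inj)/=; apply: eq_bigr => i _; congr f.
  by have := ltn_ord i; lia.
have d0 : \sum_(i < m + m) var_deficit m i = 0 :> R.
  by rewrite /var_deficit sumrB (rev (fun j => 8 / (j%:R + 16))) subrr.
have q (j : nat) : (8 / (j%:R + 16 : R)) ^+ 2 <= 64 * j.+1%:R ^- 2.
  have -> : 64 * j.+1%:R ^- 2 = (8 / j.+1%:R) ^+ 2 :> R by rewrite expr_div_n; congr (_ / _); ring.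
  rewrite lerXn2r ?nnegrE ?divr_ge0 ?(ltW (s j))// ler_wpM2l// lef_pV2 ?posrE// -natr1; lra.
have d2 : \sum_(i < m + m) var_deficit m i ^+ 2 <= 512 :> R.
  apply: (@le_trans _ _ (\sum_(i < m + m) (2 * (64 * i.+1%:R ^- 2) + 2 * (64 * ((m + m).-1 - i).+1%:R ^- 2)))).
    apply: ler_sum => i _; have h1 := q i; have h2 := q ((m + m).-1 - i)%N.
    have aux (a b X Y : R) : a ^+ 2 <= X -> b ^+ 2 <= Y -> (a - b) ^+ 2 <= 2 * X + 2 * Y by move=> *; have := sqr_ge0 (a + b); nra.
    exact: aux h1 h2.
  rewrite big_split/= -!mulr_sumr (rev (fun j => j.+1%:R ^- 2)).
  by have := @inv_sqr_sum R (m + m); move: (\sum_(_ < _) _) => S; lra.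
apply: (@le_trans _ _ (\sum_(i < m + m) (1 - var_deficit m i / 2 - var_deficit m i ^+ 2 / 2))); last first.
  by apply: ler_sum => i _; apply: pt; [exact: var_deficit_bounds|exact: sqrtr_ge0|exact: level_sd_sqr].
rewrite !sumrB -!mulr_suml d0 mul0r subr0 sumr_const card_ord.
by move: (\sum_(_ < _) _) d2 => S; lra.
Qed.

Lemma deficit_linear (sigma a : nat -> R) (D : R) k : (forall i, `|a i.+1 - a i| + 2 * (`|sigma i.+1| * gauss_abs) <= D) ->
  0 <= tree_deficit sigma a k <= `|a 0%N| + D * k%:R.
Proof.
move=> hD; have g0 : 0 <= gauss_abs :> R by apply: Ex_ge0.
elim: k => [|k /andP[ih0 ih]] /=; first by rewrite mulr0 addr0 lexx normr_ge0.
have [_ wb] := tree_tail_bounds sigma k; have /andP[w0 w1] := wb (a k).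
have h := hD k; have n1 : 0 <= `|a k.+1 - a k| by [].
have n2 : 0 <= 2 * (`|sigma k.+1| * gauss_abs) by rewrite !mulr_ge0.
rewrite -[k.+1%:R]natr1; move: (tree_tail _ _ _) w0 w1 => w w0 w1.
have : 0 <= (1 - w) * tree_deficit sigma a k by rewrite mulr_ge0// subr_ge0.
have : (1 - w) * tree_deficit sigma a k <= tree_deficit sigma a k by rewrite ler_piMl//; lra.
by move=> h1 h2; apply/andP; split; lra.
Qed.

(** A level at which the reference is exceeded with probability at least c0 multiplies the deficit
    by at most 1 - c0 and adds at most D; the added terms form a geometric series. *)
Lemma deficit_contract (sigma a : nat -> R) (D c0 : R) k l : (forall i, `|a i.+1 - a i| + 2 * (`|sigma i.+1| * gauss_abs) <= D) ->
  0 < c0 <= 1 -> (forall i, (k <= i < k + l)%N -> c0 <= tree_tail sigma i (a i)) ->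
  tree_deficit sigma a (k + l) <= (1 - c0) ^+ l * tree_deficit sigma a k + D / c0.
Proof.
move=> hD /andP[c00 c01] hc; have g0 : 0 <= gauss_abs :> R by apply: Ex_ge0.
have D0 : 0 <= D by apply: le_trans (hD 0%N); rewrite addr_ge0// !mulr_ge0.
have q0 : 0 <= 1 - c0 by lra.
elim: l hc => [|l ih] hc; first by rewrite addn0 expr0 mul1r lerDl divr_ge0// ltW.
have := ih (fun i hi => hc i ltac:(lia)) => {}ih.
have wc := hc (k + l)%N ltac:(lia).
have [_ wb] := tree_tail_bounds sigma (k + l); have /andP[w0 w1] := wb (a (k + l)%N).
have /andP[d0 _] := deficit_linear (k + l) hD.
rewrite addnS /=; have h := hD (k + l)%N.
have h1 : (1 - tree_tail sigma (k + l) (a (k + l)%N)) * tree_deficit sigma a (k + l) <= (1 - c0) * tree_deficit sigma a (k + l).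
  by rewrite ler_wpM2r// lerD2l lerN2.
have h2 : (1 - c0) * tree_deficit sigma a (k + l) <= (1 - c0) * ((1 - c0) ^+ l * tree_deficit sigma a k + D / c0) by rewrite ler_wpM2l.
have e : (1 - c0) * ((1 - c0) ^+ l * tree_deficit sigma a k + D / c0) + D = (1 - c0) ^+ l.+1 * tree_deficit sigma a k + D / c0.
  by rewrite exprS; field; rewrite gt_eqF.
by rewrite -e; lra.
Qed.

(** Uniformity in m rests on [P0], which is fixed by the condition on the amplitude at level 1 and
    does not involve m. *)
Lemma tail_floor_exists : exists2 c0 : R, 0 < c0 & forall m k, (1 < m)%N -> 60 ^+ 2 <= (m + m)%:R :> R ->
  (m <= k <= m + m)%N -> (m + m - k)%:R <= Num.sqrt (m + m)%:R :> R ->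
  c0 <= tree_tail (level_sd m) k (front m (slope (m + m)) k - 3).
Proof.
pose P0 : R := gauss_floor / 4 * p32 (1 / 6) * expR (- (2 * bot_cst)).
have gf0 := @gauss_floor_gt0 R.
have p60 : 0 < p32 (1 / 6) :> R by rewrite p32_gt0.
have P00 : 0 < P0 by rewrite /P0 mulr_gt0 ?expR_gt0// mulr_gt0// divr_gt0.
pose num : R := (expR (- 8) * (P0 * expR (- (27 / 2) - top_cst)) * expR (- 8)) ^+ 2.
have num0 : 0 < num by rewrite exprn_gt0// !mulr_gt0 ?expR_gt0.
have den0 : 0 < 5 * (gauss_floor + 111 * src_cst P0) by rewrite mulr_gt0// ltr_pwDl// mulr_ge0// src_cst_ge0.
exists (num / (5 * (gauss_floor + 111 * src_cst P0))); first by rewrite divr_gt0.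
move=> m k m1 n60 mk hk; have m0 : (0 < m)%N by exact: ltnW.
have hP0 : 4 * amp m P0 1 <= gauss_floor.
  rewrite /amp m1 /amp_low pvar1 /P0.
  have y1 := @ysq_ge R m 1 isT.
  have : expR (- (2 * bot_cst)) * expR (bot_cst / ysq m 1) <= 1 :> R.
    rewrite -expRD -[leRHS]expR0 ler_expR addrC subr_le0 [leRHS]mulrC ler_wpM2l ?bot_cst_ge0//.
    by rewrite -[leRHS]invrK lef_pV2 ?posrE ?invr_gt0//; lra.
  move=> h; have -> : 4 * ((gauss_floor : R) / 4 * p32 (1 / 6) * expR (- (2 * bot_cst)) * expR (bot_cst / ysq m 1) / p32 (1 / 6)) =
    gauss_floor * (expR (- (2 * bot_cst)) * expR (bot_cst / ysq m 1)) by field; rewrite gt_eqF.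
  by rewrite ler_piMr// ltW.
have hA j : (0 < j <= m + m)%N -> growth (slope (m + m)) ^+ j <= 5 * p32 j%:R by exact: growth_le.
have hg : expR (- 8) * p32 m%:R <= growth (slope (m + m)) ^+ k.
  apply: le_trans (growth_ge _ hk); last by lia.
  by rewrite ler_wpM2l ?expR_ge0//; apply: le_p32 => //; rewrite ler_nat leq_addr.
have := tree_tail_floor m1 (slope_bounds n60) P00 hA hP0 mk (expR_gt0 _) hg.
apply: le_trans; rewrite -/num ler_wpM2l ?(ltW num0)//.
have A1 := @amp_gt0 R m m0 P0 P00 1 isT.
have S0 : 0 <= src_cst P0 by exact: src_cst_ge0.
rewrite lef_pV2 ?posrE//; last by rewrite mulr_gt0// ltr_pwDl// mulr_ge0.
by rewrite ler_wpM2l// lerD2r; lra.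
Qed.

Lemma tree_lower : exists C : R, forall m, (0 < m)%N -> exists d (T : measurableType d) (P : probability T R)
  (B : leaf (m + m) -> T -> R) V, [/\ gfield P B V,
   forall x y, Ex P (fun t => (B x t - B y t) ^+ 2) = 2 * \sum_(i < branch_height x y) (1 - var_deficit m i) &
   lam * (m + m)%:R - 3 / (2 * lam) * ln (m + m)%:R - C <= Ex P (fun t => fmax (leaf0 (m + m)) (fun x => B x t))].
Proof.
have [c0 c00 hc0] := tail_floor_exists.
have /andP[l1 l2] := @lam_bounds R.
have g0 : 0 <= gauss_abs :> R by apply: Ex_ge0.
pose D : R := 3 + 3 * gauss_abs.
pose C1 : R := expR c0 * (2 / c0 ^+ 2) * (6 + D) + D / c0 + 515.
exists (C1 + 2 * 60 ^+ 2) => m m0.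
have N0 : 0 < (m + m)%:R :> R by rewrite ltr0n addn_gt0 m0.
have N1 : 1 <= (m + m)%:R :> R by rewrite ler1n addn_gt0 m0.
have D0 : 0 <= D by rewrite /D addr_ge0// mulr_ge0.
have C10 : 0 <= C1.
  apply: addr_ge0; last exact: ler0n.
  apply: addr_ge0; last by rewrite divr_ge0// ltW.
  apply: mulr_ge0; last by rewrite addr_ge0.
  by rewrite mulr_ge0 ?expR_ge0 ?divr_ge0 ?sqr_ge0.
have ln0 : 0 <= ln (m + m)%:R :> R by exact: ln_ge0.
have gl : 0 <= 3 / (2 * lam) * ln (m + m)%:R by rewrite mulr_ge0// divr_ge0//; lra.
pose n := (m + m)%N; pose L := Num.truncn (Num.sqrt n%:R : R).
pose k0 := (n - L)%N; pose c := slope n.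
(* The reference level is constant up to height k0 and follows the front minus 3 over the last L
   levels, L being the integer part of sqrt n. At k0 the deficit is at most linear in n, and n (1 -
   c0)^L is bounded. *)
pose a (k : nat) := front m c (maxn k k0) - 3.
have [d [T [P [B [V [gB _ vB _ defB]]]]]] := tree_exists (level_sd m) a n.
exists d, T, P, B, V; split => //.
  by move=> x y; rewrite vB; congr (2 * _); apply: eq_bigr => i _; rewrite level_sd_sqr.
have LB x : L1 P (B x) by exact: (gfield_L1 gB x).
pose M t := fmax (leaf0 n) (fun x => B x t).
have LM : L1 P M by exact: L1_fmax.
(* For n < 60^2 the mean is nonnegative and, as lam <= 2, the term 2 times 60^2 in the constant
   covers lam n. *)
case: (leP (60 ^+ 2) (n%:R : R)) => n60; last first.
  have h0 : 0 <= Ex P M.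
    rewrite -(gfield_mean gB (leaf0 n)); apply: le_Ex => // t; exact: (@fmax_ge _ _ _ (fun x => B x t)).
  apply: le_trans h0; rewrite -/n; rewrite -/n in gl; nra.
have m1 : (1 < m)%N.
  rewrite ltn_neqAle m0 andbT; apply/eqP => e; move: n60; rewrite /n -e natrD; lra.
have cb := slope_bounds n60; rewrite -/c in cb.
have /andP[c1 c2] := cb.
have incr i : `|a i.+1 - a i| + 2 * (`|level_sd m i.+1| * gauss_abs) <= D.
  have /andP[s1 s2] := @level_sd_bounds R m i.+1.
  rewrite [`|level_sd m i.+1|]ger0_norm; last by lra.
  have h1 : 2 * (level_sd m i.+1 * gauss_abs) <= 3 * gauss_abs :> R.
    by rewrite mulrA ler_wpM2r//; lra.
  have h2 : `|a i.+1 - a i| <= 3.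
    rewrite /a; case: (leqP k0 i) => ik.
      rewrite (maxn_idPl (leqW ik)) /front big_ord_recr/=.
      rewrite (_ : _ - 3 - (_ - 3) = c * level_sd m i.+1); last by ring.
      by rewrite ger0_norm; nra.
    by rewrite (maxn_idPr ik) subrr normr0.
  rewrite /D; lra.
have sL : L%:R <= Num.sqrt n%:R :> R by have /andP[] := @truncn_itv R (Num.sqrt n%:R) (sqrtr_ge0 _).
have sL1 : Num.sqrt n%:R < L%:R + 1 :> R by rewrite natr1; have /andP[] := @truncn_itv R (Num.sqrt n%:R) (sqrtr_ge0 _).
have s60 : 60 <= Num.sqrt n%:R :> R.
  by rewrite -(ler_pXn2r (n := 2)) ?nnegrE ?sqrtr_ge0// sqr_sqrtr.
have Lm : (L <= m)%N.
  rewrite -(ler_nat R); apply: le_trans sL _.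
  have := sqr_sqrtr (ltW N0); rewrite -/n; move: s60; rewrite natrD; move: (Num.sqrt _) => s s60 e.
  by have : s * 60 <= s ^+ 2 by [rewrite expr2 ler_wpM2l//; lra]; lra.
have k0n : (k0 + L)%N = n by rewrite subnK//; exact: leq_trans Lm (leq_addr _ _).
have mk0 : (m <= k0)%N by rewrite /k0 /n -addnBA// leq_addr.
have floor i : (k0 <= i <= n)%N -> c0 <= tree_tail (level_sd m) i (a i).
  move=> /andP[ki ik]; rewrite /a (maxn_idPl ki); apply: hc0 => //; first by rewrite (leq_trans mk0 ki).
  by apply: le_trans sL; rewrite ler_nat leq_subLR [(i + L)%N]addnC -leq_subLR.
have c01 : c0 <= 1.
  apply: le_trans (floor n ltac:(by rewrite leq_subr leqnn)) _.
  by have [_ wb] := tree_tail_bounds (level_sd m : nat -> R) n; case/andP: (wb (a n)).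
have front_le k : 0 <= front m c k <= 3 * k%:R.
  rewrite /front; apply/andP; split.
    by apply: sumr_ge0 => i _; have := @level_sd_bounds R m i.+1; nra.
  apply: (@le_trans _ _ (\sum_(i < k) 3)).
    by apply: ler_sum => i _; have := @level_sd_bounds R m i.+1; nra.
  by rewrite sumr_const card_ord [leRHS]mulr_natr.
have db : tree_deficit (level_sd m) a n <= expR c0 * (2 / c0 ^+ 2) * (6 + D) + D / c0.
  rewrite -{1}k0n.
  have floor' i : (k0 <= i < k0 + L)%N -> c0 <= tree_tail (level_sd m) i (a i).
    by move=> /andP[h1 h2]; apply: floor; rewrite h1 -k0n ltnW.
  have c0b : 0 < c0 <= 1 by rewrite c00.
  apply: le_trans (deficit_contract incr c0b floor') _.
  rewrite lerD2r; have /andP[dd0 dd1] := deficit_linear k0 incr.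
  have q0 : 0 <= 1 - c0 by lra.
  have dd : tree_deficit (level_sd m) a k0 <= (6 + D) * n%:R.
    apply: le_trans dd1 _; rewrite [leRHS]mulrDl; apply: lerD; last by rewrite ler_wpM2l// ler_nat leq_subr.
    rewrite /a max0n; have /andP[f0 f1] := front_le k0.
    have : k0%:R <= n%:R :> R by rewrite ler_nat leq_subr.
    by rewrite ler_norml => kn; apply/andP; split; rewrite -/n in N1; lra.
  have qL : (1 - c0) ^+ L <= expR c0 * (2 / c0 ^+ 2) / n%:R.
    apply: (@le_trans _ _ (expR (- c0) ^+ L)); first by rewrite lerXn2r ?nnegrE ?expR_ge0// expR_ge1Dx.
    rewrite -expRM_natr.
    apply: (@le_trans _ _ (expR c0 * expR (- (c0 * Num.sqrt n%:R)))); first by rewrite -expRD ler_expR; nra.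
    have c2n : 0 < c0 ^+ 2 * n%:R / 2 by rewrite divr_gt0// mulr_gt0// exprn_gt0.
    rewrite -[leRHS]mulrA (_ : 2 / c0 ^+ 2 / n%:R = (c0 ^+ 2 * n%:R / 2)^-1); last by field; rewrite !gt_eqF.
    rewrite ler_wpM2l ?expR_ge0// expRN lef_pV2 ?posrE ?expR_gt0//.
    apply: le_trans (expR_ge2 _); last by rewrite mulr_ge0// ltW.
    by rewrite exprMn sqr_sqrtr// lerDr addr_ge0// mulr_ge0// ltW.
  apply: (@le_trans _ _ (expR c0 * (2 / c0 ^+ 2) / n%:R * ((6 + D) * n%:R))).
    by apply: ler_pM => //; rewrite exprn_ge0.
  by rewrite le_eqVlt; apply/orP; left; apply/eqP; field; rewrite !gt_eqF.
have fr : lam * n%:R - 3 / (2 * lam) * ln n%:R - 512 <= front m c n.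
  rewrite /front -mulr_sumr; have := level_sd_sum m; rewrite -/n => hs.
  apply: (@le_trans _ _ (c * (n%:R - 256))); last by rewrite ler_wpM2l//; lra.
  have -> : c * (n%:R - 256) = c * n%:R - 256 * c by ring.
  have -> : c * n%:R = lam * n%:R - 3 / (2 * lam) * ln n%:R by rewrite /c /slope mulrBl -!mulrA mulVf ?mulr1// gt_eqF.
  lra.
have LR : L1 P (fun t => Num.max (a n - M t) 0).
  by apply: L1_max; [apply: L1B => //; exact: L1_cst|exact: L1_cst].
have key : a n - tree_deficit (level_sd m) a n <= Ex P M.
  apply: (@le_trans _ _ (a n - Ex P (fun t => Num.max (a n - M t) 0))); first by rewrite lerD2l lerN2.
  rewrite -{1}(Ex_cst P (a n)) -ExB//; last exact: L1_cst.
  apply: le_Ex => //; first by apply: L1B => //; exact: L1_cst.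
  move=> t; rewrite lerBlDr -lerBlDl le_max lexx//.
apply: le_trans key; rewrite /a (maxn_idPl (leq_subr _ _)) -/n /C1.
move: fr db; move: (front m c n) (tree_deficit _ _ _) (expR c0 * _ * _) (3 / (2 * lam) * _) (lam * _) => *; lra.
Qed.

End LowerMean.

(** * Comparison of the free field with trees *)

Section GreenOfWalk.
Context {R : realType} (dW : measure_display) (W : measurableType dW).
Variables (PW : int * int -> probability W R) (w : nat -> W -> int * int).
Hypothesis srw_w : forall x, simple_random_walk (PW x) x w.

Definition green_of (N : nat) (x y : int * int) : R := if interior_pt N x then green_fun N x y else 0.

Section one_field.
Context d (T : measurableType d) (P : probability T R) (n : nat) (X : site n.+1 -> {RV P >-> R}).
Hypothesis gX : discrete_GFF PW w X.

Lemma gff_cov (i j : site n.+1) :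
  ('E_P[fun t => (X i t * X j t)%R] = (green_of n.+1 (site_point i) (site_point j))%:E)%E.
Proof.
rewrite (gff_covariance gX) /green_of; case: (boolP (interior_pt _ _)) => ii.
  exact: (green_interior srw_w).
have [|bi] := orP (site_pointP i); first by rewrite (negbTE ii).
exact: (green_boundary srw_w).
Qed.

Definition gff_var (a : site n.+1 -> R) : R :=
  \sum_i \sum_j a i * a j * green_of n.+1 (site_point i) (site_point j).

Lemma gff_gfield : gfield P (fun i => X i : T -> R) gff_var.
Proof.
exact: (gfield_of_gaussian_field (gff_gaussian gX) (gff_centered gX) gff_cov).
Qed.

(** The Laplacian, the sign and the vanishing outside come from the walk; symmetry and positive
    semidefiniteness are read off the field, whose covariance this is. *)
Lemma gff_is_green : is_green n.+1 (green_of n.+1).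
Proof.
split.
- by move=> x y nx; rewrite /green_of (negbTE nx).
- move=> x y ix iy; rewrite /lap /green_of ix (green_fun_eq ix iy); ring.
- have half x y : interior_pt n.+1 x -> ~~ interior_pt n.+1 y -> green_fun n.+1 x y = 0 :> R.
    by move=> ix ny; apply: green_fun_out.
  move=> x y; rewrite /green_of; case: (boolP (interior_pt _ x)) => ix; case: (boolP (interior_pt _ y)) => iy //.
  + have [i ei] := site_interior ix; have [j ej] := site_interior iy.
    have h1 := gff_cov i j; have h2 := gff_cov j i; rewrite /green_of ei ej ix in h1; rewrite /green_of ei ej iy in h2.
    apply: EFin_inj; rewrite -h1 -h2; congr expectation.
    by apply/funext => t; rewrite mulrC.
  + by rewrite half.
  + by rewrite half.
- by move=> x y; rewrite /green_of; case: ifP => ix //; exact: (green_fun_ge0 ix).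
- by move=> b; case: (gff_gfield b).
Qed.

Lemma gff_dist (i j : site n.+1) : let G := green_of n.+1 in
  Ex P (fun t => (X i t - X j t) ^+ 2) =
  G (site_point i) (site_point i) + G (site_point j) (site_point j) - 2 * G (site_point i) (site_point j).
Proof.
move=> G; rewrite (cgauss_var (gfield_cgaussB gff_gfield i j)) /gff_var.
have S (f : site n.+1 -> R) : \sum_k (dirac_coef i k - dirac_coef j k) * f k = f i - f j.
  by rewrite -(sum_dirac_coef i f) -(sum_dirac_coef j f) -sumrB; apply: eq_bigr => k _; rewrite mulrBl.
transitivity (\sum_k (dirac_coef i k - dirac_coef j k) * (G (site_point k) (site_point i) - G (site_point k) (site_point j))).
  apply: eq_bigr => k _; rewrite -(S (fun l => G (site_point k) (site_point l))) mulr_sumr.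
  by apply: eq_bigr => l _; rewrite mulrA.
rewrite (S (fun k => G (site_point k) (site_point i) - G (site_point k) (site_point j))).
rewrite /G (green_sym gff_is_green (site_point j) (site_point i)); ring.
Qed.

Lemma gff_var_site (i : site n.+1) : Ex P (fun t => X i t ^+ 2) = green_of n.+1 (site_point i) (site_point i).
Proof.
rewrite (cgauss_var (gfield_cgauss gff_gfield i)) /gff_var.
rewrite -[RHS](sum_dirac_coef i (fun k => green_of n.+1 (site_point k) (site_point i))).
apply: eq_bigr => k _; rewrite -(sum_dirac_coef i (fun l => green_of n.+1 (site_point k) (site_point l))) mulr_sumr.
by apply: eq_bigr => l _; rewrite mulrA.
Qed.

End one_field.
End GreenOfWalk.

(** * Upper comparison by binary digits *)

Section UpperEmbedding.
Context {R : realType}.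
Local Notation lam := (@lam R).

(** Two tree levels per binary digit above [K] idle levels at the leaves. The recursive form lets
    the type of leaves reduce as [encode] needs. *)
Fixpoint depth (K L : nat) : nat := if L is L'.+1 then (depth K L').+2 else K.

Lemma depthE K L : depth K L = (L + L + K)%N.
Proof. by elim: L => //= L ->; rewrite !addSn !addnS. Qed.

(* Interleaves the binary digits of the two coordinates. *)
Fixpoint encode (K L a b : nat) : leaf (depth K L) :=
  if L is L'.+1 return leaf (depth K L) then
    (2 ^ L' <= a, (2 ^ L' <= b, encode K L' (a %% 2 ^ L') (b %% 2 ^ L')))%N
  else leaf0 K.

(** Points that first differ at a given digit share a square of twice that digit's scale, hence are
    close. The idle levels raise the branching height of all pairs of distinct points by the same
    [K]. *)
Lemma encode_dist K L a b a' b' : (a < 2 ^ L)%N -> (b < 2 ^ L)%N -> (a' < 2 ^ L)%N -> (b' < 2 ^ L)%N ->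
  (a, b) != (a', b') -> exists2 h, branch_height (encode K L a b) (encode K L a' b') = (h + K)%N &
    (`|a%:Z - a'%:Z| ^ 2 + `|b%:Z - b'%:Z| ^ 2 <= 4 * 2 ^ h)%N.
Proof.
elim: L a b a' b' => [|L ih] a b a' b' ha hb ha' hb' ne.
  by rewrite expn0 !ltnS !leqn0 in ha hb ha' hb'; rewrite (eqP ha) (eqP hb) (eqP ha') (eqP hb') eqxx in ne.
have p0 : (0 < 2 ^ L)%N by rewrite expn_gt0.
have pS : (2 ^ L.+1 = 2 ^ L + 2 ^ L)%N by rewrite expnS mul2n addnn.
have p2 : (2 ^ (L + L) = 2 ^ L * 2 ^ L)%N by rewrite expnD.
rewrite pS in ha hb ha' hb'; rewrite [branch_height _ _]/=.
have modE x : (x < 2 ^ L + 2 ^ L)%N -> (x %% 2 ^ L = x - (2 ^ L <= x) * 2 ^ L)%N.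
  move=> hx; case: leqP => h; last by rewrite mul0n subn0 modn_small.
  by rewrite mul1n -[in LHS](subnK h) modnDr modn_small// ltn_subLR.
case: eqP => [e1|e1]; last first.
  exists (L + L).+2; first by rewrite depthE.
  rewrite (expnS 2 (L + L).+1) (expnS 2 (L + L)) p2; move: (2 ^ L)%N ha hb ha' hb' => q *.
  have : (`|a%:Z - a'%:Z| <= q + q)%N by lia.
  have : (`|b%:Z - b'%:Z| <= q + q)%N by lia.
  move: (`|_|)%N (`|_|)%N => u v; rewrite -!mulnn; nia.
case: eqP => [e2|e2]; last first.
  exists (L + L).+1; first by rewrite depthE.
  rewrite (expnS 2 (L + L)) p2; move: (2 ^ L)%N ha hb ha' hb' e1 => q *.
  have : (`|a%:Z - a'%:Z| <= q)%N by lia.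
  have : (`|b%:Z - b'%:Z| <= q + q)%N by lia.
  move: (`|_|)%N (`|_|)%N => u v; rewrite -!mulnn; nia.
have m x : (x %% 2 ^ L < 2 ^ L)%N by rewrite ltn_mod.
have ne' : (a %% 2 ^ L, b %% 2 ^ L)%N != (a' %% 2 ^ L, b' %% 2 ^ L)%N.
  apply: contra ne => /eqP [h1 h2]; rewrite !modE// e1 e2 in h1 h2.
  apply/eqP; congr pair; move: h1 h2 e1 e2; case: leqP; case: leqP => //; lia.
have [h hb1 hb2] := ih _ _ _ _ (m a) (m b) (m a') (m b') ne'.
exists h; first exact: hb1.
apply: leq_trans hb2; rewrite !modE// -e1 -e2; apply: eq_leq; congr (_ ^ 2 + _ ^ 2)%N.
  by move: e1; case: leqP => h1; case: leqP => h2 // _; lia.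
by move: e2; case: leqP => h1; case: leqP => h2 // _; lia.
Qed.

End UpperEmbedding.

Section UpperBound.
Context {R : realType}.
Local Notation lam := (@lam R).
Variable G : nat -> int * int -> int * int -> R.
Hypothesis hG : forall n, is_green n.+1 (G n).

Let k0 : 0 < kappa := kappa_gt0 hG.

Lemma green_cst_ge0 : 0 <= green_cst :> R.
Proof.
have h := @green_dist R 9 (G 8) (4, 4) (4, 4) (hG 8) isT isT isT isT.
by have := le_trans (normr_ge0 _) h; rewrite pmulr_rge0.
Qed.

(** Scales the tree so that one level adds ln 2 to [kappa] times the squared increment, which is
    what doubling |x - y|^2 adds on the side of the field. *)
Definition vol : R := Num.sqrt (ln 2 / (2 * kappa)).

Lemma ln2_gt0 : 0 < ln 2 :> R. Proof. by have := @ln2_bounds R; lra. Qed.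

Lemma vol_sqr : kappa * (2 * vol ^+ 2) = ln 2.
Proof.
rewrite sqr_sqrtr; last by rewrite divr_ge0 ?mulr_ge0 ?(ltW k0) ?(ltW ln2_gt0).
by field; rewrite gt_eqF.
Qed.

Lemma vol_ge0 : 0 <= vol. Proof. exact: sqrtr_ge0. Qed.

Lemma normsq_nat (z : int * int) : normsq z = (`|z.1| ^ 2 + `|z.2| ^ 2)%N%:R :> R.
Proof.
rewrite /normsq natrD !natrX; congr (_ + _);
by rewrite -[LHS]real_normK ?num_real// -intr_norm -abszE.
Qed.

Definition is_gff n d (T : measurableType d) (P : probability T R) (X : site n.+1 -> T -> R) : Prop :=
  (exists V, gfield P X V) /\ forall i j, Ex P (fun t => (X i t - X j t) ^+ 2) =
    G n (site_point i) (site_point i) + G n (site_point j) (site_point j) - 2 * G n (site_point i) (site_point j).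

(** [green_dist] holds only in the bulk, so the field is first compared with the one on a box three
    times as large, in the middle of which the given box is placed. The idle levels absorb the error
    4 [green_cst] and the factor 4 of [encode_dist], using ln 2 >= 1/2. *)
Lemma gff_upper : exists C : R, exists K : nat, forall n d (T : measurableType d) (P : probability T R) (X : site n.+1 -> T -> R),
  is_gff P X -> Ex P (fun t => fmax (ord0, ord0) (fun i => X i t)) <= vol * (front_up (depth K (up_log 2 n.+1)) + C).
Proof.
have [C hC] := @tree_upper R.
have c0 := green_cst_ge0.
pose K := (2 + Num.bound (8 * green_cst : R))%N.
exists C, K => n d T P X [[V gX] dX].
set L := up_log 2 n.+1.
have [d' [T' [P' [B [V' [gB vB mB]]]]]] := hC (depth K L).
have NL : (n.+1 <= 2 ^ L)%N by exact: up_logP.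
have LB x : L1 P' (B x) by exact: (gfield_L1 gB x).
apply: (@le_trans _ _ (Ex P' (fun t => fmax (leaf0 (depth K L)) (fun x => vol * B x t)))); last first.
  under eq_Ex do rewrite (fmaxZ _ _ vol_ge0).
  by rewrite ExZ ?ler_wpM2l ?vol_ge0//; exact: L1_fmax.
apply: (sudakov_fernique (ord0, ord0) (leaf0 _) (iota := fun i : site n.+1 => encode K L i.1 i.2) gX (gfield_scale gB vol)) => i j.
case: (eqVneq i j) => [->|ij].
  under eq_Ex do rewrite subrr expr0n.
  by rewrite Ex_cst; apply: Ex_ge0 => t; exact: sqr_ge0.
rewrite dX; set bi := encode _ _ _ _; set bj := encode _ _ _ _.
have -> : Ex P' (fun t => (vol * B bi t - vol * B bj t) ^+ 2) = vol ^+ 2 * (2 * (branch_height bi bj)%:R).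
  rewrite -vB -ExZ; last exact: (sqr_diff_L1 bi bj gB).
  by apply: eq_Ex => t; rewrite -mulrBr exprMn.
have lt_n (k : 'I_n.+1) : (k < 2 ^ L)%N by exact: leq_trans (ltn_ord k) NL.
have ne : ((i.1 : nat), (i.2 : nat)) != ((j.1 : nat), (j.2 : nat)).
  apply: contra ij => /eqP [/val_inj h1 /val_inj h2]; apply/eqP.
  by case: (i) (j) h1 h2 => [a b] [a' b'] /= -> ->.
have [h -> hdist] := @encode_dist K L _ _ _ _ (lt_n i.1) (lt_n i.2) (lt_n j.1) (lt_n j.2) ne.
pose o : int * int := (n.+1%:Z, n.+1%:Z).
pose M := (n.+1 + n.+1 + n)%N.
have inM (k : site n.+1) : interior_pt M.+1 (site_point k + o).
  by case: k => [[a ha] [b hb]]; rewrite /interior_pt /site_point /o /M /=; lia.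
have bulkM (k : site n.+1) : bulk M.+1 (site_point k + o).
  by case: k => [[a ha] [b hb]]; rewrite /bulk /site_point /o /M /=; lia.
have mono : forall z, interior_pt n.+1 z -> interior_pt M.+1 (z + o).
  by move=> [a b]; rewrite /interior_pt /o /M /=; lia.
apply: le_trans (green_domain_mono (hG n) (hG M) mono (site_interior (inM i)) (site_interior (inM j))) _.
have := green_dist (hG M) (inM i) (inM j) (bulkM i) (bulkM j).
set D := _ - 2 * G M _ _; rewrite ler_norml => /andP[_ hD].
rewrite -(ler_pM2l k0).
have -> : kappa * (vol ^+ 2 * (2 * (h + K)%:R)) = ln 2 * (h + K)%:R by rewrite -vol_sqr; ring.
have hl : 2 * logf (site_point i + o - (site_point j + o)) <= (h%:R + 2) * ln 2 :> R.
  rewrite /logf mulrCA divff// mulr1.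
  have -> : (h%:R + 2) * ln 2 = ln ((4 * 2 ^ h)%N%:R) :> R.
    by rewrite (_ : (4 * 2 ^ h)%N = (2 ^ h.+2)%N); [rewrite natrX lnXn// -[RHS]mulr_natr -[h.+2%:R]natr1 -[h.+1%:R]natr1; ring|rewrite !expnS mulnA].
  rewrite ler_ln ?posrE ?ltr0n ?muln_gt0 ?expn_gt0//; last by rewrite lt_max ltr01 orbT.
  rewrite ge_max ler1n muln_gt0 expn_gt0 andbT normsq_nat ler_nat.
  apply: leq_trans hdist; rewrite opprD addrACA subrr addr0.
  by case: (i) (j) => [a b] [a' b'].
have Kb : 2 + 8 * green_cst <= K%:R :> R.
  by rewrite /K natrD lerD2l; apply/ltW/archi_boundP; rewrite mulr_ge0.
have l2 := @ln2_bounds R.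
apply: (@le_trans _ _ ((h%:R + 2) * ln 2 + 4 * green_cst)); first by lra.
rewrite (natrD _ h K).
have aux (l gc q x : R) : 1 / 2 <= l -> 0 <= gc -> 2 + 8 * gc <= q -> (x + 2) * l + 4 * gc <= l * (x + q).
  move=> hl' hc hq; have : l * (2 + 8 * gc) <= l * q by rewrite ler_wpM2l//; lra.
  nra.
by apply: aux => //; case/andP: l2.
Qed.

End UpperBound.

(** * Lower comparison: placing a tree in the bulk of the box *)

Section Placement.
Context {R : realType}.
Variables (m : nat) (c : R).
Hypothesis c0 : 0 <= c.

Definition def_sum (j : nat) : R := \sum_(i < j) var_deficit m i.

(** Its square is exp(4 c + ln 2 V), V being the variance of the first j levels. With c =
    [green_cst], this is the separation at which [green_dist] makes the field increments dominate
    those of the tree. *)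
Definition gap_real (j : nat) : R := expR (2 * c + ln 2 / 2 * (j%:R - def_sum j)).

Definition gap (j : nat) : nat := (Num.truncn (gap_real j)).+1.

Lemma gap_bounds j : gap_real j <= (gap j)%:R <= gap_real j + 1.
Proof.
have /andP[h1 h2] := @truncn_itv R (gap_real j) (expR_ge0 _).
by rewrite (ltW h2)/= -[(gap j)%:R]natr1 lerD2r.
Qed.

(* Side lengths of the rectangle receiving a subtree; the longer side is always the first. *)
Fixpoint extent (j : nat) : nat * nat :=
  if j is j'.+1 then ((extent j').2 + (extent j').2 + gap j, (extent j').1)%N else (1, 1)%N.

Fixpoint place (j : nat) : leaf j -> nat * nat :=
  if j is j'.+1 return leaf j -> nat * nat then
    fun x => ((place x.2).2 + (if x.1 then (extent j').2 + gap j'.+1 else 0), (place x.2).1)%N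
  else fun=> (0, 0)%N.

Lemma place_lt j (x : leaf j) : ((place x).1 < (extent j).1)%N && ((place x).2 < (extent j).2)%N.
Proof.
elim: j x => [|j ih] //; move=> [b x] /=; have /andP[h1 h2] := ih x.
by rewrite h1 andbT; case: b => /=; lia.
Qed.

Lemma place_dist j (x y : leaf j) : x != y ->
  (gap (branch_height x y) ^ 2 <= `|(place x).1%:Z - (place y).1%:Z| ^ 2 + `|(place x).2%:Z - (place y).2%:Z| ^ 2)%N.
Proof.
elim: j x y => [|j ih]; first by move=> [] [].
move=> [b x] [b' y] ne; rewrite [branch_height _ _]/=; have /andP[_ hx] := place_lt x; have /andP[_ hy] := place_lt y.
case: eqP => [e|e].
  have ne' : x != y by apply: contra ne => /eqP ->; rewrite e.
  apply: leq_trans (ih _ _ ne') _; rewrite /= e addnC; apply: eq_leq; congr (_ ^ 2 + _)%N; lia.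
apply: leq_trans (leq_addr _ _); rewrite leq_exp2r//=.
move: (gap j.+1) (extent j) (place x) (place y) hx hy => g [p q] [u v] [u' v'] /=.
by case: b b' e {ne} => [] [] //= _; lia.
Qed.

Lemma var_deficit_mirror i : (i < m + m)%N -> var_deficit m ((m + m).-1 - i) = - var_deficit m i :> R.
Proof.
move=> im; rewrite /var_deficit (_ : ((m + m).-1 - ((m + m).-1 - i))%N = i) ?opprB//; lia.
Qed.

Lemma def_sum_mirror t : (t <= m)%N -> def_sum (m + t) = def_sum (m - t).
Proof.
elim: t => [|t ih] tm; first by rewrite addn0 subn0.
rewrite addnS /def_sum big_ord_recr/= -/(def_sum _) (ih (ltnW tm)).
have e : (m - t = (m - t.+1).+1)%N by lia.
rewrite e /def_sum big_ord_recr/= -addrA [X in _ + X](_ : _ = 0) ?addr0//.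
have -> : (m + t)%N = ((m + m).-1 - (m - t.+1))%N by lia.
by rewrite var_deficit_mirror ?subrr//; lia.
Qed.

Lemma def_sum_ge_low j : (j <= m)%N -> 8 * ln ((j%:R + 16) / 16) - 8 <= def_sum j.
Proof.
move=> jm; rewrite /def_sum /var_deficit sumrB; apply: lerB.
  elim: j {jm} => [|j ih]; first by rewrite big_ord0 add0r divff// ln1 mulr0.
  rewrite big_ord_recr/=; have x0 : 0 < j%:R + 16 :> R by rewrite ltr_wpDl.
  have -> : (j.+1%:R + 16) / 16 = (j%:R + 16) / 16 * (1 + (j%:R + 16)^-1) :> R.
    by rewrite -natr1; field; rewrite gt_eqF.
  have i0 : 0 < (j%:R + 16)^-1 :> R by rewrite invr_gt0.
  have xp : 0 < 1 + (j%:R + 16)^-1 :> R by rewrite addr_gt0.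
  rewrite lnM ?posrE ?divr_gt0//.
  have := @le_ln1Dx R (j%:R + 16)^-1 ltac:(by apply: lt_trans i0; rewrite ltrN10).
  by move=> h; rewrite mulrDr; apply: lerD => //; rewrite ler_wpM2l.
apply: (@le_trans _ _ (\sum_(i < j) 8 / m%:R)).
  apply: ler_sum => i _; have im : (i < m)%N by exact: leq_trans (ltn_ord i) jm.
  have m0 : 0 < m%:R :> R by rewrite ltr0n; exact: leq_ltn_trans im.
  have : m%:R <= ((m + m).-1 - i)%:R :> R by rewrite ler_nat; lia.
  by move=> h; rewrite ler_wpM2l// lef_pV2 ?posrE//; lra.
rewrite sumr_const card_ord -[leLHS]mulr_natr mulrAC -mulrA ler_piMr//.
case: (posnP m) => [m0|m0].
  by move: jm; rewrite m0 leqn0 => /eqP ->; rewrite mul0r.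
by rewrite ler_pdivrMr ?ltr0n// mul1r ler_nat.
Qed.

Lemma ge1_ln2_powers (x : R) : 1 <= x -> expR (- (ln 2 / 2 * (8 * ln x))) <= x ^- 2.
Proof.
move=> x1; have x0 : 0 < x by lra.
have e : x ^- 2 = expR (- (2 * ln x)).
  by rewrite expRN expRM_natl lnK ?posrE.
rewrite e ler_expR lerN2; have := @ln2_bounds R; have : 0 <= ln x by exact: ln_ge0.
by move: (ln x) (ln 2 : R) => a b *; nra.
Qed.

(** What the deficits buy: without them each gap has the order 2^(j/2) of the blocks, and after 2m
    levels the sides exceed 2^m by a factor of order m. Partial sums of order 8 ln j reduce the gaps
    relative to the blocks by j^-2, because 4 ln 2 >= 2; the mirror symmetry gives the second
    term. *)
Lemma def_sum_decay j : (j <= m + m)%N ->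
  expR (- (ln 2 / 2 * def_sum j)) <= expR 4 * 256 * (j.+1%:R ^- 2 + ((m + m - j).+1)%:R ^- 2).
Proof.
have main i : (i <= m)%N -> expR (- (ln 2 / 2 * def_sum i)) <= expR 4 * 256 * i.+1%:R ^- 2.
  move=> im; have := def_sum_ge_low im => h.
  have x1 : 1 <= (i%:R + 16) / 16 :> R by rewrite ler_pdivlMr// mul1r lerDr.
  have l2 := @ln2_bounds R.
  apply: (@le_trans _ _ (expR 4 * expR (- (ln 2 / 2 * (8 * ln ((i%:R + 16) / 16)))))).
    have hh : 0 <= ln 2 / 2 * (def_sum i - (8 * ln ((i%:R + 16) / 16) - 8)) by rewrite mulr_ge0//; lra.
    by rewrite -expRD ler_expR; lra.
  rewrite -[leRHS]mulrA ler_wpM2l ?expR_ge0//; apply: le_trans (ge1_ln2_powers x1) _.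
  have -> : 256 * i.+1%:R ^- 2 = (i.+1%:R / 16) ^- 2 :> R.
    by rewrite expr_div_n invf_div; congr (_ / _); ring.
  have x0 : 0 < (i%:R + 16) / 16 :> R by lra.
  rewrite lef_pV2 ?posrE ?exprn_gt0//.
  rewrite lerXn2r ?nnegrE ?divr_ge0 ?addr_ge0// ler_wpM2r// -[i.+1%:R]natr1 lerD2l ler1n//.
move=> jm; have e0 : 0 <= expR 4 * 256 :> R by apply: mulr_ge0; [exact: expR_ge0|exact: ler0n].
case: (leqP j m) => hj.
  apply: le_trans (main j hj) _; rewrite ler_wpM2l// lerDl invr_ge0 exprn_ge0//.
have -> : def_sum j = def_sum (m + m - j).
  rewrite -{1}(subnKC (ltnW hj)) def_sum_mirror; last by lia.
  by congr def_sum; lia.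
apply: le_trans (main (m + m - j)%N ltac:(lia)) _; rewrite ler_wpM2l// lerDr invr_ge0 exprn_ge0//.
Qed.

Definition extent_cst : R := 3 + (expR (2 * c) * (expR 4 * 256) * 6 + expR 1 * 64).

Lemma extent_cst_ge0 : 0 <= extent_cst.
Proof.
apply: addr_ge0; first exact: ler0n.
apply: addr_ge0; last by apply: mulr_ge0; [exact: expR_ge0|exact: ler0n].
apply: mulr_ge0; last exact: ler0n.
by apply: mulr_ge0; [exact: expR_ge0|apply: mulr_ge0; [exact: expR_ge0|exact: ler0n]].
Qed.

Lemma gap_sum : \sum_(1 <= i < (m + m).+1) (gap i)%:R * expR (- (ln 2 / 2 * i%:R)) <= expR (2 * c) * (expR 4 * 256) * 6 + expR 1 * 64.
Proof.
have sq (n : nat) : \sum_(1 <= i < n.+1) i.+1%:R ^- 2 <= 2 :> R.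
  rewrite big_add1 /= big_mkord; apply: le_trans (inv_sqr_sum n.+1); rewrite [leRHS]big_ord_recl/= -[leLHS]add0r.
  by apply: lerD.
have l2 := @ln2_bounds R.
apply: (@le_trans _ _ (\sum_(1 <= i < (m + m).+1) (expR (2 * c) * (expR 4 * 256 * (i.+1%:R ^- 2 + ((m + m - i).+1)%:R ^- 2)) + expR 1 * (32 * i.+1%:R ^- 2)))).
  rewrite big_nat [leRHS]big_nat; apply: ler_sum => i /andP[i1 im].
  have /andP[_ g1] := gap_bounds i.
  apply: (@le_trans _ _ ((gap_real i + 1) * expR (- (ln 2 / 2 * i%:R)))); first by rewrite ler_wpM2r ?expR_ge0.
  rewrite mulrDl mul1r; apply: lerD.
    rewrite /gap_real -expRD (_ : _ + _ - _ = 2 * c + - (ln 2 / 2 * def_sum i)); last by ring.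
    by rewrite expRD ler_wpM2l ?expR_ge0// def_sum_decay.
  have x0 : 0 <= (i%:R + 1) / 4 :> R by rewrite divr_ge0// addr_ge0.
  apply: (@le_trans _ _ (expR 1 * expR (- ((i%:R + 1) / 4)))).
    rewrite -expRD ler_expR; have : (0 : R) <= i%:R by [].
    by move: (i%:R : R) (ln 2 : R) l2 => a b /andP[? ?] ?; nra.
  rewrite natr1 in x0 *; rewrite ler_wpM2l ?expR_ge0// expRN.
  have -> : 32 * i.+1%:R ^- 2 = ((i.+1%:R / 4) ^+ 2 / 2)^-1 :> R by field.
  rewrite lef_pV2 ?posrE ?expR_gt0 ?divr_gt0 ?exprn_gt0 ?divr_gt0//.
  by apply: le_trans (expR_ge2 x0); rewrite lerDr addr_ge0.
rewrite big_split/= -!mulr_sumr big_split/=.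
have s2 : \sum_(1 <= i < (m + m).+1) ((m + m - i).+1)%:R ^- 2 <= 2 :> R.
  rewrite big_add1/= big_mkord; apply: le_trans (inv_sqr_sum (m + m)).
  rewrite [leRHS](reindex_inj rev_ord_inj)/=; apply: ler_sum => i _; rewrite lef_pV2 ?posrE ?exprn_gt0// lexx//.
have s1 := sq (m + m)%N.
apply: lerD; last by rewrite ler_wpM2l ?expR_ge0//; lra.
have e0 : 0 <= expR 4 * 256 :> R by apply: mulr_ge0; [exact: expR_ge0|exact: ler0n].
rewrite -[leRHS]mulrA ler_wpM2l ?expR_ge0// ler_wpM2l//; lra.
Qed.

(** Divided by 2^(j/2), the side increases by exactly one normalised gap every two levels, since the
    two directions alternate; these gaps are summable by [gap_sum]. *)
Lemma extent_le j : (j <= m + m)%N -> (extent j).1%:R <= extent_cst * expR (ln 2 / 2 * j%:R).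
Proof.
pose e j : R := (extent j).1%:R * expR (- (ln 2 / 2 * j%:R)).
pose g i : R := (gap i)%:R * expR (- (ln 2 / 2 * i%:R)).
have g0 i : 0 <= g i by rewrite mulr_ge0 ?expR_ge0.
have l2 := @ln2_bounds R.
have e2 : expR (- ln 2) = 1 / 2 :> R by rewrite expRN lnK ?posrE// div1r.
have step i : e i.+2 = e i + g i.+2.
  rewrite /e /g [extent i.+2]/= natrD mulrDl; congr (_ + _).
  have -> : expR (- (ln 2 / 2 * i.+2%:R)) = expR (- (ln 2 / 2 * i%:R)) * (1 / 2) :> R.
    by rewrite -e2 -expRD; congr expR; rewrite -[i.+2%:R]natr1 -natr1; field.
  by rewrite natrD; field.
have e0 : e 0%N = 1 by rewrite /e mulr0 oppr0 expR0 mulr1.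
have e1 : e 1%N <= 2 + g 1%N.
  rewrite /e /g [extent 1]/= natrD mulrDl lerD2r ler_piMr// -[leRHS]expR0 ler_expR; lra.
have key k : e k <= 3 + \sum_(1 <= i < k.+1) g i /\ e k.+1 <= 3 + \sum_(1 <= i < k.+2) g i.
  elim: k => [|k [ih1 ih2]].
    rewrite big_geq// big_nat1 e0; split; lra.
  split => //; rewrite step big_nat_recr//= big_nat_recr//= !addrA lerD2r.
  by apply: le_trans ih1 _; rewrite lerDl.
move=> jm; have [h _] := key j.
have : e j <= extent_cst.
  apply: le_trans h _; rewrite lerD2l; apply: le_trans gap_sum; rewrite [leRHS](big_cat_nat _ (n := j.+1))//= lerDl.
  by apply: sumr_ge0.
by rewrite /e expRN ler_pdivrMr ?expR_gt0.
Qed.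

End Placement.

Section LowerBound.
Context {R : realType}.
Local Notation lam := (@lam R).
Variable G : nat -> int * int -> int * int -> R.
Hypothesis hG : forall n, is_green n.+1 (G n).

Let k0 : 0 < kappa := kappa_gt0 hG.

Lemma fmax_mean_ge0 (I : finType) (i0 : I) d (T : measurableType d) (P : probability T R) (X : I -> T -> R) V :
  gfield P X V -> 0 <= Ex P (fun t => fmax i0 (fun i => X i t)).
Proof.
move=> gX; rewrite -(gfield_mean gX i0); apply: le_Ex.
- exact: (gfield_L1 gX i0).
- by apply: L1_fmax => i; exact: (gfield_L1 gX i).
- by move=> t; exact: (@fmax_ge _ _ _ (fun i => X i t)).
Qed.

Lemma bulk_of_offset (n p q : nat) : (16 <= n.+1)%N -> (2 * p.+1 <= n.+1)%N -> (2 * q.+1 <= n.+1)%N ->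
  let o := (n.+1 %/ 8).+1 in let z : int * int := ((o + p)%N%:Z, (o + q)%N%:Z) in
  [/\ (o + p < n.+1)%N, (o + q < n.+1)%N, interior_pt n.+1 z & bulk n.+1 z].
Proof.
move=> n16 hp hq o; have o1 : (n.+1 %/ 8 * 8 <= n.+1)%N by exact: leq_trunc_div.
have o2 : (n.+1 < (n.+1 %/ 8).+1 * 8)%N by rewrite ltn_ceil.
rewrite /o; move: (n.+1 %/ 8)%N o1 o2 => r o1 o2 {o}.
by rewrite /interior_pt /bulk /=; split; lia.
Qed.

Fact distn_shift (o a b : nat) : `|(o + a)%N%:Z - (o + b)%N%:Z|%N = `|a%:Z - b%:Z|%N.
Proof. by rewrite !PoszD opprD addrACA subrr add0r. Qed.

(** [c1] is such that 2^c1 >= 4 [extent_cst]: the tree of height 2m then fits into half of the box,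
    and an offset of about an eighth of the side keeps it in the bulk. The 4 added in [c1] makes the
    side at least 16. *)
Lemma gff_lower : exists C : R, exists c1 : nat, forall n d (T : measurableType d) (P : probability T R) (X : site n.+1 -> T -> R),
  is_gff G P X -> forall m, (0 < m)%N -> up_log 2 n.+1 = (c1 + m)%N ->
  vol * (lam * (m + m)%:R - 3 / (2 * lam) * ln (m + m)%:R - C) <= Ex P (fun t => fmax (ord0, ord0) (fun i => X i t)).
Proof.
have [C hC] := @tree_lower R.
pose c := green_cst : R.
have cg0 : 0 <= c by exact: (green_cst_ge0 hG).
pose E := extent_cst c.
have E0 : 0 <= E by exact: extent_cst_ge0.
exists C, (Num.bound (4 * E) + 4)%N => n d T P X [[V gX] dX].
set c1 := (_ + 4)%N => m m0; set L := up_log 2 n.+1 => Lm.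
have cL : (c1 < L)%N by rewrite Lm -addn1 leq_add2l.
have [d' [T' [P' [B [V' [gB vB mB]]]]]] := hC m m0.
have LB x : L1 P' (B x) by exact: (gfield_L1 gB x).
have Ec : 4 * E <= (2 ^ c1)%N%:R.
  apply/ltW; apply: (lt_le_trans (archi_boundP (mulr_ge0 (ler0n _ 4) E0))).
  by rewrite ler_nat; apply: leq_trans (ltnW (ltn_expl _ (leqnn 2))) _; rewrite leq_exp2l// leq_addr.
have n1 : (1 < n.+1)%N by have := cL; rewrite /L; case: (n) => //; rewrite up_log1.
have nL : (2 ^ L.-1 < n.+1)%N by exact: up_log_gtn.
have L0 : (0 < L)%N by exact: leq_ltn_trans cL.
have nL2 : (2 ^ L < n.+1 + n.+1)%N by rewrite -(prednK L0) expnS mul2n -addnn; lia.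
have n16 : (16 <= n.+1)%N.
  apply: ltnW; apply: leq_ltn_trans nL; rewrite (_ : 16 = 2 ^ 4)%N// leq_exp2l//.
  by rewrite -ltnS prednK//; apply: leq_trans cL; rewrite ltnS leq_addl.
have ext k : (k <= m + m)%N -> (2 * (extent m c k).1 <= n.+1)%N.
  move=> km; have h := extent_le cg0 km.
  have e2 : expR (ln 2 / 2 * k%:R) <= (2 ^ m)%N%:R :> R.
    have l2 := @ln2_gt0 R.
    have -> : (2 ^ m)%N%:R = expR (ln 2 * m%:R) :> R by rewrite natrX mulrC expRM_natl lnK ?posrE.
    rewrite ler_expR; have : k%:R <= m%:R + m%:R :> R by rewrite -natrD ler_nat.
    by move: (ln 2 : R) (k%:R : R) (m%:R : R) l2 => l a b l0 ab; rewrite -mulrA ler_wpM2l ?(ltW l0)//; lra.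
  have : 4 * (extent m c k).1%:R <= (2 ^ L)%N%:R :> R.
    have -> : (2 ^ L)%N%:R = (2 ^ c1)%N%:R * (2 ^ m)%N%:R :> R by rewrite -natrM -expnD -Lm.
    apply: (@le_trans _ _ (4 * E * (2 ^ m)%N%:R)); last by rewrite ler_wpM2r.
    by rewrite -mulrA ler_wpM2l//; apply: le_trans h _; rewrite ler_wpM2l.
  rewrite -natrM ler_nat => h4; move: h4 nL2; move: (2 ^ L)%N (extent m c k).1 => a b; lia.
have mm : (m + m)%N = (m + m).-1.+1 by rewrite prednK// addn_gt0 m0.
have ext2 : (2 * (extent m c (m + m)).2 <= n.+1)%N by rewrite mm /=; apply: ext; exact: leq_pred.
have ext1 := ext _ (leqnn (m + m)).
pose o := (n.+1 %/ 8).+1.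
have plc x : let p := place m c (x : leaf (m + m)) in
   [/\ (o + p.1 < n.+1)%N, (o + p.2 < n.+1)%N, interior_pt n.+1 ((o + p.1)%N%:Z, (o + p.2)%N%:Z) & bulk n.+1 ((o + p.1)%N%:Z, (o + p.2)%N%:Z)].
  have /andP[h1 h2] := place_lt m cg0 x.
  apply: bulk_of_offset => //.
    by apply: leq_trans ext1; rewrite leq_mul2l.
  by apply: leq_trans ext2; rewrite leq_mul2l.
pose iota (x : leaf (m + m)) : site n.+1 := (inord (o + (place m c x).1), inord (o + (place m c x).2)).
have sp x : site_point (iota x) = ((o + (place m c x).1)%N%:Z, (o + (place m c x).2)%N%:Z).
  by have [h1 h2 _ _] := plc x; rewrite /site_point /iota /= !inordK.
apply: (@le_trans _ _ (Ex P' (fun t => fmax (leaf0 (m + m)) (fun x => vol * B x t)))).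
  under eq_Ex do rewrite (fmaxZ _ _ vol_ge0).
  by rewrite ExZ ?ler_wpM2l ?vol_ge0//; exact: L1_fmax.
apply: (sudakov_fernique (leaf0 _) (ord0, ord0) (iota := iota) (gfield_scale gB vol) gX) => x y.
case: (eqVneq x y) => [->|xy].
  under eq_Ex do rewrite subrr expr0n.
  by rewrite Ex_cst; apply: Ex_ge0 => t; exact: sqr_ge0.
rewrite dX.
have -> : Ex P' (fun t => (vol * B x t - vol * B y t) ^+ 2) = vol ^+ 2 * (2 * \sum_(i < branch_height x y) (1 - var_deficit m i)).
  rewrite -vB -ExZ; last exact: (sqr_diff_L1 x y gB).
  by apply: eq_Ex => t; rewrite -mulrBr exprMn.
set b := branch_height x y.
have -> : \sum_(i < b) (1 - var_deficit m i) = b%:R - def_sum m b :> R by rewrite sumrB sumr_const card_ord.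
have [_ _ ix bx] := plc x; have [_ _ iy by_] := plc y; rewrite -!sp in ix bx iy by_.
have := green_dist (hG n) ix iy bx by_.
set D := _ - 2 * G n _ _; rewrite ler_norml => /andP[hD _].
rewrite -(ler_pM2l k0).
rewrite mulrA.
have -> : kappa * vol ^+ 2 * (2 * (b%:R - def_sum m b)) = ln 2 * (b%:R - def_sum m b) :> R.
  by rewrite -[ln 2 in RHS](vol_sqr hG); ring.
have hl : 4 * c + ln 2 * (b%:R - def_sum m b) <= 2 * logf (site_point (iota x) - site_point (iota y)).
  rewrite /logf mulrCA divff// mulr1.
  have g0 : 0 < gap_real m c b by exact: expR_gt0.
  have -> : 4 * c + ln 2 * (b%:R - def_sum m b) = ln (gap_real m c b ^+ 2).
    by rewrite lnXn// expRK -[RHS]mulr_natr; field.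
  have /andP[g1 _] := gap_bounds m c b.
  rewrite ler_ln ?posrE ?exprn_gt0//; last by rewrite lt_max ltr01 orbT.
  rewrite le_max; apply/orP; left; rewrite normsq_nat.
  apply: (@le_trans _ _ ((gap m c b)%:R ^+ 2)); first by rewrite lerXn2r ?nnegrE ?(ltW g0).
  rewrite -natrX ler_nat; apply: leq_trans (place_dist m cg0 xy) _; rewrite !sp /=.
  by rewrite !distn_shift.
rewrite -/c in hD; lra.
Qed.

Fact double_shift (c m K : nat) : ((c + m).+1 + (c + m).+1 + K = m + m + (c + c + 2 + K))%N.
Proof. by lia. Qed.

(** The second box has side 2 (n + 1). Doubling raises [up_log] by one, so the two heights differ by
    a constant and the logarithmic corrections compensate. If the box is too small for the lower
    bound, the mean is still nonnegative and the upper bound is a constant. *)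
Lemma mean_increment : exists C : R, forall n d (T : measurableType d) (P : probability T R) (X : site n.+1 -> T -> R)
    d' (T' : measurableType d') (P' : probability T' R) (X' : site (n + n.+1).+1 -> T' -> R),
  is_gff G P X -> is_gff G P' X' ->
  Ex P' (fun t => fmax (ord0, ord0) (fun i => X' i t)) - Ex P (fun t => fmax (ord0, ord0) (fun i => X i t)) <= C.
Proof.
have [Cu [K hu]] := gff_upper hG; have [Cl [c1 hl]] := gff_lower.
have v0 := @vol_ge0 R.
have /andP[l1 l2] := @lam_bounds R.
exists (vol * (lam * (c1 + c1 + 2 + K)%:R + `|Cu| + `|Cl|)) => n d T P X d' T' P' X' gX gX'.
have := hu _ _ _ _ _ gX'; set a' := Ex P' _ => ha'.
have [[V gV] _] := gX; have a0 := fmax_mean_ge0 (ord0, ord0) gV.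
have := hl _ _ _ _ _ gX; set a := Ex P _ in a0 * => ha.
have eL : up_log 2 (n + n.+1).+1 = (up_log 2 n.+1).+1.
  by rewrite -(@up_logMp 2 n.+1)//; congr up_log; lia.
rewrite eL in ha'; set L := up_log 2 n.+1 in ha ha'.
have nu := ler_norm Cu; have nl := ler_norm Cl.
have fu k : front_up k <= lam * k%:R - 3 / (2 * lam) * ln (k%:R + 16) by rewrite /front_up /time_up.
have g0 : 0 <= 3 / (2 * lam) by rewrite divr_ge0//; lra.
rewrite depthE in ha'; have := fu (L.+1 + L.+1 + K)%N => {}fu.
case: (ltnP c1 L) => cL; last first.
  have lk : (L.+1 + L.+1 + K)%:R <= (c1 + c1 + 2 + K)%:R :> R by rewrite ler_nat leq_add2r !addSn !addnS addn0 !ltnS leq_add.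
  have ln0 : 0 <= ln ((L.+1 + L.+1 + K)%:R + 16) :> R by apply: ln_ge0; have : (0 : R) <= (L.+1 + L.+1 + K)%:R by []; lra.
  have h1 : front_up (L.+1 + L.+1 + K) <= lam * (c1 + c1 + 2 + K)%:R.
    apply: le_trans fu _; have := mulr_ge0 g0 ln0.
    have : lam * (L.+1 + L.+1 + K)%:R <= lam * (c1 + c1 + 2 + K)%:R by rewrite ler_wpM2l//; lra.
    lra.
  apply: (@le_trans _ _ a'); first by rewrite gerBl.
  apply: le_trans ha' _; rewrite ler_wpM2l//.
  by have : 0 <= `|Cl| by []; lra.
have m0 : (0 < L - c1)%N by rewrite subn_gt0.
have Lm : L = (c1 + (L - c1))%N by rewrite subnKC// ltnW.
move: (L - c1)%N m0 Lm => m m0 Lm; have {}ha := ha m m0 Lm.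
have kE : (L.+1 + L.+1 + K)%:R = (m + m)%:R + (c1 + c1 + 2 + K)%:R :> R.
  by rewrite -natrD; congr (_%:R); rewrite Lm double_shift.
have lnm : ln (m + m)%:R <= ln ((L.+1 + L.+1 + K)%:R + 16) :> R.
  have mp : 0 < (m + m)%:R :> R by rewrite ltr0n addn_gt0 m0.
  have q0 : 0 <= (c1 + c1 + 2 + K)%:R :> R by [].
  rewrite ler_ln ?posrE//; rewrite kE; lra.
have h1 : front_up (L.+1 + L.+1 + K) - (lam * (m + m)%:R - 3 / (2 * lam) * ln (m + m)%:R) <= lam * (c1 + c1 + 2 + K)%:R.
  have := ler_wpM2l g0 lnm; rewrite kE mulrDr in fu *; lra.
apply: (@le_trans _ _ (vol * (front_up (L.+1 + L.+1 + K) + Cu) - vol * (lam * (m + m)%:R - 3 / (2 * lam) * ln (m + m)%:R - Cl))).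
  exact: lerB.
rewrite -mulrBr ler_wpM2l//; lra.
Qed.

End LowerBound.

(** * Two independent copies *)

Section TwoCopies.
Context {R : realType}.

Lemma two_copies_var (I J : finType) d1 (T1 : measurableType d1) (P1 : probability T1 R) (X : I -> T1 -> R) V
    d2 (T2 : measurableType d2) (P2 : probability T2 R) (Y : J -> T2 -> R) W i j :
  gfield P1 X V -> gfield P2 Y W ->
  Ex (P1 \x P2)%E (fun z => (X i z.1 - Y j z.2) ^+ 2) = Ex P1 (fun t => X i t ^+ 2) + Ex P2 (fun t => Y j t ^+ 2).
Proof.
move=> gX gY; have gU := gfield_union gX gY.
rewrite (cgauss_var (gfield_cgaussB gU (inl i) (inr j))) /=.
congr (_ + _).
  rewrite (cgauss_var (gfield_cgauss gX i)); congr V; apply/funext => k.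
  by rewrite /dirac_coef /= subr0.
rewrite -(cgauss_var (gY (fun k => dirac_coef (inl i) (inr k) - dirac_coef (inr j) (inr k)))).
apply: eq_Ex => t; rewrite -sqrrN; congr (_ ^+ 2); rewrite -sumrN -[RHS](sum_dirac_coef j (fun k => Y k t)).
by apply: eq_bigr => k _; rewrite /dirac_coef /= sub0r mulNr opprK.
Qed.

Variable G : nat -> int * int -> int * int -> R.
Hypothesis hG : forall n, is_green n.+1 (G n).

(** The second copy is shifted by the side N. Both copies vanish on their boundary points, so the
    interiors are not adjacent: pairs in different copies are handled by [green_two_copies], pairs
    in the same copy by [green_domain_mono]. *)
Lemma max_two_copies n d (T : measurableType d) (P : probability T R) (X : site n.+1 -> T -> R)
    d' (T' : measurableType d') (P' : probability T' R) (X' : site (n + n.+1).+1 -> T' -> R) :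
  is_gff G P X -> is_gff G P' X' -> (forall i, Ex P (fun t => X i t ^+ 2) = G n (site_point i) (site_point i)) ->
  forall M, M = (fun t => fmax (ord0, ord0) (fun i => X i t)) ->
  Ex (P \x P)%E (fun z => Num.max (M z.1) (M z.2)) <= Ex P' (fun t => fmax (ord0, ord0) (fun i => X' i t)).
Proof.
move=> [[V gX] dX] [[V' gX'] dX'] vX M ME.
have gU := gfield_union gX gX.
have LM : L1 P M by rewrite ME; apply: L1_fmax => i; exact: (gfield_L1 gX i).
have [LM1 _] := Ex_fst P LM.
have [LM2 _] := Ex_snd P LM.
set N := n.+1.
have wl (a : 'I_N) : (a < (n + n.+1).+1)%N by have := ltn_ord a; rewrite /N; lia.
have wr (a : 'I_N) : (N + a < (n + n.+1).+1)%N by have := ltn_ord a; rewrite /N; lia.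
pose iota (k : site N + site N) : site (n + n.+1).+1 :=
  match k with inl i => (Ordinal (wl i.1), Ordinal (wl i.2)) | inr j => (Ordinal (wr j.1), Ordinal (wl j.2)) end.
pose o : int * int := (N%:Z, 0).
have spl i : site_point (iota (inl i)) = site_point i by [].
have spr j : site_point (iota (inr j)) = site_point j + o.
  case: j => [a b]; rewrite /site_point /o /= [RHS](_ : _ = (a%:Z + N%:Z, b%:Z + 0))//.
  by rewrite addr0 PoszD addrC.
pose Y (k : site N + site N) (z : T * T) := match k with inl i => X i z.1 | inr j => X j z.2 end.
have i1 z : interior_pt N z -> interior_pt (n + n.+1).+1 (z + 0).
  by case: z => a b; rewrite addr0 /interior_pt /N /=; lia.
have i1' z : interior_pt N z -> interior_pt (n + n.+1).+1 z by move/i1; rewrite addr0.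
have i2 z : interior_pt N z -> interior_pt (n + n.+1).+1 (z + o).
  by case: z => a b; rewrite /interior_pt /o /N /=; lia.
have cross (i j : site N) : G n (site_point i) (site_point i) + G n (site_point j) (site_point j) <=
    G (n + n.+1)%N (site_point i) (site_point i) + G (n + n.+1)%N (site_point j + o) (site_point j + o) - 2 * G (n + n.+1)%N (site_point i) (site_point j + o).
  apply: (green_two_copies (hG n) (hG _) i1' i2).
  - move=> [a b] h; split => [|e]; [move: h|rewrite !inE => /or4P[] /eqP ->; move: h]; rewrite /interior_pt /o /N /=; lia.
  - move=> [a b] h; split => [|e]; [move: h|rewrite !inE => /or4P[] /eqP ->; move: h]; rewrite /interior_pt /o /N /=; lia.
  - by exists (iota (inl i)).
  - by exists (iota (inr j)); rewrite spr.
  - by case: i => [[a ha] [b hb]]; rewrite /interior_pt /site_point /o /N /= in ha hb *; lia.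
  - by case: j => [[a ha] [b hb]]; rewrite /interior_pt /site_point /o /N /= in ha hb *; lia.
have LY : L1 (P \x P)%E (fun z => fmax (inl (ord0, ord0)) (fun k => Y k z)).
  by apply: L1_fmax => k; exact: (gfield_L1 gU k).
apply: (@le_trans _ _ (Ex (P \x P)%E (fun z => fmax (inl (ord0, ord0)) (fun k => Y k z)))).
  apply: le_Ex => //; first exact: L1_max.
  move=> z; rewrite ME ge_max; apply/andP; split; apply: fmax_le => i.
    exact: (@fmax_ge _ _ _ (fun k => Y k z) (inl i)).
  exact: (@fmax_ge _ _ _ (fun k => Y k z) (inr i)).
apply: (sudakov_fernique (inl (ord0, ord0)) (ord0, ord0) (iota := iota) gU gX').
case=> [i|i] [j|j]; rewrite dX' ?spl ?spr.
- have [_ ->] := Ex_fst P (sqr_diff_L1 i j gX); rewrite dX.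
  have := @green_domain_mono R N _ (G n) (G (n + n.+1)%N) 0 (site_point i) (site_point j) (hG n) (hG _) i1.
  by rewrite !addr0; apply; [exists (iota (inl i))|exists (iota (inl j))].
- by rewrite (two_copies_var i j gX gX) !vX; exact: cross.
- under eq_Ex do rewrite -sqrrN opprB.
  rewrite (two_copies_var j i gX gX) !vX addrC [leRHS](_ : _ = G (n + n.+1)%N (site_point j) (site_point j) +
    G (n + n.+1)%N (site_point i + o) (site_point i + o) - 2 * G (n + n.+1)%N (site_point j) (site_point i + o)).
    by rewrite addrC; exact: cross.
  by congr (_ - 2 * _); [exact: addrC|exact: (green_sym (hG _))].
- have [_ ->] := Ex_snd P (sqr_diff_L1 i j gX); rewrite dX.
  apply: (green_domain_mono (hG n) (hG _) i2); [exists (iota (inr i))|exists (iota (inr j))]; exact: spr.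
Qed.

(** As |a - b| = 2 max(a, b) - (a + b), the mean of the larger of two copies controls their mean
    distance, and by Jensen this is at least the mean distance of one copy to its expectation. *)
Lemma deviation_le_increment n d (T : measurableType d) (P : probability T R) (X : site n.+1 -> T -> R)
    d' (T' : measurableType d') (P' : probability T' R) (X' : site (n + n.+1).+1 -> T' -> R) :
  is_gff G P X -> is_gff G P' X' -> (forall i, Ex P (fun t => X i t ^+ 2) = G n (site_point i) (site_point i)) ->
  forall M, M = (fun t => fmax (ord0, ord0) (fun i => X i t)) ->
  Ex P (fun t => `|M t - Ex P M|) <= 2 * (Ex P' (fun t => fmax (ord0, ord0) (fun i => X' i t)) - Ex P M).
Proof.
move=> gX gX' vX M ME; have h := max_two_copies gX gX' vX ME.
have [[V gV] _] := gX.
have LM : L1 P M by rewrite ME; apply: L1_fmax => i; exact: (gfield_L1 gV i).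
have [LM1 E1] := Ex_fst P LM; have [LM2 E2] := Ex_snd P LM.
have LD : L1 (P \x P)%E (fun z => `|M z.1 - M z.2|) by apply: L1_norm; exact: L1B.
have LDx x : L1 P (fun y => `|M x - M y|) by apply: L1_norm; apply: L1B => //; exact: L1_cst.
have [LF EF] := Ex_fubini LD LDx.
apply: (@le_trans _ _ (Ex (P \x P)%E (fun z => `|M z.1 - M z.2|))).
  rewrite EF; apply: le_Ex => //; first by apply: L1_norm; apply: L1B => //; exact: L1_cst.
  move=> x; apply: le_trans (ler_norm_Ex (L1B (L1_cst P (M x)) LM)).
  by rewrite (ExB (L1_cst P _) LM) Ex_cst.
have -> : Ex (P \x P)%E (fun z => `|M z.1 - M z.2|) =
   Ex (P \x P)%E (fun z => 2 * Num.max (M z.1) (M z.2) - (M z.1 + M z.2)).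
  apply: eq_Ex => z; case: (leP (M z.1) (M z.2)) => hz.
    by rewrite distrC ger0_norm ?subr_ge0//; ring.
  by rewrite gtr0_norm ?subr_gt0//; ring.
rewrite (ExB (L1Z 2 (L1_max LM1 LM2)) (L1D LM1 LM2)) (ExZ _ (L1_max LM1 LM2)) (ExD LM1 LM2) E1 E2.
lra.
Qed.

Lemma markov_compact d (T : measurableType d) (P : probability T R) (Y : T -> R) (C e : R) :
  L1 P Y -> Ex P (fun t => `|Y t|) <= C -> 0 < C -> 0 < e ->
  (P (Y @^-1` (~` `[(- (C / e))%R, (C / e)%R]%classic)) <= e%:E)%E.
Proof.
move=> LY hC C0 e0; set A := Y @^-1` _.
have mA : measurable A.
  rewrite -[A]setTI; apply: (L1_measurable LY) => //.
  by apply: measurableC; exact: measurable_itv.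
have LA : L1 P (fun t => \1_A t : R).
  apply: (@L1_bounded _ _ _ _ _ 1); first exact: measurable_indic.
  by move=> t; rewrite indicE ger0_norm// lern1 leq_b1.
have -> : P A = (Ex P (fun t => \1_A t : R))%:E.
  by rewrite -ExE// integral_indic// setIT.
rewrite lee_fin; apply: (@le_trans _ _ (Ex P (fun t => e / C * `|Y t|))).
  apply: le_Ex => //; first by apply: L1Z; exact: L1_norm.
  move=> t; rewrite indicE; case: (boolP (t \in A)) => /=; last by rewrite mulr_ge0 ?divr_ge0// ltW.
  rewrite inE /A /= in_itv /= => /negP; rewrite -ler_norml -ltNge => h.
  have : e / C * (C / e) <= e / C * `|Y t| by rewrite ler_wpM2l ?divr_ge0 ?ltW.
  by apply: le_trans; rewrite mulrA divfK ?gt_eqF// divff ?gt_eqF.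
rewrite ExZ; last exact: L1_norm.
apply: (@le_trans _ _ (e / C * C)); first by rewrite ler_wpM2l ?divr_ge0// ltW.
by rewrite divfK ?gt_eqF.
Qed.

End TwoCopies.

(* The index [n] corresponds to the side length [N = n.+1 >= 1]. *)
Theorem theorem1p1 (R : realType)
  (dW : measure_display) (W : measurableType dW)
  (PW : int * int -> probability W R) (w : nat -> W -> int * int)
  (srw_w : forall x, simple_random_walk (PW x) x w)
  (d : nat -> measure_display) (T : forall n, measurableType (d n))
  (P : forall n, probability (T n) R)
  (X : forall n, site n.+1 -> {RV (P n) >-> R})
  (gff_X : forall n, discrete_GFF PW w (X n)) :
  tight P (fun n => centered_max (X n)).
Proof.
have hG n : is_green n.+1 (green_of (R := R) n.+1) := gff_is_green srw_w (gff_X n).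
pose G n := green_of (R := R) n.+1.
have gX n : is_gff G (P n) (fun i => X n i : T n -> R).
  split; first by exists (@gff_var R n); exact: (gff_gfield srw_w (gff_X n)).
  exact: (gff_dist srw_w (gff_X n)).
have vX n i := gff_var_site srw_w (gff_X n) i.
have [C hC] := mean_increment hG.
(* The increment bound makes 2 C only nonnegative; 2 C + 1 provides the positive constant that
   [markov_compact] asks for. *)
move=> e e0; exists `[(- ((2 * C + 1) / e))%R, ((2 * C + 1) / e)%R]%classic; first exact: segment_compact.
move=> n; pose M (t : T n) := fmax (ord0, ord0) (fun i => X n i t).
have LM : L1 (P n) M by apply: L1_fmax => i; exact: (gfield_L1 (gff_gfield srw_w (gff_X n)) i).
have dev := deviation_le_increment hG (gX n) (gX (n + n.+1)%N) (vX n) (erefl M).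
have inc := hC _ _ _ _ _ _ _ _ _ (gX n) (gX (n + n.+1)%N).
have dev0 : 0 <= Ex (P n) (fun t => `|M t - Ex (P n) M|) by apply: Ex_ge0.
have -> : centered_max (X n) = (fun t => M t - Ex (P n) M).
  by apply/funext => t; rewrite /centered_max unlock.
apply: (@markov_compact R _ _ (P n) (fun t => M t - Ex (P n) M)) => //.
- by apply: L1B => //; exact: L1_cst.
- rewrite -/M in dev inc; lra.
- rewrite -/M in dev inc; lra.
Qed.
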